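(* Let $T>0$, $\omega=2\pi/T$, let $p$ be a real-valued $T$-periodic function with Fourier coefficients $\widetilde p_\ell$ satisfying $\sum_{\ell}|\widetilde p_\ell|(1+\ell^2)^{1/4}<\infty$, and let $\lambda\in\mathbb C\setminus\{0\}$. Then: (i) The limit $\Delta(s;\lambda):=\lim_{N\to\infty}\Delta^{(N)}(s;\lambda)$ exists for all $s\in\mathbb C\setminus\Lambda$, uniformly in $s$ with $\operatorname{dist}(s,\Lambda)>\delta$ for each $\delta>0$; and if $|\operatorname{Im}s|<1$, the limit coincides with $\det(I-\lambda^{-1}H(s))$. (ii) The function $s\mapsto\Delta(s;\lambda)$ is even, doubly periodic with periods $2i$ and $\omega$, and satisfies $\overline{\Delta(s;\lambda)}=\Delta(\bar s;\bar\lambda)$ and $\Delta(s+i;\lambda)=\Delta(s;-\lambda)$. Furthermore, $\Delta(\cdot;\lambda)$ is either constant on $\mathbb C$, or an elliptic function of order two with simple poles at the points of $\Lambda$, and $\operatorname{Res}_{s=i/2}\Delta(s;\lambda)=-\operatorname{Res}_{s=-i/2}\Delta(s;\lambda)$. (iii) If $\Delta(\cdot;\lambda)$ is non-constant, then the zeros of $\partial\Delta(s;\lambda)/\partial s$ are simple and the set of these zeros consists exactly of the points congruent to $0,\ \omega/2,\ \omega/2+i,\ i$ modulo the lattice $\mathsf M=\{\omega m+2in:m,n\in\mathbb Z\}$.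
   Context: $\widetilde p_\ell=\frac1T\int_0^Te^{-i\ell\omega x}p(x)dx$, $B(z_1,z_2)=\Gamma(z_1)\Gamma(z_2)/\Gamma(z_1+z_2)$, $\Lambda=\{\omega n+i(m+\frac12):n,m\in\mathbb Z\}$. For $s\in\mathbb C\setminus\Lambda$, $H(s)$ is the operator on $\ell^2(\mathbb Z)$ with matrix $[H(s)]_{n,m}=B(\frac12-i\omega n-is,\frac12+i\omega m+is)\widetilde p_{n-m}$; it is trace class for $|\operatorname{Im}s|<1$, $s\notin\Lambda$. For $N\ge1$, $H^{(N)}(s)$ is the operator with matrix entries equal to those of $H(s)$ when $|n-m|\le N$ and $0$ otherwise (the operator associated with the truncated trigonometric polynomial $\sum_{|\ell|\le N}\widetilde p_\ell e^{i\ell\omega\xi}$); it is trace class and holomorphic for all $s\in\mathbb C\setminus\Lambda$, and $\Delta^{(N)}(s;\lambda)=\det(I-\lambda^{-1}H^{(N)}(s))$ is the Fredholm determinant. *)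

(* Defs.v *)
From Stdlib Require Import Reals ZArith.
From Coquelicot Require Import Coquelicot.
From mathcomp Require Rstruct Rstruct_topology lebesgue_measure lebesgue_integral.

Module Leb.
From mathcomp Require Import all_boot all_algebra.
From mathcomp Require Import all_classical all_reals all_analysis Rstruct Rstruct_topology.
Local Open Scope classical_set_scope.
Local Open Scope ring_scope.
Definition per_integrable (T : R) (p : R -> R) : Prop :=
  (@lebesgue_measure R).-integrable `[0%R, T] (EFin \o p).
Definition per_integral (T : R) (f : R -> R) : R :=
  Rintegral (@lebesgue_measure R) `[0%R, T] f.
End Leb.

Open Scope R_scope.

Definition omega (T : R) : R := 2 * PI / T.

Definition cexp (z : C) : C := (exp (Re z) * cos (Im z), exp (Re z) * sin (Im z)).

Fixpoint csum (n : nat) (f : nat -> C) : C :=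
  match n with O => RtoC 0 | S k => (csum k f + f k)%C end.
Fixpoint cprod (n : nat) (f : nat -> C) : C :=
  match n with O => RtoC 1 | S k => (cprod k f * f k)%C end.
Fixpoint cpow (z : C) (n : nat) : C :=
  match n with O => RtoC 1 | S k => (cpow z k * z)%C end.

(* limit of a complex sequence (meaningful when it converges) *)
Definition clim (u : nat -> C) : C :=
  (real (Lim_seq (fun n => Re (u n))), real (Lim_seq (fun n => Im (u n)))).

(* Euler's Gamma function on C minus {0,-1,-2,...} via Gauss' limit formula
   Gamma z = lim n^z n! / (z (z+1) ... (z+n)) *)
Definition gauss_term (z : C) (n : nat) : C :=
  (cexp (z * RtoC (ln (INR n))) * RtoC (INR (fact n))
   / cprod (S n) (fun k => z + RtoC (INR k)))%C.
Definition cGamma (z : C) : C := clim (gauss_term z).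

Definition cBeta (z1 z2 : C) : C := (cGamma z1 * cGamma z2 / cGamma (z1 + z2))%C.

Definition ptilde (T : R) (p : R -> R) (l : Z) : C :=
  (/ T * Leb.per_integral T (fun x => p x * cos (IZR l * omega T * x)),
   - (/ T * Leb.per_integral T (fun x => p x * sin (IZR l * omega T * x)))).

Definition inLambda (T : R) (s : C) : Prop :=
  exists n m : Z, s = (omega T * IZR n, IZR m + / 2).

Definition congr_M (T : R) (s c : C) : Prop :=
  exists m n : Z, s = (c + ((omega T * IZR m)%R, (2 * IZR n)%R))%C.

(* matrix of H(s) on l^2(Z) *)
Definition Hent (T : R) (p : R -> R) (s : C) (n m : Z) : C :=
  (cBeta (RtoC (/ 2) - Ci * RtoC (omega T * IZR n) - Ci * s)
         (RtoC (/ 2) + Ci * RtoC (omega T * IZR m) + Ci * s)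
   * ptilde T p (n - m)%Z)%C.

Definition HNent (T : R) (p : R -> R) (N : nat) (s : C) (n m : Z) : C :=
  if (Z.abs (n - m) <=? Z.of_nat N)%Z then Hent T p s n m else RtoC 0.

Fixpoint cdet (n : nat) (A : nat -> nat -> C) : C :=
  match n with
  | O => RtoC 1
  | S k => csum (S k) (fun j =>
      ((if Nat.even j then RtoC 1 else RtoC (-1)) * A O j
       * cdet k (fun r c => A (S r) (if Nat.ltb c j then c else S c)))%C)
  end.

Definition zcons (k : Z) (i : nat -> Z) : nat -> Z :=
  fun j => match j with O => k | S j' => i j' end.

Fixpoint boxsum (n M : nat) (f : (nat -> Z) -> C) : C :=
  match n with
  | O => f (fun _ => 0%Z)
  | S k => csum (2 * M + 1) (fun t =>
             boxsum k M (fun i => f (zcons (Z.of_nat t - Z.of_nat M)%Z i)))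
  end.

(* sum over all (i_1..i_n) in Z^n of det[K_{i_a i_b}]  ( = n! tr (Lambda^n K) ) *)
Definition fred_coef (n : nat) (K : Z -> Z -> C) : C :=
  clim (fun M => boxsum n M (fun i => cdet n (fun a b => K (i a) (i b)))).

(* Fredholm determinant det(I - mu K) of a trace class operator with matrix K
   in the standard basis of l^2(Z):  sum_n (-mu)^n / n! * fred_coef n K *)
Definition fredholm_det (mu : C) (K : Z -> Z -> C) : C :=
  clim (fun N => csum N (fun n =>
     (cpow (- mu) n / RtoC (INR (fact n)) * fred_coef n K)%C)).

Definition DeltaN (T : R) (p : R -> R) (N : nat) (s lam : C) : C :=
  fredholm_det (/ lam)%C (HNent T p N s).

Definition cderiv (f : C -> C) (z l : C) : Prop :=
  @is_derive C_AbsRing C_NormedModule f z l.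
Definition cdifferentiable (f : C -> C) (z : C) : Prop :=
  @ex_derive C_AbsRing C_NormedModule f z.

(* lim_{z -> a, z <> a} (z - a) f(z) = r  (the residue at a simple pole / removable point) *)
Definition res_lim (f : C -> C) (a r : C) : Prop :=
  filterlim (fun z => ((z - a) * f z)%C) (locally' a) (locally r).

(* Main.v *)
(** Write [w(s) = PI / cosh (PI s)].  After conjugation by a diagonal matrix, each minor of [H(s)]
    is [prod_a w(s + om i_a)] times [det (c (i_a - i_b))], where the coefficients
    [c l = ptilde l / Gamma (1 - i om l)] do not depend on [s].  The product of the [w] is a
    combination of the functions [w(s + om i_a)] if the number of factors is odd, and of
    [tanh (PI (s + om i_a))] if it is even, with constant coefficients.  Since these depend only on
    differences of indices, summing over lattice translates turns [w] into
    [f(s) = sum_k w(s + om k)]; in the even case the dependence on [s] cancels by the symmetry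
    [i -> - i] and the transposition of the determinant.  Hence
    [Delta(s; lam) = A(lam) + B(lam) f(s)] with [A] even and [B] odd in [lam].

    The minors are dominated by products of row sums of
    [sqrt (w(om k) w(om m)) |c (k - m)|].  By the reflection formula,
    [|Gamma (1 + i y)|^2 = PI y / sinh (PI y)], this entry is [|ptilde (k - m)|] times the square root
    of [PI (tanh (PI om k) - tanh (PI om m)) / (om (k - m))], and the tanh difference is
    exponentially small unless [k] and [m] have opposite signs; the double sum is thus controlled by
    [sum_l |ptilde l| sqrt |l|].

    The function [f] satisfies [f'' = A f - 2 f^3].  If [f'(s) = 0], uniqueness for this equation
    makes [f] symmetric about [s], so that the reflection of a nearest pole in [s] is again a pole,
    and [2 s] is a sum of two poles.  The points [om/2 + i/2] are excluded, because [f] is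
    antisymmetric about them.  If moreover [f''(s) = 0], then [f] would be constant up to the pole. *)

From mathcomp Require all_boot all_algebra all_classical all_reals all_analysis Rstruct Rstruct_topology.
Require Import Defs.
From Stdlib Require Import Reals ZArith Lra Lia Classical FunctionalExtensionality.
From Coquelicot Require Import Coquelicot.

(** Holomorphy is replaced by difference quotients with a quadratic remainder, which survive
    dominated summation over the lattice; no theory of elliptic functions is invoked, since only the
    explicit sum f has to be analysed. The coth and tanh kernels do not decay; identities containing
    them are kept on finite boxes and passed to the limit only after the value at s = 0 has been
    subtracted. The differential equation rests on the same partial fractions: f^2 minus the sum of
    the w^2 is constant because the csch kernel is odd and has total mass 0, and f times the sum of
    the w^2 is the sum of the w^3 plus a multiple of f. All estimates are monotone in the moduli of
    the coefficients, so a single majorant [rho] serves the full matrix and every truncation, whence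
    the uniform limit. The Gamma function being given as a Gauss limit, the reflection formula is
    derived from the sine product, and that from the integrals of cos(t)^(2n) cos(2 z t) over
    [0, PI/2]. *)

Module PerIntegral.
Import all_boot all_algebra all_classical all_reals all_analysis Rstruct Rstruct_topology.
Import GRing.Theory.
Local Open Scope classical_set_scope.
Local Open Scope ring_scope.

(** Negation exchanges the positive and negative parts, and an infinite part makes both sides 0, so
    the identity also survives divergence. It yields the conjugation symmetry of the Fourier
    coefficients. *)
Lemma fine_integral_opp (f : R -> R) (D : set R) :
  Rintegral (@lebesgue_measure R) D (fun x => - f x) = - Rintegral (@lebesgue_measure R) D f.
Proof.
rewrite /Rintegral.
have -> : (fun x : R => (- f x)%:E) = (\- (EFin \o f))%E by apply/funext => x.
rewrite [in LHS]integralE [in RHS]integralE funeposN funenegN.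
move: (integral _ _ _) (integral _ _ _) => a b.
case: a => [a| |]; case: b => [b| |] //=; rewrite ?oppr0 //.
by rewrite opprB.
Qed.

Lemma per_integral_opp (T : R) (f : R -> R) :
  Leb.per_integral T (fun x => Ropp (f x)) = Ropp (Leb.per_integral T f).
Proof. exact: fine_integral_opp. Qed.
End PerIntegral.

Open Scope R_scope.

(** * Finite sums, products and complex limits *)

Fixpoint rsum (n : nat) (f : nat -> R) : R :=
  match n with O => 0 | S k => rsum k f + f k end.
Fixpoint rprod (n : nat) (f : nat -> R) : R :=
  match n with O => 1 | S k => rprod k f * f k end.

Lemma rsum_ext n f g : (forall k, (k < n)%nat -> f k = g k) -> rsum n f = rsum n g.
Proof. induction n; simpl; intros H; auto. rewrite IHn, H; auto. Qed.

Lemma rsum_le n f g : (forall k, (k < n)%nat -> f k <= g k) -> rsum n f <= rsum n g.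
Proof.
  induction n; simpl; intros H; [lra|].
  apply Rplus_le_compat; [apply IHn; intros; apply H; lia | apply H; lia].
Qed.

Lemma rsum_const n x : rsum n (fun _ => x) = INR n * x.
Proof. induction n; [simpl; ring|]. rewrite S_INR; simpl rsum. rewrite IHn; ring. Qed.

Lemma rsum_ge0 n f : (forall k, (k < n)%nat -> 0 <= f k) -> 0 <= rsum n f.
Proof.
  intros H; rewrite <- (Rmult_0_r (INR n)), <- rsum_const.
  now apply rsum_le.
Qed.

Lemma rsum_plus n f g : rsum n (fun k => f k + g k) = rsum n f + rsum n g.
Proof. induction n; simpl; [ring|rewrite IHn; ring]. Qed.

Lemma rsum_scal n a f : rsum n (fun k => a * f k) = a * rsum n f.
Proof. induction n; simpl; [ring|rewrite IHn; ring]. Qed.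

Lemma rsum_app a b f : rsum (a + b) f = rsum a f + rsum b (fun k => f (a + k)%nat).
Proof.
  induction b; simpl; [rewrite Nat.add_0_r; ring|].
  rewrite Nat.add_succ_r; simpl; rewrite IHb; ring.
Qed.

Lemma rsum_swap a b f :
  rsum a (fun i => rsum b (fun j => f i j)) = rsum b (fun j => rsum a (fun i => f i j)).
Proof.
  induction a; simpl.
  - induction b; simpl; [reflexivity|rewrite <- IHb; ring].
  - now rewrite IHa, rsum_plus.
Qed.

Lemma rprod_ext n f g : (forall k, (k < n)%nat -> f k = g k) -> rprod n f = rprod n g.
Proof. induction n; simpl; intros H; auto. rewrite IHn, H; auto. Qed.

Lemma rprod_ge0 n f : (forall k, (k < n)%nat -> 0 <= f k) -> 0 <= rprod n f.
Proof.
  induction n; simpl; intros H; [lra|].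
  apply Rmult_le_pos; [apply IHn; intros; apply H; lia | apply H; lia].
Qed.

Lemma rprod_le n f g :
  (forall k, (k < n)%nat -> 0 <= f k <= g k) -> rprod n f <= rprod n g.
Proof.
  induction n; simpl; intros H; [lra|].
  apply Rmult_le_compat; try (apply H; lia).
  - apply rprod_ge0; intros; apply H; lia.
  - apply IHn; intros; apply H; lia.
Qed.

Lemma rprod_mult n f g : rprod n (fun k => f k * g k) = rprod n f * rprod n g.
Proof. induction n; simpl; [ring|rewrite IHn; ring]. Qed.

Lemma rprod_const n x : rprod n (fun _ => x) = x ^ n.
Proof. induction n; simpl; [ring|rewrite IHn; ring]. Qed.

Lemma rprod_S_l n f : rprod (S n) f = f O * rprod n (fun k => f (S k)).
Proof.
  induction n; simpl; [ring|].
  simpl in IHn; rewrite IHn; ring.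
Qed.

Lemma csum_ext n f g : (forall k, (k < n)%nat -> f k = g k) -> csum n f = csum n g.
Proof. induction n; simpl; intros H; auto. rewrite IHn, H; auto. Qed.

Lemma csum_zero n f : (forall k, (k < n)%nat -> f k = RtoC 0) -> csum n f = RtoC 0.
Proof.
  induction n; simpl; intros H; auto.
  rewrite IHn, H by auto; ring.
Qed.

Lemma csum_plus n f g : csum n (fun k => f k + g k)%C = (csum n f + csum n g)%C.
Proof. induction n; simpl; [ring|rewrite IHn; ring]. Qed.

Lemma csum_minus n f g : csum n (fun k => f k - g k)%C = (csum n f - csum n g)%C.
Proof. induction n; simpl; [ring|rewrite IHn; ring]. Qed.

Lemma csum_scal n a f : csum n (fun k => a * f k)%C = (a * csum n f)%C.
Proof. induction n; simpl; [ring|rewrite IHn; ring]. Qed.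

Lemma csum_app a b f : csum (a + b) f = (csum a f + csum b (fun k => f (a + k)%nat))%C.
Proof.
  induction b; simpl; [rewrite Nat.add_0_r; ring|].
  rewrite Nat.add_succ_r; simpl; rewrite IHb; ring.
Qed.

Lemma csum_S_l n f : csum (S n) f = (f O + csum n (fun k => f (S k)))%C.
Proof. change (S n) with (1 + n)%nat; rewrite csum_app; simpl; ring. Qed.

Lemma csum_swap a b (f : nat -> nat -> C) :
  csum a (fun i => csum b (fun j => f i j)) = csum b (fun j => csum a (fun i => f i j)).
Proof.
  induction a; simpl.
  - symmetry; now apply csum_zero.
  - now rewrite IHa, csum_plus.
Qed.

Lemma csum_rev n f : csum n f = csum n (fun k => f (n - S k)%nat).
Proof.
  induction n; [reflexivity|].
  rewrite (csum_S_l n (fun k => f (S n - S k)%nat)).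
  change (csum (S n) f) with (csum n f + f n)%C.
  replace (S n - 1)%nat with n by lia.
  rewrite IHn, Cplus_comm; reflexivity.
Qed.

Lemma csum_conj n f : Cconj (csum n f) = csum n (fun k => Cconj (f k)).
Proof.
  induction n; simpl; [unfold Cconj, RtoC; simpl; f_equal; ring|].
  now rewrite Cplus_conj, IHn.
Qed.

Lemma Cmod_csum n f : Cmod (csum n f) <= rsum n (fun k => Cmod (f k)).
Proof.
  induction n; simpl; [rewrite Cmod_0; lra|].
  eapply Rle_trans; [apply Cmod_triangle|lra].
Qed.

Lemma RtoC_rsum n f : RtoC (rsum n f) = csum n (fun k => RtoC (f k)).
Proof. induction n; simpl; [reflexivity|]. now rewrite RtoC_plus, IHn. Qed.

Lemma cprod_ext n f g : (forall k, (k < n)%nat -> f k = g k) -> cprod n f = cprod n g.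
Proof. induction n; simpl; intros H; auto. rewrite IHn, H; auto. Qed.

Lemma cprod_mult n f g : cprod n (fun k => f k * g k)%C = (cprod n f * cprod n g)%C.
Proof. induction n; simpl; [ring|rewrite IHn; ring]. Qed.

Lemma cprod_const n x : cprod n (fun _ => x) = cpow x n.
Proof. induction n; simpl; [ring|rewrite IHn; ring]. Qed.

Lemma cprod_S_l n f : cprod (S n) f = (f O * cprod n (fun k => f (S k)))%C.
Proof. induction n; simpl; [ring|]. simpl in IHn; rewrite IHn; ring. Qed.

Lemma cprod_conj n f : Cconj (cprod n f) = cprod n (fun k => Cconj (f k)).
Proof.
  induction n; simpl; [unfold Cconj, RtoC; simpl; f_equal; ring|].
  now rewrite Cmult_conj, IHn.
Qed.

Lemma Cmod_cprod n f : Cmod (cprod n f) = rprod n (fun k => Cmod (f k)).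
Proof. induction n; simpl; [apply Cmod_1|now rewrite Cmod_mult, IHn]. Qed.

Lemma cprod_neq0 n f : (forall k, (k < n)%nat -> f k <> RtoC 0) -> cprod n f <> RtoC 0.
Proof.
  induction n; simpl; intros H.
  - intros E; apply RtoC_inj in E; lra.
  - apply Cmult_neq_0; [apply IHn; intros; apply H; lia|apply H; lia].
Qed.

Lemma Cmod_cpow z n : Cmod (cpow z n) = Cmod z ^ n.
Proof. induction n; simpl; [apply Cmod_1|rewrite Cmod_mult, IHn; ring]. Qed.

Lemma cpow_conj z n : Cconj (cpow z n) = cpow (Cconj z) n.
Proof.
  induction n; simpl; [unfold Cconj, RtoC; simpl; f_equal; ring|].
  now rewrite Cmult_conj, IHn.
Qed.

Lemma Cmod_minus_sym a b : Cmod (a - b)%C = Cmod (b - a)%C.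
Proof. rewrite <- Cmod_opp; f_equal; ring. Qed.

Lemma Cmod_triangle_minus a b c : Cmod (a - c)%C <= Cmod (a - b)%C + Cmod (b - c)%C.
Proof. replace (a - c)%C with ((a - b) + (b - c))%C by ring. apply Cmod_triangle. Qed.

Lemma Cmod_rev_triangle a b : Cmod a - Cmod b <= Cmod (a - b)%C.
Proof.
  assert (H := Cmod_triangle (a - b)%C b).
  replace (a - b + b)%C with a in H by ring. lra.
Qed.

Lemma Cmod_le_ReIm z : Cmod z <= Rabs (Re z) + Rabs (Im z).
Proof.
  destruct z as [x y]; unfold Cmod, Re, Im; simpl fst; simpl snd.
  rewrite <- (sqrt_Rsqr (Rabs x + Rabs y)) by (generalize (Rabs_pos x) (Rabs_pos y); lra).
  apply sqrt_le_1_alt.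
  assert (Hx := Rsqr_abs x); assert (Hy := Rsqr_abs y); unfold Rsqr in *.
  generalize (Rabs_pos x) (Rabs_pos y); nra.
Qed.

Lemma im_le_Cmod z : Rabs (Im z) <= Cmod z.
Proof. eapply Rle_trans; [|apply (Rmax_Cmod z)]; apply Rmax_r. Qed.

(** * Convergence of complex sequences *)

(** [clim] returns a value for every sequence; convergence is therefore carried by this predicate
    and transferred to [clim] by [clim_ccv]. *)
Definition ccv (u : nat -> C) (l : C) : Prop := is_lim_seq (fun n => Cmod (u n - l)%C) 0.

Lemma is_lim_seq_0_eps u : (forall n, 0 <= u n) ->
  (is_lim_seq u 0 <-> forall eps, 0 < eps -> exists N, forall n, (N <= n)%nat -> u n < eps).
Proof.
  intros Hu; rewrite <- is_lim_seq_spec; simpl; split.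
  - intros H eps He; destruct (H (mkposreal eps He)) as [N HN].
    exists N; intros n Hn; specialize (HN n Hn); simpl in HN.
    rewrite Rminus_0_r in HN; apply Rabs_def2 in HN; lra.
  - intros H eps; destruct (H eps (cond_pos eps)) as [N HN].
    exists N; intros n Hn; rewrite Rminus_0_r, Rabs_pos_eq; auto.
Qed.

Lemma ccv_eps u l :
  ccv u l <-> forall eps, 0 < eps -> exists N, forall n, (N <= n)%nat -> Cmod (u n - l)%C < eps.
Proof. apply is_lim_seq_0_eps; intros; apply Cmod_ge_0. Qed.

Lemma squeeze_0 u v : (forall n, 0 <= u n <= v n) -> is_lim_seq v 0 -> is_lim_seq u 0.
Proof.
  intros H Hv; apply (is_lim_seq_le_le (fun _ => 0) u v); auto.
  apply is_lim_seq_const.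
Qed.

Lemma ccv_dom u l v : (forall n, Cmod (u n - l)%C <= v n) -> is_lim_seq v 0 -> ccv u l.
Proof. intros H Hv; apply (squeeze_0 _ v); auto; intros; split; auto; apply Cmod_ge_0. Qed.

Lemma ccv_ext u v l : (forall n, u n = v n) -> ccv u l -> ccv v l.
Proof. intros H; apply is_lim_seq_ext; intros n; now rewrite H. Qed.

Lemma ccv_ext_loc u v l N : (forall n, (N <= n)%nat -> u n = v n) -> ccv u l -> ccv v l.
Proof.
  intros H; apply is_lim_seq_ext_loc; exists N; intros n Hn; now rewrite H.
Qed.

Lemma ccv_const l : ccv (fun _ => l) l.
Proof.
  unfold ccv; apply is_lim_seq_ext with (fun _ => 0); [|apply is_lim_seq_const].
  intros _; replace (l - l)%C with (RtoC 0) by ring; now rewrite Cmod_0.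
Qed.

Lemma is_lim_seq_plus0 u v : is_lim_seq u 0 -> is_lim_seq v 0 ->
  is_lim_seq (fun n => u n + v n) 0.
Proof.
  intros Hu Hv; replace (Finite 0) with (Finite (0 + 0)) by (f_equal; ring).
  now apply is_lim_seq_plus'.
Qed.

Lemma is_lim_seq_scal0 a u : is_lim_seq u 0 -> is_lim_seq (fun n => a * u n) 0.
Proof.
  intros Hu; replace (Finite 0) with (Rbar_mult a 0) by (simpl; f_equal; ring).
  now apply is_lim_seq_scal_l.
Qed.

Lemma ccv_plus u v l m : ccv u l -> ccv v m -> ccv (fun n => u n + v n)%C (l + m)%C.
Proof.
  intros Hu Hv.
  apply (ccv_dom _ _ (fun n => Cmod (u n - l)%C + Cmod (v n - m)%C)).
  - intros n; replace (u n + v n - (l + m))%C with ((u n - l) + (v n - m))%C by ring.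
    apply Cmod_triangle.
  - now apply is_lim_seq_plus0.
Qed.

Lemma ccv_scal a u l : ccv u l -> ccv (fun n => a * u n)%C (a * l)%C.
Proof.
  intros Hu.
  apply (ccv_dom _ _ (fun n => Cmod a * Cmod (u n - l)%C)).
  - intros n; rewrite <- Cmod_mult; right; f_equal; ring.
  - now apply is_lim_seq_scal0.
Qed.

Lemma ccv_minus u v l m : ccv u l -> ccv v m -> ccv (fun n => u n - v n)%C (l - m)%C.
Proof.
  intros Hu Hv; replace (l - m)%C with (l + (RtoC (-1)) * m)%C by ring.
  apply (ccv_ext (fun n => u n + (RtoC (-1)) * v n)%C); [intros; ring|].
  apply ccv_plus; auto; now apply ccv_scal.
Qed.

Lemma ccv_mult u v l m : ccv u l -> ccv v m -> ccv (fun n => u n * v n)%C (l * m)%C.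
Proof.
  intros Hu Hv.
  apply (ccv_dom _ _ (fun n => (Cmod (u n - l) * Cmod (v n - m)
     + (Cmod m * Cmod (u n - l) + Cmod l * Cmod (v n - m)))%R)).
  - intros n.
    replace (u n * v n - l * m)%C
      with ((u n - l) * (v n - m) + (m * (u n - l) + l * (v n - m)))%C by ring.
    rewrite <- !Cmod_mult.
    eapply Rle_trans; [apply Cmod_triangle|].
    apply Rplus_le_compat_l, Cmod_triangle.
  - apply is_lim_seq_plus0; [|apply is_lim_seq_plus0; now apply is_lim_seq_scal0].
    replace (Finite 0) with (Finite (0 * 0)) by (f_equal; ring).
    now apply is_lim_seq_mult'.
Qed.

Lemma ccv_unique u l m : ccv u l -> ccv u m -> l = m.
Proof.
  intros Hl Hm.
  assert (H : ccv (fun n => u n - u n)%C (l - m)%C) by now apply ccv_minus.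
  assert (H' : is_lim_seq (fun _ : nat => Cmod (l - m)%C) 0).
  { apply is_lim_seq_ext with (2 := H); intros n.
    rewrite <- Cmod_opp; f_equal; ring. }
  assert (E : Cmod (l - m)%C = 0).
  { generalize (is_lim_seq_unique _ _ H'); rewrite Lim_seq_const; congruence. }
  apply Cmod_eq_0 in E.
  replace l with (m + (l - m))%C by ring; rewrite E; ring.
Qed.

Lemma ccv_Re u l : ccv u l -> is_lim_seq (fun n => Re (u n)) (Re l).
Proof.
  intros H; apply is_lim_seq_spec; intros eps.
  apply ccv_eps with (eps := pos eps) in H; [|apply cond_pos].
  destruct H as [N HN]; exists N; intros n Hn.
  eapply Rle_lt_trans; [|apply HN, Hn].
  apply (re_le_Cmod (u n - l)%C).
Qed.

Lemma ccv_Im u l : ccv u l -> is_lim_seq (fun n => Im (u n)) (Im l).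
Proof.
  intros H; apply is_lim_seq_spec; intros eps.
  apply ccv_eps with (eps := pos eps) in H; [|apply cond_pos].
  destruct H as [N HN]; exists N; intros n Hn.
  eapply Rle_lt_trans; [|apply HN, Hn].
  apply (im_le_Cmod (u n - l)%C).
Qed.

Lemma ccv_pair u x y :
  is_lim_seq (fun n => Re (u n)) (Finite x) -> is_lim_seq (fun n => Im (u n)) (Finite y) ->
  ccv u (x, y).
Proof.
  intros Hx Hy.
  apply (ccv_dom _ _ (fun n => Rabs (Re (u n) - x) + Rabs (Im (u n) - y))).
  - intros n; apply (Cmod_le_ReIm (u n - (x, y))%C).
  - apply is_lim_seq_plus0; apply -> is_lim_seq_abs_0.
    + replace (Finite 0) with (Finite (x - x)) by (f_equal; ring).
      apply is_lim_seq_minus'; auto; apply is_lim_seq_const.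
    + replace (Finite 0) with (Finite (y - y)) by (f_equal; ring).
      apply is_lim_seq_minus'; auto; apply is_lim_seq_const.
Qed.

Lemma clim_ccv u l : ccv u l -> clim u = l.
Proof.
  intros H; unfold clim.
  rewrite (is_lim_seq_unique _ _ (ccv_Re _ _ H)), (is_lim_seq_unique _ _ (ccv_Im _ _ H)).
  now destruct l.
Qed.

Lemma ccv_conj u l : ccv u l -> ccv (fun n => Cconj (u n)) (Cconj l).
Proof.
  apply is_lim_seq_ext; intros n.
  now rewrite <- Cminus_conj, Cmod_conj.
Qed.

Lemma ccv_bound u l B : ccv u l -> (forall n, Cmod (u n) <= B) -> Cmod l <= B.
Proof.
  intros H HB; apply Rnot_lt_le; intros Hl.
  apply ccv_eps with (eps := Cmod l - B) in H; [|lra].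
  destruct H as [N HN]; specialize (HN N (le_n N)); specialize (HB N).
  rewrite Cmod_minus_sym in HN; generalize (Cmod_rev_triangle l (u N)); lra.
Qed.

Lemma ccv_cauchy u :
  (forall eps, 0 < eps -> exists N, forall n, (N <= n)%nat -> Cmod (u n - u N)%C < eps) ->
  exists l, ccv u l.
Proof.
  intros H.
  assert (HC : forall pr : C -> R, (forall a b, Rabs (pr a - pr b) <= Cmod (a - b)%C) ->
     ex_finite_lim_seq (fun n => pr (u n))).
  { intros pr Hpr; apply ex_lim_seq_cauchy_corr; intros eps.
    destruct (H (eps / 2)) as [N HN]; [generalize (cond_pos eps); lra|].
    exists N; intros n m Hn Hm.
    eapply Rle_lt_trans; [apply Hpr|].
    eapply Rle_lt_trans; [apply (Cmod_triangle_minus _ (u N))|].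
    generalize (HN n Hn) (HN m Hm); rewrite (Cmod_minus_sym (u m)); lra. }
  destruct (HC Re) as [x Hx]; [intros a b; apply (re_le_Cmod (a - b)%C)|].
  destruct (HC Im) as [y Hy]; [intros a b; apply (im_le_Cmod (a - b)%C)|].
  exists (x, y); now apply ccv_pair.
Qed.

Lemma ccv_incr u l k : ccv u l -> ccv (fun n => u (n + k)%nat) l.
Proof. intros H; now apply (is_lim_seq_incr_n (fun n => Cmod (u n - l)%C) k). Qed.

Lemma ccv_csum n (u : nat -> nat -> C) l :
  (forall k, (k < n)%nat -> ccv (fun m => u m k) (l k)) ->
  ccv (fun m => csum n (u m)) (csum n l).
Proof.
  induction n; intros H; simpl; [apply ccv_const|].
  apply ccv_plus; [apply IHn; intros; apply H; lia|apply H; lia].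
Qed.

Lemma filterlim_ccv u l : ccv u l -> filterlim u eventually (locally (l : C)).
Proof.
  intros H; apply filterlim_locally; intros eps.
  apply ccv_eps with (eps := pos eps) in H; [|apply cond_pos].
  destruct H as [N HN]; exists N; intros n Hn.
  apply C_NormedModule_mixin_compat1, HN, Hn.
Qed.

(** * Sums over the integers *)

(** Windows may start anywhere: translating the index of a symmetric sum produces an off-centre
    window. *)
Definition zwin (lo : Z) (L : nat) (g : Z -> C) : C :=
  csum L (fun t => g (Z.of_nat t + lo)%Z).
Definition rwin (lo : Z) (L : nat) (g : Z -> R) : R :=
  rsum L (fun t => g (Z.of_nat t + lo)%Z).
Definition zs (M : nat) (g : Z -> C) : C := zwin (- Z.of_nat M) (2 * M + 1) g.
Definition rzs (M : nat) (g : Z -> R) : R := rwin (- Z.of_nat M) (2 * M + 1) g.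

Lemma rwin_split lo a b c g :
  rwin lo (a + b + c) g
  = rwin lo a g + rwin (lo + Z.of_nat a) b g + rwin (lo + Z.of_nat (a + b)) c g.
Proof.
  unfold rwin; rewrite !rsum_app.
  f_equal; [f_equal|]; apply rsum_ext; intros k _; f_equal; lia.
Qed.

Lemma zwin_split lo a b c g :
  zwin lo (a + b + c) g
  = (zwin lo a g + zwin (lo + Z.of_nat a) b g + zwin (lo + Z.of_nat (a + b)) c g)%C.
Proof.
  unfold zwin; rewrite !csum_app.
  f_equal; [f_equal|]; apply csum_ext; intros k _; f_equal; lia.
Qed.

Lemma rwin_ge0 lo L h : (forall k, 0 <= h k) -> 0 <= rwin lo L h.
Proof. intros H; apply rsum_ge0; auto. Qed.

Lemma Cmod_zwin lo L g : Cmod (zwin lo L g) <= rwin lo L (fun k => Cmod (g k)).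
Proof. apply Cmod_csum. Qed.

Lemma rwin_le lo L g h : (forall k, g k <= h k) -> rwin lo L g <= rwin lo L h.
Proof. intros H; apply rsum_le; auto. Qed.

Lemma subwindow lo L lo' L' :
  (lo <= lo')%Z -> (lo' + Z.of_nat L' <= lo + Z.of_nat L)%Z ->
  exists a c, L = (a + L' + c)%nat /\ lo' = (lo + Z.of_nat a)%Z.
Proof.
  intros H1 H2; exists (Z.to_nat (lo' - lo)), (L - L' - Z.to_nat (lo' - lo))%nat; lia.
Qed.

Lemma rwin_mono lo L lo' L' h : (forall k, 0 <= h k) ->
  (lo <= lo')%Z -> (lo' + Z.of_nat L' <= lo + Z.of_nat L)%Z ->
  rwin lo' L' h <= rwin lo L h.
Proof.
  intros Hh H1 H2; destruct (subwindow _ _ _ _ H1 H2) as (a & c & -> & ->).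
  rewrite rwin_split.
  generalize (rwin_ge0 lo a h Hh) (rwin_ge0 (lo + Z.of_nat (a + L')) c h Hh); lra.
Qed.

Lemma zwin_sub lo L lo' L' g h : (forall k, Cmod (g k) <= h k) ->
  (lo <= lo')%Z -> (lo' + Z.of_nat L' <= lo + Z.of_nat L)%Z ->
  Cmod (zwin lo L g - zwin lo' L' g)%C <= rwin lo L h - rwin lo' L' h.
Proof.
  intros Hh H1 H2; destruct (subwindow _ _ _ _ H1 H2) as (a & c & -> & ->).
  rewrite rwin_split, zwin_split.
  match goal with |- Cmod ?z <= _ =>
    replace z with (zwin lo a g + zwin (lo + Z.of_nat (a + L')) c g)%C by ring end.
  eapply Rle_trans; [apply Cmod_triangle|].
  assert (H := fun lo L => Rle_trans _ _ _ (Cmod_zwin lo L g) (rwin_le lo L _ h Hh)).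
  generalize (H lo a) (H (lo + Z.of_nat (a + L'))%Z c); lra.
Qed.

(** * Summable majorants and dominated convergence over the integers *)

Definition l1 (h : Z -> R) : Prop :=
  (forall k, 0 <= h k) /\ exists X, forall M, rzs M h <= X.

Lemma l1_window h : l1 h -> exists X, 0 <= X /\ forall lo L, rwin lo L h <= X.
Proof.
  intros [Hh [X HX]]; exists X; split.
  - eapply Rle_trans; [|apply (HX O)]; apply rwin_ge0, Hh.
  - intros lo L.
    eapply Rle_trans; [|apply (HX (Z.to_nat (Z.abs lo) + L)%nat)].
    apply rwin_mono; auto; lia.
Qed.

Lemma l1_le g h : (forall k, 0 <= g k <= h k) -> l1 h -> l1 g.
Proof.
  intros H [Hh [X HX]]; split; [intros; apply H|].
  exists X; intros M; eapply Rle_trans; [apply rwin_le|apply HX]; intros; apply H.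
Qed.

Lemma rwin_scal lo L a h : rwin lo L (fun k => a * h k) = a * rwin lo L h.
Proof. apply rsum_scal. Qed.

Lemma rwin_plus lo L g h : rwin lo L (fun k => g k + h k) = rwin lo L g + rwin lo L h.
Proof. apply rsum_plus. Qed.

Lemma l1_scal a h : 0 <= a -> l1 h -> l1 (fun k => a * h k).
Proof.
  intros Ha [Hh [X HX]]; split; [intros; now apply Rmult_le_pos|].
  exists (a * X); intros M; unfold rzs; rewrite rwin_scal.
  apply Rmult_le_compat_l; [auto|apply HX].
Qed.

Lemma l1_plus g h : l1 g -> l1 h -> l1 (fun k => g k + h k).
Proof.
  intros [Hg [X HX]] [Hh [Y HY]]; split; [intros; now apply Rplus_le_le_0_compat|].
  exists (X + Y); intros M; unfold rzs; rewrite rwin_plus.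
  apply Rplus_le_compat; [apply HX|apply HY].
Qed.

Lemma l1_tail h : l1 h -> forall eps, 0 < eps -> exists M0, forall M lo L,
  (M0 <= M)%nat -> rwin lo L h - rzs M h < eps.
Proof.
  intros Hl eps He; destruct (Hl) as [Hh [X HX]].
  assert (Hm : forall M M', (M <= M')%nat -> rzs M h <= rzs M' h).
  { intros; apply rwin_mono; auto; lia. }
  destruct (ex_finite_lim_seq_incr (fun M => rzs M h) X) as [l Hlim];
    [intros; apply Hm; lia|auto|].
  assert (Hle : forall lo L, rwin lo L h <= l).
  { intros lo L.
    apply Rle_trans with (rzs (Z.to_nat (Z.abs lo) + L)%nat h);
      [apply rwin_mono; auto; lia|].
    apply (is_lim_seq_incr_compare (fun M => rzs M h)); auto; intros; apply Hm; lia. }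
  apply is_lim_seq_spec in Hlim; destruct (Hlim (mkposreal eps He)) as [M0 HM].
  exists M0; intros M lo L HM0; specialize (HM M0 (le_n _)); simpl in HM.
  apply Rabs_def2 in HM; generalize (Hle lo L) (Hm M0 M HM0); lra.
Qed.

Definition zlim (g : Z -> C) : C := clim (fun M => zs M g).

Definition dominated (g : Z -> C) : Prop := exists h, l1 h /\ forall k, Cmod (g k) <= h k.

(** Absolute convergence: any window containing a large symmetric one is close to the limit. This
    freedom gives the translation invariance of [zlim] and the limits of convolutions. *)
Lemma zwin_cv g : dominated g -> forall eps, 0 < eps -> exists M0, forall lo L,
  (lo <= - Z.of_nat M0)%Z -> (Z.of_nat M0 < lo + Z.of_nat L)%Z ->
  Cmod (zwin lo L g - zlim g)%C < eps.
Proof.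
  intros (h & Hl & Hd).
  assert (Ht : forall eps, 0 < eps -> exists M0, forall lo L,
     (lo <= - Z.of_nat M0)%Z -> (Z.of_nat M0 < lo + Z.of_nat L)%Z ->
     Cmod (zwin lo L g - zs M0 g)%C < eps).
  { intros eps He; destruct (l1_tail h Hl eps He) as [M0 HM]; exists M0; intros lo L H1 H2.
    eapply Rle_lt_trans; [apply (zwin_sub _ _ _ _ g h Hd); lia|].
    apply HM; lia. }
  assert (Hc : ccv (fun M => zs M g) (zlim g)).
  { destruct (ccv_cauchy (fun M => zs M g)) as [l Hc].
    - intros eps He; destruct (Ht eps He) as [M0 HM]; exists M0; intros n Hn.
      apply HM; lia.
    - unfold zlim; now rewrite (clim_ccv _ _ Hc). }
  intros eps He; destruct (Ht (eps / 3)) as [M0 HM]; [lra|].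
  apply ccv_eps with (eps := eps / 3) in Hc; [|lra].
  destruct Hc as [M1 HM1]; exists (M0 + M1)%nat; intros lo L H1 H2.
  assert (H3 : Cmod (zwin lo L g - zs M0 g)%C < eps / 3) by (apply HM; lia).
  assert (H4 : Cmod (zs (M0 + M1) g - zs M0 g)%C < eps / 3) by (apply HM; lia).
  assert (H5 := HM1 (M0 + M1)%nat ltac:(lia)).
  rewrite Cmod_minus_sym in H4.
  generalize (Cmod_triangle_minus (zwin lo L g) (zs M0 g) (zlim g))
    (Cmod_triangle_minus (zs M0 g) (zs (M0 + M1) g) (zlim g)); lra.
Qed.

Lemma zs_cv g : dominated g -> ccv (fun M => zs M g) (zlim g).
Proof.
  intros Hd; apply ccv_eps; intros eps He; destruct (zwin_cv g Hd eps He) as [M0 HM].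
  exists M0; intros n Hn; apply HM; lia.
Qed.

Lemma zs_ext M g h : (forall k, g k = h k) -> zs M g = zs M h.
Proof. intros H; apply csum_ext; intros; apply H. Qed.

Lemma zlim_ext g h : (forall k, g k = h k) -> zlim g = zlim h.
Proof. intros H; f_equal; now apply functional_extensionality. Qed.

Lemma zlim_unique g l : ccv (fun M => zs M g) l -> zlim g = l.
Proof. apply clim_ccv. Qed.

Lemma dominated_plus g h : dominated g -> dominated h -> dominated (fun k => g k + h k)%C.
Proof.
  intros (a & Ha & Hga) (b & Hb & Hhb); exists (fun k => a k + b k); split.
  - now apply l1_plus.
  - intros k; eapply Rle_trans; [apply Cmod_triangle|now apply Rplus_le_compat].
Qed.

Lemma dominated_scal a g : dominated g -> dominated (fun k => a * g k)%C.
Proof.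
  intros (h & Hh & Hg); exists (fun k => Cmod a * h k); split.
  - apply l1_scal; [apply Cmod_ge_0|auto].
  - intros k; rewrite Cmod_mult; apply Rmult_le_compat_l; [apply Cmod_ge_0|auto].
Qed.

Lemma dominated_ext g h : (forall k, g k = h k) -> dominated g -> dominated h.
Proof. intros H (a & Ha & Hg); exists a; split; auto; intros; now rewrite <- H. Qed.

Lemma zlim_plus g h : dominated g -> dominated h ->
  zlim (fun k => g k + h k)%C = (zlim g + zlim h)%C.
Proof.
  intros Hg Hh; apply zlim_unique.
  apply ccv_ext with (fun M => zs M g + zs M h)%C; [intros; symmetry; apply csum_plus|].
  now apply ccv_plus; apply zs_cv.
Qed.

Lemma zlim_scal a g : dominated g -> zlim (fun k => a * g k)%C = (a * zlim g)%C.
Proof.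
  intros Hg; apply zlim_unique.
  apply ccv_ext with (fun M => a * zs M g)%C; [intros; symmetry; apply csum_scal|].
  now apply ccv_scal, zs_cv.
Qed.

Lemma zlim_shift g j : dominated g -> zlim (fun k => g (k + j)%Z) = zlim g.
Proof.
  intros Hg; apply zlim_unique, ccv_eps; intros eps He.
  destruct (zwin_cv g Hg eps He) as [M0 HM].
  exists (M0 + Z.to_nat (Z.abs j))%nat; intros M HMM.
  replace (zs M (fun k => g (k + j)%Z)) with (zwin (- Z.of_nat M + j) (2 * M + 1) g).
  - apply HM; lia.
  - apply csum_ext; intros; f_equal; lia.
Qed.

Lemma zs_opp M g : zs M (fun k => g (- k)%Z) = zs M g.
Proof.
  unfold zs, zwin at 1; rewrite csum_rev; apply csum_ext; intros; f_equal; lia.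
Qed.

Lemma zlim_opp g : zlim (fun k => g (- k)%Z) = zlim g.
Proof. unfold zlim; f_equal; apply functional_extensionality; intros; apply zs_opp. Qed.

Lemma zlim_conj g : dominated g -> zlim (fun k => Cconj (g k)) = Cconj (zlim g).
Proof.
  intros Hg; apply zlim_unique.
  apply ccv_ext with (fun M => Cconj (zs M g)); [intros; apply csum_conj|].
  now apply ccv_conj, zs_cv.
Qed.

Lemma Cmod_zlim g h X : l1 h -> (forall k, Cmod (g k) <= h k) ->
  (forall lo L, rwin lo L h <= X) -> Cmod (zlim g) <= X.
Proof.
  intros Hh Hg HX; apply (ccv_bound (fun M => zs M g)).
  - apply zs_cv; exists h; auto.
  - intros M; eapply Rle_trans; [apply Cmod_zwin|].
    eapply Rle_trans; [apply rwin_le, Hg|apply HX].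
Qed.

(** Dominated convergence in which the summand and the window vary with the same M. A fixed window m
    splits the error into a tail of [G M], a finite sum and a tail of [g]. *)
Lemma tannery h (G : nat -> Z -> C) g : l1 h -> (forall M k, Cmod (G M k) <= h k) ->
  (forall k, ccv (fun M => G M k) (g k)) -> ccv (fun M => zs M (G M)) (zlim g).
Proof.
  intros Hh HG Hg.
  assert (Hgh : forall k, Cmod (g k) <= h k).
  { intros k; apply (ccv_bound (fun M => G M k)); auto. }
  assert (Hd : dominated g) by (exists h; auto).
  apply ccv_eps; intros eps He.
  destruct (zwin_cv g Hd (eps / 3)) as [M0 HM0]; [lra|].
  destruct (l1_tail h Hh (eps / 3)) as [M1 HM1]; [lra|].
  set (m := (M0 + M1)%nat).
  assert (Hf : ccv (fun M => zs m (G M)) (zs m g)) by (apply ccv_csum; intros; apply Hg).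
  apply ccv_eps with (eps := eps / 3) in Hf; [|lra].
  destruct Hf as [M2 HM2]; exists (m + M2)%nat; intros M HM.
  assert (H1 : Cmod (zs M (G M) - zs m (G M))%C < eps / 3).
  { eapply Rle_lt_trans; [apply (zwin_sub _ _ _ _ (G M) h (HG M)); lia|].
    apply HM1; unfold m; lia. }
  assert (H2 := HM2 M ltac:(lia)).
  assert (H3 : Cmod (zs m g - zlim g)%C < eps / 3) by (apply HM0; unfold m; lia).
  generalize (Cmod_triangle_minus (zs M (G M)) (zs m (G M)) (zlim g))
    (Cmod_triangle_minus (zs m (G M)) (zs m g) (zlim g)); lra.
Qed.

(** * Sums over integer boxes *)

(** [boxsum] over an arbitrary window: off-centre boxes arise once an index has been split off and
    the others are translated by it. *)
Fixpoint gbox (n : nat) (lo : Z) (L : nat) (f : (nat -> Z) -> C) : C :=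
  match n with
  | O => f (fun _ => 0%Z)
  | S k => zwin lo L (fun t => gbox k lo L (fun i => f (zcons t i)))
  end.

Lemma boxsum_gbox n M f : boxsum n M f = gbox n (- Z.of_nat M) (2 * M + 1) f.
Proof.
  revert f; induction n; intros f; [reflexivity|].
  simpl boxsum; simpl gbox; unfold zwin; apply csum_ext; intros k _; apply IHn.
Qed.

Lemma gbox_ext n lo L f g : (forall i, f i = g i) -> gbox n lo L f = gbox n lo L g.
Proof. intros H; f_equal; now apply functional_extensionality. Qed.

(* Only the indices in the window (and the padding value 0) are visited. *)
Lemma gbox_ext_window n lo L f g :
  (forall i, (forall a, (a < n)%nat -> (lo <= i a < lo + Z.of_nat L)%Z) -> f i = g i) ->
  gbox n lo L f = gbox n lo L g.
Proof.
  revert f g; induction n; intros f g H; simpl.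
  - apply H; intros; lia.
  - apply csum_ext; intros t Ht; apply IHn; intros i Hi; apply H.
    intros [|a] Ha; simpl; [lia|apply Hi; lia].
Qed.

Lemma gbox_csum n lo L m F :
  gbox n lo L (fun i => csum m (fun a => F a i)) = csum m (fun a => gbox n lo L (F a)).
Proof.
  revert F; induction n; intros F; [reflexivity|].
  simpl gbox; unfold zwin; rewrite csum_swap; apply csum_ext; intros t _.
  now rewrite IHn.
Qed.

Lemma gbox_plus n lo L F G :
  gbox n lo L (fun i => F i + G i)%C = (gbox n lo L F + gbox n lo L G)%C.
Proof.
  revert F G; induction n; intros F G; [reflexivity|].
  simpl; unfold zwin; rewrite <- csum_plus; apply csum_ext; intros t _; apply IHn.
Qed.

Lemma gbox_scal n lo L a F :
  gbox n lo L (fun i => a * F i)%C = (a * gbox n lo L F)%C.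
Proof.
  revert F; induction n; intros F; [reflexivity|].
  simpl; unfold zwin; rewrite <- csum_scal; apply csum_ext; intros t _; apply IHn.
Qed.

Lemma gbox_conj n lo L F : Cconj (gbox n lo L F) = gbox n lo L (fun i => Cconj (F i)).
Proof.
  revert F; induction n; intros F; [reflexivity|].
  simpl; unfold zwin; rewrite csum_conj; apply csum_ext; intros t _; apply IHn.
Qed.

Lemma rprod_zcons n rho k i :
  rprod (S n) (fun a => rho (zcons k i a)) = rho k * rprod n (fun a => rho (i a)).
Proof. now rewrite rprod_S_l. Qed.

Lemma gbox_bound n lo L K rho G : 0 <= K -> (forall k, 0 <= rho k) ->
  (forall i, Cmod (G i) <= K * rprod n (fun a => rho (i a))) ->
  Cmod (gbox n lo L G) <= K * rwin lo L rho ^ n.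
Proof.
  intros HK Hr; revert K HK G; induction n; intros K HK G HG; [apply HG|].
  simpl gbox; eapply Rle_trans; [apply Cmod_zwin|].
  apply Rle_trans with (rwin lo L (fun k => (K * rwin lo L rho ^ n) * rho k)).
  - apply rwin_le; intros k.
    replace (K * rwin lo L rho ^ n * rho k) with ((K * rho k) * rwin lo L rho ^ n) by ring.
    apply IHn; [now apply Rmult_le_pos|]; intros i.
    eapply Rle_trans; [apply HG|]; rewrite rprod_zcons; right; ring.
  - rewrite rwin_scal; simpl; right; ring.
Qed.

(** Boxes telescope: with X and Y the larger and the smaller window sum, enlarging the first
    coordinate costs K X^n (X - Y), enlarging the others inside the small window costs K (X^n - Y^n)
    Y, and the two add up to K (X^(n+1) - Y^(n+1)). *)
Lemma gbox_diff n lo L lo' L' K rho G : 0 <= K -> (forall k, 0 <= rho k) ->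
  (forall i, Cmod (G i) <= K * rprod n (fun a => rho (i a))) ->
  (lo <= lo')%Z -> (lo' + Z.of_nat L' <= lo + Z.of_nat L)%Z ->
  Cmod (gbox n lo L G - gbox n lo' L' G)%C <= K * (rwin lo L rho ^ n - rwin lo' L' rho ^ n).
Proof.
  intros HK Hr HG H1 H2; revert K HK G HG; induction n; intros K HK G HG.
  - simpl; replace (_ - _)%C with (RtoC 0) by ring; rewrite Cmod_0; lra.
  - simpl gbox.
    set (A := fun k => gbox n lo L (fun i => G (zcons k i))).
    set (B := fun k => gbox n lo' L' (fun i => G (zcons k i))).
    set (X := rwin lo L rho); set (Y := rwin lo' L' rho).
    assert (HGk : forall k i, Cmod (G (zcons k i)) <= (K * rho k) * rprod n (fun a => rho (i a))).
    { intros k i; eapply Rle_trans; [apply HG|]; rewrite rprod_zcons; right; ring. }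
    assert (HKk : forall k, 0 <= K * rho k) by (intros; now apply Rmult_le_pos).
    assert (HA : Cmod (zwin lo L A - zwin lo' L' A)%C <= K * X ^ n * X - K * X ^ n * Y).
    { unfold X at 2, Y; rewrite <- !rwin_scal.
      apply zwin_sub; auto; intros k.
      eapply Rle_trans; [apply gbox_bound with (K := K * rho k) (rho := rho); auto|].
      unfold X; right; ring. }
    assert (HB : Cmod (zwin lo' L' (fun k => A k - B k)%C) <= K * (X ^ n - Y ^ n) * Y).
    { unfold Y at 2; rewrite <- rwin_scal.
      eapply Rle_trans; [apply Cmod_zwin|apply rwin_le]; intros k.
      eapply Rle_trans; [apply IHn with (K := K * rho k); auto|].
      unfold X, Y; right; ring. }
    replace (zwin lo L A - zwin lo' L' B)%C
      with ((zwin lo L A - zwin lo' L' A) + zwin lo' L' (fun k => A k - B k))%C.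
    + eapply Rle_trans; [apply Cmod_triangle|]; simpl; lra.
    + unfold zwin at 3; rewrite csum_minus; unfold zwin; ring.
Qed.

Lemma pow_sub_le n x y X : 0 <= y <= x -> x <= X -> 1 <= X ->
  x ^ n - y ^ n <= INR n * X ^ n * (x - y).
Proof.
  intros Hy Hx HX; induction n; [simpl; lra|].
  rewrite S_INR; simpl pow.
  assert (0 <= X ^ n) by (apply pow_le; lra).
  assert (y ^ n <= X ^ n) by (apply pow_incr; lra).
  assert (0 <= y ^ n) by (apply pow_le; lra).
  assert (0 <= INR n) by apply pos_INR.
  assert (x * (x ^ n - y ^ n) <= X * (INR n * X ^ n * (x - y))).
  { apply Rle_trans with (x * (INR n * X ^ n * (x - y))).
    - apply Rmult_le_compat_l; lra.
    - apply Rmult_le_compat_r; [|lra].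
      apply Rmult_le_pos; [apply Rmult_le_pos|]; lra. }
  assert ((x - y) * y ^ n <= (x - y) * (X * X ^ n)).
  { apply Rmult_le_compat_l; [lra|]. nra. }
  nra.
Qed.

(** M0 is chosen before G: one box serves all functions under the common majorant, in particular the
    minors of all truncations. *)
Lemma gbox_tail n K rho : 0 <= K -> l1 rho -> forall eps, 0 < eps -> exists M0,
  forall G, (forall i, Cmod (G i) <= K * rprod n (fun a => rho (i a))) ->
  forall lo L, (lo <= - Z.of_nat M0)%Z -> (Z.of_nat M0 < lo + Z.of_nat L)%Z ->
  Cmod (gbox n lo L G - gbox n (- Z.of_nat M0) (2 * M0 + 1) G)%C < eps.
Proof.
  intros HK Hl eps He.
  destruct (l1_window rho Hl) as (X & HX0 & HX).
  set (D := K * (INR n * (X + 1) ^ n) + 1).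
  assert (HD : 0 < D).
  { unfold D; assert (0 <= K * (INR n * (X + 1) ^ n)); [|lra].
    repeat apply Rmult_le_pos; auto; [apply pos_INR|apply pow_le; lra]. }
  destruct (l1_tail rho Hl (eps / D)) as [M0 HM]; [now apply Rdiv_lt_0_compat|].
  exists M0; intros G HG lo L H1 H2.
  eapply Rle_lt_trans; [apply gbox_diff with (K := K) (rho := rho); auto; try lia; apply Hl|].
  set (x := rwin lo L rho); set (y := rwin (- Z.of_nat M0) (2 * M0 + 1) rho).
  assert (Hxy : x - y < eps / D) by (apply HM; lia).
  assert (Hy : 0 <= y <= x).
  { split; [apply rwin_ge0, Hl|apply rwin_mono; try lia; apply Hl]. }
  assert (HxX : x <= X + 1) by (generalize (HX lo L); unfold x; lra).
  apply Rle_lt_trans with (K * (INR n * (X + 1) ^ n * (x - y))).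
  - apply Rmult_le_compat_l; auto; apply pow_sub_le; lra.
  - apply Rle_lt_trans with (D * (x - y)).
    + unfold D; nra.
    + apply Rlt_le_trans with (D * (eps / D)); [now apply Rmult_lt_compat_l|].
      right; field; lra.
Qed.

Definition glim (n : nat) (G : (nat -> Z) -> C) : C :=
  clim (fun M => gbox n (- Z.of_nat M) (2 * M + 1) G).

Lemma gbox_cv n K rho G : 0 <= K -> l1 rho ->
  (forall i, Cmod (G i) <= K * rprod n (fun a => rho (i a))) ->
  ccv (fun M => gbox n (- Z.of_nat M) (2 * M + 1) G) (glim n G).
Proof.
  intros HK Hl HG.
  destruct (ccv_cauchy (fun M => gbox n (- Z.of_nat M) (2 * M + 1) G)) as [l Hc].
  - intros eps He; destruct (gbox_tail n K rho HK Hl eps He) as [M0 HM].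
    exists M0; intros M HMM; apply HM; auto; lia.
  - unfold glim; now rewrite (clim_ccv _ _ Hc).
Qed.

Lemma gbox_window_cv n K rho G : 0 <= K -> l1 rho ->
  (forall i, Cmod (G i) <= K * rprod n (fun a => rho (i a))) ->
  forall eps, 0 < eps -> exists M0, forall lo L,
  (lo <= - Z.of_nat M0)%Z -> (Z.of_nat M0 < lo + Z.of_nat L)%Z ->
  Cmod (gbox n lo L G - glim n G)%C < eps.
Proof.
  intros HK Hl HG eps He.
  destruct (gbox_tail n K rho HK Hl (eps / 3)) as [M0 HM0]; [lra|].
  assert (Hc := gbox_cv n K rho G HK Hl HG).
  apply ccv_eps with (eps := eps / 3) in Hc; [|lra].
  destruct Hc as [M1 HM1]; exists M0; intros lo L H1 H2.
  assert (H3 := HM0 G HG lo L H1 H2).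
  assert (H4 := HM0 G HG (- Z.of_nat (M0 + M1))%Z (2 * (M0 + M1) + 1)%nat ltac:(lia) ltac:(lia)).
  assert (H5 := HM1 (M0 + M1)%nat ltac:(lia)); cbv beta in H5.
  set (a := gbox n lo L G) in *.
  set (b := gbox n (- Z.of_nat M0) (2 * M0 + 1) G) in *.
  set (c := gbox n (- Z.of_nat (M0 + M1)) (2 * (M0 + M1) + 1) G) in *.
  rewrite Cmod_minus_sym in H4.
  generalize (Cmod_triangle_minus a b (glim n G)) (Cmod_triangle_minus b c (glim n G)).
  lra.
Qed.

Lemma glim_bound n K rho G X : 0 <= K -> l1 rho -> (forall lo L, rwin lo L rho <= X) ->
  (forall i, Cmod (G i) <= K * rprod n (fun a => rho (i a))) ->
  Cmod (glim n G) <= K * X ^ n.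
Proof.
  intros HK Hl HX HG; eapply ccv_bound; [apply gbox_cv with (K := K) (rho := rho); auto|].
  intros M; eapply Rle_trans; [apply gbox_bound with (K := K) (rho := rho); auto; apply Hl|].
  apply Rmult_le_compat_l; auto; apply pow_incr; split; auto; apply rwin_ge0, Hl.
Qed.

(** * Splitting off one index; translations and reflections of boxes *)

(** Generalizes [zcons] to any position: in the a-th partial fraction it is the a-th index that
    carries the kernel. The values are polymorphic because factors of products are inserted in the
    same way. *)
Definition zins {A : Type} (a : nat) (k : A) (i : nat -> A) : nat -> A :=
  fun b => if Nat.ltb b a then i b else if Nat.eqb b a then k else i (b - 1)%nat.

Lemma zins_0 k i : zins 0 k i = zcons k i.
Proof.
  apply functional_extensionality; intros [|b]; unfold zins; simpl; auto.
  now rewrite Nat.sub_0_r.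
Qed.

Lemma zins_S a k u i : zins (S a) k (zcons u i) = zcons u (zins a k i).
Proof.
  apply functional_extensionality; intros [|b]; unfold zins; simpl; auto.
  change (S b <? S a) with (b <? a).
  destruct (Nat.ltb_spec b a); auto.
  destruct (Nat.eqb_spec b a); auto.
  rewrite Nat.sub_0_r; destruct b; [lia|simpl; now rewrite Nat.sub_0_r].
Qed.

(** Fubini for one coordinate: the recursion of [gbox] peels indices from the front, whereas the
    partial fractions single out the a-th one. *)
Lemma gbox_insert n a lo L G : (a <= n)%nat ->
  gbox (S n) lo L G = zwin lo L (fun k => gbox n lo L (fun i => G (zins a k i))).
Proof.
  revert n G; induction a; intros n G Ha.
  - apply csum_ext; intros t _; apply gbox_ext; intros i; now rewrite zins_0.
  - destruct n; [lia|].
    transitivity (zwin lo L (fun u => gbox (S n) lo L (fun i => G (zcons u i)))); [reflexivity|].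
    transitivity (zwin lo L (fun u => zwin lo L (fun k =>
       gbox n lo L (fun i => G (zcons u (zins a k i)))))).
    { apply csum_ext; intros t _; apply IHa; lia. }
    unfold zwin; rewrite csum_swap; apply csum_ext; intros t _.
    apply csum_ext; intros u _; apply gbox_ext; intros i; now rewrite zins_S.
Qed.

Lemma rprod_zins m a (u : R) f : (a <= m)%nat -> rprod (S m) (zins a u f) = u * rprod m f.
Proof.
  intros Ha; induction m.
  - replace a with O by lia; unfold zins; simpl; ring.
  - change (rprod (S m) (zins a u f) * zins a u f (S m) = u * (rprod m f * f m)).
    destruct (Nat.eq_dec a (S m)) as [->|Hn].
    + rewrite (rprod_ext (S m) _ f).
      * unfold zins; rewrite Nat.ltb_irrefl, Nat.eqb_refl; simpl; ring.
      * intros k Hk; unfold zins; destruct (Nat.ltb_spec k (S m)); [auto|lia].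
    + rewrite IHm by lia; unfold zins.
      destruct (Nat.ltb_spec (S m) a); [lia|].
      destruct (Nat.eqb_spec (S m) a); [lia|].
      replace (S m - 1)%nat with m by lia; ring.
Qed.

Lemma cprod_zins m a (u : C) f : (a <= m)%nat -> cprod (S m) (zins a u f) = (u * cprod m f)%C.
Proof.
  intros Ha; induction m.
  - replace a with O by lia; unfold zins; simpl; ring.
  - change (cprod (S m) (zins a u f) * zins a u f (S m) = u * (cprod m f * f m))%C.
    destruct (Nat.eq_dec a (S m)) as [->|Hn].
    + rewrite (cprod_ext (S m) _ f).
      * unfold zins; rewrite Nat.ltb_irrefl, Nat.eqb_refl; simpl; ring.
      * intros k Hk; unfold zins; destruct (Nat.ltb_spec k (S m)); [auto|lia].
    + rewrite IHm by lia; unfold zins.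
      destruct (Nat.ltb_spec (S m) a); [lia|].
      destruct (Nat.eqb_spec (S m) a); [lia|].
      replace (S m - 1)%nat with m by lia; ring.
Qed.

Lemma zins_map {A B : Type} (phi : A -> B) a k i b :
  phi (zins a k i b) = zins a (phi k) (fun c => phi (i c)) b.
Proof. unfold zins; destruct (Nat.ltb b a), (Nat.eqb b a); reflexivity. Qed.

Lemma zins_same {A : Type} a (k : A) i : zins a k i a = k.
Proof. unfold zins; now rewrite Nat.ltb_irrefl, Nat.eqb_refl. Qed.

(** [gbox] pads its index sequences with 0, a value that a translation by j would turn into j; this
    condition makes the padding invisible. *)
Definition depends_on_first (n : nat) (G : (nat -> Z) -> C) : Prop :=
  forall i i', (forall a, (a < n)%nat -> i a = i' a) -> G i = G i'.

Lemma gbox_shift n lo L j G : depends_on_first n G ->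
  gbox n lo L (fun i => G (fun a => (i a + j)%Z)) = gbox n (lo + j) L G.
Proof.
  revert G; induction n; intros G HG; simpl.
  - apply HG; intros; lia.
  - apply csum_ext; intros t _.
    replace (Z.of_nat t + (lo + j))%Z with ((Z.of_nat t + lo) + j)%Z by ring.
    set (k := (Z.of_nat t + lo)%Z).
    rewrite <- (IHn (fun i => G (zcons (k + j)%Z i))).
    + apply gbox_ext; intros i; f_equal; apply functional_extensionality; intros [|b]; auto.
    + intros i i' Hi; apply HG; intros [|b] Hb; simpl; auto; apply Hi; lia.
Qed.

Lemma gbox_opp n M G :
  gbox n (- Z.of_nat M) (2 * M + 1) (fun i => G (fun a => (- i a)%Z))
  = gbox n (- Z.of_nat M) (2 * M + 1) G.
Proof.
  revert G; induction n; intros G; [reflexivity|].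
  simpl gbox; change (zs M (fun t => gbox n (- Z.of_nat M) (2 * M + 1)
     (fun i => G (fun a => (- zcons t i a)%Z)))
   = zs M (fun t => gbox n (- Z.of_nat M) (2 * M + 1) (fun i => G (zcons t i)))).
  rewrite <- (zs_opp M (fun t => gbox n (- Z.of_nat M) (2 * M + 1) (fun i => G (zcons t i)))).
  apply zs_ext; intros k.
  rewrite <- (IHn (fun i => G (zcons (- k)%Z i))); apply gbox_ext; intros i; f_equal.
  apply functional_extensionality; intros [|b]; auto.
Qed.

(** * Partial fractions of products of hyperbolic cosecants *)

Definition ccosh (z : C) : C := ((cexp z + cexp (- z)) / RtoC 2)%C.
Definition csinh (z : C) : C := ((cexp z - cexp (- z)) / RtoC 2)%C.

Lemma C_ext (z w : C) : Re z = Re w -> Im z = Im w -> z = w.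
Proof. destruct z, w; unfold Re, Im; simpl; congruence. Qed.

Lemma Cmult_m1_l z : (RtoC (-1) * z)%C = (- z)%C.
Proof. apply C_ext; simpl; ring. Qed.

Lemma RtoC_neq0 x : x <> 0 -> RtoC x <> RtoC 0.
Proof. intros H E; apply RtoC_inj in E; auto. Qed.

Lemma Ci_neq0 : Ci <> RtoC 0.
Proof. intros E; injection E; lra. Qed.

Lemma cexp_plus a b : cexp (a + b) = (cexp a * cexp b)%C.
Proof.
  destruct a as [x y], b as [u v]; unfold cexp, Cplus, Cmult, Re, Im; simpl.
  rewrite exp_plus, cos_plus, sin_plus; f_equal; ring.
Qed.

Lemma cexp_0 : cexp 0 = RtoC 1.
Proof. unfold cexp, RtoC; simpl; rewrite exp_0, cos_0, sin_0; f_equal; ring. Qed.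

Lemma cexp_opp_mult z : (cexp z * cexp (- z))%C = RtoC 1.
Proof. rewrite <- cexp_plus, <- cexp_0; f_equal; ring. Qed.

Lemma cexp_neq0 z : cexp z <> RtoC 0.
Proof.
  intros E; generalize (cexp_opp_mult z); rewrite E, Cmult_0_l; intros H.
  apply RtoC_inj in H; lra.
Qed.

Lemma cexp_opp z : cexp (- z) = (/ cexp z)%C.
Proof.
  generalize (cexp_neq0 z) (cexp_opp_mult z); intros H E.
  replace (/ cexp z)%C with (/ cexp z * (cexp z * cexp (- z)))%C by (rewrite E; ring).
  now field.
Qed.

Lemma Cmod_cexp z : Cmod (cexp z) = exp (Re z).
Proof.
  unfold Cmod, cexp; simpl.
  replace (_ + _) with (Rsqr (exp (Re z)) * (Rsqr (sin (Im z)) + Rsqr (cos (Im z))))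
    by (unfold Rsqr; ring).
  rewrite sin2_cos2, Rmult_1_r; apply sqrt_Rsqr, Rlt_le, exp_pos.
Qed.

Lemma RtoC_2_neq0 : RtoC 2 <> RtoC 0.
Proof. apply RtoC_neq0; lra. Qed.
#[local] Hint Resolve RtoC_2_neq0 cexp_neq0 : core.

Lemma ccosh_plus a b : ccosh (a + b) = (ccosh a * ccosh b + csinh a * csinh b)%C.
Proof.
  unfold ccosh, csinh; rewrite !cexp_opp, !cexp_plus; field; auto.
Qed.

Lemma csinh_plus a b : csinh (a + b) = (csinh a * ccosh b + ccosh a * csinh b)%C.
Proof.
  unfold ccosh, csinh; rewrite !cexp_opp, !cexp_plus; field; auto.
Qed.

Lemma ccosh_opp z : ccosh (- z) = ccosh z.
Proof. unfold ccosh; replace (- - z)%C with z by ring; f_equal; ring. Qed.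

Lemma csinh_opp z : csinh (- z) = (- csinh z)%C.
Proof. unfold csinh; replace (- - z)%C with z by ring; field; auto. Qed.

Lemma csinh_minus a b : csinh (a - b) = (csinh a * ccosh b - ccosh a * csinh b)%C.
Proof. unfold Cminus at 1; rewrite csinh_plus, ccosh_opp, csinh_opp; ring. Qed.

Lemma ccosh_minus a b : ccosh (a - b) = (ccosh a * ccosh b - csinh a * csinh b)%C.
Proof. unfold Cminus at 1; rewrite ccosh_plus, ccosh_opp, csinh_opp; ring. Qed.

Lemma ccosh_sqr z : (ccosh z * ccosh z)%C = (RtoC 1 + csinh z * csinh z)%C.
Proof. unfold ccosh, csinh; rewrite !cexp_opp; field; auto. Qed.

Lemma ccosh_pair x y : ccosh (x, y) = (cosh x * cos y, sinh x * sin y).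
Proof.
  unfold ccosh, cosh, sinh, cexp; apply C_ext; simpl;
  rewrite cos_neg, sin_neg; unfold Rdiv;
  replace (2 * (2 * 1) + 0 * (0 * 1)) with 4 by ring; field.
Qed.

Lemma csinh_pair x y : csinh (x, y) = (sinh x * cos y, cosh x * sin y).
Proof.
  unfold csinh, cosh, sinh, cexp; apply C_ext; simpl;
  rewrite cos_neg, sin_neg; unfold Rdiv;
  replace (2 * (2 * 1) + 0 * (0 * 1)) with 4 by ring; field.
Qed.

Lemma ccosh_real x : ccosh (RtoC x) = RtoC (cosh x).
Proof. unfold RtoC; rewrite ccosh_pair, cos_0, sin_0; apply C_ext; simpl; ring. Qed.

Lemma csinh_real x : csinh (RtoC x) = RtoC (sinh x).
Proof. unfold RtoC; rewrite csinh_pair, cos_0, sin_0; apply C_ext; simpl; ring. Qed.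

Lemma ccosh_conj z : Cconj (ccosh z) = ccosh (Cconj z).
Proof.
  destruct z as [x y]; change (Cconj (x, y)) with (x, - y).
  rewrite !ccosh_pair, cos_neg, sin_neg; apply C_ext; simpl; ring.
Qed.

Lemma ccosh_shift z : ccosh (z + (0, PI / 2)) = (Ci * csinh z)%C.
Proof.
  rewrite ccosh_plus, ccosh_pair, csinh_pair, cosh_0, sinh_0, cos_PI2, sin_PI2.
  destruct (csinh z), (ccosh z); apply C_ext; simpl; ring.
Qed.

Lemma csinh_shift z : csinh (z + (0, PI / 2)) = (Ci * ccosh z)%C.
Proof.
  rewrite csinh_plus, ccosh_pair, csinh_pair, cosh_0, sinh_0, cos_PI2, sin_PI2.
  destruct (csinh z), (ccosh z); apply C_ext; simpl; ring.
Qed.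

Lemma ccosh_shift_PI z : ccosh (z + (0, PI)) = (- ccosh z)%C.
Proof.
  rewrite ccosh_plus, ccosh_pair, csinh_pair, cosh_0, sinh_0, cos_PI, sin_PI.
  destruct (csinh z), (ccosh z); apply C_ext; simpl; ring.
Qed.

Lemma cosh_sqr x : cosh x * cosh x = 1 + sinh x * sinh x.
Proof.
  unfold cosh, sinh; rewrite exp_Ropp; field; apply Rgt_not_eq, exp_pos.
Qed.

Lemma Cmod_ccosh_sqr x y :
  Cmod (ccosh (x, y)) * Cmod (ccosh (x, y)) = sinh x * sinh x + cos y * cos y.
Proof.
  replace (Cmod (ccosh (x, y)) * Cmod (ccosh (x, y))) with (Cmod (ccosh (x, y)) ^ 2) by ring.
  rewrite Cmod2_alt, ccosh_pair; simpl.
  assert (H1 := cosh_sqr x); assert (H2 := sin2_cos2 y); unfold Rsqr in H2.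
  replace (cosh x * cos y * (cosh x * cos y * 1) + sinh x * sin y * (sinh x * sin y * 1))
    with ((cosh x * cosh x) * (cos y * cos y) + sinh x * sinh x * (sin y * sin y)) by ring.
  rewrite H1; replace (sin y * sin y) with (1 - cos y * cos y) by lra; ring.
Qed.

Lemma Cmult_cancel_r a b z : z <> RtoC 0 -> (a * z)%C = (b * z)%C -> a = b.
Proof.
  intros Hz E; replace a with (a * z / z)%C by now field.
  rewrite E; now field.
Qed.

(** Under y -> y + i PI a product of n factors csch changes by the sign (-1)^n, so it decomposes
    into csch if n is odd and into coth if n is even. *)
Definition pf_kernel (n : nat) (z : C) : C :=
  if Nat.odd n then (/ csinh z)%C else (ccosh z / csinh z)%C.

(** The value of the remaining csch factors at the pole y = - x a. *)
Definition pf_coef (n : nat) (x : nat -> C) (a : nat) : C :=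
  cprod n (fun b => if Nat.eqb b a then RtoC 1 else (/ csinh (x b - x a))%C).

Lemma pf_coef_S n x a : (a < n)%nat -> pf_coef (S n) x a = (pf_coef n x a / csinh (x n - x a))%C.
Proof.
  intros Ha; unfold pf_coef; simpl.
  destruct (Nat.eqb_spec n a); [lia|reflexivity].
Qed.

Lemma pf_coef_last n x : pf_coef (S n) x n = cprod n (fun b => (/ csinh (x b - x n))%C).
Proof.
  unfold pf_coef; simpl; rewrite Nat.eqb_refl, Cmult_1_r.
  apply cprod_ext; intros b Hb; destruct (Nat.eqb_spec b n); [lia|reflexivity].
Qed.

(* The coefficient of the new term is the case [n] of the identity at [y = - x n]. *)
Lemma csch_partial_fractions n x y : (0 < n)%nat ->
  (forall a b, (a < n)%nat -> (b < n)%nat -> a <> b -> csinh (x b - x a) <> RtoC 0) ->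
  (forall a, (a < n)%nat -> csinh (y + x a) <> RtoC 0) ->
  cprod n (fun a => (/ csinh (y + x a))%C)
  = csum n (fun a => pf_coef n x a * pf_kernel n (y + x a))%C.
Proof.
  intros Hn; revert y; induction n as [|n IHn]; [lia|]; intros y Hx Hy.
  destruct (Nat.eq_dec n 0) as [->|Hn0].
  { unfold pf_coef, pf_kernel; simpl; ring. }
  assert (IH := fun y H => IHn ltac:(lia) y ltac:(intros; apply Hx; lia) H); clear IHn.
  assert (Elast : pf_coef (S n) x n = csum n (fun a => pf_coef n x a * pf_kernel n (x a - x n))%C).
  { rewrite pf_coef_last.
    transitivity (cprod n (fun a => / csinh (- x n + x a))%C).
    - apply cprod_ext; intros a _; do 2 f_equal; ring.
    - rewrite IH.
      + apply csum_ext; intros a _; do 2 f_equal; ring.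
      + intros a Ha; replace (- x n + x a)%C with (x a - x n)%C by ring; apply Hx; lia. }
  change (cprod (S n) (fun a => / csinh (y + x a))%C)
    with (cprod n (fun a => / csinh (y + x a)) * / csinh (y + x n))%C.
  change (csum (S n) (fun a => pf_coef (S n) x a * pf_kernel (S n) (y + x a))%C) with
    (csum n (fun a => pf_coef (S n) x a * pf_kernel (S n) (y + x a)) +
     pf_coef (S n) x n * pf_kernel (S n) (y + x n))%C.
  rewrite IH, Elast by (intros; apply Hy; lia).
  rewrite (Cmult_comm _ (/ csinh (y + x n)))%C, (Cmult_comm _ (pf_kernel (S n) (y + x n)))%C.
  (* Termwise the induction step is an addition formula for A = y + x a and B = y + x n: csch A csch
     B = csch (B - A) (coth A - coth B) if n is odd, and coth A csch B = csch (B - A) csch A - coth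
     (B - A) csch B if n is even. *)
  rewrite <- !csum_scal, <- csum_plus; apply csum_ext; intros a Ha.
  rewrite pf_coef_S by auto.
  set (K := pf_coef n x a).
  assert (H1 : csinh (x n - x a) <> RtoC 0) by (apply Hx; lia).
  assert (H2 := Hy a ltac:(lia)); assert (H3 := Hy n ltac:(lia)).
  replace (x a - x n)%C with (- (x n - x a))%C by ring.
  unfold pf_kernel.
  replace (Nat.odd (S n)) with (negb (Nat.odd n))
    by (rewrite Nat.odd_succ, <- Nat.negb_odd; reflexivity).
  rewrite ccosh_opp, csinh_opp.
  replace (x n - x a)%C with ((y + x n) - (y + x a))%C in * by ring.
  set (A := (y + x a)%C) in *; set (B := (y + x n)%C) in *.
  rewrite csinh_minus, ?ccosh_minus in *.
  generalize (ccosh_sqr A) (ccosh_sqr B); intros EA EB.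
  assert (H4 : (- (csinh B * ccosh A - ccosh B * csinh A))%C <> RtoC 0).
  { intros E; apply H1.
    replace (csinh B * ccosh A - ccosh B * csinh A)%C
      with (- (- (csinh B * ccosh A - ccosh B * csinh A)))%C by ring.
    rewrite E; ring. }
  destruct (Nat.odd n); simpl negb; cbv iota.
  - field; auto.
  - apply Cmult_cancel_r with (z := (csinh A * csinh B * (csinh B * ccosh A - ccosh B * csinh A))%C);
      [apply Cmult_neq_0; [apply Cmult_neq_0|]; auto|].
    transitivity (K * ccosh A * (csinh B * ccosh A - ccosh B * csinh A))%C; [field; auto|].
    transitivity (K * (csinh B - csinh A * (ccosh B * ccosh A - csinh B * csinh A)))%C.
    + transitivity (K * (csinh B * (ccosh A * ccosh A) - ccosh B * ccosh A * csinh A))%C; [ring|].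
      rewrite EA; ring.
    + field; auto.
Qed.

(** * Determinants *)

Module ComplexDet.
From HB Require Import structures.
Import all_boot all_algebra Rstruct.
Import GRing.Theory.

(** A copy of [C] with the MathComp ring structure, so that transposition, alternation and diagonal
    scaling of [cdet] come from [\det]. *)
Definition cR : Type := C.
HB.instance Definition _ := Choice.copy cR (R * R)%type.
Fact cR_addA : associative (Cplus : cR -> cR -> cR).
Proof. by move=> x y z; rewrite Cplus_assoc. Qed.
HB.instance Definition _ := GRing.isZmodule.Build cR cR_addA Cplus_comm Cplus_0_l
  (fun x => etrans (Cplus_comm _ _) (Cplus_opp_r x)).
Fact cR_1_neq0 : (RtoC 1 : cR) != (RtoC 0 : cR).
Proof. by apply/eqP=> E; apply RtoC_inj in E; lra. Qed.
HB.instance Definition _ := GRing.Zmodule_isComNzRing.Build cR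
  Cmult_assoc Cmult_comm Cmult_1_l Cmult_plus_distr_r cR_1_neq0.

Lemma csum_big n (F : nat -> cR) : csum n F = (\sum_(i < n) F i)%R.
Proof. by elim: n => [|n IH]; rewrite ?big_ord0 // big_ord_recr /= IH. Qed.

Lemma cprod_big n (F : nat -> cR) : cprod n F = (\prod_(i < n) F i)%R.
Proof. by elim: n => [|n IH]; rewrite ?big_ord0 // big_ord_recr /= IH. Qed.

Lemma sign_even j : (if Nat.even j then RtoC 1 else RtoC (-1)) = ((-1) ^+ j : cR)%R.
Proof.
elim: j => [|j IH] //; rewrite Nat.even_succ -Nat.negb_even exprS -IH.
case: (Nat.even j) => /=.
  by rewrite mulr1; apply C_ext; simpl; ring.
by rewrite mulN1r; apply C_ext; simpl; ring.
Qed.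

Lemma ltb_ltn m n : Nat.ltb m n = (m < n)%N.
Proof. by apply/idP/idP => [/Nat.ltb_lt/ltP|/ltP/Nat.ltb_lt]. Qed.

Lemma cdet_det n (A : nat -> nat -> cR) :
  cdet n A = (\det (\matrix_(i < n, j < n) A i j))%R.
Proof.
elim: n A => [|n IH] A; first by rewrite det_mx00.
rewrite (expand_det_row _ ord0) /= -[LHS]/(csum n.+1 _) csum_big.
apply: eq_bigr => j _; rewrite !mxE /cofactor IH sign_even add0n.
rewrite [RHS]mulrCA mulrA; apply: (congr1 (fun d : cR => (_ * _ * d)%R)).
congr (\det _)%R.
apply/matrixP=> r c; rewrite !mxE; congr A.
by rewrite ltb_ltn /= /bump; case: ltnP.
Qed.

Lemma cdet_ext n (A B : nat -> nat -> C) :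
  (forall i j, (i < n)%coq_nat -> (j < n)%coq_nat -> A i j = B i j) -> cdet n A = cdet n B.
Proof.
move=> H; rewrite !cdet_det; apply: (congr1 (fun M : 'M[cR]_n => (\det M)%R)).
apply/matrixP=> i j; rewrite !mxE.
by apply: H; apply/ltP.
Qed.

Lemma cdet_tr n (A : nat -> nat -> C) : cdet n (fun i j => A j i) = cdet n A.
Proof.
rewrite !cdet_det -det_tr; apply: (congr1 (fun M : 'M[cR]_n => (\det M)%R)).
by apply/matrixP=> i j; rewrite !mxE.
Qed.

Lemma cdet_equal_rows n (A : nat -> nat -> C) a b :
  (a < n)%coq_nat -> (b < n)%coq_nat -> a <> b ->
  (forall j, A a j = A b j) -> cdet n A = RtoC 0.
Proof.
move=> /ltP Ha /ltP Hb Hab H; rewrite cdet_det.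
apply: (@determinant_alternate cR _ _ (Ordinal Ha) (Ordinal Hb)).
  by apply/eqP=> -[].
by move=> j; rewrite !mxE.
Qed.

Lemma cdet_scale n (u v : nat -> C) (A : nat -> nat -> C) :
  cdet n (fun i j => u i * A i j * v j)%C = (cprod n u * cprod n v * cdet n A)%C.
Proof.
rewrite !cdet_det !cprod_big.
have -> : (\matrix_(i < n, j < n) ((u i * A i j * v j)%C : cR))%R
  = (diag_mx (\row_i (u i : cR)) *m (\matrix_(i < n, j < n) (A i j : cR))
       *m diag_mx (\row_i (v i : cR)))%R.
  by apply/matrixP=> i j; rewrite mul_mx_diag mul_diag_mx !mxE.
rewrite !det_mulmx !det_diag mulrAC; apply: (f_equal2 Cmult) => //.
by apply: (f_equal2 Cmult); apply: eq_bigr => i _; rewrite mxE.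
Qed.
End ComplexDet.
Import ComplexDet.

Lemma cdet_S n A : cdet (S n) A = csum (S n) (fun j =>
  ((if Nat.even j then RtoC 1 else RtoC (-1)) * A O j
   * cdet n (fun r c => A (S r) (if Nat.ltb c j then c else S c)))%C).
Proof. reflexivity. Qed.

Lemma cdet_conj n (A : nat -> nat -> C) : Cconj (cdet n A) = cdet n (fun i j => Cconj (A i j)).
Proof.
  revert A; induction n; intros A.
  - apply C_ext; simpl; ring.
  - rewrite !cdet_S, csum_conj; apply csum_ext; intros j _.
    rewrite !Cmult_conj, IHn; do 2 f_equal.
    destruct (Nat.even j); apply C_ext; simpl; ring.
Qed.

Lemma rsum_skip n j f : (j <= n)%nat -> (forall k, 0 <= f k) ->
  rsum n (fun c => f (if Nat.ltb c j then c else S c)) + f j = rsum (S n) f.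
Proof.
  intros Hj Hf; induction n.
  - replace j with O by lia; simpl; ring.
  - destruct (Nat.eq_dec j (S n)) as [->|Hn].
    + change (rsum (S (S n)) f) with (rsum (S n) f + f (S n)); f_equal.
      apply rsum_ext; intros c Hc; destruct (Nat.ltb_spec c (S n)); [reflexivity|lia].
    + change (rsum (S (S n)) f) with (rsum (S n) f + f (S n)).
      rewrite <- IHn by lia; simpl.
      destruct (Nat.ltb_spec n j); [lia|ring].
Qed.

(** Cruder than Hadamard's inequality, but multiplicative over rows with l^1 norms, the form that
    can be summed over all index tuples. Expansion along the first row gives it, each minor having
    shorter rows. *)
Lemma Cmod_cdet n (A : nat -> nat -> C) :
  Cmod (cdet n A) <= rprod n (fun a => rsum n (fun b => Cmod (A a b))).
Proof.
  revert A; induction n; intros A; [simpl; rewrite Cmod_1; lra|].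
  rewrite rprod_S_l.
  set (P := rprod n (fun a => rsum (S n) (fun b => Cmod (A (S a) b)))).
  rewrite cdet_S.
  eapply Rle_trans; [apply Cmod_csum|].
  apply Rle_trans with (rsum (S n) (fun j => P * Cmod (A O j))).
  - apply rsum_le; intros j Hj; rewrite !Cmod_mult.
    replace (Cmod (if Nat.even j then RtoC 1 else RtoC (-1))) with 1.
    + rewrite Rmult_1_l, Rmult_comm; apply Rmult_le_compat_r; [apply Cmod_ge_0|].
      eapply Rle_trans; [apply IHn|]; apply rprod_le; intros k Hk; split.
      * apply rsum_ge0; intros; apply Cmod_ge_0.
      * rewrite <- (rsum_skip n j (fun b => Cmod (A (S k) b)));
          [generalize (Cmod_ge_0 (A (S k) j)); lra|lia|intros; apply Cmod_ge_0].
    + destruct (Nat.even j); rewrite Cmod_R; [rewrite Rabs_R1|rewrite Rabs_left]; lra.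
  - rewrite rsum_scal; lra.
Qed.

(** * The traces of the exterior powers *)

Definition wfun (s : C) : C := (RtoC PI / ccosh (RtoC PI * s))%C.
Definition node (om : R) (s : C) (k : Z) : C := (s + RtoC (om * IZR k))%C.
(** The weights at s = 0 serve as reference: [wbound] compares every other s with them, so the
    minors have to be dominated only once. *)
Definition w0 (om : R) (k : Z) : R := PI / cosh (PI * om * IZR k).

Definition regular (om : R) (s : C) : Prop := forall k, ccosh (RtoC PI * node om s k) <> RtoC 0.

Lemma cosh_ge_exp x : exp (Rabs x) / 2 <= cosh x.
Proof.
  unfold cosh; generalize (exp_pos x) (exp_pos (- x)); intros.
  unfold Rabs; destruct (Rcase_abs x); lra.
Qed.

Lemma cosh_gt0 x : 0 < cosh x.
Proof. unfold cosh; generalize (exp_pos x) (exp_pos (- x)); lra. Qed.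

Lemma cosh_le_exp x : cosh x <= exp (Rabs x).
Proof.
  unfold cosh, Rabs; destruct (Rcase_abs x) as [H|H].
  - assert (exp x <= exp (- x)) by (apply Rlt_le, exp_increasing; lra); lra.
  - assert (exp (- x) <= exp x).
    { destruct (Req_dec x 0) as [->|]; [rewrite Ropp_0; lra|].
      apply Rlt_le, exp_increasing; lra. }
    lra.
Qed.

Lemma w0_pos om k : 0 < w0 om k.
Proof. apply Rdiv_lt_0_compat; [apply PI_RGT_0|apply cosh_gt0]. Qed.

Definition edecay (om : R) (k : Z) : R := exp (- (PI * om * Rabs (IZR k))).

Lemma w0_le_edecay om k : 0 < om -> w0 om k <= 2 * PI * edecay om k.
Proof.
  intros Ho; unfold w0, edecay; rewrite exp_Ropp.
  assert (HP := PI_RGT_0).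
  assert (H := cosh_ge_exp (PI * om * IZR k)).
  replace (Rabs (PI * om * IZR k)) with (PI * om * Rabs (IZR k)) in H.
  2: { rewrite Rabs_mult, (Rabs_pos_eq (PI * om)); auto.
       apply Rmult_le_pos; lra. }
  set (e := exp (PI * om * Rabs (IZR k))) in *.
  assert (0 < e) by apply exp_pos.
  replace (2 * PI * / e) with (PI / (e / 2)) by (field; lra).
  apply Rmult_le_compat_l; [lra|]; apply Rinv_le_contravar; lra.
Qed.

Lemma edecay_le_w0 om k : 0 < om -> PI * edecay om k <= w0 om k.
Proof.
  intros Ho; unfold w0, edecay; rewrite exp_Ropp.
  assert (HP := PI_RGT_0).
  assert (H := cosh_le_exp (PI * om * IZR k)).
  replace (Rabs (PI * om * IZR k)) with (PI * om * Rabs (IZR k)) in H.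
  2: { rewrite Rabs_mult, (Rabs_pos_eq (PI * om)); auto.
       apply Rmult_le_pos; lra. }
  apply Rmult_le_compat_l; [lra|]; apply Rinv_le_contravar; auto; apply cosh_gt0.
Qed.

Lemma rsum_geom q n : 0 <= q < 1 -> rsum n (fun k => q ^ k) <= / (1 - q).
Proof.
  intros Hq.
  assert (E : rsum n (fun k => q ^ k) = (1 - q ^ n) / (1 - q)).
  { induction n; [simpl; field; lra|].
    simpl rsum; rewrite IHn; simpl pow; field; lra. }
  rewrite E; unfold Rdiv; rewrite <- (Rmult_1_l (/ (1 - q))) at 2.
  apply Rmult_le_compat_r; [apply Rlt_le, Rinv_0_lt_compat; lra|].
  generalize (pow_le q n (proj1 Hq)); lra.
Qed.

Lemma exp_pow x n : exp x ^ n = exp (INR n * x).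
Proof.
  induction n; [simpl; now rewrite Rmult_0_l, exp_0|].
  rewrite S_INR; simpl; rewrite IHn, <- exp_plus; f_equal; ring.
Qed.

Lemma rsum_rev n f : rsum n f = rsum n (fun k => f (n - S k)%nat).
Proof. apply RtoC_inj; rewrite !RtoC_rsum; apply csum_rev. Qed.

Lemma l1_exp a : 0 < a -> l1 (fun k => exp (- (a * Rabs (IZR k)))).
Proof.
  intros Ha; split; [intros; apply Rlt_le, exp_pos|].
  assert (Hq : 0 <= exp (- a) < 1).
  { split; [apply Rlt_le, exp_pos|rewrite <- exp_0; apply exp_increasing; lra]. }
  exists (/ (1 - exp (- a)) + / (1 - exp (- a))); intros M.
  unfold rzs; replace (2 * M + 1)%nat with (M + S M + 0)%nat by lia.
  rewrite rwin_split.
  assert (H1 : rwin (- Z.of_nat M) M (fun k => exp (- (a * Rabs (IZR k)))) <= / (1 - exp (- a))).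
  { eapply Rle_trans; [|apply (rsum_geom _ M Hq)].
    unfold rwin; rewrite rsum_rev; apply rsum_le; intros k Hk.
    rewrite exp_pow.
    replace (Z.of_nat (M - S k) + - Z.of_nat M)%Z with (- (Z.of_nat k + 1))%Z by lia.
    rewrite opp_IZR, Rabs_Ropp, plus_IZR, <- INR_IZR_INZ, Rabs_pos_eq
      by (generalize (pos_INR k); lra).
    apply Rlt_le, exp_increasing; lra. }
  assert (H2 : rwin (- Z.of_nat M + Z.of_nat M) (S M) (fun k => exp (- (a * Rabs (IZR k))))
     <= / (1 - exp (- a))).
  { eapply Rle_trans; [|apply (rsum_geom _ (S M) Hq)].
    apply rsum_le; intros k Hk; rewrite exp_pow.
    replace (Z.of_nat k + (- Z.of_nat M + Z.of_nat M))%Z with (Z.of_nat k) by lia.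
    rewrite <- INR_IZR_INZ, Rabs_pos_eq by apply pos_INR.
    right; f_equal; ring. }
  change (rwin (- Z.of_nat M + Z.of_nat (M + S M)) 0 (fun k => exp (- (a * Rabs (IZR k))))) with 0.
  lra.
Qed.

Lemma l1_edecay om : 0 < om -> l1 (edecay om).
Proof.
  intros Ho; apply l1_exp, Rmult_lt_0_compat; auto; apply PI_RGT_0.
Qed.

Lemma l1_w0 om : 0 < om -> l1 (w0 om).
Proof.
  intros Ho; apply l1_le with (fun k => 2 * PI * edecay om k).
  - intros k; split; [apply Rlt_le, w0_pos|now apply w0_le_edecay].
  - apply l1_scal; [generalize PI_RGT_0; lra|now apply l1_edecay].
Qed.

Definition detc (c : Z -> C) (n : nat) (i : nat -> Z) : C :=
  cdet n (fun a b => c (i a - i b)%Z).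

(** The role of the trace class property is played by this bound: one summable [rho], the same for
    all orders n, majorizes all weighted minors, and the determinant series is then majorized by an
    exponential series. *)
Definition minors_dominated (om : R) (c : Z -> C) (rho : Z -> R) : Prop :=
  l1 rho /\ forall n i, Cmod (detc c n i) * rprod n (fun a => w0 om (i a))
                        <= rprod n (fun a => rho (i a)).

Definition minor_term (om : R) (c : Z -> C) (s : C) (n : nat) (i : nat -> Z) : C :=
  (detc c n i * cprod n (fun a => wfun (node om s (i a))))%C.

Definition trace_term (om : R) (c : Z -> C) (s : C) (n : nat) : C :=
  glim n (minor_term om c s n).

Definition wbound (om : R) (s : C) (K : R) : Prop :=
  regular om s /\ 0 <= K /\ forall k, Cmod (wfun (node om s k)) <= K * w0 om k.

Definition fsum (om : R) (s : C) : C := zlim (fun k => wfun (node om s k)).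

Definition xnode (om : R) (k : Z) : C := RtoC (PI * om * IZR k).

Definition coef_term (om : R) (c : Z -> C) (n a : nat) (i : nat -> Z) : C :=
  (detc c n i * pf_coef n (fun b => xnode om (i b)) a)%C.

Lemma detc_shift c n i k : detc c n (fun a => (i a + k)%Z) = detc c n i.
Proof. apply cdet_ext; intros a b _ _; f_equal; ring. Qed.

(** Negating the indices transposes the Toeplitz matrix. *)
Lemma detc_opp c n i : detc c n (fun a => (- i a)%Z) = detc c n i.
Proof.
  unfold detc; rewrite <- cdet_tr; apply cdet_ext; intros a b _ _; f_equal; ring.
Qed.

Lemma detc_equal c n i a b : (a < n)%nat -> (b < n)%nat -> a <> b -> i a = i b ->
  detc c n i = RtoC 0.
Proof.
  intros Ha Hb Hab E; apply (cdet_equal_rows n _ a b Ha Hb Hab).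
  intros j; now rewrite E.
Qed.

Lemma detc_depends c n : depends_on_first n (detc c n).
Proof. intros i i' H; apply cdet_ext; intros a b Ha Hb; now rewrite !H. Qed.

Lemma sinh_neq0 x : x <> 0 -> sinh x <> 0.
Proof.
  intros Hx E; rewrite <- sinh_0 in E.
  destruct (Rtotal_order x 0) as [H|[H|H]]; [|auto|];
  generalize (sinh_lt _ _ H); lra.
Qed.

Lemma PI_om_neq0 om k : 0 < om -> k <> 0%Z -> PI * om * IZR k <> 0.
Proof.
  intros Ho Hk; apply Rmult_integral_contrapositive; split.
  - apply Rgt_not_eq, Rmult_lt_0_compat; auto; apply PI_RGT_0.
  - intros E; apply Hk; now apply eq_IZR.
Qed.

Lemma csinh_xnode_minus om k l :
  csinh (xnode om k - xnode om l) = RtoC (sinh (PI * om * IZR (k - l))).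
Proof.
  unfold xnode; rewrite <- RtoC_minus, csinh_real; do 2 f_equal.
  rewrite minus_IZR; ring.
Qed.

Lemma csinh_xnode_neq0 om k l : 0 < om -> k <> l ->
  csinh (xnode om k - xnode om l) <> RtoC 0.
Proof.
  intros Ho Hkl; rewrite csinh_xnode_minus.
  apply RtoC_neq0, sinh_neq0, PI_om_neq0; auto; lia.
Qed.

(** The shift by i PI/2 turns cosh into i sinh, hence [wfun] into a csch, the form in which the
    partial fractions are available. *)
Definition ynode (s : C) : C := (RtoC PI * s + (0, PI / 2)%R)%C.

Lemma csinh_ynode om s k :
  csinh (ynode s + xnode om k) = (Ci * ccosh (RtoC PI * node om s k))%C.
Proof.
  rewrite <- csinh_shift; f_equal; unfold ynode, xnode, node.
  rewrite !RtoC_mult; ring.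
Qed.

Lemma ccosh_ynode om s k :
  ccosh (ynode s + xnode om k) = (Ci * csinh (RtoC PI * node om s k))%C.
Proof.
  rewrite <- ccosh_shift; f_equal; unfold ynode, xnode, node.
  rewrite !RtoC_mult; ring.
Qed.

Lemma csinh_ynode_neq0 om s k : regular om s -> csinh (ynode s + xnode om k) <> RtoC 0.
Proof.
  intros H; rewrite csinh_ynode; apply Cmult_neq_0; [apply Ci_neq0|apply H].
Qed.

Lemma wfun_csch om s k : regular om s ->
  wfun (node om s k) = (RtoC PI * Ci * / csinh (ynode s + xnode om k))%C.
Proof.
  intros H; rewrite csinh_ynode; unfold wfun; field; split; [apply H|apply Ci_neq0].
Qed.

Lemma injective_dec (n : nat) (i : nat -> Z) :
  (forall a b, (a < n)%nat -> (b < n)%nat -> a <> b -> i b <> i a) \/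
  exists a b, (a < n)%nat /\ (b < n)%nat /\ a <> b /\ i a = i b.
Proof.
  destruct (classic (exists a b, (a < n)%nat /\ (b < n)%nat /\ a <> b /\ i a = i b)) as [H|H];
    [now right|left].
  intros a b Ha Hb Hab E; apply H; exists a, b; auto.
Qed.

(** For repeated indices the partial fractions break down, but then the determinant has two equal
    rows and both sides vanish. *)
Lemma minor_term_expand om c s n i : 0 < om -> regular om s -> (0 < n)%nat ->
  minor_term om c s n i
  = (cpow (RtoC PI * Ci) n *
     csum n (fun a => coef_term om c n a i * pf_kernel n (ynode s + xnode om (i a))))%C.
Proof.
  intros Ho Hs Hn; unfold minor_term.
  destruct (injective_dec n i) as [Hi|(a & b & Ha & Hb & Hab & E)].
  - transitivity (detc c n i * (cpow (RtoC PI * Ci) n *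
        cprod n (fun a => / csinh (ynode s + xnode om (i a)))))%C.
    + f_equal; rewrite <- cprod_const, <- cprod_mult; apply cprod_ext; intros a _.
      now apply wfun_csch.
    + rewrite (csch_partial_fractions n (fun a => xnode om (i a))); auto.
      * rewrite Cmult_assoc, (Cmult_comm (detc c n i)), <- Cmult_assoc; f_equal.
        rewrite <- csum_scal; apply csum_ext; intros a _; unfold coef_term; ring.
      * intros a b Ha Hb Hab; apply csinh_xnode_neq0; auto.
      * intros a _; now apply csinh_ynode_neq0.
  - assert (Z0 : detc c n i = RtoC 0) by (apply (detc_equal c n i a b); auto).
    unfold coef_term; rewrite Z0.
    rewrite (csum_zero n); [ring|intros; ring].
Qed.

Lemma coef_term_shift om c n a i k :
  coef_term om c n a (fun b => (i b + k)%Z) = coef_term om c n a i.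
Proof.
  unfold coef_term; rewrite detc_shift; f_equal; apply cprod_ext; intros b _.
  rewrite !csinh_xnode_minus.
  replace (i b + k - (i a + k))%Z with (i b - i a)%Z by ring; reflexivity.
Qed.

(** Only differences of indices matter, so the distinguished index is normalized to 0 and m indices
    remain free. *)
Definition reduced_coef (om : R) (c : Z -> C) (m a : nat) (j : nat -> Z) : C :=
  coef_term om c (S m) a (zins a 0%Z j).

Lemma coef_term_zins om c m a k j :
  coef_term om c (S m) a (zins a k j) = reduced_coef om c m a (fun b => (j b + - k)%Z).
Proof.
  unfold reduced_coef; rewrite <- (coef_term_shift om c _ _ (zins a 0%Z _) k); f_equal.
  apply functional_extensionality; intros b.
  rewrite (zins_map (fun z => (z + k)%Z)); unfold zins.
  destruct (Nat.ltb b a); [ring|destruct (Nat.eqb b a); ring].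
Qed.

Lemma coef_term_depends om c n a : (a < n)%nat -> depends_on_first n (coef_term om c n a).
Proof.
  intros Ha i i' H; unfold coef_term; rewrite (detc_depends c n i i' H); f_equal.
  apply cprod_ext; intros b Hb; now rewrite !H.
Qed.

Lemma reduced_coef_depends om c m a : (a <= m)%nat -> depends_on_first m (reduced_coef om c m a).
Proof.
  intros Ha i i' H; apply coef_term_depends; [lia|]; intros b Hb; unfold zins.
  destruct (Nat.ltb_spec b a); [apply H; lia|].
  destruct (Nat.eqb_spec b a); [auto|apply H; lia].
Qed.

(** With the a-th index k split off, translating the others by -k moves their window to lo - k and
    makes the summand independent of k; the kernel multiplies a sum that is free of s. *)
Lemma gbox_coef_kernel om c m a lo L kap : (a <= m)%nat ->
  gbox (S m) lo L (fun i => coef_term om c (S m) a i * kap (i a))%C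
  = zwin lo L (fun k => kap k * gbox m (lo + - k) L (reduced_coef om c m a))%C.
Proof.
  intros Ha; rewrite (gbox_insert m a) by auto.
  apply csum_ext; intros t _; set (k := (Z.of_nat t + lo)%Z).
  rewrite <- gbox_shift by now apply reduced_coef_depends.
  rewrite <- gbox_scal; apply gbox_ext; intros j.
  rewrite zins_same, coef_term_zins; ring.
Qed.

(** Monotonicity of tanh, cleared of denominators and extended to negative x by parity. *)
Lemma sinh_cosh_ratio x q : 0 < q -> q <= Rabs x ->
  cosh x * sinh q <= Rabs (sinh x) * cosh q.
Proof.
  intros Hq Hx.
  assert (H : forall y, q <= y -> cosh y * sinh q <= sinh y * cosh q).
  { intros y Hy; assert (Hs : 0 <= sinh (y - q)).
    { destruct (Req_dec y q) as [->|]; [replace (q - q) with 0 by ring; rewrite sinh_0; lra|].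
      rewrite <- sinh_0; apply Rlt_le, sinh_lt; lra. }
    assert (E : sinh (y - q) = sinh y * cosh q - cosh y * sinh q).
    { unfold sinh, cosh; replace (y - q) with (y + - q) by ring.
      replace (- (y + - q)) with (- y + q) by ring; rewrite !exp_plus, !exp_Ropp; field.
      split; apply Rgt_not_eq, exp_pos. }
    lra. }
  unfold Rabs in Hx; destruct (Rcase_abs x) as [Hn|Hp].
  - assert (E1 : sinh x = - sinh (- x)) by (unfold sinh; rewrite Ropp_involutive; field).
    assert (E2 : cosh x = cosh (- x)) by (unfold cosh; rewrite Ropp_involutive; field).
    rewrite E1, E2, Rabs_Ropp, Rabs_pos_eq; [now apply H|].
    rewrite <- sinh_0; apply Rlt_le, sinh_lt; lra.
  - rewrite Rabs_pos_eq; [apply H; lra|].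
    rewrite <- sinh_0; destruct Hp; [apply Rlt_le, sinh_lt; lra|subst; lra].
Qed.

(** Away from 0 the functions csch and sech are comparable; on the lattice the worst case is k = 1
    or -1, so the constant is coth (PI om) / PI. *)
Lemma csch_le_w0 om : 0 < om -> exists K, 0 <= K /\ forall k, k <> 0%Z ->
  Rabs (/ sinh (PI * om * IZR k)) <= K * w0 om k.
Proof.
  intros Ho; assert (HP := PI_RGT_0).
  assert (Hq : 0 < PI * om) by now apply Rmult_lt_0_compat.
  assert (Hs : 0 < sinh (PI * om)) by (rewrite <- sinh_0; apply sinh_lt; lra).
  assert (Hc := cosh_gt0 (PI * om)).
  exists (cosh (PI * om) / sinh (PI * om) / PI); split.
  - apply Rlt_le, Rdiv_lt_0_compat; auto; now apply Rdiv_lt_0_compat.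
  - intros k Hk; set (x := PI * om * IZR k).
    assert (Hx : PI * om <= Rabs x).
    { unfold x; rewrite Rabs_mult, (Rabs_pos_eq (PI * om)) by lra.
      rewrite <- (Rmult_1_r (PI * om)) at 1; apply Rmult_le_compat_l; [lra|].
      rewrite <- abs_IZR; apply IZR_le; lia. }
    assert (H := sinh_cosh_ratio x _ Hq Hx).
    assert (Hsx : sinh x <> 0) by (apply sinh_neq0, PI_om_neq0; auto).
    assert (H1 := Rabs_pos_lt _ Hsx); assert (H2 := cosh_gt0 x).
    rewrite Rabs_inv; unfold w0; fold x.
    replace (cosh (PI * om) / sinh (PI * om) / PI * (PI / cosh x))
      with (/ (cosh x * sinh (PI * om) / cosh (PI * om)))
      by (field; repeat split; lra).
    apply Rinv_le_contravar.
    + apply Rdiv_lt_0_compat; auto; now apply Rmult_lt_0_compat.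
    + apply Rle_div_l; lra.
Qed.

(** Each csch factor costs K times a weight [w0], and the domination of minors is applied to the
    tuple with 0 inserted; dividing by the weight at 0 leaves the m free indices. *)
Lemma reduced_coef_bound om c rho : 0 < om -> minors_dominated om c rho ->
  forall m a, (a <= m)%nat -> exists K, 0 <= K /\
  forall j, Cmod (reduced_coef om c m a j) <= K * rprod m (fun b => rho (j b)).
Proof.
  intros Ho [Hl Hdom] m a Ha.
  destruct (csch_le_w0 om Ho) as (K & HK & Hcs).
  assert (Hw := w0_pos om 0).
  exists (K ^ m * rho 0%Z / w0 om 0); split.
  { apply Rdiv_le_0_compat; auto; apply Rmult_le_pos; [now apply pow_le|apply Hl]. }
  intros j; unfold reduced_coef, coef_term; rewrite Cmod_mult.
  assert (Hr : 0 <= K ^ m * rho 0%Z / w0 om 0 * rprod m (fun b => rho (j b))).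
  { apply Rmult_le_pos; [|apply rprod_ge0; intros; apply Hl].
    apply Rdiv_le_0_compat; auto; apply Rmult_le_pos; [now apply pow_le|apply Hl]. }
  (* A free index equal to 0 repeats the inserted one, and the determinant vanishes. After the
     insertion its position is b or b + 1, depending on the side of a. *)
  destruct (classic (exists b, (b < m)%nat /\ j b = 0%Z)) as [(b & Hb & E)|Hj].
  { rewrite (detc_equal c (S m) _ a (if Nat.ltb b a then b else S b)).
    - rewrite Cmod_0; lra.
    - lia.
    - destruct (Nat.ltb b a); lia.
    - destruct (Nat.ltb_spec b a); lia.
    - rewrite zins_same; unfold zins; destruct (Nat.ltb_spec b a).
      + destruct (Nat.ltb_spec b a); [auto|lia].
      + destruct (Nat.ltb_spec (S b) a); [lia|].
        destruct (Nat.eqb_spec (S b) a); [lia|].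
        now replace (S b - 1)%nat with b by lia. }
  set (i := zins a 0%Z j); set (d := Cmod (detc c (S m) i)).
  assert (Hpf : Cmod (pf_coef (S m) (fun b => xnode om (i b)) a)
     <= K ^ m * rprod m (fun b => w0 om (j b))).
  { unfold pf_coef; rewrite (cprod_ext _ _
      (zins a (RtoC 1) (fun b => RtoC (/ sinh (PI * om * IZR (j b)))))).
    - rewrite cprod_zins by auto; rewrite Cmod_mult, Cmod_1, Rmult_1_l, Cmod_cprod.
      rewrite <- rprod_const, <- rprod_mult; apply rprod_le; intros b Hb; split.
      + apply Cmod_ge_0.
      + rewrite Cmod_R; apply Hcs; intros E; apply Hj; exists b; auto.
    - intros b Hb; rewrite csinh_xnode_minus; unfold i; rewrite zins_same, Z.sub_0_r.
      unfold zins; destruct (Nat.ltb_spec b a), (Nat.eqb_spec b a); try lia; auto;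
      (rewrite RtoC_inv; [reflexivity|]); apply sinh_neq0, PI_om_neq0; auto;
      intros E; apply Hj; [exists b|exists (b - 1)%nat]; split; auto; lia. }
  assert (Hd : d * (w0 om 0 * rprod m (fun b => w0 om (j b)))
    <= rho 0%Z * rprod m (fun b => rho (j b))).
  { assert (E : forall g : Z -> R, rprod (S m) (fun b => g (i b))
       = g 0%Z * rprod m (fun b => g (j b))).
    { intros g; rewrite <- (rprod_zins m a) by auto.
      apply rprod_ext; intros b _; apply zins_map. }
    rewrite <- !E; apply Hdom. }
  assert (Hd0 : 0 <= d) by apply Cmod_ge_0.
  eapply Rle_trans; [apply Rmult_le_compat_l; [apply Cmod_ge_0|apply Hpf]|].
  fold d; set (P := rprod m (fun b => w0 om (j b))) in *.
  set (Q := rprod m (fun b => rho (j b))) in *.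
  replace (d * (K ^ m * P)) with (K ^ m * (d * (w0 om 0 * P)) / w0 om 0) by (field; lra).
  replace (K ^ m * rho 0%Z / w0 om 0 * Q) with (K ^ m * (rho 0%Z * Q) / w0 om 0) by (field; lra).
  apply Rmult_le_compat_r; [apply Rlt_le, Rinv_0_lt_compat; lra|].
  apply Rmult_le_compat_l; auto; now apply pow_le.
Qed.

(** For fixed k the translated boxes still exhaust all m-tuples, so dominated convergence in k
    factors the limit. The kernel has to be summable, which csch is and coth is not. *)
Lemma gbox_coef_kernel_cv om c rho m a kap : 0 < om -> minors_dominated om c rho ->
  (a <= m)%nat -> dominated kap ->
  ccv (fun M => gbox (S m) (- Z.of_nat M) (2 * M + 1)
         (fun i => coef_term om c (S m) a i * kap (i a))%C)
      (zlim kap * glim m (reduced_coef om c m a))%C.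
Proof.
  intros Ho Hd Ha (h & Hh & Hk).
  destruct (reduced_coef_bound om c rho Ho Hd m a Ha) as (K & HK & HG).
  destruct Hd as [Hl _]; destruct (l1_window rho Hl) as (X & HX0 & HX).
  set (b := glim m (reduced_coef om c m a)).
  replace (zlim kap * b)%C with (zlim (fun k => b * kap k)%C)
    by (rewrite zlim_scal by (exists h; auto); ring).
  eapply ccv_ext; [intros M; symmetry; apply gbox_coef_kernel, Ha|].
  apply (tannery (fun k => K * X ^ m * h k)
    (fun M k => kap k * gbox m (- Z.of_nat M + - k) (2 * M + 1) (reduced_coef om c m a))%C).
  - apply l1_scal; auto; apply Rmult_le_pos; auto; now apply pow_le.
  - intros M k; rewrite Cmod_mult, Rmult_comm; apply Rmult_le_compat; try apply Cmod_ge_0; auto.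
    eapply Rle_trans; [apply gbox_bound with (K := K) (rho := rho); auto; apply Hl|].
    apply Rmult_le_compat_l; auto; apply pow_incr; split; auto; apply rwin_ge0, Hl.
  - intros k; rewrite (Cmult_comm b); apply ccv_scal, ccv_eps; intros eps He.
    destruct (gbox_window_cv m K rho _ HK Hl HG eps He) as [M0 HM].
    exists (M0 + Z.to_nat (Z.abs k))%nat; intros M HMM; apply HM; lia.
Qed.

Lemma wfun_node_0 om k : wfun (node om 0 k) = RtoC (w0 om k).
Proof.
  unfold wfun, node, w0; rewrite Cplus_0_l, <- RtoC_mult, ccosh_real.
  replace (PI * (om * IZR k)) with (PI * om * IZR k) by ring.
  rewrite RtoC_div; [reflexivity|apply Rgt_not_eq, cosh_gt0].
Qed.

Lemma wbound_0 om : wbound om 0 1.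
Proof.
  repeat split; [|lra|].
  - intros k; unfold node; rewrite Cplus_0_l, <- RtoC_mult, ccosh_real.
    apply RtoC_neq0, Rgt_not_eq, cosh_gt0.
  - intros k; rewrite wfun_node_0, Cmod_R, Rabs_pos_eq; [lra|apply Rlt_le, w0_pos].
Qed.

Lemma w0_le_2PI om k : w0 om k <= 2 * PI.
Proof.
  assert (HP := PI_RGT_0).
  assert (H := cosh_ge_exp (PI * om * IZR k)).
  assert (H1 := exp_ineq1_le (Rabs (PI * om * IZR k))).
  assert (H2 := Rabs_pos (PI * om * IZR k)).
  unfold w0; replace (2 * PI) with (PI / (/ 2)) by field.
  apply Rmult_le_compat_l; [lra|]; apply Rinv_le_contravar; lra.
Qed.

Lemma dominated_wfun om s K : 0 < om -> wbound om s K ->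
  dominated (fun k => wfun (node om s k)).
Proof.
  intros Ho (_ & HK & Hb); exists (fun k => K * w0 om k); split; auto.
  apply l1_scal; auto; now apply l1_w0.
Qed.

Lemma minor_term_bound om c rho s K : minors_dominated om c rho -> wbound om s K ->
  forall n i, Cmod (minor_term om c s n i) <= K ^ n * rprod n (fun a => rho (i a)).
Proof.
  intros [_ Hd] (_ & HK & Hb) n i; unfold minor_term; rewrite Cmod_mult, Cmod_cprod.
  apply Rle_trans with (Cmod (detc c n i) * (K ^ n * rprod n (fun a => w0 om (i a)))).
  - apply Rmult_le_compat_l; [apply Cmod_ge_0|].
    rewrite <- rprod_const, <- rprod_mult; apply rprod_le; intros; split; auto.
    apply Cmod_ge_0.
  - replace (Cmod (detc c n i) * (K ^ n * rprod n (fun a => w0 om (i a))))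
      with (K ^ n * (Cmod (detc c n i) * rprod n (fun a => w0 om (i a)))) by ring.
    apply Rmult_le_compat_l; [now apply pow_le|auto].
Qed.

Lemma trace_term_cv om c rho s K n : minors_dominated om c rho -> wbound om s K ->
  ccv (fun M => gbox n (- Z.of_nat M) (2 * M + 1) (minor_term om c s n)) (trace_term om c s n).
Proof.
  intros Hd Hw; apply gbox_cv with (K := K ^ n) (rho := rho).
  - apply pow_le, Hw.
  - apply Hd.
  - now apply minor_term_bound.
Qed.

Lemma gbox_minor_term om c s n lo L : 0 < om -> regular om s -> (0 < n)%nat ->
  gbox n lo L (minor_term om c s n)
  = (cpow (RtoC PI * Ci) n * csum n (fun a => gbox n lo L (fun i =>
       coef_term om c n a i * pf_kernel n (ynode s + xnode om (i a)))))%C.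
Proof.
  intros Ho Hs Hn; rewrite <- gbox_csum, <- gbox_scal; apply gbox_ext; intros i.
  now apply minor_term_expand.
Qed.

(** For odd n the kernel is [wfun] up to the factor PI i, so every position a contributes the same
    lattice sum times a coefficient free of s. *)
Lemma trace_term_odd om c rho n : 0 < om -> minors_dominated om c rho -> Nat.odd n = true ->
  exists B, forall s K, wbound om s K -> trace_term om c s n = (B * fsum om s)%C.
Proof.
  intros Ho Hd Hn; destruct n as [|m]; [discriminate|].
  exists (cpow (RtoC PI * Ci) (S m) * / (RtoC PI * Ci) *
     csum (S m) (fun a => glim m (reduced_coef om c m a)))%C.
  intros s K Hw; apply (ccv_unique _ _ _ (trace_term_cv om c rho s K (S m) Hd Hw)).
  destruct (Hw) as (Hr & _).
  eapply ccv_ext; [intros M; symmetry; apply gbox_minor_term; auto; lia|].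
  assert (HPi : (RtoC PI * Ci)%C <> RtoC 0).
  { apply Cmult_neq_0; [apply RtoC_neq0, PI_neq0|apply Ci_neq0]. }
  set (kap := fun k => (/ csinh (ynode s + xnode om k))%C).
  assert (Ek : forall k, (/ (RtoC PI * Ci) * wfun (node om s k))%C = kap k).
  { intros k; rewrite wfun_csch by auto; unfold kap; field; repeat split.
    - now apply csinh_ynode_neq0.
    - apply Ci_neq0.
    - apply RtoC_neq0, PI_neq0. }
  assert (Hk : dominated kap).
  { eapply dominated_ext; [exact Ek|]; apply dominated_scal; eapply dominated_wfun; eauto. }
  replace (_ * fsum om s)%C with (cpow (RtoC PI * Ci) (S m) *
     csum (S m) (fun a => zlim kap * glim m (reduced_coef om c m a)))%C.
  - apply ccv_scal, ccv_csum; intros a Ha.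
    eapply ccv_ext; [|apply (gbox_coef_kernel_cv om c rho m a kap); auto; lia].
    intros M; apply gbox_ext; intros i; unfold pf_kernel; now rewrite Hn.
  - rewrite csum_scal; replace (zlim kap) with (/ (RtoC PI * Ci) * fsum om s)%C; [ring|].
    unfold fsum; rewrite <- zlim_scal; [|eapply dominated_wfun; eauto].
    now apply zlim_ext.
Qed.

(** Exactly n - 1 factors change sign, an odd number when n is even. *)
Lemma pf_coef_opp n x a : (a < n)%nat -> Nat.odd n = false ->
  pf_coef n (fun b => - x b)%C a = (- pf_coef n x a)%C.
Proof.
  intros Ha Hn; unfold pf_coef.
  (* The factor at b = a is 1 and keeps its sign: a second -1 inserted at position a compensates the
     uniform -1, so the total sign is (-1)^n times -1. *)
  transitivity (cprod n (fun b => (RtoC (-1) * zins a (RtoC (-1)) (fun _ => RtoC 1) b) *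
     (if Nat.eqb b a then RtoC 1 else / csinh (x b - x a)))%C).
  - apply cprod_ext; intros b Hb; unfold zins.
    destruct (Nat.eqb_spec b a) as [->|Hba].
    + rewrite Nat.ltb_irrefl; apply C_ext; simpl; ring.
    + replace (- x b - - x a)%C with (- (x b - x a))%C by ring; rewrite csinh_opp.
      assert (E : forall z, (/ - z)%C = (RtoC (-1) * / z)%C).
      { intros z; destruct (classic (z = RtoC 0)) as [->|Hz].
        - apply C_ext; simpl; unfold Rdiv; ring.
        - apply Cmult_cancel_r with z; auto.
          assert (Hz' : (- z)%C <> RtoC 0).
          { intros E; apply Hz; replace z with (- - z)%C by ring; rewrite E; ring. }
          replace (/ - z * z)%C with (- (/ - z * - z))%C by ring.
          rewrite Cinv_l, <- Cmult_assoc, Cinv_l by auto; apply C_ext; simpl; ring. }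
      rewrite E; destruct (Nat.ltb b a); ring.
  - rewrite !cprod_mult, cprod_const; destruct n as [|m]; [lia|].
    rewrite cprod_zins, cprod_const by lia.
    assert (E1 : forall k, cpow (RtoC 1) k = RtoC 1).
    { induction k; simpl; [auto|rewrite IHk; ring]. }
    assert (E2 : forall k, cpow (RtoC (-1)) k = if Nat.odd k then RtoC (-1) else RtoC 1).
    { induction k; [reflexivity|].
      rewrite Nat.odd_succ, <- Nat.negb_odd; simpl cpow; rewrite IHk.
      destruct (Nat.odd k); apply C_ext; simpl; ring. }
    rewrite E1, E2, Hn; ring_simplify.
    apply C_ext; simpl; ring.
Qed.

Lemma reduced_coef_opp om c m a j : (a <= m)%nat -> Nat.odd (S m) = false ->
  reduced_coef om c m a (fun b => (- j b)%Z) = (RtoC (-1) * reduced_coef om c m a j)%C.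
Proof.
  intros Ha Hn; unfold reduced_coef, coef_term.
  replace (zins a 0%Z (fun b => (- j b)%Z)) with (fun b => (- zins a 0%Z j b)%Z).
  - rewrite detc_opp.
    replace (fun b => xnode om (- zins a 0%Z j b)) with (fun b => (- xnode om (zins a 0%Z j b))%C).
    + rewrite (pf_coef_opp (S m) (fun b => xnode om (zins a 0%Z j b))); auto; [|lia].
      rewrite Cmult_m1_l; ring.
    + apply functional_extensionality; intros b; unfold xnode.
      rewrite opp_IZR, <- RtoC_opp; f_equal; ring.
  - apply functional_extensionality; intros b; now rewrite (zins_map Z.opp).
Qed.

Lemma glim_reduced_coef_even om c rho m a : 0 < om -> minors_dominated om c rho ->
  (a <= m)%nat -> Nat.odd (S m) = false -> glim m (reduced_coef om c m a) = RtoC 0.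
Proof.
  intros Ho Hd Ha Hn.
  destruct (reduced_coef_bound om c rho Ho Hd m a Ha) as (K & HK & HG).
  set (G := reduced_coef om c m a) in *.
  assert (Hc := gbox_cv m K rho G HK (proj1 Hd) HG).
  assert (Hc' : ccv (fun M => gbox m (- Z.of_nat M) (2 * M + 1) G) (RtoC (-1) * glim m G)%C).
  { eapply ccv_ext; [|apply (ccv_scal (RtoC (-1)) _ _ Hc)].
    intros M; cbv beta; rewrite <- gbox_scal, <- (gbox_opp m M G).
    apply gbox_ext; intros j; symmetry; now apply reduced_coef_opp. }
  assert (E := ccv_unique _ _ _ Hc Hc').
  apply Cmult_cancel_r with (RtoC 2); [apply RtoC_neq0; lra|].
  replace (glim m G * RtoC 2)%C with (glim m G - RtoC (-1) * glim m G)%C.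
  - rewrite <- E; ring.
  - replace (RtoC 2) with (RtoC 1 - RtoC (-1))%C; [ring|].
    rewrite <- RtoC_minus; f_equal; ring.
Qed.

(** The coth kernel is not summable, so the kernels at s and at 0 are subtracted before summing. The
    difference is summable, and its coefficient vanishes by [glim_reduced_coef_even]. *)
Lemma trace_term_even om c rho n : 0 < om -> minors_dominated om c rho -> Nat.odd n = false ->
  forall s K, wbound om s K -> trace_term om c s n = trace_term om c 0 n.
Proof.
  intros Ho Hd Hn s K Hw.
  assert (Hw0 := wbound_0 om).
  assert (Hs := trace_term_cv om c rho s K n Hd Hw).
  assert (H0 := trace_term_cv om c rho 0 1 n Hd Hw0).
  destruct n as [|m].
  { apply (ccv_unique _ _ _ Hs); exact H0. }
  destruct (Hw) as (Hr & HK & Hb); destruct (Hw0) as (Hr0 & _).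
  set (kap := fun k => (ccosh (ynode s + xnode om k) / csinh (ynode s + xnode om k)
     - ccosh (ynode 0 + xnode om k) / csinh (ynode 0 + xnode om k))%C).
  assert (HPn : RtoC PI <> RtoC 0) by apply RtoC_neq0, PI_neq0.
  (* The two nodes differ by s for every k, so the numerator of the difference of the coth is csinh
     (PI s), independent of k. *)
  assert (Ek : forall k, (csinh (RtoC PI * s) / (RtoC PI * RtoC PI) *
     (wfun (node om s k) * wfun (node om 0 k)))%C = kap k).
  { intros k; unfold kap; rewrite !csinh_ynode, !ccosh_ynode; unfold wfun.
    replace (RtoC PI * s)%C with (RtoC PI * node om s k - RtoC PI * node om 0 k)%C
      by (unfold node; ring).
    rewrite csinh_minus; field; repeat split; auto; apply Ci_neq0. }
  assert (Hk : dominated kap).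
  { eapply dominated_ext; [exact Ek|]; apply dominated_scal.
    exists (fun k => (K * (2 * PI)) * w0 om k); split.
    - apply l1_scal; [|now apply l1_w0].
      apply Rmult_le_pos; auto; generalize PI_RGT_0; lra.
    - intros k; rewrite Cmod_mult, wfun_node_0, Cmod_R, Rabs_pos_eq by apply Rlt_le, w0_pos.
      apply Rmult_le_compat_r; [apply Rlt_le, w0_pos|].
      eapply Rle_trans; [apply Hb|]; apply Rmult_le_compat_l; auto; apply w0_le_2PI. }
  assert (Hdiff : ccv (fun M => gbox (S m) (- Z.of_nat M) (2 * M + 1) (minor_term om c s (S m))
      - gbox (S m) (- Z.of_nat M) (2 * M + 1) (minor_term om c 0 (S m)))%C
    (cpow (RtoC PI * Ci) (S m) *
       csum (S m) (fun a => zlim kap * glim m (reduced_coef om c m a)))%C).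
  { eapply ccv_ext; [intros M; symmetry; rewrite !gbox_minor_term by (auto; lia); reflexivity|].
    apply ccv_ext with (fun M => cpow (RtoC PI * Ci) (S m) * csum (S m) (fun a =>
       gbox (S m) (- Z.of_nat M) (2 * M + 1)
         (fun i => coef_term om c (S m) a i * kap (i a))))%C.
    - intros M.
      match goal with |- (?p * ?a)%C = (?p * ?b - ?p * ?c)%C =>
        transitivity (p * (b - c))%C; [|ring] end.
      f_equal; rewrite <- csum_minus; apply csum_ext; intros a Ha.
      match goal with |- _ = (?u - gbox ?n ?lo ?L ?g)%C =>
        transitivity (u + RtoC (-1) * gbox n lo L g)%C; [|rewrite Cmult_m1_l; ring] end.
      rewrite <- gbox_scal, <- gbox_plus; apply gbox_ext; intros i.
      unfold pf_kernel, kap; rewrite Hn, Cmult_m1_l; ring.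
    - apply ccv_scal, ccv_csum; intros a Ha.
      apply (gbox_coef_kernel_cv om c rho m a kap); auto; lia. }
  rewrite csum_zero in Hdiff.
  2: { intros a Ha; rewrite (glim_reduced_coef_even om c rho m a); auto; [ring|lia]. }
  assert (E := ccv_unique _ _ _ Hdiff (ccv_minus _ _ _ _ Hs H0)).
  replace (trace_term om c s (S m))
    with (trace_term om c 0 (S m) + (trace_term om c s (S m) - trace_term om c 0 (S m)))%C by ring.
  rewrite <- E; ring.
Qed.

(** * The lattice sum of w and its derivatives *)

(** [inLambda] with the horizontal period as a parameter; the two are convertible for om = omega
    T. *)
Definition pole (om : R) (s : C) : Prop :=
  exists n m : Z, s = (om * IZR n, IZR m + / 2).

Definition far (om delta : R) (s : C) : Prop :=
  forall a, pole om a -> delta < Cmod (s - a)%C.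

(** * Growth of cosh and decay of w away from the poles *)

Lemma floor_scaled om r : 0 < om -> exists n, om * IZR n <= r < om * (IZR n + 1).
Proof.
  intros Ho; exists (up (r / om) - 1)%Z.
  destruct (archimed (r / om)) as [H1 H2]; rewrite minus_IZR.
  assert (E : r = om * (r / om)) by (field; lra).
  split.
  - rewrite E at 2; apply Rmult_le_compat_l; lra.
  - rewrite E at 1; apply Rmult_lt_compat_l; lra.
Qed.

Lemma cos_sqr_period_nat x n : cos (x + INR n * PI) ^ 2 = cos x ^ 2.
Proof.
  induction n.
  - simpl INR; do 2 f_equal; ring.
  - rewrite S_INR; replace (x + (INR n + 1) * PI) with (x + INR n * PI + PI) by ring.
    rewrite neg_cos, <- IHn; ring.
Qed.

Lemma cos_sqr_period x m : cos (x + IZR m * PI) ^ 2 = cos x ^ 2.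
Proof.
  destruct (Z_le_gt_dec 0 m).
  - rewrite <- (cos_sqr_period_nat x (Z.to_nat m)), INR_IZR_INZ, Z2Nat.id by auto; reflexivity.
  - rewrite <- (cos_sqr_period_nat (x + IZR m * PI) (Z.to_nat (- m))).
    rewrite INR_IZR_INZ, Z2Nat.id, opp_IZR by lia; do 2 f_equal; ring.
Qed.

Lemma Cmod_pair_le x y : Cmod (x, y) <= Rabs x + Rabs y.
Proof. apply (Cmod_le_ReIm (x, y)). Qed.

Lemma sqr_le_abs a b : 0 <= b -> a ^ 2 <= b ^ 2 -> Rabs a <= b.
Proof.
  intros Hb H; apply Rnot_lt_le; intros Hl.
  unfold Rabs in Hl; destruct (Rcase_abs a); nra.
Qed.

(** |cosh (PI (x + i y))|^2 = sinh^2 (PI x) + cos^2 (PI y): either |x| is bounded below and sinh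
    gives the growth, or y stays away from the half-integers and the cosine is bounded below. *)
Lemma ccosh_lower delta : 0 < delta <= 1 -> exists c, 0 < c /\ forall x y,
  (forall m, delta < Cmod (x, y - (IZR m + / 2))) ->
  c * exp (PI * Rabs x) <= Cmod (ccosh (RtoC PI * (x, y))%C).
Proof.
  intros Hd; assert (HP := PI_RGT_0).
  assert (H1 : 0 < 1 - exp (- (PI * delta))).
  { assert (exp (- (PI * delta)) < exp 0) by (apply exp_increasing; nra).
    rewrite exp_0 in *; lra. }
  assert (H2 : 0 < sin (PI * (delta / 2))) by (apply sin_gt_0; nra).
  (* [c1] serves |x| >= delta/2, where exp (- PI |x|) is at most exp (PI |x|) exp (- PI delta). [c2]
     serves |x| < delta/2: there y is more than delta/2 away from the half-integers, and the growth
     factor is at most exp PI. *)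
  set (c1 := (1 - exp (- (PI * delta))) / 2); set (c2 := sin (PI * (delta / 2)) / exp PI).
  assert (Hc2 : 0 < c2) by (apply Rdiv_lt_0_compat; auto; apply exp_pos).
  exists (Rmin c1 c2); split; [apply Rmin_pos; unfold c1; lra|].
  intros x y Hm.
  replace (RtoC PI * (x, y))%C with ((PI * x, PI * y) : C) by (apply C_ext; simpl; ring).
  set (A := Cmod (ccosh (PI * x, PI * y))).
  assert (HA : A * A = sinh (PI * x) * sinh (PI * x) + cos (PI * y) * cos (PI * y))
    by apply Cmod_ccosh_sqr.
  assert (HA0 : 0 <= A) by apply Cmod_ge_0.
  destruct (Rle_lt_dec (delta / 2) (Rabs x)) as [Hx|Hx].
  - apply Rle_trans with (c1 * exp (PI * Rabs x)).
    { apply Rmult_le_compat_r; [apply Rlt_le, exp_pos|apply Rmin_l]. }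
    apply Rle_trans with (sinh (PI * Rabs x)).
    + unfold sinh, c1; set (e := exp (PI * Rabs x)).
      assert (He : exp (- (PI * Rabs x)) <= e * exp (- (PI * delta))).
      { unfold e; rewrite <- exp_plus.
        destruct (Req_dec (- (PI * Rabs x)) (PI * Rabs x + - (PI * delta))) as [->|Hn]; [lra|].
        apply Rlt_le, exp_increasing; nra. }
      lra.
    + apply Rle_trans with (Rabs (sinh (PI * Rabs x))); [apply Rle_abs|].
      apply sqr_le_abs; auto.
      replace (sinh (PI * Rabs x) ^ 2) with (sinh (PI * x) * sinh (PI * x)).
      * simpl; rewrite Rmult_1_r, HA; nra.
      * unfold Rabs; destruct (Rcase_abs x); [|ring].
        replace (PI * - x) with (- (PI * x)) by ring.
        unfold sinh; rewrite Ropp_involutive; field.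
  - apply Rle_trans with (c2 * exp PI).
    { apply Rmult_le_compat; try apply Rmin_r; try apply Rlt_le, exp_pos.
      - apply Rmin_glb; unfold c1; lra.
      - apply Rlt_le, exp_increasing; nra. }
    unfold c2; replace (sin (PI * (delta / 2)) / exp PI * exp PI) with (sin (PI * (delta / 2)))
      by (field; apply Rgt_not_eq, exp_pos).
    destruct (floor_scaled 1 y Rlt_0_1) as [m Hy]; rewrite !Rmult_1_l in Hy.
    set (t := y - (IZR m + / 2)).
    assert (Ht : delta / 2 < Rabs t).
    { generalize (Hm m) (Cmod_pair_le x t); fold t; lra. }
    assert (Ht2 : Rabs t <= / 2) by (unfold t; apply Rabs_le; lra).
    apply Rle_trans with (Rabs (sin (PI * (delta / 2)))); [apply Rle_abs|].
    apply sqr_le_abs; auto.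
    replace (A ^ 2) with (A * A) by ring; rewrite HA.
    replace (cos (PI * y) * cos (PI * y)) with (sin (PI * Rabs t) ^ 2).
    + assert (sin (PI * (delta / 2)) <= sin (PI * Rabs t)).
      { apply sin_incr_1; nra. }
      nra.
    + replace (cos (PI * y) * cos (PI * y)) with (cos (PI * y) ^ 2) by ring.
      replace (PI * y) with (PI / 2 + PI * t + IZR m * PI) by (unfold t; field).
      rewrite cos_sqr_period.
      assert (E := sin_cos (PI * t)).
      replace (cos (PI / 2 + PI * t)) with (- sin (PI * t)) by lra.
      unfold Rabs; destruct (Rcase_abs t); [|ring].
      replace (PI * - t) with (- (PI * t)) by ring; rewrite sin_neg; ring.
Qed.

Lemma frac_dist om r : 0 < om -> (forall n, r <> om * IZR n) ->
  exists d, 0 < d /\ forall n, d <= Rabs (r - om * IZR n).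
Proof.
  intros Ho Hr; destruct (floor_scaled om r Ho) as [n0 [H1 H2]].
  assert (H3 : om * IZR n0 < r) by (destruct H1; auto; exfalso; now apply (Hr n0)).
  exists (Rmin (r - om * IZR n0) (om * (IZR n0 + 1) - r)); split; [apply Rmin_pos; lra|].
  intros n; destruct (Z_le_gt_dec n n0) as [Hn|Hn].
  - eapply Rle_trans; [apply Rmin_l|].
    eapply Rle_trans; [|apply Rle_abs].
    apply IZR_le in Hn; nra.
  - eapply Rle_trans; [apply Rmin_r|].
    rewrite Rabs_minus_sym; eapply Rle_trans; [|apply Rle_abs].
    assert (IZR (n0 + 1) <= IZR n) by (apply IZR_le; lia).
    rewrite plus_IZR in *; nra.
Qed.

(** The poles form a product set, so any other point misses it in one coordinate, and [frac_dist]
    keeps that coordinate at a positive distance. *)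
Lemma far_of_not_pole om s : 0 < om -> ~ pole om s -> exists delta, 0 < delta <= 1 /\ far om delta s.
Proof.
  intros Ho Hs; destruct s as [x y].
  assert (H : exists d, 0 < d /\ forall a, pole om a -> d <= Cmod ((x, y) - a)%C).
  { destruct (classic (exists n, x = om * IZR n)) as [[n0 Hx]|Hx].
    - destruct (frac_dist 1 (y - / 2) Rlt_0_1) as (d & Hd & H).
      { intros m Hm; apply Hs; exists n0, m; f_equal; lra. }
      exists d; split; auto; intros a (n & m & ->).
      eapply Rle_trans; [apply (H m)|].
      eapply Rle_trans; [|apply im_le_Cmod]; right; simpl; f_equal; ring.
    - destruct (frac_dist om x Ho) as (d & Hd & H); [intros n Hn; apply Hx; now exists n|].
      exists d; split; auto; intros a (n & m & ->).
      eapply Rle_trans; [apply (H n)|].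
      eapply Rle_trans; [|apply re_le_Cmod]; right; simpl; f_equal; ring. }
  destruct H as (d & Hd & H); exists (Rmin (d / 2) 1); repeat split.
  - apply Rmin_pos; lra.
  - apply Rmin_r.
  - intros a Ha; generalize (H a Ha) (Rmin_l (d / 2) 1); lra.
Qed.

Lemma far_weaken om d d' s : d' <= d -> far om d s -> far om d' s.
Proof. intros H Hf a Ha; generalize (Hf a Ha); lra. Qed.

Lemma far_shift om d s k : far om d s -> far om d (node om s k).
Proof.
  intros Hf a (n & m & ->).
  replace (node om s k - (om * IZR n, IZR m + / 2)%R)%C
    with (s - (om * IZR (n - k), IZR m + / 2)%R)%C.
  - apply Hf; now exists (n - k)%Z, m.
  - rewrite minus_IZR; unfold node; destruct s; apply C_ext; simpl; ring.
Qed.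

Lemma far_not_pole om d s : 0 < d -> far om d s -> ~ pole om s.
Proof.
  intros Hd Hf Hp; generalize (Hf s Hp); replace (s - s)%C with (RtoC 0) by ring.
  rewrite Cmod_0; lra.
Qed.

(** K depends on delta alone, which is what the bound of the lattice sum uniform in s needs. *)
Lemma sech_decay delta : 0 < delta <= 1 -> exists K, 0 < K /\ forall om s,
  far om delta s -> ccosh (RtoC PI * s) <> RtoC 0 /\
  Cmod (/ ccosh (RtoC PI * s))%C <= K * exp (- (PI * Rabs (Re s))).
Proof.
  intros Hd; destruct (ccosh_lower delta Hd) as (c & Hc & H).
  exists (/ c); split; [now apply Rinv_0_lt_compat|]; intros om [x y] Hf.
  assert (HL : c * exp (PI * Rabs x) <= Cmod (ccosh (RtoC PI * (x, y))%C)).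
  { apply H; intros m.
    replace (x, y - (IZR m + / 2)) with ((x, y) - (om * IZR 0, IZR m + / 2)%R)%C
      by (apply C_ext; simpl; ring).
    apply Hf; now exists 0%Z, m. }
  assert (Hp : 0 < c * exp (PI * Rabs x)) by (apply Rmult_lt_0_compat; auto; apply exp_pos).
  assert (Hne : ccosh (RtoC PI * (x, y))%C <> RtoC 0).
  { intros E; rewrite E, Cmod_0 in HL; lra. }
  split; auto.
  rewrite Cmod_inv, exp_Ropp, <- Rinv_mult by auto; simpl Re.
  apply Rinv_le_contravar; auto.
Qed.

Lemma exp_le x y : x <= y -> exp x <= exp y.
Proof. intros [H| ->]; [apply Rlt_le, exp_increasing, H|lra]. Qed.

Lemma Re_node om s k : Re (node om s k) = Re s + om * IZR k.
Proof. reflexivity. Qed.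

Lemma exp_node_le om s k : 0 < om ->
  exp (- (PI * Rabs (Re (node om s k)))) <= exp (PI * Rabs (Re s)) * edecay om k.
Proof.
  intros Ho; unfold edecay; rewrite <- exp_plus; apply exp_le.
  assert (HP := PI_RGT_0).
  assert (Rabs (om * IZR k) <= Rabs (Re (node om s k)) + Rabs (Re s)).
  { replace (om * IZR k) with (Re (node om s k) - Re s) by (rewrite Re_node; ring).
    unfold Rminus; eapply Rle_trans; [apply Rabs_triang|]; rewrite Rabs_Ropp; lra. }
  rewrite Rabs_mult, (Rabs_pos_eq om) in H by lra; nra.
Qed.

Lemma sech_node_decay delta : 0 < delta <= 1 -> exists K, 0 < K /\ forall om s k, 0 < om ->
  far om delta s -> ccosh (RtoC PI * node om s k) <> RtoC 0 /\
  Cmod (/ ccosh (RtoC PI * node om s k))%C <= K * exp (PI * Rabs (Re s)) * edecay om k.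
Proof.
  intros Hd; destruct (sech_decay delta Hd) as (K & HK & H); exists K; split; auto.
  intros om s k Ho Hf; destruct (H om (node om s k) (far_shift _ _ _ _ Hf)) as [H1 H2].
  split; auto; eapply Rle_trans; [apply H2|]; rewrite Rmult_assoc.
  apply Rmult_le_compat_l; [lra|now apply exp_node_le].
Qed.

Lemma wbound_far om delta s : 0 < om -> 0 < delta <= 1 -> far om delta s -> exists K, wbound om s K.
Proof.
  intros Ho Hd Hf; destruct (sech_node_decay delta Hd) as (K & HK & H).
  exists (K * exp (PI * Rabs (Re s))); repeat split.
  - intros k; now apply H.
  - apply Rlt_le, Rmult_lt_0_compat; auto; apply exp_pos.
  - intros k; destruct (H om s k Ho Hf) as [H1 H2].
    assert (HP := PI_RGT_0).
    unfold wfun, Cdiv; rewrite Cmod_mult, Cmod_R, Rabs_pos_eq by lra.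
    apply Rle_trans with (PI * (K * exp (PI * Rabs (Re s)) * edecay om k)).
    + apply Rmult_le_compat_l; lra.
    + rewrite <- Rmult_assoc, (Rmult_comm PI), Rmult_assoc.
      apply Rmult_le_compat_l; [|now apply edecay_le_w0].
      apply Rlt_le, Rmult_lt_0_compat; auto; apply exp_pos.
Qed.

Lemma wbound_not_pole om s : 0 < om -> ~ pole om s -> exists K, wbound om s K.
Proof.
  intros Ho Hs; destruct (far_of_not_pole om s Ho Hs) as (d & Hd & Hf).
  now apply (wbound_far om d).
Qed.

Lemma dominated_node om s : 0 < om -> ~ pole om s -> dominated (fun k => wfun (node om s k)).
Proof.
  intros Ho Hs; destruct (wbound_not_pole om s Ho Hs) as [K HK].
  now apply (dominated_wfun om s K).
Qed.

(** * Symmetries of w and of the lattice sum *)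

Lemma wfun_opp s : wfun (- s) = wfun s.
Proof.
  unfold wfun; replace (RtoC PI * - s)%C with (- (RtoC PI * s))%C by ring.
  now rewrite ccosh_opp.
Qed.

Lemma wfun_Ci s : wfun (s + Ci) = (- wfun s)%C.
Proof.
  unfold wfun; replace (RtoC PI * (s + Ci))%C with (RtoC PI * s + (0, PI)%R)%C
    by (destruct s; apply C_ext; simpl; ring).
  rewrite ccosh_shift_PI; unfold Cdiv.
  replace (/ - ccosh (RtoC PI * s))%C with (- / ccosh (RtoC PI * s))%C; [ring|].
  generalize (ccosh (RtoC PI * s)); intros [x y]; apply C_ext; simpl;
  replace (- x * (- x * 1) + - y * (- y * 1)) with (x * (x * 1) + y * (y * 1)) by ring;
  unfold Rdiv; ring.
Qed.

Lemma Cinv_conj' z : Cconj (/ z)%C = (/ Cconj z)%C.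
Proof.
  destruct z as [x y]; apply C_ext; simpl;
  replace (- y * (- y * 1)) with (y * (y * 1)) by ring; unfold Rdiv; ring.
Qed.

Lemma wfun_conj s : Cconj (wfun s) = wfun (Cconj s).
Proof.
  unfold wfun, Cdiv; rewrite Cmult_conj, Cinv_conj', ccosh_conj; f_equal.
  - apply C_ext; simpl; ring.
  - do 2 f_equal; rewrite Cmult_conj; f_equal; apply C_ext; simpl; ring.
Qed.

Lemma fsum_opp om s : fsum om (- s) = fsum om s.
Proof.
  unfold fsum; rewrite <- zlim_opp; apply zlim_ext; intros k.
  rewrite <- wfun_opp; f_equal; unfold node; rewrite opp_IZR.
  replace (om * - IZR k) with (- (om * IZR k)) by ring; rewrite RtoC_opp; ring.
Qed.

Lemma fsum_Ci om s : 0 < om -> ~ pole om s -> fsum om (s + Ci) = (- fsum om s)%C.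
Proof.
  intros Ho Hs; unfold fsum; rewrite <- Cmult_m1_l, <- zlim_scal by now apply dominated_node.
  apply zlim_ext; intros k; rewrite Cmult_m1_l, <- wfun_Ci; f_equal; unfold node; ring.
Qed.

Lemma fsum_shift om s j : 0 < om -> ~ pole om s -> fsum om (node om s j) = fsum om s.
Proof.
  intros Ho Hs; unfold fsum.
  rewrite <- (zlim_shift (fun k => wfun (node om s k)) j) by now apply dominated_node.
  apply zlim_ext; intros k; f_equal; unfold node; rewrite plus_IZR, Rmult_plus_distr_l, RtoC_plus.
  ring.
Qed.

Lemma fsum_conj om s : 0 < om -> ~ pole om s -> Cconj (fsum om s) = fsum om (Cconj s).
Proof.
  intros Ho Hs; unfold fsum; rewrite <- zlim_conj by now apply dominated_node.
  apply zlim_ext; intros k; rewrite wfun_conj; f_equal; unfold node.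
  rewrite Cplus_conj; f_equal; apply C_ext; simpl; ring.
Qed.

(** The termwise bound grows like exp (PI |Re s|); periodicity first moves s to the strip 0 <= Re s
    < om, where it is uniform. *)
Lemma fsum_bound om delta : 0 < om -> 0 < delta <= 1 -> exists B, 0 <= B /\ forall s,
  far om delta s -> Cmod (fsum om s) <= B.
Proof.
  intros Ho Hd; assert (HP := PI_RGT_0).
  destruct (sech_node_decay delta Hd) as (K & HK & H).
  set (A := PI * (K * exp (PI * om))).
  assert (HA : 0 <= A).
  { unfold A; generalize (exp_pos (PI * om)); intros He.
    apply Rmult_le_pos; [lra|apply Rmult_le_pos; lra]. }
  destruct (l1_window _ (l1_edecay om Ho)) as (X & HX0 & HX).
  exists (A * X); split; [now apply Rmult_le_pos|]; intros s Hf.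
  destruct (floor_scaled om (Re s) Ho) as [n Hn].
  rewrite <- (fsum_shift om s (- n)) by (auto; apply (far_not_pole om delta); auto; lra).
  set (z := node om s (- n)).
  assert (Hz : far om delta z) by now apply far_shift.
  assert (Hr : Rabs (Re z) <= om).
  { unfold z; rewrite Re_node, opp_IZR; apply Rabs_le; lra. }
  apply (Cmod_zlim _ (fun k => A * edecay om k)).
  - apply l1_scal; auto; now apply l1_edecay.
  - intros k; destruct (H om z k Ho Hz) as [_ H2].
    unfold wfun, Cdiv; rewrite Cmod_mult, Cmod_R, Rabs_pos_eq by lra.
    unfold A; rewrite (Rmult_assoc PI); apply Rmult_le_compat_l; [lra|].
    eapply Rle_trans; [apply H2|].
    apply Rmult_le_compat_r; [apply Rlt_le, exp_pos|].
    apply Rmult_le_compat_l; [lra|]; apply exp_le; nra.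
  - intros lo L; rewrite rwin_scal; apply Rmult_le_compat_l; auto.
Qed.

(** Allows the division by f(0) that expresses the odd traces at s through those at 0; realness
    enters the conjugation symmetry. *)
Lemma fsum_0_pos om : 0 < om -> exists x, 0 < x /\ fsum om 0 = RtoC x.
Proof.
  intros Ho; destruct (l1_w0 om Ho) as [Hw [X HX]].
  assert (Hm : forall M, rzs M (w0 om) <= rzs (S M) (w0 om)) by
    (intros M; apply rwin_mono; auto; lia).
  destruct (ex_finite_lim_seq_incr (fun M => rzs M (w0 om)) X Hm HX) as [l Hl].
  exists l; split.
  - apply Rlt_le_trans with (rzs 0 (w0 om)).
    + unfold rzs, rwin; simpl; generalize (w0_pos om 0); lra.
    + apply (is_lim_seq_incr_compare (fun M => rzs M (w0 om))); auto.
  - apply zlim_unique.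
    apply (ccv_ext (fun M => RtoC (rzs M (w0 om)))).
    + intros M; unfold rzs, rwin; rewrite RtoC_rsum; apply csum_ext; intros k _.
      now rewrite wfun_node_0.
    + apply ccv_pair; [exact Hl|apply is_lim_seq_const].
Qed.

(** * Taylor estimates with quadratic remainder *)

Lemma sin_abs_le y : Rabs (sin y) <= Rabs y.
Proof.
  assert (H : forall t, 0 <= t -> Rabs (sin t) <= t).
  { intros t [Ht|<-]; [|rewrite sin_0, Rabs_R0; lra].
    assert (HP := PI2_1); assert (H1 := SIN_bound t).
    apply Rabs_le; split; [|now apply Rlt_le, sin_lt_x].
    destruct (Rle_lt_dec t 1) as [H2|H2]; [|lra].
    assert (0 < sin t) by (apply sin_gt_0; lra); lra. }
  destruct (Rle_lt_dec 0 y) as [Hy|Hy].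
  - rewrite (Rabs_pos_eq y) by auto; auto.
  - rewrite <- (Rabs_Ropp (sin y)), <- sin_neg, (Rabs_left y) by auto; apply H; lra.
Qed.

Lemma cos_sub_1_le y : Rabs (cos y - 1) <= y ^ 2 / 2.
Proof.
  assert (E : cos y - 1 = - (2 * (sin (y / 2) * sin (y / 2)))).
  { replace (cos y) with (cos (2 * (y / 2))) by (f_equal; field).
    rewrite cos_2a_sin; ring. }
  rewrite E, Rabs_Ropp, Rabs_pos_eq by nra.
  assert (H := sin_abs_le (y / 2)).
  apply Rsqr_le_abs_1 in H; unfold Rsqr in H; lra.
Qed.

Lemma sin_sub_le y : Rabs y <= 1 -> Rabs (sin y - y) <= y ^ 2.
Proof.
  assert (H : forall t, 0 < t <= 1 -> Rabs (sin t - t) <= t ^ 2).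
  { intros t Ht.
    destruct (MVT_cor2 (fun u => sin u - u) (fun u => cos u - 1) 0 t) as (c & E & Hc).
    - lra.
    - intros u _; apply is_derive_Reals; auto_derive; auto; ring.
    - rewrite sin_0 in E; replace (sin t - t) with ((cos c - 1) * (t - 0)) by lra.
      rewrite Rabs_mult, Rminus_0_r, (Rabs_pos_eq t) by lra.
      generalize (cos_sub_1_le c); intros Hcc; nra. }
  intros Hy; destruct (Rtotal_order y 0) as [Hn|[->|Hp]].
  - replace (sin y - y) with (- (sin (- y) - (- y))) by (rewrite sin_neg; ring).
    rewrite Rabs_Ropp, Rabs_left in * by auto; replace (y ^ 2) with ((- y) ^ 2) by ring.
    apply H; lra.
  - rewrite sin_0, Rminus_0_r, Rabs_R0; lra.
  - apply H; rewrite Rabs_pos_eq in Hy; lra.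
Qed.

Lemma exp_sub_le x : Rabs x <= / 2 -> 0 <= exp x - 1 - x <= 2 * x ^ 2.
Proof.
  intros Hx; apply Rabs_le_between in Hx.
  assert (H1 := exp_ineq1_le x); assert (H2 := exp_ineq1_le (- x)).
  assert (H3 : exp x * exp (- x) = 1) by (rewrite <- exp_plus, <- exp_0; f_equal; ring).
  assert (H4 := exp_pos x); split; [lra|].
  assert (exp x * (1 - x) <= 1) by nra.
  (* Since (1 + x + 2 x^2) (1 - x) = 1 + x^2 (1 - 2 x), this makes the right-hand side at least 1 >=
     exp x (1 - x). *)
  assert (0 <= x ^ 2 * (1 - 2 * x)) by (apply Rmult_le_pos; nra).
  assert (exp x * (1 - x) <= (1 + x + 2 * x ^ 2) * (1 - x)) by nra.
  assert (exp x <= 1 + x + 2 * x ^ 2) by (apply Rmult_le_reg_r with (1 - x); lra).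
  lra.
Qed.

Lemma Cmod_sqr_pair x y : Cmod (x, y) ^ 2 = x ^ 2 + y ^ 2.
Proof. now rewrite Cmod2_alt. Qed.

Lemma cexp_taylor h : Cmod h <= / 2 -> Cmod (cexp h - 1 - h)%C <= 8 * Cmod h ^ 2.
Proof.
  destruct h as [x y]; intros Hh.
  assert (Hx : Rabs x <= / 2) by (eapply Rle_trans; [apply (re_le_Cmod (x, y))|auto]).
  assert (Hy : Rabs y <= / 2) by (eapply Rle_trans; [apply (im_le_Cmod (x, y))|auto]).
  rewrite Cmod_sqr_pair.
  eapply Rle_trans; [apply Cmod_le_ReIm|]; simpl Re; simpl Im.
  assert (H1 := exp_sub_le x Hx); assert (H2 := cos_sub_1_le y).
  assert (H3 := sin_sub_le y ltac:(lra)).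
  apply Rabs_le_between in Hx; apply Rabs_le_between in Hy.
  apply Rabs_le_between in H2; apply Rabs_le_between in H3.
  assert (He : 0 < exp x <= 2) by (split; [apply exp_pos|nra]).
  assert (HA : Rabs (exp x * cos y + - (1) + - x) <= 2 * x ^ 2 + y ^ 2).
  { replace (exp x * cos y + - (1) + - x)
      with ((exp x - 1 - x) + exp x * (cos y - 1)) by ring.
    apply Rabs_le; split; nra. }
  assert (HB : Rabs (exp x * sin y + - 0 + - y) <= 4 * x ^ 2 + 4 * y ^ 2).
  { replace (exp x * sin y + - 0 + - y)
      with (exp x * (sin y - y) + (exp x - 1 - x) * y + x * y) by ring.
    assert (Rabs (exp x * (sin y - y)) <= 2 * y ^ 2).
    { rewrite Rabs_mult, (Rabs_pos_eq (exp x)) by lra.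
      apply Rmult_le_compat; try lra; try apply Rabs_pos; now apply Rabs_le. }
    assert (Rabs ((exp x - 1 - x) * y) <= 2 * x ^ 2).
    { rewrite Rabs_mult, (Rabs_pos_eq (exp x - 1 - x)) by lra.
      assert (Rabs y <= 1) by (apply Rabs_le; lra); generalize (Rabs_pos y); nra. }
    assert (Rabs (x * y) <= x ^ 2 + y ^ 2) by (apply Rabs_le; nra).
    eapply Rle_trans; [apply Rabs_triang|].
    eapply Rle_trans; [apply Rplus_le_compat_r, Rabs_triang|]; nra. }
  change (Rabs (exp x * cos y + - (1) + - x) + Rabs (exp x * sin y + - 0 + - y)
    <= 8 * (x ^ 2 + y ^ 2)).
  nra.
Qed.

Lemma cosh_sinh_taylor h : Cmod h <= / 2 ->
  Cmod (ccosh h - 1)%C <= 8 * Cmod h ^ 2 /\ Cmod (csinh h - h)%C <= 8 * Cmod h ^ 2 /\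
  Cmod (csinh h) <= 5 * Cmod h.
Proof.
  intros Hh; assert (H1 := cexp_taylor h Hh).
  assert (H2 := cexp_taylor (- h)%C); rewrite Cmod_opp in H2; specialize (H2 Hh).
  set (a := (cexp h - 1 - h)%C) in *; set (b := (cexp (- h) - 1 - - h)%C) in *.
  assert (H2' : Cmod (RtoC 2) = 2) by (rewrite Cmod_R; apply Rabs_pos_eq; lra).
  assert (HA : Cmod (ccosh h - 1)%C <= 8 * Cmod h ^ 2).
  { replace (ccosh h - 1)%C with ((a + b) / RtoC 2)%C
      by (unfold a, b, ccosh; field; apply RtoC_2_neq0).
    rewrite Cmod_div, H2' by apply RtoC_2_neq0; generalize (Cmod_triangle a b); lra. }
  assert (HB : Cmod (csinh h - h)%C <= 8 * Cmod h ^ 2).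
  { replace (csinh h - h)%C with ((a - b) / RtoC 2)%C
      by (unfold a, b, csinh; field; apply RtoC_2_neq0).
    rewrite Cmod_div, H2' by apply RtoC_2_neq0; generalize (Cmod_triangle a (- b)%C).
    rewrite Cmod_opp; unfold Cminus; lra. }
  repeat split; auto.
  replace (csinh h) with ((csinh h - h) + h)%C by ring.
  generalize (Cmod_triangle (csinh h - h)%C h) (Cmod_ge_0 h); nra.
Qed.

Lemma csinh_le_exp s : Cmod (csinh s) <= exp (Rabs (Re s)).
Proof.
  unfold csinh; rewrite Cmod_div, (Cmod_R 2), (Rabs_pos_eq 2) by (lra || apply RtoC_2_neq0).
  assert (H := Cmod_triangle (cexp s) (- cexp (- s))%C).
  rewrite Cmod_opp, !Cmod_cexp in H.
  assert (H1 : exp (Re s) <= exp (Rabs (Re s))) by (apply exp_le, Rle_abs).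
  assert (H2 : exp (Re (- s)%C) <= exp (Rabs (Re s))).
  { apply exp_le; simpl; rewrite <- Rabs_Ropp; apply Rle_abs. }
  unfold Cminus; apply Rle_div_l; lra.
Qed.

Definition tnh (z : C) : C := (csinh z / ccosh z)%C.

(** Here and in [tnh_add] the increments are exact, so the Taylor estimates enter only through cosh
    h and sinh h. *)
Lemma sech_add x h : ccosh x <> RtoC 0 -> ccosh (x + h) <> RtoC 0 ->
  (/ ccosh (x + h) - / ccosh x
   = / ccosh (x + h) * (1 - ccosh h) - / ccosh (x + h) * tnh x * csinh h)%C.
Proof.
  intros H1 H2; unfold tnh; rewrite ccosh_plus in *; field; auto.
Qed.

Lemma tnh_add x h : ccosh x <> RtoC 0 -> ccosh (x + h) <> RtoC 0 ->
  (tnh (x + h) - tnh x = csinh h * / ccosh x * / ccosh (x + h))%C.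
Proof.
  intros H1 H2; unfold tnh.
  transitivity ((csinh (x + h) * ccosh x - ccosh (x + h) * csinh x) *
     / ccosh x * / ccosh (x + h))%C; [field; auto|].
  do 2 f_equal; rewrite ccosh_plus, csinh_plus.
  transitivity (csinh h * (ccosh x * ccosh x - csinh x * csinh x))%C; [ring|].
  rewrite ccosh_sqr; ring.
Qed.

Lemma Cmod_mult_le a b x y : Cmod a <= x -> Cmod b <= y -> Cmod (a * b)%C <= x * y.
Proof. intros; rewrite Cmod_mult; apply Rmult_le_compat; auto; apply Cmod_ge_0. Qed.

Lemma Cmod_plus_le a b x y : Cmod a <= x -> Cmod b <= y -> Cmod (a + b)%C <= x + y.
Proof. intros; eapply Rle_trans; [apply Cmod_triangle|lra]. Qed.

Lemma Cmod_minus_le a b x y : Cmod a <= x -> Cmod b <= y -> Cmod (a - b)%C <= x + y.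
Proof. intros; apply Cmod_plus_le; auto; now rewrite Cmod_opp. Qed.

(** Meant for a goal whose right-hand side is an existential variable: the bound is assembled along
    the expression from the hypotheses on its subterms. *)
Ltac cmod_bound :=
  lazymatch goal with
  | |- Cmod (?a * ?b)%C <= _ => first [eassumption | apply Cmod_mult_le; cmod_bound]
  | |- Cmod (?a + ?b)%C <= _ => first [eassumption | apply Cmod_plus_le; cmod_bound]
  | |- Cmod (?a - ?b)%C <= _ => first [eassumption | apply Cmod_minus_le; cmod_bound]
  | |- _ => eassumption
  end.

Lemma Cmod_1_minus_ccosh h : Cmod h <= / 2 -> Cmod (1 - ccosh h)%C <= 8 * Cmod h ^ 2.
Proof. intros Hh; rewrite Cmod_minus_sym; now apply cosh_sinh_taylor. Qed.

(** Encodes sech' = - sech tanh and (sech tanh)' = sech^3 - sech tanh^2 with remainders that retain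
    the decay factor e, so that they can be summed over the nodes. The numbers 8 and 5 come from
    [cosh_sinh_taylor]. *)
Lemma sech_tnh_jet K L : 0 <= K -> 0 <= L -> exists A, 0 <= A /\ forall e x h,
  0 <= e <= 1 -> Cmod h <= / 2 -> ccosh x <> RtoC 0 -> ccosh (x + h) <> RtoC 0 ->
  Cmod (/ ccosh x)%C <= L * e -> Cmod (/ ccosh (x + h))%C <= L * e ->
  Cmod (tnh x) <= K -> Cmod (tnh (x + h)) <= K ->
  Cmod (/ ccosh (x + h) - / ccosh x + h * (/ ccosh x * tnh x))%C <= A * e * Cmod h ^ 2 /\
  Cmod (/ ccosh (x + h) * tnh (x + h) - / ccosh x * tnh x
        - h * (/ ccosh x * (/ ccosh x * / ccosh x) - / ccosh x * (tnh x * tnh x)))%C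
    <= A * e * Cmod h ^ 2.
Proof.
  intros HK HL.
  set (A1 := L * (8 + 8 * K + (4 + 5 * K) * K)).
  set (A2 := L * L * (12 + 5 * K)).
  set (A3 := A1 * K + L * K * (5 * (L * L)) + L * A2).
  assert (HLL : 0 <= L * L) by now apply Rmult_le_pos.
  assert (HKK : 0 <= K * K) by now apply Rmult_le_pos.
  assert (HA1 : 0 <= A1) by (apply Rmult_le_pos; nra).
  assert (HA2 : 0 <= A2) by (apply Rmult_le_pos; nra).
  assert (HA3 : 0 <= A3).
  { unfold A3; assert (0 <= A1 * K) by now apply Rmult_le_pos.
    assert (0 <= L * K * (5 * (L * L))) by (apply Rmult_le_pos; [now apply Rmult_le_pos|lra]).
    assert (0 <= L * A2) by now apply Rmult_le_pos. lra. }
  exists (A1 + A3); split; [lra|].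
  intros e x h He Hh Hx Hxh HS HS' HT HT'.
  destruct (cosh_sinh_taylor h Hh) as (_ & Hsh1 & Hsh2).
  assert (Hch := Cmod_1_minus_ccosh h Hh).
  assert (E1 := sech_add x h Hx Hxh); assert (E2 := tnh_add x h Hx Hxh).
  set (S := (/ ccosh x)%C) in *; set (S' := (/ ccosh (x + h))%C) in *.
  set (T := tnh x) in *; set (T' := tnh (x + h)) in *.
  set (ch := ccosh h) in *; set (sh := csinh h) in *; set (t := Cmod h) in *.
  assert (Ht : 0 <= t) by apply Cmod_ge_0.
  assert (Hth : Cmod h <= t) by (unfold t; lra).
  assert (HLe : 0 <= L * e) by (apply Rmult_le_pos; lra).
  assert (HD : Cmod (S' - S)%C <= L * e * (4 + 5 * K) * t).
  { rewrite E1.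
    eapply Rle_trans; [cmod_bound|].
    assert (L * e * (8 * t ^ 2) <= L * e * (4 * t)) by (apply Rmult_le_compat_l; nra).
    nra. }
  assert (HDT : Cmod (T' - T)%C <= 5 * t * (L * L)).
  { rewrite E2.
    eapply Rle_trans; [cmod_bound|].
    assert (L * e * (L * e) <= L * L).
    { replace (L * e * (L * e)) with (L * L * (e * e)) by ring.
      rewrite <- (Rmult_1_r (L * L)) at 2; apply Rmult_le_compat_l; nra. }
    nra. }
  assert (HR1 : Cmod (S' - S + h * (S * T))%C <= A1 * e * t ^ 2).
  { replace (S' - S + h * (S * T))%C
      with ((S' - S) - (S' - S) * (T * h) + S' * (T * h))%C by ring.
    (* Only the first occurrence of S' - S is expanded; the second carries a factor h and is
       controlled by [HD], which leaves a quadratic remainder. *)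
    rewrite E1 at 1.
    replace (S' * (1 - ch) - S' * T * sh - (S' - S) * (T * h) + S' * (T * h))%C
      with (S' * (1 - ch) - S' * (T * (sh - h)) - (S' - S) * (T * h))%C by ring.
    eapply Rle_trans.
    { cmod_bound. }
    unfold A1; right; ring. }
  assert (HR2 : Cmod (T' - T - h * (S * S))%C <= A2 * t ^ 2).
  { rewrite E2.
    replace (sh * S * S' - h * (S * S))%C with ((sh - h) * (S * S') + h * (S * (S' - S)))%C by ring.
    eapply Rle_trans.
    { cmod_bound. }
    assert (L * e * (L * e) <= L * L).
    { replace (L * e * (L * e)) with (L * L * (e * e)) by ring.
      rewrite <- (Rmult_1_r (L * L)) at 2; apply Rmult_le_compat_l; nra. }
    replace (8 * t ^ 2 * (L * e * (L * e)) + t * (L * e * (L * e * (4 + 5 * K) * t)))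
      with ((L * e * (L * e)) * ((12 + 5 * K) * t ^ 2)) by ring.
    unfold A2; rewrite (Rmult_assoc (L * L)).
    apply Rmult_le_compat_r; auto; apply Rmult_le_pos; nra. }
  assert (Ht2 : 0 <= e * t ^ 2) by (apply Rmult_le_pos; nra).
  split.
  - eapply Rle_trans; [apply HR1|]; nra.
  - replace (S' * T' - S * T - h * (S * (S * S) - S * (T * T)))%C
      with ((S' - S + h * (S * T)) * T' - h * (S * (T * (T' - T)))
            + S * (T' - T - h * (S * S)))%C by ring.
    eapply Rle_trans.
    { cmod_bound. }
    replace (A1 * e * t ^ 2 * K + t * (L * e * (K * (5 * t * (L * L)))) + L * e * (A2 * t ^ 2))
      with (A3 * (e * t ^ 2)) by (unfold A3; ring).
    nra.
Qed.

(** * Termwise differentiation of the lattice sum *)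

Definition wfun1 (s : C) : C :=
  (- (RtoC PI * RtoC PI) * (/ ccosh (RtoC PI * s) * tnh (RtoC PI * s)))%C.
(** The second derivative in the form of the equation w'' = PI^2 w - 2 w^3 satisfied by w itself,
    from which the equation of the lattice sum is derived. *)
Definition wfun2 (s : C) : C :=
  (RtoC PI * RtoC PI * wfun s - RtoC 2 * (wfun s * wfun s * wfun s))%C.

Lemma wfun2_alt s : ccosh (RtoC PI * s) <> RtoC 0 ->
  wfun2 s = (- (RtoC PI * RtoC PI * RtoC PI) *
    (/ ccosh (RtoC PI * s) * (/ ccosh (RtoC PI * s) * / ccosh (RtoC PI * s))
     - / ccosh (RtoC PI * s) * (tnh (RtoC PI * s) * tnh (RtoC PI * s))))%C.
Proof.
  intros H; unfold wfun2, wfun, tnh.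
  set (c := ccosh (RtoC PI * s)) in *; set (sh := csinh (RtoC PI * s)).
  assert (E : (c * c)%C = (1 + sh * sh)%C) by apply ccosh_sqr.
  transitivity (RtoC PI * RtoC PI * RtoC PI * (c * c - RtoC 2) / (c * c * c))%C; [field; auto|].
  transitivity (RtoC PI * RtoC PI * RtoC PI * (sh * sh - RtoC 1) / (c * c * c))%C; [|field; auto].
  f_equal; f_equal; rewrite E; replace (RtoC 2) with (RtoC 1 + RtoC 1)%C; [ring|].
  rewrite <- RtoC_plus; f_equal; ring.
Qed.

Definition fsum1 (om : R) (s : C) : C := zlim (fun k => wfun1 (node om s k)).
Definition fsum2 (om : R) (s : C) : C := zlim (fun k => wfun2 (node om s k)).

(** Stronger than [cderiv]: the explicit constant of the quadratic remainder can be summed over the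
    lattice. *)
Definition sq_derivable (f : C -> C) (z l : C) : Prop :=
  exists A r, 0 <= A /\ 0 < r /\ forall h, Cmod h <= r ->
  Cmod (f (z + h)%C - f z - h * l)%C <= A * Cmod h ^ 2.

Lemma zlim_sq_derivable (g : C -> Z -> C) (l : Z -> C) z e r A :
  0 <= A -> 0 < r -> l1 e -> (forall h, Cmod h <= r -> dominated (g (z + h)%C)) ->
  dominated l ->
  (forall k h, Cmod h <= r -> Cmod (g (z + h)%C k - g z k - h * l k)%C <= A * e k * Cmod h ^ 2) ->
  sq_derivable (fun w => zlim (g w)) z (zlim l).
Proof.
  intros HA Hr He Hg Hl H.
  destruct (l1_window e He) as (X & HX0 & HX).
  exists (A * X), r; repeat split; auto; [now apply Rmult_le_pos|]; intros h Hh.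
  assert (Hg0 : dominated (g z)).
  { replace z with (z + RtoC 0)%C by ring; apply Hg; rewrite Cmod_0; lra. }
  replace (zlim (g (z + h)%C) - zlim (g z) - h * zlim l)%C
    with (zlim (fun k => g (z + h)%C k + (RtoC (-1) * g z k + (- h) * l k))%C).
  - apply (Cmod_zlim _ (fun k => (A * Cmod h ^ 2) * e k)).
    + apply l1_scal; auto; apply Rmult_le_pos; auto; apply pow_le, Cmod_ge_0.
    + intros k; replace (g (z + h)%C k + (RtoC (-1) * g z k + - h * l k))%C
        with (g (z + h)%C k - g z k - h * l k)%C by (rewrite Cmult_m1_l; ring).
      eapply Rle_trans; [now apply H|right; ring].
    + intros lo L; rewrite rwin_scal.
      replace (A * X * Cmod h ^ 2) with (A * Cmod h ^ 2 * X) by ring.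
      apply Rmult_le_compat_l; auto; apply Rmult_le_pos; auto; apply pow_le, Cmod_ge_0.
  - rewrite !zlim_plus, !zlim_scal, Cmult_m1_l; auto; try ring;
    repeat apply dominated_plus; try apply dominated_scal; auto.
Qed.

(** A disc of radius delta/2 stays delta/2 away from the poles. The tanh is bounded because |sinh z|
    <= exp |Re z| is offset by the decay of sech. *)
Lemma sech_tnh_node_bounds delta om z0 : 0 < delta <= 1 -> 0 < om -> far om delta z0 ->
  exists K L, 0 <= K /\ 0 <= L /\ forall k h, Cmod h <= delta / 2 ->
  ccosh (RtoC PI * node om (z0 + h) k) <> RtoC 0 /\
  Cmod (/ ccosh (RtoC PI * node om (z0 + h) k))%C <= L * edecay om k /\
  Cmod (tnh (RtoC PI * node om (z0 + h) k)) <= K.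
Proof.
  intros Hd Ho Hf; assert (HP := PI_RGT_0).
  destruct (sech_decay (delta / 2)) as (K & HK & H); [lra|].
  exists K, (K * exp (PI * (Rabs (Re z0) + 1))); repeat split; try lra.
  { apply Rmult_le_pos; [lra|apply Rlt_le, exp_pos]. }
  all: assert (Hfh : far om (delta / 2) (z0 + h)%C) by
   (intros a Ha; generalize (Hf a Ha) (Cmod_triangle_minus z0 (z0 + h) a);
    replace (z0 - (z0 + h))%C with (- h)%C by ring; rewrite Cmod_opp; lra).
  all: destruct (H om _ (far_shift om (delta / 2) (z0 + h)%C k Hfh)) as [H1 H2]; auto.
  - eapply Rle_trans; [apply H2|]; rewrite Rmult_assoc; apply Rmult_le_compat_l; [lra|].
    eapply Rle_trans; [now apply exp_node_le|].
    apply Rmult_le_compat_r; [apply Rlt_le, exp_pos|]; apply exp_le.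
    apply Rmult_le_compat_l; [lra|].
    replace (Re (z0 + h)%C) with (Re z0 + Re h) by reflexivity.
    generalize (Rabs_triang (Re z0) (Re h)) (re_le_Cmod h); lra.
  - unfold tnh, Cdiv; rewrite Cmod_mult.
    assert (H3 := csinh_le_exp (RtoC PI * node om (z0 + h) k)).
    replace (Re (RtoC PI * node om (z0 + h) k)%C) with (PI * Re (node om (z0 + h) k)) in H3
      by (unfold Re, Cmult, RtoC; simpl; ring).
    rewrite Rabs_mult, (Rabs_pos_eq PI) in H3 by lra.
    set (E := PI * Rabs (Re (node om (z0 + h) k))) in *.
    rewrite exp_Ropp in H2; assert (HE := exp_pos E).
    apply Rle_trans with (exp E * (K * / exp E)).
    + apply Rmult_le_compat; auto; apply Cmod_ge_0.
    + right; field; lra.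
Qed.

Lemma edecay_le_1 om k : 0 < om -> 0 <= edecay om k <= 1.
Proof.
  intros Ho; split; [apply Rlt_le, exp_pos|].
  unfold edecay; rewrite <- exp_0; apply exp_le.
  assert (0 <= PI * om * Rabs (IZR k)); [|lra].
  apply Rmult_le_pos; [|apply Rabs_pos].
  apply Rmult_le_pos; [apply Rlt_le, PI_RGT_0|lra].
Qed.

Lemma dominated_sech_tnh om e s K L : l1 e -> 0 <= K -> 0 <= L ->
  (forall k, Cmod (/ ccosh (RtoC PI * node om s k))%C <= L * e k) ->
  (forall k, Cmod (tnh (RtoC PI * node om s k)) <= K) ->
  dominated (fun k => wfun1 (node om s k)).
Proof.
  intros He HK HL H1 H2; apply dominated_scal.
  exists (fun k => K * L * e k); split.
  - apply l1_scal; auto; now apply Rmult_le_pos.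
  - intros k; eapply Rle_trans; [apply Cmod_mult_le; [apply H1|apply H2]|right; ring].
Qed.

Lemma dominated_wfun_mult om s g : 0 < om -> ~ pole om s -> dominated g ->
  dominated (fun k => wfun (node om s k) * g k)%C.
Proof.
  intros Ho Hs (h & Hh & Hg).
  destruct (wbound_not_pole om s Ho Hs) as (K & _ & HK & Hw).
  exists (fun k => K * (2 * PI) * h k); split.
  - apply l1_scal; auto; apply Rmult_le_pos; auto; generalize PI_RGT_0; lra.
  - intros k; apply Cmod_mult_le; auto.
    eapply Rle_trans; [apply Hw|]; apply Rmult_le_compat_l; auto; apply w0_le_2PI.
Qed.

Lemma dominated_wfun2 om s : 0 < om -> ~ pole om s -> dominated (fun k => wfun2 (node om s k)).
Proof.
  intros Ho Hs; assert (Hd := dominated_node om s Ho Hs).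
  apply (dominated_ext (fun k => RtoC PI * RtoC PI * wfun (node om s k)
     + (- RtoC 2) * (wfun (node om s k) * (wfun (node om s k) * wfun (node om s k))))%C).
  - intros k; unfold wfun2; ring.
  - apply dominated_plus; apply dominated_scal; auto.
    now repeat apply dominated_wfun_mult.
Qed.

Lemma fsum_derivatives om s : 0 < om -> ~ pole om s ->
  dominated (fun k => wfun1 (node om s k)) /\
  sq_derivable (fsum om) s (fsum1 om s) /\ sq_derivable (fsum1 om) s (fsum2 om s).
Proof.
  intros Ho Hs; assert (HP := PI_RGT_0).
  destruct (far_of_not_pole om s Ho Hs) as (delta & Hd & Hf).
  destruct (sech_tnh_node_bounds delta om s Hd Ho Hf) as (K & L & HK & HL & Hb).
  destruct (sech_tnh_jet K L HK HL) as (A & HA & Hjet).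
  (* The bound 1/8 ensures |PI h| <= 1/2, the range of the Taylor estimates. *)
  set (r := Rmin (delta / 2) (/ 8)).
  assert (Hr : 0 < r) by (apply Rmin_pos; lra).
  assert (HPI4 := PI_4).
  assert (Hnp : forall h, Cmod h <= r -> ~ pole om (s + h)%C).
  { intros h Hh; apply (far_not_pole om (delta / 2)); [lra|].
    intros a Ha; generalize (Hf a Ha) (Cmod_triangle_minus s (s + h) a) (Rmin_l (delta / 2) (/ 8)).
    replace (s - (s + h))%C with (- h)%C by ring; rewrite Cmod_opp; fold r; lra. }
  assert (Hd1 : forall h, Cmod h <= r -> dominated (fun k => wfun1 (node om (s + h) k))).
  { intros h Hh; apply (dominated_sech_tnh om (edecay om) _ K L); auto; [now apply l1_edecay| |];
    intros k; apply Hb; generalize (Rmin_l (delta / 2) (/ 8)); fold r; lra. }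
  assert (Hs0 : s = (s + RtoC 0)%C) by ring.
  assert (H00 : Cmod 0 <= r) by (rewrite Cmod_0; lra).
  assert (HJ : forall k h, Cmod h <= r ->
    let x := (RtoC PI * node om s k)%C in let eta := (RtoC PI * h)%C in
    Cmod (/ ccosh (x + eta) - / ccosh x + eta * (/ ccosh x * tnh x))%C
      <= A * edecay om k * Cmod eta ^ 2 /\
    Cmod (/ ccosh (x + eta) * tnh (x + eta) - / ccosh x * tnh x
        - eta * (/ ccosh x * (/ ccosh x * / ccosh x) - / ccosh x * (tnh x * tnh x)))%C
    <= A * edecay om k * Cmod eta ^ 2).
  { intros k h Hh x eta.
    destruct (Hb k 0) as (B1 & B2 & B3); [rewrite Cmod_0; lra|].
    destruct (Hb k h) as (C1 & C2 & C3);
      [generalize (Rmin_l (delta / 2) (/ 8)); fold r; lra|].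
    rewrite <- Hs0 in B1, B2, B3; fold x in B1, B2, B3.
    replace (RtoC PI * node om (s + h) k)%C with (x + eta)%C in C1, C2, C3
      by (unfold x, eta, node; ring).
    apply Hjet; auto; [now apply edecay_le_1|].
    unfold eta; rewrite Cmod_mult, Cmod_R, Rabs_pos_eq by lra.
    generalize (Rmin_r (delta / 2) (/ 8)) (Cmod_ge_0 h); fold r; nra. }
  assert (Heta : forall h, Cmod (RtoC PI * h)%C = PI * Cmod h).
  { intros h; rewrite Cmod_mult, Cmod_R, Rabs_pos_eq; lra. }
  repeat split.
  - rewrite Hs0; now apply Hd1.
  - apply (zlim_sq_derivable (fun z k => wfun (node om z k)) _ s (edecay om) r (PI * (A * PI ^ 2)));
      auto.
    + apply Rmult_le_pos; [lra|]; apply Rmult_le_pos; [auto|apply pow_le; lra].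
    + now apply l1_edecay.
    + intros h Hh; apply dominated_node; auto.
    + rewrite Hs0; now apply Hd1.
    + intros k h Hh; destruct (HJ k h Hh) as [HJ1 _].
      replace (wfun (node om (s + h) k) - wfun (node om s k) - h * wfun1 (node om s k))%C
        with (RtoC PI * (/ ccosh (RtoC PI * node om s k + RtoC PI * h)
          - / ccosh (RtoC PI * node om s k) + (RtoC PI * h) *
          (/ ccosh (RtoC PI * node om s k) * tnh (RtoC PI * node om s k))))%C.
      * rewrite Heta; eapply Rle_trans; [apply Rmult_le_compat_l; [lra|apply HJ1]|].
        rewrite Heta; right; ring.
      * unfold wfun, wfun1, Cdiv.
        replace (RtoC PI * node om (s + h) k)%C with (RtoC PI * node om s k + RtoC PI * h)%C
          by (unfold node; ring).
        ring.
  - apply (zlim_sq_derivable (fun z k => wfun1 (node om z k)) _ s (edecay om) r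
       (PI * PI * (A * PI ^ 2))); auto.
    + apply Rmult_le_pos; [nra|]; apply Rmult_le_pos; [auto|apply pow_le; lra].
    + now apply l1_edecay.
    + now apply dominated_wfun2.
    + intros k h Hh; destruct (HJ k h Hh) as [_ HJ2].
      rewrite wfun2_alt.
      2: { rewrite Hs0; apply Hb; rewrite Cmod_0; lra. }
      unfold wfun1.
      replace (RtoC PI * node om (s + h) k)%C with (RtoC PI * node om s k + RtoC PI * h)%C
          by (unfold node; ring).
      set (x := (RtoC PI * node om s k)%C) in *; set (eta := (RtoC PI * h)%C) in *.
      match goal with |- Cmod ?z <= _ => replace z with (- (RtoC PI * RtoC PI) *
        (/ ccosh (x + eta) * tnh (x + eta) - / ccosh x * tnh x
        - eta * (/ ccosh x * (/ ccosh x * / ccosh x) - / ccosh x * (tnh x * tnh x))))%C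
        by (unfold eta; ring) end.
      rewrite Cmod_mult, Cmod_opp, Heta, Cmod_R, Rabs_pos_eq by lra.
      eapply Rle_trans; [apply Rmult_le_compat_l; [nra|apply HJ2]|].
      unfold eta; rewrite Heta; right; ring.
Qed.

(** * The differential equation *)

Lemma zs_plus M g h : zs M (fun k => g k + h k)%C = (zs M g + zs M h)%C.
Proof. apply csum_plus. Qed.

Lemma zs_minus M g h : zs M (fun k => g k - h k)%C = (zs M g - zs M h)%C.
Proof. apply csum_minus. Qed.

Lemma zs_scal M a g : zs M (fun k => a * g k)%C = (a * zs M g)%C.
Proof. apply csum_scal. Qed.

Lemma zs_swap M (F : Z -> Z -> C) :
  zs M (fun k => zs M (fun l => F k l)) = zs M (fun l => zs M (fun k => F k l)).
Proof. apply csum_swap. Qed.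

(** The inner sum is the kernel over a window translated by -k, which for fixed k tends to the full
    sum; dominated convergence in k then factors the double sum. *)
Lemma zs_convolution_cv u ker : dominated u -> dominated ker ->
  ccv (fun M => zs M (fun k => u k * zs M (fun l => ker (l - k)%Z))%C) (zlim u * zlim ker)%C.
Proof.
  intros (h & Hh & Hu) Hker.
  assert (Hker' := Hker); destruct Hker' as (e & He & Hk).
  destruct (l1_window e He) as (X & HX0 & HX).
  replace (zlim u * zlim ker)%C with (zlim (fun k => zlim ker * u k)%C)
    by (rewrite zlim_scal by (exists h; auto); ring).
  apply (tannery (fun k => X * h k) (fun M k => u k * zs M (fun l => ker (l - k)%Z))%C).
  - now apply l1_scal.
  - intros M k; rewrite Rmult_comm; apply Cmod_mult_le; auto.
    eapply Rle_trans; [apply Cmod_zwin|].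
    eapply Rle_trans; [|apply (HX (- Z.of_nat M + - k)%Z (2 * M + 1)%nat)].
    apply rsum_le; intros t _; eapply Rle_trans; [apply Hk|right; f_equal; ring].
  - intros k; rewrite (Cmult_comm (zlim ker)); apply ccv_scal, ccv_eps; intros eps Heps.
    destruct (zwin_cv ker Hker eps Heps) as [M0 HM].
    exists (M0 + Z.to_nat (Z.abs k))%nat; intros M HMM.
    replace (zs M (fun l => ker (l - k)%Z)) with (zwin (- Z.of_nat M + - k) (2 * M + 1) ker).
    + apply HM; lia.
    + apply csum_ext; intros; f_equal; lia.
Qed.

(** * Partial fractions of products of w at different nodes *)

(** These three kernels in j = l - k are the coefficients in the partial fractions of w_k w_l and
    w_k^2 w_l; the value 0 at j = 0 leaves the diagonal to be added separately by [zs_offdiag]. *)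
Definition csch_ker (om : R) (j : Z) : C :=
  if Z.eqb j 0 then RtoC 0 else RtoC (PI ^ 2 / sinh (PI * om * IZR j)).
Definition csch2_ker (om : R) (j : Z) : C :=
  if Z.eqb j 0 then RtoC 0 else RtoC (PI ^ 2 / sinh (PI * om * IZR j) ^ 2).
Definition coth_csch_ker (om : R) (j : Z) : C :=
  if Z.eqb j 0 then RtoC 0
  else RtoC (PI ^ 2 * cosh (PI * om * IZR j) / sinh (PI * om * IZR j) ^ 2).

Lemma sinh_opp x : sinh (- x) = - sinh x.
Proof. unfold sinh; rewrite Ropp_involutive; field. Qed.

Lemma csch_ker_opp om j : 0 < om -> csch_ker om (- j) = (- csch_ker om j)%C.
Proof.
  intros Ho; unfold csch_ker; destruct (Z.eqb_spec j 0) as [->|Hj].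
  - simpl; ring.
  - destruct (Z.eqb_spec (- j) 0); [lia|].
    rewrite opp_IZR; replace (PI * om * - IZR j) with (- (PI * om * IZR j)) by ring.
    rewrite sinh_opp, <- RtoC_opp; f_equal; field.
    apply sinh_neq0, PI_om_neq0; auto.
Qed.

Lemma csch2_ker_opp om j : 0 < om -> csch2_ker om (- j) = csch2_ker om j.
Proof.
  intros Ho; unfold csch2_ker; destruct (Z.eqb_spec j 0) as [->|Hj].
  - reflexivity.
  - destruct (Z.eqb_spec (- j) 0); [lia|].
    rewrite opp_IZR; replace (PI * om * - IZR j) with (- (PI * om * IZR j)) by ring.
    rewrite sinh_opp; do 2 f_equal; ring.
Qed.

Lemma dominated_kernels om : 0 < om ->
  dominated (csch_ker om) /\ dominated (csch2_ker om) /\ dominated (coth_csch_ker om).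
Proof.
  intros Ho; destruct (csch_le_w0 om Ho) as (K & HK & H).
  assert (HP := PI_RGT_0).
  assert (Hq : 0 < PI * om) by now apply Rmult_lt_0_compat.
  assert (Hl : l1 (fun j => PI ^ 2 * K * w0 om j)).
  { apply l1_scal; [apply Rmult_le_pos; nra|now apply l1_w0]. }
  assert (Hs : 0 < sinh (PI * om)) by (rewrite <- sinh_0; apply sinh_lt; lra).
  set (ct := cosh (PI * om) / sinh (PI * om)).
  assert (Hct : 0 < ct) by (apply Rdiv_lt_0_compat; auto; apply cosh_gt0).
  assert (Hsn : forall j, j <> 0%Z -> sinh (PI * om * IZR j) <> 0)
    by (intros; apply sinh_neq0, PI_om_neq0; auto).
  assert (Hpos : forall j, 0 <= PI ^ 2 * K * w0 om j).
  { intros j; apply Rmult_le_pos; [nra|apply Rlt_le, w0_pos]. }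
  assert (Hcoth : forall j, j <> 0%Z ->
    cosh (PI * om * IZR j) <= ct * Rabs (sinh (PI * om * IZR j))).
  { intros j Hj; assert (Hx : PI * om <= Rabs (PI * om * IZR j)).
    { rewrite Rabs_mult, (Rabs_pos_eq (PI * om)) by lra.
      rewrite <- (Rmult_1_r (PI * om)) at 1; apply Rmult_le_compat_l; [lra|].
      rewrite <- abs_IZR; apply IZR_le; lia. }
    assert (Hr := sinh_cosh_ratio _ _ Hq Hx).
    unfold ct; replace (cosh (PI * om) / sinh (PI * om) * Rabs (sinh (PI * om * IZR j)))
      with (Rabs (sinh (PI * om * IZR j)) * cosh (PI * om) / sinh (PI * om)) by (field; lra).
    apply (Rle_div_r _ _ _ Hs); lra. }
  assert (Hdc : forall j, Cmod (coth_csch_ker om j) <= ct * (PI ^ 2 * K * w0 om j)).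
  { intros j; unfold coth_csch_ker; destruct (Z.eqb_spec j 0) as [->|Hj].
    - rewrite Cmod_0; apply Rmult_le_pos; [lra|auto].
    - rewrite Cmod_R; specialize (H j Hj); specialize (Hcoth j Hj).
      specialize (Hsn j Hj); set (x := PI * om * IZR j) in *.
      replace (PI ^ 2 * cosh x / sinh x ^ 2)
        with (PI ^ 2 * (cosh x * (/ sinh x) * / sinh x)) by (field; auto).
      rewrite !Rabs_mult, (Rabs_pos_eq (PI ^ 2)), (Rabs_pos_eq (cosh x))
        by (try (apply Rlt_le, cosh_gt0); nra).
      replace (ct * (PI ^ 2 * K * w0 om j)) with (PI ^ 2 * (ct * (K * w0 om j))) by ring.
      apply Rmult_le_compat_l; [nra|].
      apply Rmult_le_compat; auto; try apply Rabs_pos.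
      { apply Rmult_le_pos; [apply Rlt_le, cosh_gt0|apply Rabs_pos]. }
      rewrite Rabs_inv; apply Rle_div_l; auto.
      now apply Rabs_pos_lt. }
  repeat split.
  - exists (fun j => PI ^ 2 * K * w0 om j); split; auto; intros j; unfold csch_ker.
    destruct (Z.eqb_spec j 0) as [->|Hj]; [rewrite Cmod_0; auto|].
    rewrite Cmod_R; unfold Rdiv; rewrite Rabs_mult, (Rabs_pos_eq (PI ^ 2)), (Rmult_assoc (PI ^ 2) K) by nra.
    apply Rmult_le_compat_l; [nra|auto].
  - exists (fun j => ct * (PI ^ 2 * K * w0 om j)); split; [apply l1_scal; [lra|auto]|].
    intros j; eapply Rle_trans; [|apply Hdc]; unfold csch2_ker, coth_csch_ker.
    destruct (Z.eqb_spec j 0) as [->|Hj]; [lra|].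
    specialize (Hsn j Hj); set (x := PI * om * IZR j) in *.
    assert (Hc1 : 1 <= cosh x).
    { assert (Hc := cosh_sqr x); assert (Hc0 := cosh_gt0 x); nra. }
    assert (Hp : 0 < PI ^ 2 / sinh x ^ 2) by (apply Rdiv_lt_0_compat; [nra|nra]).
    rewrite !Cmod_R; replace (PI ^ 2 * cosh x / sinh x ^ 2)
      with (PI ^ 2 / sinh x ^ 2 * cosh x) by (field; auto).
    rewrite Rabs_mult, (Rabs_pos_eq (cosh x)) by lra.
    rewrite <- (Rmult_1_r (Rabs (PI ^ 2 / sinh x ^ 2))) at 1.
    apply Rmult_le_compat_l; [apply Rabs_pos|auto].
  - exists (fun j => ct * (PI ^ 2 * K * w0 om j)); split; [apply l1_scal; [lra|auto]|auto].
Qed.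

(** An odd kernel has total mass 0; this removes the tanh terms from the identities for the squares
    and the cubes. *)
Lemma zlim_csch_ker om : 0 < om -> zlim (csch_ker om) = RtoC 0.
Proof.
  intros Ho; destruct (dominated_kernels om Ho) as (Hd & _).
  assert (E : zlim (csch_ker om) = (RtoC (-1) * zlim (csch_ker om))%C).
  { rewrite <- zlim_scal by auto; rewrite <- (zlim_opp (fun k => (RtoC (-1) * csch_ker om k)%C)).
    apply zlim_ext; intros k; rewrite csch_ker_opp, Cmult_m1_l by auto; ring. }
  rewrite Cmult_m1_l in E.
  apply Cmult_cancel_r with (RtoC 2); [apply RtoC_2_neq0|].
  replace (RtoC 2) with (RtoC 1 + RtoC 1)%C by (rewrite <- RtoC_plus; f_equal; ring).
  transitivity (zlim (csch_ker om) + zlim (csch_ker om))%C; [ring|].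
  rewrite E at 2; ring.
Qed.

Definition tnode (om : R) (s : C) (k : Z) : C := tnh (RtoC PI * node om s k).

Lemma node_sub om s k l : (RtoC PI * node om s l - RtoC PI * node om s k)%C
  = RtoC (PI * om * IZR (l - k)).
Proof.
  rewrite minus_IZR; unfold node; destruct s; apply C_ext; simpl; ring.
Qed.

(** The addition formula tanh B - tanh A = sinh (B - A) sech A sech B. *)
Lemma wfun_mult om s k l : 0 < om -> regular om s -> k <> l ->
  (wfun (node om s k) * wfun (node om s l)
   = csch_ker om (l - k) * (tnode om s l - tnode om s k))%C.
Proof.
  intros Ho Hr Hkl; unfold csch_ker; destruct (Z.eqb_spec (l - k) 0); [lia|].
  assert (Hs : sinh (PI * om * IZR (l - k)) <> 0) by (apply sinh_neq0, PI_om_neq0; auto).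
  rewrite RtoC_div by auto; rewrite <- csinh_real, <- (node_sub om s k l).
  assert (Hs' : csinh (RtoC PI * node om s l - RtoC PI * node om s k) <> RtoC 0).
  { rewrite node_sub, csinh_real; now apply RtoC_neq0. }
  unfold tnode, tnh, wfun; rewrite csinh_minus in *.
  replace (RtoC (PI ^ 2)) with (RtoC PI * RtoC PI)%C by (rewrite <- RtoC_mult; f_equal; ring).
  field; repeat split; auto.
Qed.

(** Partial fractions in s: the double pole of node k contributes w_k and w_k tanh_k = - w_k' / PI,
    the simple pole of node l contributes w_l. *)
Lemma wfun_sqr_mult om s k l : 0 < om -> regular om s -> k <> l ->
  (wfun (node om s k) * wfun (node om s k) * wfun (node om s l)
   = coth_csch_ker om (l - k) * wfun (node om s k) - csch2_ker om (l - k) * wfun (node om s l)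
     - csch_ker om (l - k) * (wfun (node om s k) * tnode om s k))%C.
Proof.
  intros Ho Hr Hkl; unfold csch_ker, csch2_ker, coth_csch_ker.
  destruct (Z.eqb_spec (l - k) 0); [lia|].
  assert (Hs : sinh (PI * om * IZR (l - k)) <> 0) by (apply sinh_neq0, PI_om_neq0; auto).
  rewrite !RtoC_div by (auto; apply pow_nonzero; auto).
  rewrite RtoC_mult, RtoC_pow, (RtoC_pow (sinh _)), <- csinh_real, <- ccosh_real.
  rewrite <- (node_sub om s k l).
  assert (Hs' : csinh (RtoC PI * node om s l - RtoC PI * node om s k) <> RtoC 0).
  { rewrite node_sub, csinh_real; now apply RtoC_neq0. }
  unfold tnode, tnh, wfun.
  assert (Ck := Hr k); assert (Cl := Hr l).
  set (A := (RtoC PI * node om s k)%C) in *; set (B := (RtoC PI * node om s l)%C) in *.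
  assert (EA := ccosh_sqr A).
  rewrite csinh_minus, ccosh_minus in *.
  set (D := (csinh B * ccosh A - ccosh B * csinh A)%C) in *.
  apply Cmult_cancel_r with (ccosh A * ccosh A * ccosh B * (D * D))%C.
  { repeat match goal with |- (_ * _)%C <> _ => apply Cmult_neq_0 end; auto. }
  transitivity (RtoC PI ^ 3 * (D * D))%C; [field; auto|].
  transitivity (RtoC PI ^ 3 * ((ccosh B * ccosh A - csinh B * csinh A) * ccosh A * ccosh B
     - ccosh A * ccosh A - D * csinh A * ccosh B))%C; [|field; auto].
  f_equal; unfold D.
  transitivity ((ccosh A * ccosh A) * (csinh B * csinh B)
    + (csinh A * csinh A) * (ccosh B * ccosh B)
    - RtoC 2 * csinh A * csinh B * ccosh A * ccosh B)%C; [simpl; ring|].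
  transitivity ((ccosh A * ccosh A) * (ccosh B * ccosh B) - ccosh A * ccosh A
    + (csinh A * csinh A) * (ccosh B * ccosh B)
    - RtoC 2 * csinh A * csinh B * ccosh A * ccosh B)%C.
  - rewrite (ccosh_sqr B); ring.
  - replace (RtoC 2) with (RtoC 1 + RtoC 1)%C by (rewrite <- RtoC_plus; f_equal; ring); ring.
Qed.

Definition fsq (om : R) (s : C) : C :=
  zlim (fun k => wfun (node om s k) * wfun (node om s k))%C.
Definition fcube (om : R) (s : C) : C :=
  zlim (fun k => wfun (node om s k) * wfun (node om s k) * wfun (node om s k))%C.

Lemma zs_point M (g : Z -> C) k : (Z.abs k <= Z.of_nat M)%Z ->
  zs M (fun l => if Z.eqb l k then g l else RtoC 0) = g k.
Proof.
  intros Hk; unfold zs, zwin.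
  assert (H : forall L lo, (lo <= k < lo + Z.of_nat L)%Z ->
    csum L (fun t => if Z.eqb (Z.of_nat t + lo) k then g (Z.of_nat t + lo)%Z else RtoC 0) = g k).
  { induction L; intros lo Hlo; [lia|]; simpl csum.
    destruct (Z.eqb_spec (Z.of_nat L + lo) k) as [E|E].
    - rewrite csum_zero, E; [ring|]; intros t Ht.
      destruct (Z.eqb_spec (Z.of_nat t + lo) k); [lia|auto].
    - rewrite IHL by lia; ring. }
  apply H; lia.
Qed.

Lemma zs_ext_window M g h : (forall k, (Z.abs k <= Z.of_nat M)%Z -> g k = h k) -> zs M g = zs M h.
Proof. intros H; apply csum_ext; intros t Ht; apply H; lia. Qed.

Lemma zs_offdiag M (F D : Z -> Z -> C) (d : Z -> C) :
  (forall k l, k <> l -> F k l = D k l) -> (forall k, D k k = RtoC 0) -> (forall k, F k k = d k) ->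
  zs M (fun k => zs M (F k)) = (zs M d + zs M (fun k => zs M (D k)))%C.
Proof.
  intros H1 H2 H3; rewrite <- zs_plus; apply zs_ext_window; intros k Hk.
  rewrite <- (zs_point M d k Hk), <- zs_plus; apply zs_ext; intros l.
  destruct (Z.eqb_spec l k) as [->|Hn].
  - rewrite H2, H3; ring.
  - rewrite H1 by auto; ring.
Qed.

(** Off the diagonal, exchanging k and l identifies the two halves of csch (tanh_l - tanh_k) by
    antisymmetry, whence the factor -2. The window stays finite because tanh is not summable. *)
Lemma zs_sqr_expand om s M : 0 < om -> regular om s ->
  (zs M (fun k => wfun (node om s k)) * zs M (fun k => wfun (node om s k))
   - zs M (fun k => wfun (node om s k) * wfun (node om s k))
   = - RtoC 2 * zs M (fun k => tnode om s k * zs M (fun l => csch_ker om (l - k))))%C.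
Proof.
  intros Ho Hr.
  assert (E : (zs M (fun k => wfun (node om s k)) * zs M (fun k => wfun (node om s k)))%C
    = zs M (fun k => zs M (fun l => wfun (node om s k) * wfun (node om s l)))%C).
  { rewrite <- zs_scal; apply zs_ext; intros k.
    rewrite Cmult_comm, <- zs_scal; reflexivity. }
  rewrite E, (zs_offdiag M _ (fun k l => csch_ker om (l - k) * (tnode om s l - tnode om s k))%C
    (fun k => wfun (node om s k) * wfun (node om s k))%C).
  - match goal with |- (?a + ?b - ?a)%C = _ => replace (a + b - a)%C with b by ring end.
    transitivity (zs M (fun k => zs M (fun l => csch_ker om (l - k) * tnode om s l))
      - zs M (fun k => zs M (fun l => csch_ker om (l - k) * tnode om s k)))%C.
    + rewrite <- zs_minus; apply zs_ext; intros k.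
      rewrite <- zs_minus; apply zs_ext; intros l; ring.
    + rewrite zs_swap.
      replace (zs M (fun l => zs M (fun k => csch_ker om (l - k) * tnode om s l)%C))
        with (RtoC (-1) * zs M (fun k => tnode om s k * zs M (fun l => csch_ker om (l - k))))%C.
      * replace (zs M (fun k => zs M (fun l => csch_ker om (l - k) * tnode om s k)%C))
          with (zs M (fun k => tnode om s k * zs M (fun l => csch_ker om (l - k)))%C).
        -- rewrite Cmult_m1_l.
           replace (RtoC 2) with (RtoC 1 + RtoC 1)%C by (rewrite <- RtoC_plus; f_equal; ring); ring.
        -- apply zs_ext; intros k; rewrite <- zs_scal; apply zs_ext; intros l; ring.
      * rewrite <- zs_scal; apply zs_ext; intros l; rewrite <- !zs_scal; apply zs_ext; intros k.
        rewrite Cmult_m1_l; replace (l - k)%Z with (- (k - l))%Z by ring.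
        rewrite csch_ker_opp by auto; ring.
  - intros k l Hkl; now apply wfun_mult.
  - intros k; ring.
  - reflexivity.
Qed.

Lemma not_pole_regular om s : 0 < om -> ~ pole om s -> regular om s.
Proof. intros Ho Hs; destruct (wbound_not_pole om s Ho Hs) as (K & Hr & _); auto. Qed.

Lemma tnode_diff_dominated om s : 0 < om -> ~ pole om s ->
  dominated (fun k => tnode om s k - tnode om 0 k)%C.
Proof.
  intros Ho Hs; assert (Hr := not_pole_regular om s Ho Hs).
  destruct (wbound_0 om) as (Hr0 & _ & Hw0).
  assert (HPn : RtoC PI <> RtoC 0) by apply RtoC_neq0, PI_neq0.
  apply (dominated_ext (fun k => csinh (RtoC PI * s) / (RtoC PI * RtoC PI) *
    (wfun (node om s k) * wfun (node om 0 k)))%C).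
  - intros k; unfold tnode.
    assert (Hk := Hr k); assert (Hk0 := Hr0 k); unfold wfun.
    replace (RtoC PI * node om s k)%C with (RtoC PI * node om 0 k + RtoC PI * s)%C in *
      by (unfold node; ring).
    rewrite tnh_add by auto; field; auto.
  - apply dominated_scal, dominated_wfun_mult; auto.
    exists (w0 om); split; [now apply l1_w0|]; intros k.
    eapply Rle_trans; [apply Hw0|lra].
Qed.

Lemma not_pole_0 om : ~ pole om 0.
Proof.
  intros (n & m & E); injection E; intros E1 _.
  assert (H : IZR (2 * m + 1) = 0) by (rewrite plus_IZR, mult_IZR; lra).
  apply eq_IZR in H; lia.
Qed.

(** Subtracting [zs_sqr_expand] at 0 from that at s replaces tanh by a summable difference; the
    limit then contains the mass of the csch kernel as a factor and is 0. *)
Lemma fsq_identity om s : 0 < om -> ~ pole om s ->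
  (fsum om s * fsum om s - fsq om s = fsum om 0 * fsum om 0 - fsq om 0)%C.
Proof.
  intros Ho Hs; assert (H0 := not_pole_0 om).
  assert (Hf : forall z, ~ pole om z -> ccv (fun M =>
     zs M (fun k => wfun (node om z k)) * zs M (fun k => wfun (node om z k))
     - zs M (fun k => wfun (node om z k) * wfun (node om z k)))%C
     (fsum om z * fsum om z - fsq om z)%C).
  { intros z Hz; assert (Hd := dominated_node om z Ho Hz); apply ccv_minus.
    - apply ccv_mult; now apply zs_cv.
    - apply zs_cv; now apply dominated_wfun_mult. }
  assert (E := ccv_minus _ _ _ _ (Hf s Hs) (Hf _ H0)).
  assert (E' : ccv (fun M => - RtoC 2 * zs M (fun k => (tnode om s k - tnode om 0 k) *
     zs M (fun l => csch_ker om (l - k))))%C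
     (- RtoC 2 * (zlim (fun k => tnode om s k - tnode om 0 k) * zlim (csch_ker om)))%C).
  { apply ccv_scal, zs_convolution_cv; [now apply tnode_diff_dominated|now apply dominated_kernels]. }
  rewrite zlim_csch_ker in E' by auto.
  assert (E2 : (fsum om s * fsum om s - fsq om s - (fsum om 0 * fsum om 0 - fsq om 0))%C = RtoC 0).
  { apply (ccv_unique _ _ _ E).
    replace (- RtoC 2 * (zlim (fun k => tnode om s k - tnode om 0 k) * RtoC 0))%C
      with (RtoC 0) in E' by ring.
    eapply ccv_ext; [|exact E']; intros M; cbv beta.
    rewrite !zs_sqr_expand by (auto; now apply not_pole_regular).
    match goal with |- _ = (?c * ?a - ?c * ?b)%C => transitivity (c * (a - b))%C; [|ring] end.
    f_equal; rewrite <- zs_minus; apply zs_ext; intros k; ring. }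
  replace (fsum om s * fsum om s - fsq om s)%C with
   ((fsum om s * fsum om s - fsq om s - (fsum om 0 * fsum om 0 - fsq om 0))
     + (fsum om 0 * fsum om 0 - fsq om 0))%C by ring.
  rewrite E2; ring.
Qed.

Lemma dominated_wtnode om s : 0 < om -> ~ pole om s ->
  dominated (fun k => wfun (node om s k) * tnode om s k)%C.
Proof.
  intros Ho Hs; destruct (fsum_derivatives om s Ho Hs) as (Hd & _).
  assert (HPn : RtoC PI <> RtoC 0) by apply RtoC_neq0, PI_neq0.
  apply (dominated_ext (fun k => - / RtoC PI * wfun1 (node om s k))%C).
  - intros k; unfold wfun1, wfun, tnode; field; split; auto.
    now apply not_pole_regular.
  - now apply dominated_scal.
Qed.

(** The diagonal of the double sum of w_k^2 w_l gives the cubes; off the diagonal the even kernels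
    contribute their masses times f, and the csch term has mass 0. *)
Lemma fcube_identity om s : 0 < om -> ~ pole om s ->
  (fsum om s * fsq om s
   = fcube om s + (zlim (coth_csch_ker om) - zlim (csch2_ker om)) * fsum om s)%C.
Proof.
  intros Ho Hs; assert (Hr := not_pole_regular om s Ho Hs).
  assert (Hd := dominated_node om s Ho Hs).
  destruct (dominated_kernels om Ho) as (Hk1 & Hk2 & Hk3).
  set (w := fun k => wfun (node om s k)).
  assert (H1 : ccv (fun M => zs M w * zs M (fun k => w k * w k))%C (fsum om s * fsq om s)%C).
  { apply ccv_mult; apply zs_cv; [auto|now apply dominated_wfun_mult]. }
  assert (H2 : ccv (fun M => zs M (fun k => w k * w k * w k)
     + (zs M (fun k => w k * zs M (fun l => coth_csch_ker om (l - k)))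
        - zs M (fun k => w k * zs M (fun l => csch2_ker om (l - k)))
        - zs M (fun k => w k * tnode om s k * zs M (fun l => csch_ker om (l - k)))))%C
    (fcube om s + (fsum om s * zlim (coth_csch_ker om) - fsum om s * zlim (csch2_ker om)
       - zlim (fun k => w k * tnode om s k) * zlim (csch_ker om)))%C).
  { apply ccv_plus.
    - apply zs_cv; eapply dominated_ext;
        [|apply dominated_wfun_mult; [exact Ho|exact Hs|apply dominated_wfun_mult;
           [exact Ho|exact Hs|exact Hd]]].
      intros k; unfold w; cbv beta; ring.
    - apply ccv_minus; [apply ccv_minus|]; apply zs_convolution_cv; auto.
      now apply dominated_wtnode. }
  rewrite zlim_csch_ker in H2 by auto.
  transitivity (fcube om s + (fsum om s * zlim (coth_csch_ker om)
     - fsum om s * zlim (csch2_ker om)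
       - zlim (fun k => w k * tnode om s k) * RtoC 0))%C; [|ring].
  apply (ccv_unique _ _ _ H1).
  eapply ccv_ext; [|exact H2]; intros M; cbv beta.
  assert (E : (zs M w * zs M (fun k => w k * w k))%C
    = zs M (fun k => zs M (fun l => w k * w k * w l))%C).
  { rewrite Cmult_comm, (Cmult_comm _ (zs M w)), <- zs_scal.
    apply zs_ext; intros k; rewrite Cmult_comm, <- zs_scal; reflexivity. }
  rewrite E, (zs_offdiag M _ (fun k l => coth_csch_ker om (l - k) * w k
     - csch2_ker om (l - k) * w l - csch_ker om (l - k) * (w k * tnode om s k))%C
    (fun k => w k * w k * w k)%C).
  - f_equal.
    transitivity (zs M (fun k => zs M (fun l => coth_csch_ker om (l - k) * w k))
     - zs M (fun k => zs M (fun l => csch2_ker om (l - k) * w l))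
     - zs M (fun k => zs M (fun l => csch_ker om (l - k) * (w k * tnode om s k))))%C.
    + f_equal; [f_equal|].
      * apply zs_ext; intros k; rewrite <- zs_scal; apply zs_ext; intros l; ring.
      * rewrite zs_swap; apply zs_ext; intros k; rewrite <- zs_scal.
        apply zs_ext; intros l; replace (k - l)%Z with (- (l - k))%Z by ring.
        rewrite csch2_ker_opp by auto; ring.
      * apply zs_ext; intros k; rewrite <- zs_scal; apply zs_ext; intros l; ring.
    + rewrite <- !zs_minus; apply zs_ext; intros k; now rewrite <- !zs_minus.
  - intros k l Hkl; now apply wfun_sqr_mult.
  - intros k; rewrite Z.sub_diag; unfold csch_ker, csch2_ker, coth_csch_ker; simpl; ring.
  - reflexivity.
Qed.

Lemma fsum_ode om : 0 < om -> exists A : C, forall s, ~ pole om s ->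
  (fsum2 om s = A * fsum om s - RtoC 2 * (fsum om s * fsum om s * fsum om s))%C.
Proof.
  intros Ho.
  (* Summing w'' = PI^2 w - 2 w^3, eliminating the cubes by [fcube_identity] with the constant kappa
     (the difference of the kernel masses) and the squares by f^2 - c, leaves A = PI^2 + 2 c + 2
     kappa. *)
  exists (RtoC PI * RtoC PI + RtoC 2 * (fsum om 0 * fsum om 0 - fsq om 0)
    + RtoC 2 * (zlim (coth_csch_ker om) - zlim (csch2_ker om)))%C.
  intros s Hs.
  assert (Hd := dominated_node om s Ho Hs).
  assert (E2 : fsum2 om s = (RtoC PI * RtoC PI * fsum om s - RtoC 2 * fcube om s)%C).
  { unfold fsum2, fsum, fcube.
    assert (Hd3 : dominated (fun k => wfun (node om s k) * wfun (node om s k) * wfun (node om s k))%C).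
    { eapply dominated_ext;
        [|apply dominated_wfun_mult; [exact Ho|exact Hs|apply dominated_wfun_mult;
           [exact Ho|exact Hs|exact Hd]]].
      intros k; cbv beta; ring. }
    transitivity (zlim (fun k => RtoC PI * RtoC PI * wfun (node om s k) + (- RtoC 2) *
      (wfun (node om s k) * wfun (node om s k) * wfun (node om s k)))%C).
    - apply zlim_ext; intros k; unfold wfun2; ring.
    - rewrite zlim_plus, !zlim_scal; auto; try (now apply dominated_scal); ring. }
  assert (E3 := fcube_identity om s Ho Hs); assert (Es := fsq_identity om s Ho Hs).
  rewrite E2, <- Es.
  replace (fcube om s) with
    (fsum om s * fsq om s - (zlim (coth_csch_ker om) - zlim (csch2_ker om)) * fsum om s)%C
    by (rewrite E3; ring).
  ring.
Qed.

(** * Poles *)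

Definition has_residue (f : C -> C) (a r : C) : Prop :=
  forall eps, 0 < eps -> exists delta, 0 < delta /\ forall h, 0 < Cmod h < delta ->
  Cmod (h * f (a + h) - r)%C < eps.

Lemma zlim_point (g : Z -> C) :
  dominated (fun l => if Z.eqb l 0 then g l else RtoC 0) /\
  zlim (fun l => if Z.eqb l 0 then g l else RtoC 0) = g 0%Z.
Proof.
  split.
  - exists (fun k => Cmod (g 0%Z) * edecay 1 k); split.
    + apply l1_scal; [apply Cmod_ge_0|apply l1_edecay; lra].
    + intros k; destruct (Z.eqb_spec k 0) as [->|Hk].
      * unfold edecay; rewrite Rabs_R0, Rmult_0_r, Ropp_0, exp_0; lra.
      * rewrite Cmod_0; apply Rmult_le_pos; [apply Cmod_ge_0|apply edecay_le_1; lra].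
  - apply zlim_unique, (ccv_ext (fun _ => g 0%Z)); [|apply ccv_const].
    intros M; now rewrite zs_point by lia.
Qed.

Lemma csinh_ratio eta : 0 < Cmod eta <= / 16 ->
  csinh eta <> RtoC 0 /\ Cmod (eta / csinh eta - 1)%C <= 16 * Cmod eta.
Proof.
  intros He; destruct (cosh_sinh_taylor eta) as (_ & H & _); [lra|].
  assert (H1 := Cmod_rev_triangle eta (csinh eta)); rewrite Cmod_minus_sym in H1.
  assert (H2 : Cmod eta / 2 <= Cmod (csinh eta)) by nra.
  assert (Hn : csinh eta <> RtoC 0) by (apply Cmod_gt_0; lra).
  split; auto.
  replace (eta / csinh eta - 1)%C with (- (csinh eta - eta) / csinh eta)%C by (field; auto).
  rewrite Cmod_div, Cmod_opp by auto; apply Rle_div_l; [lra|nra].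
Qed.

(** Only the node k = 0 is singular at i/2; the others keep a horizontal distance from the poles and
    sum to a bounded quantity. *)
Lemma fsum_near_half_i om : 0 < om -> exists B r, 0 < r /\ r <= / 2 /\ forall h, 0 < Cmod h < r ->
  ~ pole om ((0, / 2)%R + h)%C /\
  Cmod (fsum om ((0, / 2)%R + h) - wfun ((0, / 2)%R + h))%C <= B.
Proof.
  intros Ho; assert (HP := PI_RGT_0).
  (* Since d <= om/4, for |h| < d a node with k <> 0 has real part at least 3 om/4 > d in modulus,
     so [ccosh_lower] applies with parameter d; d <= 1/2 excludes the other poles on the vertical
     line. *)
  set (d := Rmin (om / 2) 1 / 2).
  assert (Hd0 : 0 < Rmin (om / 2) 1) by (apply Rmin_pos; lra).
  assert (Hd1 := Rmin_l (om / 2) 1); assert (Hd2 := Rmin_r (om / 2) 1).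
  destruct (ccosh_lower d) as (c & Hc & Hlow); [unfold d; lra|].
  set (A := PI * (/ c * exp PI)).
  assert (Hci := Rinv_0_lt_compat _ Hc).
  assert (HA : 0 <= A).
  { unfold A; generalize (exp_pos PI); intros.
    apply Rmult_le_pos; [lra|apply Rmult_le_pos; lra]. }
  destruct (l1_window _ (l1_edecay om Ho)) as (X & HX0 & HX).
  exists (A * X), d; repeat split; [unfold d; lra|unfold d; lra| |].
  - intros (n & m & E).
    assert (Eh : h = (om * IZR n, IZR m)).
    { replace h with (((0, / 2)%R + h) - (0, / 2)%R)%C by ring; rewrite E.
      apply C_ext; simpl; ring. }
    destruct (Z.eq_dec n 0) as [->|Hn].
    + destruct (Z.eq_dec m 0) as [->|Hm].
      * rewrite Eh in H; replace (om * 0, 0) with (RtoC 0) in H by (apply C_ext; simpl; ring).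
        rewrite Cmod_0 in H; lra.
      * assert (H1 := im_le_Cmod h); rewrite Eh in H1 at 1; simpl in H1.
        assert (1 <= Rabs (IZR m)) by (rewrite <- abs_IZR; apply IZR_le; lia).
        unfold d in *; lra.
    + assert (H1 := re_le_Cmod h); rewrite Eh in H1 at 1; simpl in H1.
      rewrite Rabs_mult, (Rabs_pos_eq om) in H1 by lra.
      assert (1 <= Rabs (IZR n)) by (rewrite <- abs_IZR; apply IZR_le; lia).
      assert (om <= Cmod h) by nra.
      unfold d in *; lra.
  - set (z := ((0, / 2)%R + h)%C).
    set (g := fun k => if Z.eqb k 0 then RtoC 0 else wfun (node om z k)).
    assert (Hg : forall k, Cmod (g k) <= A * edecay om k).
    { intros k; unfold g; destruct (Z.eqb_spec k 0) as [->|Hk].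
      - rewrite Cmod_0; apply Rmult_le_pos; auto; apply edecay_le_1; auto.
      - destruct h as [h1 h2].
        assert (Hh1 := re_le_Cmod (h1, h2)); simpl Re in Hh1.
        assert (Ez : node om z k = (h1 + om * IZR k, / 2 + h2)).
        { unfold z, node; apply C_ext; simpl; ring. }
        assert (H1 : 1 <= Rabs (IZR k)) by (rewrite <- abs_IZR; apply IZR_le; lia).
        assert (H2 : om * Rabs (IZR k) - Rabs h1 <= Rabs (h1 + om * IZR k)).
        { assert (T := Rabs_triang (h1 + om * IZR k) (- h1)).
          replace (h1 + om * IZR k + - h1) with (om * IZR k) in T by ring.
          rewrite Rabs_Ropp, Rabs_mult, (Rabs_pos_eq om) in T; lra. }
        assert (HL := Hlow (h1 + om * IZR k) (/ 2 + h2)).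
        assert (HL' : c * exp (PI * Rabs (h1 + om * IZR k)) <=
          Cmod (ccosh (RtoC PI * (h1 + om * IZR k, / 2 + h2)%R)%C)).
        { apply HL; intros m.
          apply Rlt_le_trans with (Rabs (h1 + om * IZR k)).
          - assert (om <= om * Rabs (IZR k)) by nra. unfold d in *; lra.
          - apply (re_le_Cmod (h1 + om * IZR k, / 2 + h2 - (IZR m + / 2))). }
        rewrite Ez; unfold wfun.
        set (P := exp (PI * Rabs (h1 + om * IZR k))) in *.
        assert (HPp : 0 < P) by apply exp_pos.
        assert (HcP : 0 < c * P) by now apply Rmult_lt_0_compat.
        rewrite Cmod_div, Cmod_R, Rabs_pos_eq by (try lra; apply Cmod_gt_0; lra).
        apply Rle_trans with (PI * / (c * P)).
        + apply Rmult_le_compat_l; [lra|]; apply Rinv_le_contravar; auto.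
        + unfold A; rewrite !Rmult_assoc; apply Rmult_le_compat_l; [lra|].
          rewrite Rinv_mult; apply Rmult_le_compat_l; [lra|].
          unfold P, edecay; rewrite <- exp_Ropp, <- exp_plus; apply exp_le.
          assert (Cmod (h1, h2) <= 1) by (unfold d in *; lra). nra. }
    assert (Hdg : dominated g).
    { exists (fun k => A * edecay om k); split; auto; apply l1_scal; auto; now apply l1_edecay. }
    destruct (zlim_point (fun k => wfun (node om z k))) as [Hdp Ep].
    assert (E : fsum om z = (zlim g + wfun z)%C).
    { unfold fsum; rewrite (zlim_ext _ (fun k => g k + (if Z.eqb k 0 then wfun (node om z k)
         else RtoC 0))%C).
      - rewrite zlim_plus, Ep by auto; f_equal; f_equal; unfold node.
        rewrite Rmult_0_r; ring.
      - intros k; unfold g; destruct (Z.eqb k 0); ring. }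
    rewrite E; replace (zlim g + wfun z - wfun z)%C with (zlim g) by ring.
    apply (Cmod_zlim _ (fun k => A * edecay om k)); auto.
    + apply l1_scal; auto; now apply l1_edecay.
    + intros lo L; rewrite rwin_scal; now apply Rmult_le_compat_l.
Qed.

(** From cosh (eta + i PI/2) = i sinh eta with eta = PI h one gets h w(i/2 + h) = - i eta / sinh
    eta; the other nodes contribute O(h). *)
Lemma fsum_residue_half_i om : 0 < om -> has_residue (fsum om) (0, / 2) (- Ci).
Proof.
  intros Ho eps He; assert (HP := PI_RGT_0); assert (HP4 := PI_4).
  destruct (fsum_near_half_i om Ho) as (B & r & Hr & Hr2 & HB).
  (* With PI <= 4, |h| < 1/64 gives |PI h| <= 1/16 as [csinh_ratio] demands, and 65 exceeds 16
     PI. *)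
  set (d := Rmin (Rmin r (/ 64)) (eps / (Rabs B + 65))).
  assert (HB0 := Rabs_pos B).
  exists d; split.
  { repeat apply Rmin_pos; try lra; apply Rdiv_lt_0_compat; lra. }
  intros h Hh.
  assert (H1 : Cmod h < r /\ Cmod h < / 64 /\ Cmod h * (Rabs B + 65) < eps).
  { unfold d in Hh; generalize (Rmin_l (Rmin r (/ 64)) (eps / (Rabs B + 65)))
     (Rmin_r (Rmin r (/ 64)) (eps / (Rabs B + 65))) (Rmin_l r (/ 64)) (Rmin_r r (/ 64)).
    intros; repeat split; try lra.
    apply (Rmult_lt_reg_r (/ (Rabs B + 65))); [apply Rinv_0_lt_compat; lra|].
    replace (Cmod h * (Rabs B + 65) * / (Rabs B + 65)) with (Cmod h) by (field; lra).
    unfold Rdiv in *; lra. }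
  destruct H1 as (H1 & H2 & H3).
  destruct (HB h) as [_ HBh]; [lra|].
  set (z := ((0, / 2)%R + h)%C) in *.
  set (eta := (RtoC PI * h)%C).
  assert (Heta : Cmod eta = PI * Cmod h).
  { unfold eta; rewrite Cmod_mult, Cmod_R, Rabs_pos_eq; lra. }
  destruct (csinh_ratio eta) as [Hs Hq]; [rewrite Heta; nra|].
  assert (Ew : (h * wfun z)%C = (- Ci * (eta / csinh eta))%C).
  { unfold wfun; replace (RtoC PI * z)%C with (eta + (0, PI / 2)%R)%C.
    - rewrite ccosh_shift.
      replace (h * (RtoC PI / (Ci * csinh eta)))%C with (/ Ci * (eta / csinh eta))%C
        by (unfold eta in *; field; split; [auto|apply Ci_neq0]).
      f_equal; apply C_ext; simpl; field.
    - unfold z, eta; destruct h as [h1 h2]; apply C_ext; simpl; field. }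
  replace (h * fsum om z - - Ci)%C
    with (h * (fsum om z - wfun z) + (h * wfun z + Ci))%C by ring.
  rewrite Ew; replace (- Ci * (eta / csinh eta) + Ci)%C with (- Ci * (eta / csinh eta - 1))%C by ring.
  eapply Rle_lt_trans.
  { apply Cmod_plus_le; apply Cmod_mult_le; [apply Rle_refl|apply HBh| |apply Hq].
    rewrite Cmod_opp, Cmod_Ci; apply Rle_refl. }
  rewrite Heta; generalize (Rle_abs B); nra.
Qed.

Lemma pole_shift_Ci om a : pole om (a + Ci)%C <-> pole om a.
Proof.
  split; intros (n & m & E).
  - exists n, (m - 1)%Z; rewrite minus_IZR.
    replace a with ((a + Ci) - Ci)%C by ring; rewrite E; apply C_ext; simpl; ring.
  - exists n, (m + 1)%Z; rewrite plus_IZR, E; apply C_ext; simpl; ring.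
Qed.

Lemma pole_isolated om a h : 0 < om -> pole om a -> 0 < Cmod h < Rmin om 1 -> ~ pole om (a + h)%C.
Proof.
  intros Ho (n & m & ->) Hh (n' & m' & E).
  generalize (Rmin_l om 1) (Rmin_r om 1); intros.
  assert (Eh : h = (om * IZR (n' - n), IZR (m' - m))).
  { rewrite !minus_IZR.
    replace h with (((om * IZR n, IZR m + / 2)%R + h) - (om * IZR n, IZR m + / 2)%R)%C by ring.
    rewrite E; apply C_ext; simpl; ring. }
  destruct (Z.eq_dec (n' - n) 0) as [En|Hn].
  - destruct (Z.eq_dec (m' - m) 0) as [Em|Hm].
    + rewrite Eh, En, Em in Hh; replace (om * 0, 0) with (RtoC 0) in Hh by (apply C_ext; simpl; ring).
      rewrite Cmod_0 in Hh; lra.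
    + assert (H1 := im_le_Cmod h); rewrite Eh in H1 at 1; simpl in H1.
      assert (1 <= Rabs (IZR (m' - m))) by (rewrite <- abs_IZR; apply IZR_le; lia); lra.
  - assert (H1 := re_le_Cmod h); rewrite Eh in H1 at 1; simpl in H1.
    rewrite Rabs_mult, (Rabs_pos_eq om) in H1 by lra.
    assert (1 <= Rabs (IZR (n' - n))) by (rewrite <- abs_IZR; apply IZR_le; lia); nra.
Qed.

Lemma has_residue_Ci om a r : 0 < om -> pole om a ->
  has_residue (fsum om) a r <-> has_residue (fsum om) (a + Ci) (- r).
Proof.
  intros Ho Ha; split; intros H eps He; destruct (H eps He) as (d & Hd & Hdd);
  exists (Rmin d (Rmin om 1)); (split; [repeat apply Rmin_pos; lra|]); intros h Hh;
  generalize (Rmin_l d (Rmin om 1)) (Rmin_r d (Rmin om 1)); intros;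
  (assert (Hnp : ~ pole om (a + h)%C) by (apply pole_isolated; auto; lra));
  specialize (Hdd h ltac:(lra));
  replace (a + Ci + h)%C with (a + h + Ci)%C in * by ring;
  rewrite fsum_Ci in * by auto; rewrite <- Cmod_opp.
  - replace (- (h * - fsum om (a + h) - - r))%C with (h * fsum om (a + h) - r)%C by ring; auto.
  - replace (- (h * fsum om (a + h) - r))%C with (h * - fsum om (a + h) - - r)%C by ring; auto.
Qed.

Lemma has_residue_node om a r n : 0 < om -> pole om a ->
  has_residue (fsum om) a r -> has_residue (fsum om) (node om a n) r.
Proof.
  intros Ho Ha H eps He; destruct (H eps He) as (d & Hd & Hdd).
  exists (Rmin d (Rmin om 1)); split; [repeat apply Rmin_pos; lra|]; intros h Hh.
  generalize (Rmin_l d (Rmin om 1)) (Rmin_r d (Rmin om 1)); intros.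
  replace (node om a n + h)%C with (node om (a + h)%C n) by (unfold node; ring).
  rewrite fsum_shift; auto; [apply Hdd; lra|apply pole_isolated; auto; lra].
Qed.

(** The residues alternate in sign with the row of the pole; what is needed later is only that they
    have modulus 1. *)
Lemma fsum_residue om a : 0 < om -> pole om a ->
  has_residue (fsum om) a Ci \/ has_residue (fsum om) a (- Ci).
Proof.
  intros Ho (n & m & E).
  assert (Hp0 : forall j, pole om (0, IZR j + / 2)).
  { intros j; exists 0%Z, j; rewrite Rmult_0_r; reflexivity. }
  assert (Hup : forall j : nat, (has_residue (fsum om) (0, IZR (Z.of_nat j) + / 2) Ci \/
     has_residue (fsum om) (0, IZR (Z.of_nat j) + / 2) (- Ci)) /\
     (has_residue (fsum om) (0, IZR (- Z.of_nat j) + / 2) Ci \/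
     has_residue (fsum om) (0, IZR (- Z.of_nat j) + / 2) (- Ci))).
  { induction j as [|j [IH1 IH2]].
    - simpl; replace (0 + / 2) with (/ 2) by ring; split; right; now apply fsum_residue_half_i.
    - split.
      + replace (0, IZR (Z.of_nat (S j)) + / 2) with ((0, IZR (Z.of_nat j) + / 2)%R + Ci)%C
          by (rewrite Nat2Z.inj_succ, succ_IZR; apply C_ext; simpl; ring).
        destruct IH1 as [IH|IH]; apply (proj1 (has_residue_Ci om _ _ Ho (Hp0 _))) in IH; [right; exact IH|left].
        replace (- - Ci)%C with Ci in IH by ring; exact IH.
      + assert (E2 : (0, IZR (- Z.of_nat j) + / 2) = ((0, IZR (- Z.of_nat (S j)) + / 2)%R + Ci)%C)
          by (rewrite !opp_IZR, Nat2Z.inj_succ, succ_IZR; apply C_ext; simpl; ring).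
        rewrite E2 in IH2; destruct IH2 as [IH|IH].
        * right; apply (proj2 (has_residue_Ci om _ _ Ho (Hp0 (- Z.of_nat (S j))%Z))).
          replace (- - Ci)%C with Ci by ring; exact IH.
        * left; apply (proj2 (has_residue_Ci om _ _ Ho (Hp0 (- Z.of_nat (S j))%Z))); exact IH. }
  assert (H0 : has_residue (fsum om) (0, IZR m + / 2) Ci \/
     has_residue (fsum om) (0, IZR m + / 2) (- Ci)).
  { destruct (Z_le_gt_dec 0 m).
    - assert (Em : Z.of_nat (Z.to_nat m) = m) by lia.
      rewrite <- Em; exact (proj1 (Hup (Z.to_nat m))).
    - assert (Em : (- Z.of_nat (Z.to_nat (- m)))%Z = m) by lia.
      rewrite <- Em; exact (proj2 (Hup (Z.to_nat (- m)))). }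
  replace a with (node om (0, IZR m + / 2)%R n)
    by (rewrite E; unfold node; apply C_ext; simpl; ring).
  destruct H0; [left|right]; now apply has_residue_node.
Qed.

Lemma fsum_unbounded_near_pole om a : 0 < om -> pole om a -> forall B, exists d, 0 < d /\
  forall h, 0 < Cmod h < d -> B < Cmod (fsum om (a + h)%C).
Proof.
  intros Ho Ha B.
  assert (H : exists r, Cmod r = 1 /\ has_residue (fsum om) a r).
  { destruct (fsum_residue om a Ho Ha); eexists; split; try eassumption.
    - apply Cmod_Ci.
    - rewrite Cmod_opp; apply Cmod_Ci. }
  destruct H as (r & Hr & H); destruct (H (/ 2)) as (d & Hd & Hdd); [lra|].
  assert (HB := Rabs_pos B).
  exists (Rmin d (/ (2 * (Rabs B + 1)))); split.
  { apply Rmin_pos; auto; apply Rinv_0_lt_compat; lra. }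
  intros h Hh; generalize (Rmin_l d (/ (2 * (Rabs B + 1)))) (Rmin_r d (/ (2 * (Rabs B + 1)))); intros.
  specialize (Hdd h ltac:(lra)); rewrite Cmod_minus_sym in Hdd.
  assert (T := Cmod_rev_triangle r (h * fsum om (a + h))%C).
  rewrite Cmod_mult in T.
  apply Rnot_le_lt; intros Hle.
  assert (Cmod h * Cmod (fsum om (a + h)%C) <= / (2 * (Rabs B + 1)) * (Rabs B + 1)).
  { apply Rmult_le_compat; try apply Cmod_ge_0; [lra|].
    generalize (Rle_abs B); lra. }
  replace (/ (2 * (Rabs B + 1)) * (Rabs B + 1)) with (/ 2) in H2 by (field; lra).
  lra.
Qed.

(** * Critical points *)

(** Derivative along a real parameter, by components, so that the equation on a segment becomes a
    real system accessible to the mean value theorem. *)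
Definition path_derive (u : R -> C) (t : R) (d : C) : Prop :=
  is_derive (fun x => Re (u x)) t (Re d) /\ is_derive (fun x => Im (u x)) t (Im d).

Lemma sq_derivable_path f s v t l : sq_derivable f (s + RtoC t * v)%C l ->
  path_derive (fun x => f (s + RtoC x * v)%C) t (v * l)%C.
Proof.
  intros (A & r & HA & Hr & H).
  assert (HV := Cmod_ge_0 v); set (V := Cmod v) in *.
  assert (Hpr : forall pr : C -> R,
    (forall a b, pr (a - b)%C = pr a - pr b) -> (forall x a, pr (RtoC x * a)%C = x * pr a) ->
    (forall a, Rabs (pr a) <= Cmod a) ->
    is_derive (fun x => pr (f (s + RtoC x * v)%C)) t (pr (v * l)%C)).
  { intros pr P1 P2 P3; apply is_derive_Reals; intros eps He.
    assert (Hd : 0 < Rmin (r / (V + 1)) (eps / (A * V ^ 2 + 1))).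
    { apply Rmin_pos; apply Rdiv_lt_0_compat; try lra.
      assert (0 <= A * V ^ 2) by (apply Rmult_le_pos; nra); lra. }
    exists (mkposreal _ Hd); intros h Hh Hhd; simpl in Hhd.
    assert (Hh1 := Rabs_pos_lt h Hh).
    assert (HA1 : 0 <= A * V ^ 2) by (apply Rmult_le_pos; nra).
    assert (H1 : Rabs h * (V + 1) < r).
    { apply (Rmult_lt_reg_r (/ (V + 1))); [apply Rinv_0_lt_compat; lra|].
      replace (Rabs h * (V + 1) * / (V + 1)) with (Rabs h) by (field; lra).
      eapply Rlt_le_trans; [apply Hhd|apply Rmin_l]. }
    assert (H2 : Rabs h * (A * V ^ 2 + 1) < eps).
    { apply (Rmult_lt_reg_r (/ (A * V ^ 2 + 1))); [apply Rinv_0_lt_compat; lra|].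
      replace (Rabs h * (A * V ^ 2 + 1) * / (A * V ^ 2 + 1)) with (Rabs h) by (field; lra).
      eapply Rlt_le_trans; [apply Hhd|apply Rmin_r]. }
    assert (Hm : Cmod (RtoC h * v)%C = Rabs h * V) by (rewrite Cmod_mult, Cmod_R; reflexivity).
    assert (H3 : Cmod (f (s + RtoC t * v + RtoC h * v) - f (s + RtoC t * v)
       - RtoC h * v * l)%C <= A * (Rabs h * V) ^ 2).
    { rewrite <- Hm; apply H; rewrite Hm; nra. }
    replace (s + RtoC (t + h) * v)%C with (s + RtoC t * v + RtoC h * v)%C
      by (rewrite RtoC_plus; ring).
    set (F := f (s + RtoC t * v + RtoC h * v)%C) in *; set (G := f (s + RtoC t * v)%C) in *.
    replace ((pr F - pr G) / h - pr (v * l)%C) with (pr (F - G - RtoC h * v * l)%C / h).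
    - unfold Rdiv; rewrite Rabs_mult, Rabs_inv.
      apply Rle_lt_trans with (A * (Rabs h * V) ^ 2 * / Rabs h).
      + apply Rmult_le_compat_r; [apply Rlt_le, Rinv_0_lt_compat; lra|].
        eapply Rle_trans; [apply P3|apply H3].
      + replace (A * (Rabs h * V) ^ 2 * / Rabs h) with (Rabs h * (A * V ^ 2)) by (field; lra).
        nra.
    - rewrite !P1; replace (RtoC h * v * l)%C with (RtoC h * (v * l))%C by ring.
      rewrite P2; field; auto. }
  split; apply Hpr.
  - intros [] []; simpl; ring.
  - intros x []; simpl; ring.
  - apply re_le_Cmod.
  - intros [] []; simpl; ring.
  - intros x []; simpl; ring.
  - apply im_le_Cmod.
Qed.

Lemma is_derive_sqr x t d : is_derive x t d -> is_derive (fun s => x s * x s) t (2 * x t * d).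
Proof.
  intros H; replace (2 * x t * d) with (d * x t + x t * d) by ring.
  apply (is_derive_mult x x t d d H H); intros; apply Rmult_comm.
Qed.

Lemma path_derive_minus u v t a b : path_derive u t a -> path_derive v t b ->
  path_derive (fun x => u x - v x)%C t (a - b)%C.
Proof.
  intros [H1 H2] [H3 H4]; split.
  - apply (is_derive_minus (fun x => Re (u x)) (fun x => Re (v x)) t (Re a) (Re b) H1 H3).
  - apply (is_derive_minus (fun x => Im (u x)) (fun x => Im (v x)) t (Im a) (Im b) H2 H4).
Qed.

Lemma path_derive_sqr_mod u t d : path_derive u t d ->
  is_derive (fun x => Re (u x) * Re (u x) + Im (u x) * Im (u x)) t
    (2 * Re (u t) * Re d + 2 * Im (u t) * Im d).
Proof.
  intros [H1 H2].
  apply (is_derive_plus (fun x => Re (u x) * Re (u x)) (fun x => Im (u x) * Im (u x)));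
  now apply is_derive_sqr.
Qed.

Lemma Cmod_sqr z : Cmod z * Cmod z = Re z * Re z + Im z * Im z.
Proof. transitivity (Cmod z ^ 2); [ring|]; rewrite Cmod2_alt; ring. Qed.

Lemma inner_le_Cmod z w : Re z * Re w + Im z * Im w <= Cmod z * Cmod w.
Proof.
  replace (Re z * Re w + Im z * Im w) with (Re (z * Cconj w)%C)
    by (destruct z, w; simpl; ring).
  eapply Rle_trans; [apply Rle_abs|]; eapply Rle_trans; [apply re_le_Cmod|].
  rewrite Cmod_mult, Cmod_conj; lra.
Qed.

Lemma path_bounded u t1 : 0 <= t1 -> (forall t, 0 <= t <= t1 -> exists d, path_derive u t d) ->
  exists B, 0 <= B /\ forall t, 0 <= t <= t1 -> Cmod (u t) <= B.
Proof.
  intros Ht H.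
  destruct (continuity_ab_maj (fun x => Re (u x) * Re (u x) + Im (u x) * Im (u x)) 0 t1 Ht)
    as (m & Hm & _).
  - intros t Htt; destruct (H t Htt) as [d Hd].
    apply continuity_pt_filterlim, (ex_derive_continuous
      (fun x => Re (u x) * Re (u x) + Im (u x) * Im (u x))).
    eexists; apply path_derive_sqr_mod, Hd.
  - exists (Cmod (u m)); split; [apply Cmod_ge_0|]; intros t Htt.
    specialize (Hm t Htt); rewrite <- !Cmod_sqr in Hm.
    generalize (Cmod_ge_0 (u t)) (Cmod_ge_0 (u m)); nra.
Qed.

(* Gronwall for [E = |u1-u2|^2 + |p1-p2|^2]. *)
Lemma cubic_ode_unique (a b : C) (u1 p1 u2 p2 : R -> C) :
  (forall t, 0 <= t < 1 -> path_derive u1 t (p1 t) /\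
     path_derive p1 t (a * u1 t - b * (u1 t * u1 t * u1 t))%C) ->
  (forall t, 0 <= t < 1 -> path_derive u2 t (p2 t) /\
     path_derive p2 t (a * u2 t - b * (u2 t * u2 t * u2 t))%C) ->
  u1 0 = u2 0 -> p1 0 = p2 0 -> forall t, 0 <= t < 1 -> u1 t = u2 t.
Proof.
  intros H1 H2 E0 E1 t1 Ht1.
  (* Bounds are taken on the closed interval [0, t1] because a solution may blow up as t tends to 1,
     which happens on the segment ending at a pole. *)
  destruct (path_bounded u1 t1) as (B1 & HB1 & Hb1); [lra|intros t Ht; exists (p1 t); apply (H1 t); lra|].
  destruct (path_bounded u2 t1) as (B2 & HB2 & Hb2); [lra|intros t Ht; exists (p2 t); apply (H2 t); lra|].
  set (B := B1 + B2).
  (* Lipschitz constant of u -> a u - b u^3 on the disc of radius B, from u1^3 - u2^3 = (u1^2 + u1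
     u2 + u2^2) (u1 - u2). *)
  set (L := Cmod a + Cmod b * (3 * B ^ 2)).
  assert (HL : 0 <= L).
  { unfold L; generalize (Cmod_ge_0 a) (Cmod_ge_0 b); intros.
    assert (0 <= Cmod b * (3 * B ^ 2)) by (apply Rmult_le_pos; nra); lra. }
  set (du := fun t => (u1 t - u2 t)%C); set (dp := fun t => (p1 t - p2 t)%C).
  set (dn := fun t => ((a * u1 t - b * (u1 t * u1 t * u1 t))
     - (a * u2 t - b * (u2 t * u2 t * u2 t)))%C).
  assert (Hdn : forall t, 0 <= t <= t1 -> Cmod (dn t) <= L * Cmod (du t)).
  { intros t Ht; specialize (Hb1 t Ht); specialize (Hb2 t Ht).
    assert (HbB1 : Cmod (u1 t) <= B) by (unfold B; lra).
    assert (HbB2 : Cmod (u2 t) <= B) by (unfold B; lra).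
    replace (dn t) with ((a - b * (u1 t * u1 t + u1 t * u2 t + u2 t * u2 t)) * du t)%C
      by (unfold dn, du; ring).
    rewrite Cmod_mult; apply Rmult_le_compat_r; [apply Cmod_ge_0|].
    assert (Ha := Rle_refl (Cmod a)); assert (Hb := Rle_refl (Cmod b)).
    eapply Rle_trans; [cmod_bound|]; unfold L; right; ring. }
  set (E := fun t => (Re (du t) * Re (du t) + Im (du t) * Im (du t))
     + (Re (dp t) * Re (dp t) + Im (dp t) * Im (dp t))).
  set (dE := fun t => (2 * Re (du t) * Re (dp t) + 2 * Im (du t) * Im (dp t))
     + (2 * Re (dp t) * Re (dn t) + 2 * Im (dp t) * Im (dn t))).
  assert (HE : forall t, 0 <= t <= t1 -> is_derive E t (dE t)).
  { intros t Ht; destruct (H1 t) as [A1 A2]; [lra|]; destruct (H2 t) as [A3 A4]; [lra|].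
    apply (is_derive_plus (fun t => Re (du t) * Re (du t) + Im (du t) * Im (du t))
       (fun t => Re (dp t) * Re (dp t) + Im (dp t) * Im (dp t))).
    - apply (path_derive_sqr_mod du t (dp t)); now apply path_derive_minus.
    - apply (path_derive_sqr_mod dp t (dn t)); now apply path_derive_minus. }
  assert (HdE : forall t, 0 <= t <= t1 -> dE t <= (1 + L) * E t).
  { intros t Ht; unfold dE, E; rewrite <- !Cmod_sqr.
    assert (I1 := inner_le_Cmod (du t) (dp t)); assert (I2 := inner_le_Cmod (dp t) (dn t)).
    assert (I3 := Hdn t Ht).
    generalize (Cmod_ge_0 (du t)) (Cmod_ge_0 (dp t)); intros P Q.
    assert (Cmod (dp t) * Cmod (dn t) <= Cmod (dp t) * (L * Cmod (du t)))
      by (apply Rmult_le_compat_l; auto).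
    assert (I4 : 2 * (Cmod (du t) * Cmod (dp t))
      <= Cmod (du t) * Cmod (du t) + Cmod (dp t) * Cmod (dp t))
      by (generalize (Rle_0_sqr (Cmod (du t) - Cmod (dp t))); unfold Rsqr; lra).
    assert (I5 := Rmult_le_compat_l L _ _ HL I4).
    lra. }
  assert (HEt : E t1 <= 0).
  { destruct (Req_dec t1 0) as [->|Hn].
    - unfold E, du, dp; rewrite E0, E1; simpl; right; ring.
    - assert (Ht1p : 0 < t1) by (destruct (proj1 Ht1); [auto|congruence]).
      destruct (MVT_cor2 (fun t => E t * exp (- (1 + L) * t))
        (fun t => dE t * exp (- (1 + L) * t) + E t * (- (1 + L) * exp (- (1 + L) * t))) 0 t1)
        as (c & Ec & Hc).
      + lra.
      + intros t Ht; apply is_derive_Reals.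
        apply (is_derive_mult E (fun t => exp (- (1 + L) * t))).
        * now apply HE.
        * auto_derive; auto; ring.
        * intros; apply Rmult_comm.
      + assert (HE0 : E 0 = 0) by (unfold E, du, dp; rewrite E0, E1; simpl; ring).
        rewrite HE0, Rmult_0_l, Rminus_0_r in Ec.
        assert (Hexp := exp_pos (- (1 + L) * c)).
        assert (HdEc := HdE c ltac:(lra)).
        assert (E t1 * exp (- (1 + L) * t1) <= 0).
        { rewrite Ec.
          replace (dE c * exp (- (1 + L) * c) + E c * (- (1 + L) * exp (- (1 + L) * c)))
            with ((dE c - (1 + L) * E c) * exp (- (1 + L) * c)) by ring.
          assert ((dE c - (1 + L) * E c) * exp (- (1 + L) * c) <= 0) by nra.
          nra. }
        assert (Hexp1 := exp_pos (- (1 + L) * t1)); nra. }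
  assert (Hz : Cmod (du t1) = 0).
  { unfold E in HEt; rewrite <- !Cmod_sqr in HEt.
    generalize (Cmod_ge_0 (du t1)) (Cmod_ge_0 (dp t1)); nra. }
  apply Cmod_eq_0 in Hz; unfold du in Hz.
  replace (u1 t1) with ((u1 t1 - u2 t1) + u2 t1)%C by ring; rewrite Hz; ring.
Qed.

(** * Zeros of the derivative *)

Lemma tnh_opp z : tnh (- z) = (- tnh z)%C.
Proof. unfold tnh, Cdiv; rewrite csinh_opp, ccosh_opp; ring. Qed.

Lemma csinh_shift_PI z : csinh (z + (0, PI)) = (- csinh z)%C.
Proof.
  rewrite csinh_plus, ccosh_pair, csinh_pair, cosh_0, sinh_0, cos_PI, sin_PI.
  destruct (csinh z), (ccosh z); apply C_ext; simpl; ring.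
Qed.

Lemma wfun1_opp s : wfun1 (- s) = (- wfun1 s)%C.
Proof.
  unfold wfun1; replace (RtoC PI * - s)%C with (- (RtoC PI * s))%C by ring.
  rewrite ccosh_opp, tnh_opp; ring.
Qed.

Lemma wfun1_Ci s : ccosh (RtoC PI * s) <> RtoC 0 -> wfun1 (s + Ci) = (- wfun1 s)%C.
Proof.
  intros H; unfold wfun1; replace (RtoC PI * (s + Ci))%C with (RtoC PI * s + (0, PI)%R)%C
    by (destruct s; apply C_ext; simpl; ring).
  assert (H' : (- ccosh (RtoC PI * s))%C <> RtoC 0).
  { intros E; apply H; replace (ccosh (RtoC PI * s)) with (- - ccosh (RtoC PI * s))%C by ring.
    rewrite E; ring. }
  unfold tnh; rewrite ccosh_shift_PI, csinh_shift_PI; field; auto.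
Qed.

Lemma fsum1_opp om s : 0 < om -> ~ pole om s -> fsum1 om (- s) = (- fsum1 om s)%C.
Proof.
  intros Ho Hs; unfold fsum1; destruct (fsum_derivatives om s Ho Hs) as (Hd & _).
  rewrite <- zlim_opp, <- (Cmult_m1_l (zlim _)), <- zlim_scal by auto.
  apply zlim_ext; intros k; rewrite Cmult_m1_l, <- wfun1_opp; f_equal.
  unfold node; rewrite opp_IZR.
  replace (om * - IZR k) with (- (om * IZR k)) by ring; rewrite RtoC_opp; ring.
Qed.

Lemma fsum1_Ci om s : 0 < om -> ~ pole om s -> fsum1 om (s + Ci) = (- fsum1 om s)%C.
Proof.
  intros Ho Hs; unfold fsum1; destruct (fsum_derivatives om s Ho Hs) as (Hd & _).
  rewrite <- Cmult_m1_l, <- zlim_scal by auto.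
  apply zlim_ext; intros k; rewrite Cmult_m1_l, <- wfun1_Ci by now apply not_pole_regular.
  f_equal; unfold node; ring.
Qed.

Lemma fsum1_shift om s j : 0 < om -> ~ pole om s -> fsum1 om (node om s j) = fsum1 om s.
Proof.
  intros Ho Hs; unfold fsum1; destruct (fsum_derivatives om s Ho Hs) as (Hd & _).
  rewrite <- (zlim_shift (fun k => wfun1 (node om s k)) j) by auto.
  apply zlim_ext; intros k; f_equal; unfold node; rewrite plus_IZR, Rmult_plus_distr_l, RtoC_plus.
  ring.
Qed.

Lemma pole_opp om s : pole om (- s)%C <-> pole om s.
Proof.
  split; intros (n & m & E); exists (- n)%Z, (- m - 1)%Z; rewrite minus_IZR, !opp_IZR.
  - replace s with (- - s)%C by ring; rewrite E; apply C_ext; simpl; field.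
  - rewrite E; apply C_ext; simpl; field.
Qed.

Lemma pole_shift_int om z k : pole om (z + (0, IZR k)%R)%C <-> pole om z.
Proof.
  split; intros (n & m & E).
  - exists n, (m - k)%Z; rewrite minus_IZR.
    replace z with ((z + (0, IZR k)%R) - (0, IZR k)%R)%C by ring; rewrite E.
    apply C_ext; simpl; ring.
  - exists n, (m + k)%Z; rewrite plus_IZR, E; apply C_ext; simpl; ring.
Qed.

Lemma antiperiodic_shift om (g : C -> C) :
  (forall z, ~ pole om z -> g (z + Ci)%C = (- g z)%C) ->
  forall k z, ~ pole om z -> g (z + (0, 2 * IZR k)%R)%C = g z.
Proof.
  intros Hg.
  assert (Hnat : forall (k : nat) z, ~ pole om z -> g (z + (0, 2 * IZR (Z.of_nat k))%R)%C = g z).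
  { induction k as [|k IH]; intros z Hz.
    - f_equal; destruct z; apply C_ext; simpl; ring.
    - replace (z + (0, 2 * IZR (Z.of_nat (S k)))%R)%C
        with (((z + (0, 2 * IZR (Z.of_nat k))%R) + Ci) + Ci)%C
        by (rewrite Nat2Z.inj_succ, succ_IZR; destruct z; apply C_ext; simpl; ring).
      assert (Hk : ~ pole om (z + (0, 2 * IZR (Z.of_nat k))%R)%C).
      { rewrite <- mult_IZR; now rewrite pole_shift_int. }
      rewrite !Hg, IH by (try rewrite pole_shift_Ci; auto); ring. }
  intros k z Hz; destruct (Z_le_gt_dec 0 k) as [Hk|Hk].
  - rewrite <- (Z2Nat.id k) by auto; now apply Hnat.
  - rewrite <- (Hnat (Z.to_nat (- k)) (z + (0, 2 * IZR k)%R)%C).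
    + f_equal; rewrite Z2Nat.id, opp_IZR by lia; destruct z; apply C_ext; simpl; ring.
    + rewrite <- mult_IZR; now rewrite pole_shift_int.
Qed.

(** The condition that 2 s is a period: one equation in place of the four congruence classes, to
    which [half_period_congr] returns. *)
Definition half_period (om : R) (s : C) : Prop :=
  exists j k : Z, (s + s)%C = (om * IZR j, 2 * IZR k).

(** f' is odd and periodic, so f'(s) = f'(- s + 2 s) = f'(- s) = - f'(s). *)
Lemma fsum1_half_period om s : 0 < om -> ~ pole om s -> half_period om s -> fsum1 om s = RtoC 0.
Proof.
  intros Ho Hs (j & k & E).
  assert (Hn : ~ pole om (- s)%C) by now rewrite pole_opp.
  assert (E1 : fsum1 om s = fsum1 om (- s)).
  { replace s with (node om (- s + (0, 2 * IZR k)%R)%C j) at 1.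
    - rewrite fsum1_shift; auto.
      + apply antiperiodic_shift with (om := om); auto.
        intros z Hz; now apply fsum1_Ci.
      + rewrite <- mult_IZR; now rewrite pole_shift_int.
    - unfold node; transitivity (- s + (s + s))%C; [rewrite E|ring].
      destruct s; apply C_ext; simpl; ring. }
  rewrite fsum1_opp in E1 by auto.
  apply Cmult_cancel_r with (RtoC 2); [apply RtoC_2_neq0|].
  replace (RtoC 2) with (RtoC 1 + RtoC 1)%C by (rewrite <- RtoC_plus; f_equal; ring).
  transitivity (fsum1 om s + fsum1 om s)%C; [ring|rewrite E1 at 2; ring].
Qed.

(** Rounding each coordinate gives |Re d| <= om/2 and |Im d| <= 1/2, so for 0 < c < 2 the offset c d
    is shorter than one lattice step in both coordinates: the open segment from a to a + 2 d, with
    midpoint s, contains no pole. *)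
Lemma nearest_pole om s : 0 < om -> ~ pole om s -> exists a d, pole om a /\ s = (a + d)%C /\
  (forall c, 0 < c < 2 -> ~ pole om (a + RtoC c * d)%C) /\ d <> RtoC 0.
Proof.
  intros Ho Hs; destruct s as [x y].
  destruct (floor_scaled om (x + om / 2) Ho) as (n & Hn).
  destruct (floor_scaled 1 y Rlt_0_1) as (m & Hm).
  set (d := (x - om * IZR n, y - (IZR m + / 2)) : C).
  assert (Hd : d <> RtoC 0).
  { intros E; injection E; intros E2 E1; apply Hs; exists n, m; f_equal; lra. }
  exists (om * IZR n, IZR m + / 2), d; repeat split; auto.
  - now exists n, m.
  - apply C_ext; simpl; ring.
  - intros c Hc (n' & m' & E); injection E; intros E2 E1.
    assert (F1 : c * (x - om * IZR n) = om * IZR (n' - n)) by (rewrite minus_IZR; lra).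
    assert (F2 : c * (y - (IZR m + / 2)) = IZR (m' - m)) by (rewrite minus_IZR; lra).
    assert (Hz : forall z : Z, -1 < IZR z < 1 -> z = 0%Z).
    { intros z [Z1 Z2]; apply lt_IZR in Z1; apply lt_IZR in Z2; lia. }
    assert (G1 : (n' - n)%Z = 0%Z).
    { apply Hz; split; apply (Rmult_lt_reg_l om); auto; rewrite <- F1; nra. }
    assert (G2 : (m' - m)%Z = 0%Z) by (apply Hz; rewrite <- F2; nra).
    rewrite G1 in F1; rewrite G2 in F2; apply Hd; unfold d; apply C_ext; simpl; nra.
Qed.

Lemma fsum_blow_up om a d : 0 < om -> pole om a -> d <> RtoC 0 -> forall B, exists t,
  0 <= t < 1 /\ forall t', t <= t' < 1 -> B < Cmod (fsum om (a + RtoC (1 - t') * d)%C).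
Proof.
  intros Ho Ha Hd B; destruct (fsum_unbounded_near_pole om a Ho Ha B) as (e & He & H).
  assert (HD : 0 < Cmod d) by now apply Cmod_gt_0.
  assert (Hq : 0 < Rmin (/ 2) (e / (2 * Cmod d))).
  { apply Rmin_pos; [lra|apply Rdiv_lt_0_compat; lra]. }
  exists (1 - Rmin (/ 2) (e / (2 * Cmod d))); split.
  - generalize (Rmin_l (/ 2) (e / (2 * Cmod d))); lra.
  - intros t' Ht; apply H; rewrite Cmod_mult, Cmod_R, Rabs_pos_eq by lra; split.
    + apply Rmult_lt_0_compat; lra.
    + apply Rle_lt_trans with (e / (2 * Cmod d) * Cmod d).
      * apply Rmult_le_compat_r; [lra|].
        generalize (Rmin_r (/ 2) (e / (2 * Cmod d))); lra.
      * replace (e / (2 * Cmod d) * Cmod d) with (e / 2) by (field; lra); lra.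
Qed.

Lemma sq_derivable_bounded f z l : sq_derivable f z l ->
  exists B r, 0 < r /\ forall h, Cmod h <= r -> Cmod (f (z + h)%C) <= B.
Proof.
  intros (A & r & HA & Hr & H); exists (A * r ^ 2 + r * Cmod l + Cmod (f z)), r; split; auto.
  intros h Hh; specialize (H h Hh).
  replace (f (z + h)%C) with ((f (z + h)%C - f z - h * l) + h * l + f z)%C by ring.
  assert (Hl := Rle_refl (Cmod l)); assert (Hf := Rle_refl (Cmod (f z))).
  eapply Rle_trans; [cmod_bound|].
  assert (Cmod h ^ 2 <= r ^ 2) by (apply pow_incr; split; [apply Cmod_ge_0|auto]).
  assert (A * Cmod h ^ 2 <= A * r ^ 2) by (apply Rmult_le_compat_l; auto); lra.
Qed.

(** In direction v the pair (f, v f') satisfies a system that involves v only through v^2, so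
    opposite directions obey the same system. *)
Lemma fsum_path om A s v : 0 < om ->
  (forall z, ~ pole om z ->
    fsum2 om z = (A * fsum om z - RtoC 2 * (fsum om z * fsum om z * fsum om z))%C) ->
  (forall t, 0 <= t < 1 -> ~ pole om (s + RtoC t * v)%C) ->
  forall t, 0 <= t < 1 ->
  path_derive (fun t => fsum om (s + RtoC t * v)%C) t (v * fsum1 om (s + RtoC t * v))%C /\
  path_derive (fun t => v * fsum1 om (s + RtoC t * v))%C t
    ((v * v * A) * fsum om (s + RtoC t * v) - (RtoC 2 * (v * v)) *
      (fsum om (s + RtoC t * v) * fsum om (s + RtoC t * v) * fsum om (s + RtoC t * v)))%C.
Proof.
  intros Ho HA Hp t Ht.
  destruct (fsum_derivatives om _ Ho (Hp t Ht)) as (_ & H1 & H2); split.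
  - now apply sq_derivable_path.
  - set (z := (s + RtoC t * v)%C) in *.
    replace ((v * v * A) * fsum om z - (RtoC 2 * (v * v)) * (fsum om z * fsum om z * fsum om z))%C
      with (v * (v * fsum2 om z))%C by (rewrite HA by (now apply Hp); ring).
    apply (sq_derivable_path (fun w => v * fsum1 om w)%C).
    destruct H2 as (B & r & HB & Hr & H); exists (Cmod v * B), r; repeat split; auto.
    + apply Rmult_le_pos; auto; apply Cmod_ge_0.
    + intros h Hh; specialize (H h Hh); fold z.
      replace (v * fsum1 om (z + h) - v * fsum1 om z - h * (v * fsum2 om z))%C
        with (v * (fsum1 om (z + h) - fsum1 om z - h * fsum2 om z))%C by ring.
      rewrite Cmod_mult, Rmult_assoc; apply Rmult_le_compat_l; auto; apply Cmod_ge_0.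
Qed.

Lemma path_derive_const c t : path_derive (fun _ => c) t (RtoC 0).
Proof. split; apply @is_derive_const. Qed.

(* Both sides solve the same second order ODE with the same initial data; the segments run from
   [a + d] towards the pole [a] and away from it. *)
Lemma fsum_reflection om a d : 0 < om -> (forall c, 0 < c < 2 -> ~ pole om (a + RtoC c * d)%C) ->
  fsum1 om (a + d) = RtoC 0 -> forall t, 0 <= t < 1 ->
  fsum om (a + RtoC (1 - t) * d) = fsum om (a + RtoC (1 + t) * d) /\
  (fsum2 om (a + d) = RtoC 0 -> fsum om (a + RtoC (1 - t) * d) = fsum om (a + d)).
Proof.
  intros Ho Hp Hz t Ht; destruct (fsum_ode om Ho) as [A HA].
  assert (Em : forall t, (a + d + RtoC t * - d)%C = (a + RtoC (1 - t) * d)%C)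
    by (intros; rewrite RtoC_minus; ring).
  assert (Ep : forall t, (a + d + RtoC t * d)%C = (a + RtoC (1 + t) * d)%C)
    by (intros; rewrite RtoC_plus; ring).
  assert (H1 := fsum_path om A (a + d)%C (- d)%C Ho HA
    ltac:(intros u Hu; rewrite Em; apply Hp; lra)).
  assert (H2 := fsum_path om A (a + d)%C d Ho HA
    ltac:(intros u Hu; rewrite Ep; apply Hp; lra)).
  replace (- d * - d)%C with (d * d)%C in H1 by ring.
  assert (E0 : forall v, (a + d + RtoC 0 * v)%C = (a + d)%C) by (intros; ring).
  rewrite <- Em, <- Ep; split.
  - apply (cubic_ode_unique (d * d * A) (RtoC 2 * (d * d))
      (fun t => fsum om (a + d + RtoC t * - d)%C) (fun t => - d * fsum1 om (a + d + RtoC t * - d))%C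
      (fun t => fsum om (a + d + RtoC t * d)%C) (fun t => d * fsum1 om (a + d + RtoC t * d))%C);
      auto; cbv beta; rewrite !E0; auto; rewrite Hz; ring.
  - intros Hz2.
    apply (cubic_ode_unique (d * d * A) (RtoC 2 * (d * d))
      (fun t => fsum om (a + d + RtoC t * - d)%C) (fun t => - d * fsum1 om (a + d + RtoC t * - d))%C
      (fun _ => fsum om (a + d)) (fun _ => RtoC 0)); auto.
    + intros u Hu; split; [apply path_derive_const|].
      assert (Hnp : ~ pole om (a + d)%C).
      { replace (a + d)%C with (a + RtoC 1 * d)%C by ring; apply Hp; lra. }
      replace (d * d * A * fsum om (a + d) - RtoC 2 * (d * d) *
         (fsum om (a + d) * fsum om (a + d) * fsum om (a + d)))%C with (RtoC 0);
        [apply path_derive_const|].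
      rewrite HA in Hz2 by auto.
      transitivity (d * d * (A * fsum om (a + d)
        - RtoC 2 * (fsum om (a + d) * fsum om (a + d) * fsum om (a + d))))%C; [rewrite Hz2|]; ring.
    + cbv beta; now rewrite E0.
    + cbv beta; rewrite E0, Hz; ring.
Qed.

Lemma fsum1_zero om s : 0 < om -> ~ pole om s -> fsum1 om s = RtoC 0 ->
  half_period om s /\ fsum2 om s <> RtoC 0.
Proof.
  intros Ho Hs Hz; destruct (nearest_pole om s Ho Hs) as (a & d & Ha & -> & Hp & Hd).
  assert (Hrefl := fsum_reflection om a d Ho Hp Hz).
  assert (Hblow := fsum_blow_up om a d Ho Ha Hd).
  split.
  - assert (Hpole : pole om (a + RtoC 2 * d)%C).
    (* Were a + 2 d regular, f would be bounded near it, although by reflection it takes there the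
       large values that it takes near a. *)
    { apply NNPP; intros Hn.
      destruct (fsum_derivatives om _ Ho Hn) as (_ & H1 & _).
      destruct (sq_derivable_bounded _ _ _ H1) as (B & r & Hr & HB).
      destruct (Hblow B) as (t & Ht & Hbt).
      assert (HD : 0 < Cmod d) by now apply Cmod_gt_0.
      set (e := Rmin (1 - t) (r / Cmod d)).
      assert (He : 0 < e) by (apply Rmin_pos; [lra|now apply Rdiv_lt_0_compat]).
      assert (He1 := Rmin_l (1 - t) (r / Cmod d)); assert (He2 := Rmin_r (1 - t) (r / Cmod d)).
      fold e in He1, He2.
      assert (G1 := Hbt (1 - e) ltac:(lra)).
      rewrite (proj1 (Hrefl (1 - e) ltac:(lra))) in G1.
      replace (a + RtoC (1 + (1 - e)) * d)%C with (a + RtoC 2 * d + RtoC (- e) * d)%C in G1.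
      - assert (G2 := HB (RtoC (- e) * d)%C).
        rewrite Cmod_mult, Cmod_R, Rabs_Ropp, Rabs_pos_eq in G2 by lra.
        apply Rmult_le_compat_r with (r := Cmod d) in He2; [|lra].
        replace (r / Cmod d * Cmod d) with r in He2 by (field; lra).
        specialize (G2 He2); lra.
      - replace (1 + (1 - e)) with (2 + - e) by ring; rewrite RtoC_plus; ring. }
    destruct Ha as (n & m & Ea); destruct Hpole as (n' & m' & Ep).
    (* s is the midpoint of two poles, and the halves in their imaginary parts add up to the extra
       1. *)
    assert (E2 : ((a + d) + (a + d))%C = (om * IZR (n + n'), IZR (m + m' + 1))).
    { transitivity (a + (a + RtoC 2 * d))%C.
      - replace (RtoC 2) with (RtoC 1 + RtoC 1)%C by (rewrite <- RtoC_plus; f_equal; ring); ring.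
      - rewrite Ep, Ea, !plus_IZR; apply C_ext; simpl; field. }
    set (N := (n + n')%Z) in *; set (M := (m + m' + 1)%Z) in *.
    destruct (Zeven_odd_dec M) as [HM|HM].
    { apply Zeven_ex in HM; destruct HM as [k Hk]; exists N, k.
      now rewrite E2, Hk, mult_IZR. }
    (* With M odd and N even, s itself would be a pole. With both odd, s is a centre of
       antisymmetry; together with the reflection this makes f vanish on the segment towards a,
       against the blow-up. *)
    exfalso; apply Zodd_ex in HM; destruct HM as [k Hk].
    destruct (Zeven_odd_dec N) as [HN|HN].
    + apply Zeven_ex in HN; destruct HN as [j Hj]; apply Hs; exists j, k.
      rewrite Hk, Hj, plus_IZR, !mult_IZR in E2.
      injection E2; intros I2 I1; apply C_ext; simpl in *; lra.
    + assert (Hanti : forall t, 0 <= t < 1 ->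
        fsum om (a + RtoC (1 - t) * d) = (- fsum om (a + RtoC (1 + t) * d))%C).
      { intros t Ht.
        assert (Hq : ~ pole om (a + RtoC (1 + t) * d)%C) by (apply Hp; lra).
        assert (Hq' : ~ pole om (- (a + RtoC (1 + t) * d))%C) by now rewrite pole_opp.
        assert (Hq2 : ~ pole om (- (a + RtoC (1 + t) * d) + (0, 2 * IZR k)%R)%C).
        { rewrite <- mult_IZR; now rewrite pole_shift_int. }
        replace (a + RtoC (1 - t) * d)%C with
          (node om ((- (a + RtoC (1 + t) * d) + (0, 2 * IZR k)%R) + Ci) N)%C.
        - rewrite fsum_shift by (auto; now rewrite pole_shift_Ci).
          rewrite fsum_Ci by auto.
          rewrite (antiperiodic_shift om (fsum om)); auto.
          + now rewrite fsum_opp.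
          + intros z Hzz; now apply fsum_Ci.
        - unfold node.
          transitivity (- (a + RtoC (1 + t) * d) + ((a + d) + (a + d)))%C.
          + rewrite E2, Hk, plus_IZR, mult_IZR.
            set (q := (- (a + RtoC (1 + t) * d))%C); apply C_ext; simpl; ring.
          + rewrite RtoC_plus, RtoC_minus; ring. }
      destruct (Hblow 0) as (t & Ht & Hbt).
      assert (G := Hbt t ltac:(lra)).
      assert (G1 := Hanti t Ht); assert (G2 := proj1 (Hrefl t Ht)).
      rewrite <- G2 in G1.
      assert (G3 : fsum om (a + RtoC (1 - t) * d) = RtoC 0).
      { apply Cmult_cancel_r with (RtoC 2); [apply RtoC_2_neq0|].
        set (w := fsum om (a + RtoC (1 - t) * d)) in *.
        replace (RtoC 2) with (RtoC 1 + RtoC 1)%C by (rewrite <- RtoC_plus; f_equal; ring).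
        transitivity (w + w)%C; [ring|rewrite G1 at 2; ring]. }
      rewrite G3, Cmod_0 in G; lra.
  - intros Hz2.
    destruct (Hblow (Cmod (fsum om (a + d)))) as (t & Ht & Hbt).
    assert (G := Hbt t ltac:(lra)).
    rewrite (proj2 (Hrefl t Ht) Hz2) in G; lra.
Qed.

(** * Domination of the minors *)

Lemma rwin_ext lo L g h : (forall k, (lo <= k < lo + Z.of_nat L)%Z -> g k = h k) ->
  rwin lo L g = rwin lo L h.
Proof. intros H; apply rsum_ext; intros t Ht; apply H; lia. Qed.

Lemma rwin_zero lo L g : (forall k, (lo <= k < lo + Z.of_nat L)%Z -> g k = 0) -> rwin lo L g = 0.
Proof.
  intros H; rewrite (rwin_ext lo L g (fun _ => 0 * 0)) by (intros; rewrite H by auto; ring).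
  rewrite rwin_scal; ring.
Qed.

Lemma rzs_point M (g : Z -> R) k : (Z.abs k <= Z.of_nat M)%Z ->
  rzs M (fun l => if Z.eqb l k then g l else 0) = g k.
Proof.
  intros Hk; unfold rzs.
  replace (2 * M + 1)%nat with (Z.to_nat (k + Z.of_nat M) + 1 + Z.to_nat (Z.of_nat M - k))%nat by lia.
  rewrite rwin_split, (rwin_zero _ (Z.to_nat (k + Z.of_nat M))),
    (rwin_zero _ (Z.to_nat (Z.of_nat M - k))), Rplus_0_l, Rplus_0_r.
  - unfold rwin; simpl rsum; rewrite Rplus_0_l.
    match goal with |- (if Z.eqb ?x k then _ else _) = _ => replace x with k by lia end.
    now rewrite Z.eqb_refl.
  - intros l Hl; destruct (Z.eqb_spec l k); [lia|auto].
  - intros l Hl; destruct (Z.eqb_spec l k); [lia|auto].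
Qed.

Lemma rzs_swap M M' (F : Z -> Z -> R) :
  rzs M (fun k => rzs M' (fun l => F k l)) = rzs M' (fun l => rzs M (fun k => F k l)).
Proof. apply rsum_swap. Qed.

Lemma rzs_rsum_swap M n (F : Z -> nat -> R) :
  rzs M (fun k => rsum n (F k)) = rsum n (fun b => rzs M (fun k => F k b)).
Proof. apply rsum_swap. Qed.

(** Distinct indices use each entry of a row at most once, which bounds a row of a minor by the full
    row sum. *)
Lemma rsum_injective_le n (i : nat -> Z) (G : Z -> R) M :
  (forall a b, (a < n)%nat -> (b < n)%nat -> a <> b -> i b <> i a) ->
  (forall k, 0 <= G k) -> (forall b, (b < n)%nat -> (Z.abs (i b) <= Z.of_nat M)%Z) ->
  rsum n (fun b => G (i b)) <= rzs M G.
Proof.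
  intros Hi HG HM.
  rewrite (rsum_ext n _ (fun b => rzs M (fun m => if Z.eqb m (i b) then G m else 0)))
    by (intros; symmetry; apply rzs_point; auto).
  rewrite <- (rzs_rsum_swap M n (fun m b => if Z.eqb m (i b) then G m else 0)).
  apply rwin_le; intros m; clear HM; induction n; simpl; [apply HG|].
  destruct (Z.eqb_spec m (i n)) as [->|Hm].
  - rewrite (rsum_ext n _ (fun _ => 0)), rsum_const; [lra|].
    intros b Hb; destruct (Z.eqb_spec (i n) (i b)) as [E|]; auto.
    exfalso; apply (Hi b n); auto; lia.
  - rewrite Rplus_0_r; apply IHn; intros; apply Hi; lia.
Qed.

Lemma rzs_reflect M k (F : Z -> R) :
  rzs M (fun m => F (k - m)%Z) = rwin (k - Z.of_nat M) (2 * M + 1) F.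
Proof.
  unfold rzs, rwin; rewrite rsum_rev; apply rsum_ext; intros t Ht; f_equal; lia.
Qed.

Lemma rzs_translate M m (F : Z -> R) :
  rzs M (fun k => F (k - m)%Z) = rwin (- Z.of_nat M - m) (2 * M + 1) F.
Proof. apply rsum_ext; intros t Ht; f_equal; lia. Qed.

(** * Double sums of the entry bounds *)

Definition between (k l : Z) : R := if Z.ltb (Z.abs k) (Z.abs l) then 1 else 0.

Lemma rzs_between M l : rzs M (fun k => between k l) <= 2 * Rabs (IZR l) + 1.
Proof.
  set (n := Z.to_nat (Z.abs l)).
  apply Rle_trans with (rzs (M + n) (fun k => between k l)).
  { apply rwin_mono; try lia; intros k; unfold between; destruct (Z.ltb _ _); lra. }
  unfold rzs; replace (2 * (M + n) + 1)%nat with (M + (2 * n + 1) + M)%nat by lia.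
  rewrite rwin_split, (rwin_zero (- Z.of_nat (M + n)) M),
    (rwin_zero (- Z.of_nat (M + n) + Z.of_nat (M + (2 * n + 1))) M).
  - rewrite Rplus_0_l, Rplus_0_r.
    eapply Rle_trans; [apply (rwin_le _ _ _ (fun _ => 1))|].
    + intros k; unfold between; destruct (Z.ltb _ _); lra.
    + unfold rwin; rewrite rsum_const, plus_INR, mult_INR, INR_IZR_INZ; unfold n.
      rewrite (INR_IZR_INZ (Z.to_nat _)), Z2Nat.id, abs_IZR by lia; simpl; lra.
  - intros k Hk; unfold between; destruct (Z.ltb_spec (Z.abs k) (Z.abs l)); [lia|auto].
  - intros k Hk; unfold between; destruct (Z.ltb_spec (Z.abs k) (Z.abs l)); [lia|auto].
Qed.

Definition opposite_signs (k m : Z) : R := if Z.ltb (k * m) 0 then 1 else 0.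

(* A pair of indices of opposite signs has |k| < |k - m|, and there are at most 2 |l| + 1
   such k for each l = k - m. *)
Lemma kernel_sum_bound (e h PL : Z -> R) (g : Z -> Z -> R) : l1 e -> l1 h ->
  (forall l, 0 <= PL l) -> (forall l, (2 * Rabs (IZR l) + 1) * PL l <= h l) ->
  (forall k m, g k m <= PL (k - m)%Z * (e k + e m + opposite_signs k m)) ->
  exists X, forall M M', rzs M (fun k => rzs M' (g k)) <= X.
Proof.
  intros He Hh HPL HPLh Hg.
  destruct (l1_window e He) as (X & HX0 & HX); destruct (l1_window h Hh) as (H & HH0 & HH).
  assert (HPL1 : forall l, PL l <= h l).
  { intros l; specialize (HPLh l); specialize (HPL l); generalize (Rabs_pos (IZR l)); nra. }
  assert (HPLw : forall lo L, rwin lo L PL <= H).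
  { intros lo L; eapply Rle_trans; [apply rwin_le, HPL1|apply HH]. }
  (* H X comes once from the decay in k and once from the decay in m; the last H comes from the
     pairs of opposite signs, summed along l = k - m. *)
  exists (H * X + H * X + H); intros M M'.
  apply Rle_trans with (rzs M (fun k => rzs M' (fun m => PL (k - m)%Z * e k)
     + rzs M' (fun m => PL (k - m)%Z * e m) + rzs (M + M') (fun l => between k l * PL l))).
  { apply rsum_le; intros t Ht; set (k := (Z.of_nat t + - Z.of_nat M)%Z).
    apply Rle_trans with (rzs M' (fun m => PL (k - m)%Z * e k)
      + rzs M' (fun m => PL (k - m)%Z * e m) + rzs M' (fun m => between k (k - m) * PL (k - m)%Z)).
    - unfold rzs; rewrite <- !rwin_plus; apply rwin_le; intros m.
      eapply Rle_trans; [apply Hg|].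
      assert (opposite_signs k m <= between k (k - m)).
      { unfold opposite_signs, between.
        destruct (Z.ltb_spec (k * m) 0), (Z.ltb_spec (Z.abs k) (Z.abs (k - m))); try lra.
        exfalso; nia. }
      specialize (HPL (k - m)%Z); nra.
    - apply Rplus_le_compat_l.
      rewrite (rzs_reflect M' k (fun l => between k l * PL l)).
      apply rwin_mono; try (unfold k; lia).
      intros l; apply Rmult_le_pos; auto; unfold between; destruct (Z.ltb _ _); lra. }
  unfold rzs at 1; rewrite !rwin_plus; apply Rplus_le_compat; [apply Rplus_le_compat|].
  - apply Rle_trans with (rwin (- Z.of_nat M) (2 * M + 1) (fun k => H * e k)).
    + apply rwin_le; intros k; unfold rzs.
      rewrite (rwin_ext _ _ _ (fun m => e k * PL (k - m)%Z)), rwin_scal by (intros; ring).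
      rewrite Rmult_comm; apply Rmult_le_compat_r; [apply He|].
      change (rzs M' (fun m => PL (k - m)%Z) <= H); rewrite rzs_reflect; auto.
    + rewrite rwin_scal; now apply Rmult_le_compat_l.
  - change (rzs M (fun k => rzs M' (fun m => PL (k - m)%Z * e m)) <= H * X).
    rewrite rzs_swap; apply Rle_trans with (rzs M' (fun m => H * e m)).
    + apply rwin_le; intros m; unfold rzs.
      rewrite (rwin_ext _ _ _ (fun k => e m * PL (k - m)%Z)), rwin_scal by (intros; ring).
      rewrite Rmult_comm; apply Rmult_le_compat_r; [apply He|].
      change (rzs M (fun k => PL (k - m)%Z) <= H); rewrite rzs_translate; auto.
    + unfold rzs; rewrite rwin_scal; now apply Rmult_le_compat_l.
  - change (rzs M (fun k => rzs (M + M') (fun l => between k l * PL l)) <= H).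
    rewrite rzs_swap; eapply Rle_trans; [|apply HH].
    apply rwin_le; intros l; eapply Rle_trans; [|apply HPLh].
    unfold rzs; rewrite (rwin_ext _ _ _ (fun k => PL l * between k l)), rwin_scal by (intros; ring).
    rewrite Rmult_comm; apply Rmult_le_compat_r; auto; apply rzs_between.
Qed.

Definition row_sum (g : Z -> Z -> R) (k : Z) : R := real (Lim_seq (fun M => rzs M (g k))).

Lemma row_sum_l1 (g : Z -> Z -> R) X : (forall k m, 0 <= g k m) ->
  (forall M M', rzs M (fun k => rzs M' (g k)) <= X) ->
  l1 (row_sum g) /\ forall k M, rzs M (g k) <= row_sum g k.
Proof.
  intros Hg HX.
  assert (Hm : forall k M, rzs M (g k) <= rzs (S M) (g k)) by
    (intros k M; apply rwin_mono; auto; lia).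
  assert (Hb : forall k M, rzs M (g k) <= X).
  { intros k M; eapply Rle_trans; [|apply (HX (Z.to_nat (Z.abs k)) M)].
    rewrite <- (rzs_point (Z.to_nat (Z.abs k)) (fun l => rzs M (g l)) k) by lia.
    apply rwin_le; intros l; destruct (Z.eqb l k); [lra|apply rwin_ge0; auto]. }
  assert (Hlim : forall k, is_lim_seq (fun M => rzs M (g k)) (row_sum g k)).
  { intros k; destruct (ex_finite_lim_seq_incr _ X (Hm k) (Hb k)) as [l Hl].
    unfold row_sum; rewrite (is_lim_seq_unique _ _ Hl); exact Hl. }
  assert (Hle : forall k M, rzs M (g k) <= row_sum g k).
  { intros k M; apply (is_lim_seq_incr_compare (fun M => rzs M (g k))); auto. }
  split; auto; split.
  - intros k; eapply Rle_trans; [|apply (Hle k O)]; apply rwin_ge0; auto.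
  - exists X; intros M.
    assert (Hs : is_lim_seq (fun M' => rzs M (fun k => rzs M' (g k))) (rzs M (row_sum g))).
    { unfold rzs, rwin at 1 3; generalize (2 * M + 1)%nat; induction n; simpl.
      - apply is_lim_seq_const.
      - apply is_lim_seq_plus'; auto; apply Hlim. }
    apply (is_lim_seq_le _ (fun _ => X) (Finite (rzs M (row_sum g))) (Finite X) (fun M' => HX M M') Hs).
    apply is_lim_seq_const.
Qed.

(** Distributing the square root of each weight over a row and a column turns the weighted minor
    into a minor of the symmetrized matrix, to which the row sum bound applies; tuples with a
    repetition give 0. Since only moduli enter, smaller coefficients [c'] share the majorant. *)
Lemma minors_dominated_row_sum om c c' : 0 < om ->
  let g := fun k m => sqrt (w0 om k) * sqrt (w0 om m) * Cmod (c (k - m)%Z) in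
  (exists X, forall M M', rzs M (fun k => rzs M' (g k)) <= X) ->
  (forall l, Cmod (c' l) <= Cmod (c l)) ->
  minors_dominated om c' (row_sum g).
Proof.
  intros Ho g [X HX] Hc.
  assert (Hg : forall k m, 0 <= g k m).
  { intros k m; unfold g; repeat apply Rmult_le_pos; try apply sqrt_pos; apply Cmod_ge_0. }
  destruct (row_sum_l1 g X Hg HX) as [Hl Hle].
  split; auto; intros n i.
  assert (HR : 0 <= rprod n (fun a => row_sum g (i a))) by (apply rprod_ge0; intros; apply Hl).
  destruct (injective_dec n i) as [Hi|(a & b & Ha & Hb & Hab & E)].
  2: { rewrite (detc_equal c' n i a b), Cmod_0, Rmult_0_l by auto; auto. }
  set (u := fun a => RtoC (sqrt (w0 om (i a)))).
  assert (Esc := cdet_scale n u u (fun a b => c' (i a - i b)%Z)).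
  assert (Eu : Cmod (cprod n u) * Cmod (cprod n u) = rprod n (fun a => w0 om (i a))).
  { rewrite !Cmod_cprod, <- rprod_mult; apply rprod_ext; intros a _; unfold u.
    rewrite Cmod_R, Rabs_pos_eq by apply sqrt_pos; apply sqrt_sqrt, Rlt_le, w0_pos. }
  rewrite <- Eu, Rmult_comm; unfold detc; rewrite <- !Cmod_mult, <- Esc.
  eapply Rle_trans; [apply Cmod_cdet|]; apply rprod_le; intros a Ha; split.
  { apply rsum_ge0; intros; apply Cmod_ge_0. }
  assert (HM : exists M, forall b, (b < n)%nat -> (Z.abs (i b) <= Z.of_nat M)%Z).
  { clear; induction n as [|n [M HM]]; [exists O; intros; lia|].
    exists (M + Z.to_nat (Z.abs (i n)))%nat; intros b Hb.
    destruct (Nat.eq_dec b n) as [->|]; [lia|]; specialize (HM b ltac:(lia)); lia. }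
  destruct HM as [M HM].
  eapply Rle_trans; [|apply (Hle (i a) M)].
  eapply Rle_trans; [|apply (rsum_injective_le n i (g (i a)) M); auto].
  apply rsum_le; intros b Hb; unfold u, g; rewrite !Cmod_mult, !Cmod_R.
  rewrite !Rabs_pos_eq by apply sqrt_pos.
  rewrite (Rmult_assoc (sqrt _) (Cmod _)), (Rmult_comm (Cmod _)), <- Rmult_assoc.
  apply Rmult_le_compat_l; auto; apply Rmult_le_pos; apply sqrt_pos.
Qed.

(** * Entry estimates from differences of tanh *)

Lemma sinh_minus a b : sinh (a - b) = sinh a * cosh b - cosh a * sinh b.
Proof.
  unfold sinh, cosh; replace (a - b) with (a + - b) by ring.
  replace (- (a + - b)) with (- a + b) by ring; rewrite !exp_plus, !exp_Ropp; field.
  split; apply Rgt_not_eq, exp_pos.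
Qed.

Lemma tanh_near_1 x : 0 <= x -> 0 <= 1 - sinh x / cosh x <= 2 * exp (- x) ^ 2.
Proof.
  intros Hx; assert (Hc := cosh_gt0 x); assert (He := exp_pos (- x)).
  assert (E : 1 - sinh x / cosh x = exp (- x) / cosh x).
  { replace (exp (- x)) with (cosh x - sinh x) by (unfold cosh, sinh; field); field; lra. }
  rewrite E; split; [apply Rlt_le, Rdiv_lt_0_compat; auto|].
  apply Rle_div_l; auto.
  assert (H := cosh_ge_exp x); rewrite Rabs_pos_eq in H by auto.
  assert (E2 : exp x * exp (- x) = 1) by (rewrite <- exp_plus, <- exp_0; f_equal; ring).
  assert (1 <= 2 * exp (- x) * cosh x) by nra. nra.
Qed.

(** For indices of the same sign both values lie within 2 exp (- 2 PI om |j|) of the same limit 1 or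
    -1; otherwise the difference is at most 2. The right-hand side is a square because the entry
    estimate takes a square root. *)
Lemma tanh_diff_bound om k m : 0 < om ->
  Rabs (sinh (PI * om * IZR k) / cosh (PI * om * IZR k)
        - sinh (PI * om * IZR m) / cosh (PI * om * IZR m))
  <= 2 * (edecay om k + edecay om m + opposite_signs k m) ^ 2.
Proof.
  intros Ho; assert (HPo : 0 < PI * om) by (apply Rmult_lt_0_compat; auto; apply PI_RGT_0).
  set (t := fun j : Z => sinh (PI * om * IZR j) / cosh (PI * om * IZR j)).
  change (Rabs (t k - t m) <= 2 * (edecay om k + edecay om m + opposite_signs k m) ^ 2).
  assert (Hpos : forall j, 0 < edecay om j) by (intros; apply exp_pos).
  assert (Hp : forall j, (0 <= j)%Z -> 0 <= 1 - t j <= 2 * edecay om j ^ 2).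
  { intros j Hj; apply IZR_le in Hj; unfold t, edecay; rewrite Rabs_pos_eq by auto.
    apply tanh_near_1; nra. }
  assert (Ht : forall j, t (- j)%Z = - t j).
  { intros j; unfold t; rewrite opp_IZR.
    replace (PI * om * - IZR j) with (- (PI * om * IZR j)) by ring.
    assert (E : forall x, cosh (- x) = cosh x)
      by (intros; unfold cosh; rewrite Ropp_involutive; field).
    assert (E' : forall x, sinh (- x) = - sinh x)
      by (intros; unfold sinh; rewrite Ropp_involutive; field).
    rewrite E, E'; field; apply Rgt_not_eq, cosh_gt0. }
  assert (He : forall j, edecay om (- j) = edecay om j)
    by (intros; unfold edecay; now rewrite opp_IZR, Rabs_Ropp).
  assert (Hn : forall j, (j <= 0)%Z -> 0 <= 1 + t j <= 2 * edecay om j ^ 2).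
  { intros j Hj; assert (H := Hp (- j)%Z ltac:(lia)); rewrite Ht, He in H; lra. }
  generalize (Hpos k) (Hpos m); intros Pk Pm.
  assert (Hb : forall j, -1 <= t j <= 1).
  { intros j; destruct (Z_le_gt_dec 0 j) as [Hj|Hj].
    - generalize (Hp j Hj); intros; split; [|lra].
      assert (0 <= t j); [|lra]. unfold t; apply Rdiv_le_0_compat; [|apply cosh_gt0].
      apply IZR_le in Hj; rewrite <- sinh_0.
      destruct (Req_dec (PI * om * IZR j) 0) as [->|]; [lra|].
      apply Rlt_le, sinh_lt; nra.
    - generalize (Hn j ltac:(lia)); intros; split; [lra|].
      assert (0 <= t (- j)%Z); [|rewrite Ht in *; lra].
      unfold t; apply Rdiv_le_0_compat; [|apply cosh_gt0].
      assert (0 < IZR (- j)) by (apply IZR_lt; lia).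
      rewrite <- sinh_0; apply Rlt_le, sinh_lt; nra. }
  unfold opposite_signs; destruct (Z.ltb_spec (k * m) 0) as [Hkm|Hkm].
  - generalize (Hb k) (Hb m); intros; apply Rabs_le; nra.
  - assert (Hs : (0 <= k /\ 0 <= m)%Z \/ (k <= 0 /\ m <= 0)%Z) by nia.
    rewrite Rplus_0_r; apply Rle_trans with (2 * edecay om k ^ 2 + 2 * edecay om m ^ 2); [|nra].
    destruct Hs as [[Hk Hm]|[Hk Hm]].
    + generalize (Hp k Hk) (Hp m Hm); intros; apply Rabs_le; lra.
    + generalize (Hn k Hk) (Hn m Hm); intros; apply Rabs_le; lra.
Qed.

Definition weight (l : Z) : R := Rpower (1 + IZR l ^ 2) (/ 4).

Lemma weight_pow4 l : weight l ^ 4 = 1 + IZR l ^ 2.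
Proof.
  unfold weight, Rpower; rewrite exp_pow.
  replace (INR 4 * (/ 4 * ln (1 + IZR l ^ 2))) with (ln (1 + IZR l ^ 2)) by (simpl; field).
  apply exp_ln; nra.
Qed.

Lemma weight_ge l : 1 <= weight l /\ sqrt (Rabs (IZR l)) <= weight l.
Proof.
  assert (H4 := weight_pow4 l); assert (Hp : 0 < weight l) by apply exp_pos.
  assert (Hlt : forall x, weight l < x -> weight l ^ 4 < x ^ 4).
  { intros x Hx; assert (weight l ^ 2 < x ^ 2) by nra.
    replace (x ^ 4) with ((x ^ 2) ^ 2) by ring.
    replace (weight l ^ 4) with ((weight l ^ 2) ^ 2) by ring; nra. }
  split; apply Rnot_lt_le; intros H; apply Hlt in H; rewrite H4 in H.
  - nra.
  - replace (sqrt (Rabs (IZR l)) ^ 4) with (IZR l ^ 2) in H; [lra|].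
    replace (sqrt (Rabs (IZR l)) ^ 4)
      with ((sqrt (Rabs (IZR l)) * sqrt (Rabs (IZR l))) ^ 2) by ring.
    rewrite sqrt_sqrt by apply Rabs_pos; symmetry; apply pow2_abs.
Qed.

Lemma coefficients_dominated om c phat : 0 < om -> (forall l, 0 <= phat l) ->
  (forall l, l <> 0%Z ->
     Cmod (c l) ^ 2 = phat l ^ 2 * (sinh (PI * om * IZR l) / (PI * om * IZR l))) ->
  l1 (fun l => phat l * weight l) ->
  exists rho, forall c', (forall l, Cmod (c' l) <= Cmod (c l)) -> minors_dominated om c' rho.
Proof.
  intros Ho Hph Hc Hl; assert (HP := PI_RGT_0).
  set (S0 := sqrt (2 * PI / om)).
  assert (HS0 : 0 <= S0) by apply sqrt_pos.
  (* For l <> 0 the factor is the square root of the constant 2 PI / (om |l|) left after the tanh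
     bound; the hypothesis on the moduli says nothing at l = 0, where [w0_le_edecay] gives the bound
     directly. *)
  set (PL := fun l => if Z.eqb l 0 then 2 * PI * Cmod (c 0%Z)
     else phat l * sqrt (2 * PI / (om * Rabs (IZR l)))).
  (* The 3 comes from 2 |l| + 1 <= 3 |l| for l <> 0, and [edecay 1] is a summable function with
     value 1 at 0. *)
  set (h := fun l => 3 * S0 * (phat l * weight l) + 2 * PI * Cmod (c 0%Z) * edecay 1 l).
  assert (Hc0 := Cmod_ge_0 (c 0%Z)).
  assert (HPL : forall l, 0 <= PL l).
  { intros l; unfold PL; destruct (Z.eqb l 0).
    - apply Rmult_le_pos; lra.
    - apply Rmult_le_pos; [auto|apply sqrt_pos]. }
  assert (HPLh : forall l, (2 * Rabs (IZR l) + 1) * PL l <= h l).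
  { intros l; unfold PL, h; destruct (weight_ge l) as [W1 W2].
    assert (Hpw : 0 <= phat l * weight l) by (apply Rmult_le_pos; [auto|lra]).
    assert (He : 0 <= edecay 1 l) by (apply Rlt_le, exp_pos).
    destruct (Z.eqb_spec l 0) as [->|Hl0].
    - unfold edecay; rewrite Rabs_R0, !Rmult_0_r, Ropp_0, exp_0.
      assert (0 <= 3 * S0 * (phat 0%Z * weight 0)) by (apply Rmult_le_pos; lra); lra.
    - assert (H1 : 1 <= Rabs (IZR l)) by (rewrite <- abs_IZR; apply IZR_le; lia).
      set (a := Rabs (IZR l)) in *.
      assert (E : a * sqrt (2 * PI / (om * a)) = S0 * sqrt a).
      { unfold S0; rewrite <- sqrt_mult_alt by (apply Rlt_le, Rdiv_lt_0_compat; lra).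
        rewrite <- (sqrt_Rsqr a) at 1 by lra.
        rewrite <- sqrt_mult_alt by apply Rle_0_sqr; f_equal; unfold Rsqr; field; lra. }
      apply Rle_trans with (3 * a * (phat l * sqrt (2 * PI / (om * a)))).
      + apply Rmult_le_compat_r; [apply Rmult_le_pos; [auto|apply sqrt_pos]|lra].
      + replace (3 * a * (phat l * sqrt (2 * PI / (om * a))))
          with (3 * phat l * (a * sqrt (2 * PI / (om * a)))) by ring.
        rewrite E; replace (3 * phat l * (S0 * sqrt a)) with (3 * S0 * (phat l * sqrt a)) by ring.
        assert (3 * S0 * (phat l * sqrt a) <= 3 * S0 * (phat l * weight l)).
        { apply Rmult_le_compat_l; [lra|]; apply Rmult_le_compat_l; auto. }
        assert (0 <= 2 * PI * Cmod (c 0%Z) * edecay 1 l) 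
          by (apply Rmult_le_pos; [apply Rmult_le_pos; lra|lra]).
        lra. }
  assert (Hh : l1 h).
  { apply l1_plus; apply l1_scal; auto; [lra|apply Rmult_le_pos; lra|apply l1_edecay; lra]. }
  set (g := fun k m => sqrt (w0 om k) * sqrt (w0 om m) * Cmod (c (k - m)%Z)).
  assert (Hg : forall k m, g k m <= PL (k - m)%Z * (edecay om k + edecay om m + opposite_signs k m)).
  { intros k m; unfold g, PL.
    assert (He : forall j, 0 < edecay om j) by (intros; apply exp_pos).
    generalize (He k) (He m); intros Ek Em.
    assert (Hos : 0 <= opposite_signs k m)
      by (unfold opposite_signs; destruct (Z.ltb _ _); lra).
    destruct (Z.eqb_spec (k - m) 0) as [E|Hkm].
    - assert (m = k) by lia; subst m; rewrite Z.sub_diag, sqrt_sqrt by apply Rlt_le, w0_pos.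
      assert (Hw := w0_le_edecay om k Ho).
      replace (2 * PI * Cmod (c 0%Z) * (edecay om k + edecay om k + opposite_signs k k))
        with (2 * PI * (edecay om k + edecay om k + opposite_signs k k) * Cmod (c 0%Z)) by ring.
      apply Rmult_le_compat_r; auto; nra.
    - set (l := (k - m)%Z) in *.
      assert (H1 : 1 <= Rabs (IZR l)) by (rewrite <- abs_IZR; apply IZR_le; lia).
      set (a := Rabs (IZR l)) in *.
      set (q := edecay om k + edecay om m + opposite_signs k m).
      assert (Hq : 0 <= q) by (unfold q; lra).
      assert (Hr : 0 <= 2 * PI / (om * a))
        by (apply Rlt_le, Rdiv_lt_0_compat; [lra|apply Rmult_lt_0_compat; lra]).
      (* Squares are compared, since the hypothesis describes the squared moduli: the two weights
         turn sinh (PI om (k - m)) into the difference D of the tanh. *)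
      apply Rsqr_incr_0_var.
      2: { repeat apply Rmult_le_pos; auto; apply sqrt_pos. }
      rewrite !Rsqr_mult, !Rsqr_sqrt by (auto; apply Rlt_le, w0_pos).
      replace (Rsqr (Cmod (c l))) with (Cmod (c l) ^ 2) by (unfold Rsqr; ring).
      rewrite Hc by auto.
      assert (Hl0 : IZR l <> 0) by (intros E; apply Hkm; now apply eq_IZR).
      assert (Ht := tanh_diff_bound om k m Ho); fold q in Ht.
      assert (Es : sinh (PI * om * IZR l) = sinh (PI * om * IZR k) * cosh (PI * om * IZR m)
         - cosh (PI * om * IZR k) * sinh (PI * om * IZR m)).
      { rewrite <- sinh_minus; f_equal; unfold l; rewrite minus_IZR; ring. }
      assert (C1 := cosh_gt0 (PI * om * IZR k)); assert (C2 := cosh_gt0 (PI * om * IZR m)).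
      set (D := sinh (PI * om * IZR k) / cosh (PI * om * IZR k)
        - sinh (PI * om * IZR m) / cosh (PI * om * IZR m)) in *.
      replace (w0 om k * w0 om m * (phat l ^ 2 * (sinh (PI * om * IZR l) / (PI * om * IZR l))))
        with (phat l ^ 2 * (PI / om) * (D / IZR l))
        by (rewrite Es; unfold D, w0; field; repeat split; lra).
      replace (Rsqr (phat l) * (2 * PI / (om * a)) * Rsqr q)
        with (phat l ^ 2 * (PI / om) * (2 * q ^ 2 / a)) by (unfold Rsqr; field; lra).
      apply Rmult_le_compat_l.
      + apply Rmult_le_pos; [nra|apply Rlt_le, Rdiv_lt_0_compat; lra].
      + eapply Rle_trans; [apply Rle_abs|]; unfold Rdiv.
        rewrite Rabs_mult, Rabs_inv; apply Rmult_le_compat_r; auto.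
        apply Rlt_le, Rinv_0_lt_compat; unfold a in *; lra. }
  exists (row_sum g); intros c' Hc'.
  apply (minors_dominated_row_sum om c c' Ho); auto.
  apply (kernel_sum_bound (edecay om) h PL g); auto; now apply l1_edecay.
Qed.

(** * The sine product and the reflection formula *)

Definition ucos (a b t : R) : R := cos (a * t) * cosh (b * t).
Definition vcos (a b t : R) : R := sin (a * t) * sinh (b * t).
Definition csin (z : C) : C := (sin (Re z) * cosh (Im z), cos (Re z) * sinh (Im z)).

(* [ucos - i vcos] is cos ((a + i b) t). *)
Definition wallis_u (a b : R) (n : nat) : R := RInt (fun t => cos t ^ n * ucos a b t) 0 (PI / 2).
Definition wallis_v (a b : R) (n : nat) : R := RInt (fun t => cos t ^ n * vcos a b t) 0 (PI / 2).

Lemma continuous_ucos a b n t : continuous (fun t => cos t ^ n * ucos a b t) t.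
Proof.
  apply (ex_derive_continuous (fun t => cos t ^ n * ucos a b t)).
  unfold ucos, cosh; auto_derive; auto.
Qed.

Lemma continuous_vcos a b n t : continuous (fun t => cos t ^ n * vcos a b t) t.
Proof.
  apply (ex_derive_continuous (fun t => cos t ^ n * vcos a b t)).
  unfold vcos, sinh; auto_derive; auto.
Qed.

Lemma is_RInt_u a b n : is_RInt (fun t => cos t ^ n * ucos a b t) 0 (PI / 2) (wallis_u a b n).
Proof. apply (RInt_correct (V := R_CompleteNormedModule)), ex_RInt_continuous; intros; apply continuous_ucos. Qed.

Lemma is_RInt_v a b n : is_RInt (fun t => cos t ^ n * vcos a b t) 0 (PI / 2) (wallis_v a b n).
Proof. apply (RInt_correct (V := R_CompleteNormedModule)), ex_RInt_continuous; intros; apply continuous_vcos. Qed.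

Lemma is_RInt_lin (f g : R -> R) (c x y : R) (a b : R) :
  is_RInt f a b x -> is_RInt g a b y -> is_RInt (fun t => f t + c * g t) a b (x + c * y).
Proof.
  intros Hf Hg; apply (is_RInt_plus (V := R_NormedModule) f (fun t => c * g t)); auto.
  now apply (is_RInt_scal (V := R_NormedModule) g).
Qed.

Lemma RInt_uniq (f : R -> R) a b x y : is_RInt f a b x -> is_RInt f a b y -> x = y.
Proof.
  intros H1 H2; rewrite <- (is_RInt_unique f a b x H1); now apply is_RInt_unique.
Qed.

(** Real part of (n^2 - z^2) I_n = n (n - 1) I_(n-2), where z = a + i b and I_n is the integral of
    cos(t)^n cos(z t). [Phi] is the boundary term of two integrations by parts and vanishes at both
    ends; [wallis_rec_v] is the imaginary part. *)
Lemma wallis_rec_u a b m :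
  let n := INR (m + 2) in
  (n ^ 2 - (a ^ 2 - b ^ 2)) * wallis_u a b (m + 2) - 2 * a * b * wallis_v a b (m + 2)
  = n * (n - 1) * wallis_u a b m.
Proof.
  intros n.
  set (Phi := fun t => n * cos t ^ (m + 1) * sin t * (cos (a * t) * cosh (b * t))
     - (a * (sin (a * t) * cosh (b * t)) - b * (cos (a * t) * sinh (b * t))) * cos t ^ (m + 2)).
  set (dPhi := fun t => ((n ^ 2 - (a ^ 2 - b ^ 2)) * (cos t ^ (m + 2) * ucos a b t)
     + (- (2 * a * b)) * (cos t ^ (m + 2) * vcos a b t))
     + (- (n * (n - 1))) * (cos t ^ m * ucos a b t)).
  assert (HI : is_RInt dPhi 0 (PI / 2) (Phi (PI / 2) - Phi 0)).
  { apply (is_RInt_derive (V := R_CompleteNormedModule) Phi dPhi).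
    - intros t _; unfold Phi, dPhi, ucos, vcos.
      assert (Hs : sin t ^ 2 = 1 - cos t ^ 2).
      { generalize (sin2_cos2 t); unfold Rsqr; intros; simpl; lra. }
      assert (Hn : INR (m + 1) = n - 1) by (unfold n; rewrite !plus_INR; simpl; ring).
      unfold cosh, sinh; auto_derive; auto.
      replace (Init.Nat.pred (m + 1)) with m by lia.
      replace (Init.Nat.pred (m + 2)) with (m + 1)%nat by lia.
      rewrite Hn; fold n; rewrite !pow_add; apply Rminus_diag_uniq.
      (* The multiple of sin^2 + cos^2 - 1 by which the two sides differ is isolated; what remains
         is a rational identity. *)
      transitivity (- (n * (n - 1) * cos t ^ m * (cos (a * t) * ((exp (b * t) + exp (- (b * t))) / 2)))
        * (sin t ^ 2 - (1 - cos t ^ 2))); [field|rewrite Hs; ring].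
    - intros t _; apply (ex_derive_continuous dPhi).
      unfold dPhi, ucos, vcos, cosh, sinh; auto_derive; auto. }
  assert (HI2 : is_RInt dPhi 0 (PI / 2) (((n ^ 2 - (a ^ 2 - b ^ 2)) * wallis_u a b (m + 2)
     + (- (2 * a * b)) * wallis_v a b (m + 2)) + (- (n * (n - 1))) * wallis_u a b m)).
  { apply is_RInt_lin; [apply is_RInt_lin|]; [|apply is_RInt_v|apply is_RInt_u].
    apply (is_RInt_scal (V := R_NormedModule)), is_RInt_u. }
  assert (E := RInt_uniq _ _ _ _ _ HI HI2).
  assert (E0 : Phi (PI / 2) - Phi 0 = 0).
  { unfold Phi; rewrite cos_PI2, !Rmult_0_r, sin_0, sinh_0, !pow_ne_zero by lia; ring. }
  lra.
Qed.

Lemma wallis_rec_v a b m :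
  let n := INR (m + 2) in
  (n ^ 2 - (a ^ 2 - b ^ 2)) * wallis_v a b (m + 2) + 2 * a * b * wallis_u a b (m + 2)
  = n * (n - 1) * wallis_v a b m.
Proof.
  intros n.
  set (Phi := fun t => n * cos t ^ (m + 1) * sin t * (sin (a * t) * sinh (b * t))
     + (a * (cos (a * t) * sinh (b * t)) + b * (sin (a * t) * cosh (b * t))) * cos t ^ (m + 2)).
  set (dPhi := fun t => ((n ^ 2 - (a ^ 2 - b ^ 2)) * (cos t ^ (m + 2) * vcos a b t)
     + (2 * a * b) * (cos t ^ (m + 2) * ucos a b t))
     + (- (n * (n - 1))) * (cos t ^ m * vcos a b t)).
  assert (HI : is_RInt dPhi 0 (PI / 2) (Phi (PI / 2) - Phi 0)).
  { apply (is_RInt_derive (V := R_CompleteNormedModule) Phi dPhi).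
    - intros t _; unfold Phi, dPhi, ucos, vcos.
      assert (Hs : sin t ^ 2 = 1 - cos t ^ 2).
      { generalize (sin2_cos2 t); unfold Rsqr; intros; simpl; lra. }
      assert (Hn : INR (m + 1) = n - 1) by (unfold n; rewrite !plus_INR; simpl; ring).
      unfold cosh, sinh; auto_derive; auto.
      replace (Init.Nat.pred (m + 1)) with m by lia.
      replace (Init.Nat.pred (m + 2)) with (m + 1)%nat by lia.
      rewrite Hn; fold n; rewrite !pow_add; apply Rminus_diag_uniq.
      transitivity (- (n * (n - 1) * cos t ^ m * (sin (a * t) * ((exp (b * t) - exp (- (b * t))) / 2)))
        * (sin t ^ 2 - (1 - cos t ^ 2))); [field|rewrite Hs; ring].
    - intros t _; apply (ex_derive_continuous dPhi).
      unfold dPhi, ucos, vcos, cosh, sinh; auto_derive; auto. }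
  assert (HI2 : is_RInt dPhi 0 (PI / 2) (((n ^ 2 - (a ^ 2 - b ^ 2)) * wallis_v a b (m + 2)
     + (2 * a * b) * wallis_u a b (m + 2)) + (- (n * (n - 1))) * wallis_v a b m)).
  { apply is_RInt_lin; [apply is_RInt_lin|]; [|apply is_RInt_u|apply is_RInt_v].
    apply (is_RInt_scal (V := R_NormedModule)), is_RInt_v. }
  assert (E := RInt_uniq _ _ _ _ _ HI HI2).
  assert (E0 : Phi (PI / 2) - Phi 0 = 0).
  { unfold Phi; rewrite cos_PI2, !Rmult_0_r, sin_0, sinh_0, !pow_ne_zero by lia; ring. }
  lra.
Qed.

(** The integral of cos(t)^(2n) cos(2 z t) over [0, PI/2]; the doubled frequency turns the
    recurrence factor into n^2 - z^2, as in the sine product. *)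
Definition wallis (z : C) (n : nat) : C :=
  (wallis_u (2 * Re z) (2 * Im z) (2 * n), - wallis_v (2 * Re z) (2 * Im z) (2 * n)).

Lemma wallis_rec z n :
  (RtoC (INR (S n) ^ 2 - INR (S n) / 2) * wallis z n
   = (RtoC (INR (S n) ^ 2) - z * z) * wallis z (S n))%C.
Proof.
  destruct z as [x y].
  assert (Hu := wallis_rec_u (2 * x) (2 * y) (2 * n)).
  assert (Hv := wallis_rec_v (2 * x) (2 * y) (2 * n)).
  cbv zeta in Hu, Hv; replace (2 * n + 2)%nat with (2 * S n)%nat in Hu, Hv by lia.
  rewrite mult_INR in Hu, Hv; simpl (INR 2) in Hu, Hv.
  unfold wallis; simpl Re; simpl Im.
  set (u0 := wallis_u (2 * x) (2 * y) (2 * n)) in *; set (v0 := wallis_v (2 * x) (2 * y) (2 * n)) in *.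
  set (u1 := wallis_u (2 * x) (2 * y) (2 * S n)) in *; set (v1 := wallis_v (2 * x) (2 * y) (2 * S n)) in *.
  set (N := INR (S n)) in *.
  apply C_ext; unfold Cmult, Cminus, Cplus, Copp, RtoC, Re, Im; simpl fst; simpl snd; lra.
Qed.

Lemma wallis_0_times_2z z : (RtoC 2 * z * wallis z 0)%C = csin (RtoC PI * z).
Proof.
  destruct z as [x y]; set (a := 2 * x); set (b := 2 * y).
  assert (HP : is_RInt (fun t => a * (cos t ^ 0 * ucos a b t) + b * (cos t ^ 0 * vcos a b t)) 0 (PI / 2)
     (sin (a * (PI / 2)) * cosh (b * (PI / 2)) - sin (a * 0) * cosh (b * 0))).
  { apply (is_RInt_derive (V := R_CompleteNormedModule) (fun t => sin (a * t) * cosh (b * t))).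
    - intros t _; unfold ucos, vcos, cosh, sinh; auto_derive; auto; simpl; field.
    - intros t _; apply (ex_derive_continuous (fun t => a * (cos t ^ 0 * ucos a b t)
        + b * (cos t ^ 0 * vcos a b t))).
      unfold ucos, vcos, cosh, sinh; auto_derive; auto. }
  assert (HQ : is_RInt (fun t => b * (cos t ^ 0 * ucos a b t) + (- a) * (cos t ^ 0 * vcos a b t)) 0 (PI / 2)
     (cos (a * (PI / 2)) * sinh (b * (PI / 2)) - cos (a * 0) * sinh (b * 0))).
  { apply (is_RInt_derive (V := R_CompleteNormedModule) (fun t => cos (a * t) * sinh (b * t))).
    - intros t _; unfold ucos, vcos, cosh, sinh; auto_derive; auto; simpl; field.
    - intros t _; apply (ex_derive_continuous (fun t => b * (cos t ^ 0 * ucos a b t)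
        + (- a) * (cos t ^ 0 * vcos a b t))).
      unfold ucos, vcos, cosh, sinh; auto_derive; auto. }
  assert (HS : forall c, is_RInt (fun t => c * (cos t ^ 0 * ucos a b t)) 0 (PI / 2) (c * wallis_u a b 0))
    by (intros; apply (is_RInt_scal (V := R_NormedModule)), is_RInt_u).
  assert (E1 := RInt_uniq _ _ _ _ _ HP (is_RInt_lin _ _ b _ _ _ _ (HS a) (is_RInt_v a b 0))).
  assert (E2 := RInt_uniq _ _ _ _ _ HQ (is_RInt_lin _ _ (- a) _ _ _ _ (HS b) (is_RInt_v a b 0))).
  rewrite !Rmult_0_r, sin_0, sinh_0 in *.
  replace (a * (PI / 2)) with (PI * x) in * by (unfold a; field).
  replace (b * (PI / 2)) with (PI * y) in * by (unfold b; field).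
  unfold csin, wallis; simpl Re; simpl Im; fold a b.
  replace (PI * x - 0 * y) with (PI * x) by ring; replace (PI * y + 0 * x) with (PI * y) by ring.
  apply C_ext; simpl; unfold a, b in *; lra.
Qed.

Lemma wallis_real n : wallis 0 n = RtoC (wallis_u 0 0 (2 * n)).
Proof.
  unfold wallis, RtoC; simpl Re; simpl Im; rewrite !Rmult_0_r; f_equal.
  assert (H : is_RInt (fun t => 0) 0 (PI / 2) (wallis_v 0 0 (2 * n))).
  { apply (is_RInt_ext (V := R_NormedModule) (fun t => cos t ^ (2 * n) * vcos 0 0 t)); [|apply is_RInt_v].
    intros t _; unfold vcos; rewrite Rmult_0_l, sin_0.
    match goal with |- ?x = ?y => change (@eq R x y) end; ring. }
  assert (H0 : is_RInt (fun t => 0) 0 (PI / 2) (scal (PI / 2 - 0) 0)) by apply (is_RInt_const (V := R_NormedModule)).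
  rewrite (RInt_uniq _ _ _ _ _ H H0); unfold scal; simpl; unfold mult; simpl; ring.
Qed.

Lemma wallis_u00_pos n : 0 < wallis_u 0 0 (2 * n).
Proof.
  induction n.
  - simpl.
    assert (H0 : is_RInt (fun t => 1) 0 (PI / 2) (scal (PI / 2 - 0) 1)) by apply (is_RInt_const (V := R_NormedModule)).
    assert (H : is_RInt (fun t => 1) 0 (PI / 2) (wallis_u 0 0 0)).
    { apply (is_RInt_ext (V := R_NormedModule) (fun t => cos t ^ 0 * ucos 0 0 t)); [|apply is_RInt_u].
      intros t _; unfold ucos; rewrite !Rmult_0_l, cos_0, cosh_0; simpl.
      match goal with |- ?x = ?y => change (@eq R x y) end; ring. }
    rewrite (RInt_uniq _ _ _ _ _ H H0); unfold scal; simpl; unfold mult; simpl.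
    generalize PI_RGT_0; lra.
  - assert (E := wallis_rec_u 0 0 (2 * n)); cbv zeta in E.
    replace (2 * n + 2)%nat with (2 * S n)%nat in E by lia.
    assert (Hn : 2 <= INR (2 * S n)) by (rewrite mult_INR, (S_INR n); simpl (INR 2); generalize (pos_INR n); lra).
    set (N := INR (2 * S n)) in *.
    assert (0 < N * (N - 1) * wallis_u 0 0 (2 * n))
      by (apply Rmult_lt_0_compat; [apply Rmult_lt_0_compat; lra|auto]).
    rewrite <- E in H; apply (Rmult_lt_reg_l (N ^ 2)); [nra|lra].
Qed.

Lemma wallis_u000 : wallis_u 0 0 0 = PI / 2.
Proof.
  assert (H0 : is_RInt (fun t => 1) 0 (PI / 2) (scal (PI / 2 - 0) 1))
    by apply (is_RInt_const (V := R_NormedModule)).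
  assert (H : is_RInt (fun t => 1) 0 (PI / 2) (wallis_u 0 0 0)).
  { apply (is_RInt_ext (V := R_NormedModule) (fun t => cos t ^ 0 * ucos 0 0 t)); [|apply is_RInt_u].
    intros t _; unfold ucos; rewrite !Rmult_0_l, cos_0, cosh_0; simpl.
    match goal with |- ?x = ?y => change (@eq R x y) end; ring. }
  rewrite (RInt_uniq _ _ _ _ _ H H0); unfold scal; simpl; unfold mult; simpl; ring.
Qed.

Lemma t_cos_le_sin t : 0 <= t <= PI / 2 -> 0 <= t * cos t <= sin t.
Proof.
  intros [[Ht|<-] H2]; [|rewrite sin_0; lra].
  assert (HP := PI_RGT_0).
  split; [apply Rmult_le_pos; [lra|apply cos_ge_0; lra]|].
  destruct (MVT_cor2 (fun u => sin u - u * cos u) (fun u => u * sin u) 0 t) as (c & E & Hc).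
  - lra.
  - intros u _; apply is_derive_Reals; auto_derive; auto; ring.
  - rewrite sin_0 in E.
    assert (0 <= c * sin c) by (apply Rmult_le_pos; [lra|apply sin_ge_0; lra]).
    assert (0 <= c * sin c * (t - 0)) by (apply Rmult_le_pos; lra). lra.
Qed.

Lemma sinh_abs_le u : Rabs (sinh u) <= Rabs u * exp (Rabs u).
Proof.
  assert (H : forall t, 0 < t -> 0 <= sinh t <= t * exp t).
  { intros t Ht; split; [rewrite <- sinh_0; apply Rlt_le, sinh_lt; auto|].
    destruct (MVT_cor2 sinh cosh 0 t Ht) as (c & E & Hc).
    - intros v _; apply is_derive_Reals; unfold cosh, sinh; auto_derive; auto; field.
    - rewrite sinh_0 in E; replace (sinh t) with (cosh c * (t - 0)) by lra.
      rewrite Rminus_0_r, Rmult_comm; apply Rmult_le_compat_l; [lra|].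
      eapply Rle_trans; [apply cosh_le_exp|]; apply exp_le; rewrite Rabs_pos_eq; lra. }
  destruct (Rtotal_order u 0) as [Hu|[->|Hu]].
  - replace (sinh u) with (- sinh (- u)) by (unfold sinh; rewrite Ropp_involutive; field).
    rewrite Rabs_Ropp, (Rabs_left u), Rabs_pos_eq by (auto; apply H; lra); apply H; lra.
  - rewrite sinh_0, !Rabs_R0; lra.
  - rewrite (Rabs_pos_eq u), Rabs_pos_eq by (try lra; apply H; auto); now apply H.
Qed.

(** cos (z t) - 1 = O(t^2); the quadratic order is what the concentration of the powers of cos at t
    = 0 converts into a rate 1/n. *)
Lemma ucos_vcos_bound a b : exists K, 0 <= K /\ forall t, 0 <= t <= PI / 2 ->
  Rabs (ucos a b t - 1) <= K * t ^ 2 /\ Rabs (vcos a b t) <= K * t ^ 2.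
Proof.
  assert (HP4 := PI_4); set (M := exp (Rabs b * 2)).
  assert (HM : 1 <= M).
  { unfold M; rewrite <- exp_0; apply exp_le; generalize (Rabs_pos b); lra. }
  assert (HKa : 0 <= a ^ 2 * M) by (apply Rmult_le_pos; nra).
  assert (HKb : 0 <= b ^ 2 * M ^ 2) by (apply Rmult_le_pos; nra).
  assert (HKc : 0 <= Rabs a * Rabs b * M)
    by (apply Rmult_le_pos; [apply Rmult_le_pos; apply Rabs_pos|lra]).
  exists (a ^ 2 * M + b ^ 2 * M ^ 2 + Rabs a * Rabs b * M); split; [lra|].
  intros t Ht; assert (Ht2 : 0 <= t ^ 2) by nra.
  assert (Hbt : exp (Rabs (b * t)) <= M).
  { apply exp_le; rewrite Rabs_mult, (Rabs_pos_eq t) by lra.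
    apply Rmult_le_compat_l; [apply Rabs_pos|lra]. }
  assert (Hch : cosh (b * t) <= M) by (eapply Rle_trans; [apply cosh_le_exp|auto]).
  assert (Hch1 : 1 <= cosh (b * t)).
  { assert (E := cosh_sqr (b * t)); assert (E1 := cosh_gt0 (b * t)); nra. }
  assert (Hsh : Rabs (sinh (b * t)) <= Rabs b * t * M).
  { eapply Rle_trans; [apply sinh_abs_le|].
    assert (E : Rabs (b * t) = Rabs b * t) by (rewrite Rabs_mult, (Rabs_pos_eq t); lra).
    rewrite E in *.
    apply Rmult_le_compat_l; auto; apply Rmult_le_pos; [apply Rabs_pos|lra]. }
  split.
  - unfold ucos; replace (cos (a * t) * cosh (b * t) - 1)
      with ((cos (a * t) - 1) * cosh (b * t) + (cosh (b * t) - 1)) by ring.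
    eapply Rle_trans; [apply Rabs_triang|].
    assert (A1 : Rabs ((cos (a * t) - 1) * cosh (b * t)) <= a ^ 2 * M * t ^ 2).
    { rewrite Rabs_mult, (Rabs_pos_eq (cosh _)) by lra.
      replace (a ^ 2 * M * t ^ 2) with (((a * t) ^ 2) * M) by ring.
      apply Rmult_le_compat; auto; [apply Rabs_pos|lra|].
      eapply Rle_trans; [apply cos_sub_1_le|]; nra. }
    assert (A2 : Rabs (cosh (b * t) - 1) <= b ^ 2 * M ^ 2 * t ^ 2).
    { rewrite Rabs_pos_eq by lra.
      apply Rle_trans with (Rabs (sinh (b * t)) ^ 2).
      - rewrite pow2_abs; assert (E := cosh_sqr (b * t)); nra.
      - replace (b ^ 2 * M ^ 2 * t ^ 2) with ((Rabs b * t * M) ^ 2)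
          by (rewrite <- (pow2_abs b); ring).
        apply pow_incr; split; [apply Rabs_pos|auto]. }
    assert (0 <= Rabs a * Rabs b * M * t ^ 2) by now apply Rmult_le_pos. nra.
  - unfold vcos; rewrite Rabs_mult.
    assert (A1 : Rabs (sin (a * t)) <= Rabs a * t).
    { eapply Rle_trans; [apply sin_abs_le|]; rewrite Rabs_mult, (Rabs_pos_eq t); lra. }
    apply Rle_trans with (Rabs a * t * (Rabs b * t * M)).
    + apply Rmult_le_compat; auto; apply Rabs_pos.
    + assert (0 <= a ^ 2 * M * t ^ 2) by now apply Rmult_le_pos.
      assert (0 <= b ^ 2 * M ^ 2 * t ^ 2) by now apply Rmult_le_pos. nra.
Qed.

(* [t^2 cos^(2n+2) t <= cos^(2n) t - cos^(2n+2) t], and the latter integrates to W_(2n+2)/(2n+1). *)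
Lemma wallis_close (f : R -> R) (K x : R) n : 0 <= K ->
  (forall t, 0 <= t <= PI / 2 -> Rabs (f t) <= K * t ^ 2) ->
  is_RInt (fun t => cos t ^ (2 * S n) * f t) 0 (PI / 2) x ->
  Rabs x <= K * (wallis_u 0 0 (2 * S n) / (2 * INR n + 1)).
Proof.
  intros HK Hf Hx; assert (HP := PI_RGT_0).
  set (W := wallis_u 0 0).
  assert (HI : is_RInt (fun t => cos t ^ (2 * n) * ucos 0 0 t
     + (-1) * (cos t ^ (2 * S n) * ucos 0 0 t)) 0 (PI / 2) (W (2 * n)%nat + (-1) * W (2 * S n)%nat)).
  { apply is_RInt_lin; apply is_RInt_u. }
  assert (EW : W (2 * n)%nat + (-1) * W (2 * S n)%nat = W (2 * S n)%nat / (2 * INR n + 1)).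
  { assert (E := wallis_rec_u 0 0 (2 * n)); cbv zeta in E.
    replace (2 * n + 2)%nat with (2 * S n)%nat in E by lia; fold W in E.
    rewrite mult_INR, (S_INR n) in E; replace (INR 2) with 2 in E by (simpl; ring).
    assert (Hn := pos_INR n).
    apply (Rmult_eq_reg_l (2 * (INR n + 1) * (2 * INR n + 1))); [|nra].
    transitivity (2 * (INR n + 1) * (2 * (INR n + 1) - 1) * W (2 * n)%nat
      - 2 * (INR n + 1) * (2 * INR n + 1) * W (2 * S n)%nat); [ring|].
    rewrite <- E; field; lra. }
  rewrite EW in HI.
  assert (HIK := is_RInt_scal (V := R_NormedModule) _ _ _ K _ HI).
  assert (HIN := is_RInt_scal (V := R_NormedModule) _ _ _ (- K) _ HI).
  assert (Hpt : forall t, 0 < t < PI / 2 -> Rabs (cos t ^ (2 * S n) * f t)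
    <= K * (cos t ^ (2 * n) * ucos 0 0 t + (-1) * (cos t ^ (2 * S n) * ucos 0 0 t))).
  { intros t Ht; unfold ucos; rewrite !Rmult_0_l, cos_0, cosh_0.
    destruct (t_cos_le_sin t) as [T1 T2]; [lra|].
    assert (Hc : 0 <= cos t ^ (2 * n)) by (apply pow_le, cos_ge_0; lra).
    replace (cos t ^ (2 * S n)) with (cos t ^ (2 * n) * cos t ^ 2)
      by (rewrite <- pow_add; f_equal; lia).
    rewrite Rabs_mult, (Rabs_pos_eq (_ * _)) by (apply Rmult_le_pos; [auto|nra]).
    replace (K * (cos t ^ (2 * n) * (1 * 1) + -1 * (cos t ^ (2 * n) * cos t ^ 2 * (1 * 1))))
      with (cos t ^ (2 * n) * (K * (1 - cos t ^ 2))) by ring.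
    rewrite Rmult_assoc; apply Rmult_le_compat_l; auto.
    assert (H1 := Hf t ltac:(lra)).
    assert (H2 : (t * cos t) ^ 2 <= 1 - cos t ^ 2).
    { apply Rle_trans with (sin t ^ 2); [apply pow_incr; lra|].
      generalize (sin2_cos2 t); unfold Rsqr; intros; right; simpl; lra. }
    apply Rle_trans with (cos t ^ 2 * (K * t ^ 2)); [apply Rmult_le_compat_l; [nra|auto]|].
    replace (cos t ^ 2 * (K * t ^ 2)) with (K * (t * cos t) ^ 2) by ring.
    now apply Rmult_le_compat_l. }
  apply Rabs_le; split.
  - replace (- (K * (W (2 * S n)%nat / (2 * INR n + 1))))
      with (- K * (W (2 * S n)%nat / (2 * INR n + 1))) by ring.
    apply (is_RInt_le _ _ 0 (PI / 2) _ _ ltac:(lra) HIN Hx).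
    intros t Ht; specialize (Hpt t Ht); apply Rabs_le_between in Hpt.
    unfold scal; simpl; unfold mult; simpl in *; lra.
  - apply (is_RInt_le _ _ 0 (PI / 2) _ _ ltac:(lra) Hx HIK).
    intros t Ht; specialize (Hpt t Ht); apply Rabs_le_between in Hpt.
    unfold scal; simpl; unfold mult; simpl in *; lra.
Qed.

Lemma ccv_inv u l : l <> RtoC 0 -> ccv u l -> ccv (fun n => / u n)%C (/ l)%C.
Proof.
  intros Hl H; assert (HL : 0 < Cmod l) by now apply Cmod_gt_0.
  assert (H' := H); rewrite ccv_eps in H'.
  destruct (H' (Cmod l / 2)) as [N HN]; [lra|].
  rewrite ccv_eps in *; intros eps He.
  destruct (H (eps * (Cmod l * Cmod l) / 2)) as [N' HN'].
  { assert (0 < eps * (Cmod l * Cmod l)) by (repeat apply Rmult_lt_0_compat; auto); lra. }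
  exists (N + N')%nat; intros n Hn.
  assert (H1 := HN n ltac:(lia)); assert (H2 := HN' n ltac:(lia)).
  rewrite Cmod_minus_sym in H1, H2; assert (H3 := Cmod_rev_triangle l (u n)).
  assert (Hu : u n <> RtoC 0) by (apply Cmod_gt_0; lra).
  replace (/ u n - / l)%C with ((l - u n) / (u n * l))%C by (field; auto).
  rewrite Cmod_div, Cmod_mult by now apply Cmult_neq_0.
  apply Rlt_div_l; [apply Rmult_lt_0_compat; lra|].
  eapply Rlt_le_trans; [apply H2|].
  replace (eps * (Cmod l * Cmod l) / 2) with (eps * (Cmod l / 2 * Cmod l)) by field.
  apply Rmult_le_compat_l; [lra|]; apply Rmult_le_compat_r; lra.
Qed.

Definition sine_partial (z : C) (n : nat) : C :=
  cprod n (fun k => RtoC 1 - z * z / RtoC (INR (S k) ^ 2))%C.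

(** Comparing the recurrences at z and at 0 produces one factor 1 - z^2/n^2 at each step. *)
Lemma sine_partial_wallis z n :
  (wallis z 0 * RtoC (wallis_u 0 0 (2 * n)) = sine_partial z n * wallis z n * RtoC (PI / 2))%C.
Proof.
  induction n.
  - simpl; rewrite wallis_u000; unfold sine_partial; simpl; ring.
  - assert (Hz := wallis_rec z n); assert (H0 := wallis_rec 0 n).
    rewrite !wallis_real, Cmult_0_l in H0.
    set (N := INR (S n)) in *.
    assert (HN : 1 <= N) by (unfold N; rewrite S_INR; generalize (pos_INR n); lra).
    assert (Ha : RtoC (N ^ 2 - N / 2) <> RtoC 0) by (apply RtoC_neq0; nra).
    assert (HNn : RtoC (N ^ 2) <> RtoC 0) by (apply RtoC_neq0; nra).
    assert (E : sine_partial z (S n)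
      = (sine_partial z n * (RtoC 1 - z * z / RtoC (N ^ 2)))%C) by reflexivity.
    rewrite E.
    apply Cmult_cancel_r with (RtoC (N ^ 2)); auto.
    transitivity (wallis z 0 * ((RtoC (N ^ 2) - 0) * RtoC (wallis_u 0 0 (2 * S n))))%C; [ring|].
    rewrite <- H0.
    transitivity (RtoC (N ^ 2 - N / 2) * (wallis z 0 * RtoC (wallis_u 0 0 (2 * n))))%C; [ring|].
    rewrite IHn.
    transitivity (sine_partial z n * RtoC (PI / 2) * (RtoC (N ^ 2 - N / 2) * wallis z n))%C; [ring|].
    rewrite Hz; field; auto.
Qed.

(** cos(t)^(2n) concentrates at t = 0, where cos(2 z t) = 1; [wallis_close] bounds the relative
    error by a multiple of 1/(2n + 1). *)
Lemma wallis_ratio_cv z : ccv (fun n => wallis z n / RtoC (wallis_u 0 0 (2 * n)))%C (RtoC 1).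
Proof.
  destruct z as [x y].
  destruct (ucos_vcos_bound (2 * x) (2 * y)) as (K & HK & Hb).
  assert (Hmain : forall n, Cmod (wallis (x, y) (S n) / RtoC (wallis_u 0 0 (2 * S n)) - RtoC 1)%C
    <= (2 * K) * / (2 * INR n + 1)).
  { intros n; assert (Hw := wallis_u00_pos (S n)).
    set (W := wallis_u 0 0 (2 * S n)) in *.
    assert (HWn : RtoC W <> RtoC 0) by (apply RtoC_neq0; lra).
    assert (H1 : Rabs (wallis_u (2 * x) (2 * y) (2 * S n) - W) <= K * (W / (2 * INR n + 1))).
    { apply (wallis_close (fun t => ucos (2 * x) (2 * y) t - 1)); auto; [intros; now apply Hb|].
      assert (HI := is_RInt_lin _ _ (-1) _ _ _ _ (is_RInt_u (2 * x) (2 * y) (2 * S n))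
        (is_RInt_u 0 0 (2 * S n))).
      fold W in HI.
      replace (wallis_u (2 * x) (2 * y) (2 * S n) - W)
        with (wallis_u (2 * x) (2 * y) (2 * S n) + -1 * W) by ring.
      apply (is_RInt_ext (V := R_NormedModule)) with (2 := HI); intros t _.
      unfold ucos at 2; rewrite !Rmult_0_l, cos_0, cosh_0.
      match goal with |- ?x = ?y => change (@eq R x y) end; ring. }
    assert (H2 : Rabs (wallis_v (2 * x) (2 * y) (2 * S n)) <= K * (W / (2 * INR n + 1))).
    { apply (wallis_close (vcos (2 * x) (2 * y))); auto; [intros; now apply Hb|apply is_RInt_v]. }
    replace (wallis (x, y) (S n) / RtoC W - RtoC 1)%C
      with ((wallis (x, y) (S n) - RtoC W) / RtoC W)%C by (field; auto).
    rewrite Cmod_div, Cmod_R, (Rabs_pos_eq W) by (auto; lra).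
    apply Rle_div_l; auto.
    eapply Rle_trans; [apply Cmod_le_ReIm|].
    assert (Hn := pos_INR n).
    replace (2 * K * / (2 * INR n + 1) * W) with (2 * (K * (W / (2 * INR n + 1)))) by (field; lra).
    replace (Re (wallis (x, y) (S n) - RtoC W)%C) with (wallis_u (2 * x) (2 * y) (2 * S n) - W)
      by reflexivity.
    replace (Im (wallis (x, y) (S n) - RtoC W)%C) with (- wallis_v (2 * x) (2 * y) (2 * S n) - 0)
      by (unfold wallis; simpl; ring).
    rewrite Rminus_0_r, Rabs_Ropp; lra. }
  apply (is_lim_seq_incr_1 (fun n => Cmod (wallis (x, y) n / RtoC (wallis_u 0 0 (2 * n)) - RtoC 1)%C)).
  apply (squeeze_0 _ (fun n => (2 * K) * / (2 * INR n + 1))).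
  - intros n; split; [apply Cmod_ge_0|apply Hmain].
  - apply is_lim_seq_scal0, is_lim_seq_0_eps.
    { intros n; apply Rlt_le, Rinv_0_lt_compat; generalize (pos_INR n); lra. }
    intros eps He; destruct (archimed_cor1 eps He) as (N & HN & HN0).
    exists N; intros n Hn; apply Rle_lt_trans with (/ INR N); auto.
    assert (INR N <= INR n) by now apply le_INR.
    apply lt_INR in HN0; simpl in HN0.
    apply Rinv_le_contravar; [auto|generalize (pos_INR n); lra].
Qed.

(** As n grows the ratio of the integrals at z and at 0 tends to 1, so [sine_partial_wallis]
    identifies the limit with the initial integral, which [wallis_0_times_2z] evaluates. *)
Lemma sine_product z : exists K, ccv (sine_partial z) K /\ (RtoC PI * z * K)%C = csin (RtoC PI * z).
Proof.
  exists (wallis z 0 * / RtoC (PI / 2))%C; split.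
  - assert (HP2 : RtoC (PI / 2) <> RtoC 0) by (apply RtoC_neq0; generalize PI_RGT_0; lra).
    assert (H := wallis_ratio_cv z).
    assert (Hi := ccv_inv _ (RtoC 1) (RtoC_neq0 1 R1_neq_R0) H).
    assert (Hm := ccv_scal (wallis z 0 * / RtoC (PI / 2))%C _ _ Hi).
    replace (wallis z 0 * / RtoC (PI / 2) * / RtoC 1)%C with (wallis z 0 * / RtoC (PI / 2))%C in Hm
      by (field; auto).
    rewrite ccv_eps in H; destruct (H 1) as [N HN]; [lra|].
    apply ccv_ext_loc with (2 := Hm) (N := N); intros n Hn.
    assert (HW : RtoC (wallis_u 0 0 (2 * n)) <> RtoC 0)
      by (apply RtoC_neq0, Rgt_not_eq, wallis_u00_pos).
    assert (Hwn : wallis z n <> RtoC 0).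
    { intros E; specialize (HN n Hn); rewrite E in HN.
      replace (RtoC 0 / RtoC (wallis_u 0 0 (2 * n)) - RtoC 1)%C with (- RtoC 1)%C in HN
        by (field; auto).
      rewrite Cmod_opp, Cmod_1 in HN; lra. }
    assert (E := sine_partial_wallis z n).
    apply Cmult_cancel_r with (wallis z n * RtoC (PI / 2))%C; [now apply Cmult_neq_0|].
    transitivity (sine_partial z n * wallis z n * RtoC (PI / 2))%C; [|ring].
    rewrite <- E; field; auto.
  - rewrite <- wallis_0_times_2z; rewrite RtoC_div by lra.
    field; apply RtoC_neq0, PI_neq0.
Qed.

(** * Convergence of the Gauss limit and reflection of Gamma *)

(** The errors 1/n - 1/(n+1) telescope: the products stay bounded by an exponential, and then the
    increments are summable. *)
Lemma slowly_varying_cv (u eps : nat -> C) N K : (0 < N)%nat -> 0 <= K ->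
  (forall n, (N <= n)%nat -> u (S n) = (u n * (RtoC 1 + eps n))%C) ->
  (forall n, (N <= n)%nat -> Cmod (eps n) <= K * (/ INR n - / INR (S n))) ->
  exists l, ccv u l.
Proof.
  intros HN HK Hu He.
  assert (Hb : forall k, Cmod (u (N + k)%nat)
    <= Cmod (u N) * exp (K * (/ INR N - / INR (N + k)))).
  { induction k.
    - rewrite Nat.add_0_r, Rminus_diag, Rmult_0_r, exp_0; lra.
    - rewrite Nat.add_succ_r, Hu by lia; rewrite Cmod_mult.
      assert (E : Cmod (RtoC 1 + eps (N + k)%nat)%C
        <= exp (K * (/ INR (N + k) - / INR (S (N + k))))).
      { eapply Rle_trans; [apply Cmod_triangle|]; rewrite Cmod_1.
        eapply Rle_trans; [|apply exp_ineq1_le]; generalize (He (N + k)%nat ltac:(lia)); lra. }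
      replace (K * (/ INR N - / INR (S (N + k)))) with
        (K * (/ INR N - / INR (N + k)) + K * (/ INR (N + k) - / INR (S (N + k)))) by ring.
      rewrite exp_plus, <- Rmult_assoc; apply Rmult_le_compat; auto; apply Cmod_ge_0. }
  assert (Hpos : forall n, (N <= n)%nat -> 0 < / INR n).
  { intros n Hn; apply Rinv_0_lt_compat, lt_0_INR; lia. }
  set (B := Cmod (u N) * exp (K * / INR N)).
  assert (HB0 : 0 <= B) by (apply Rmult_le_pos; [apply Cmod_ge_0|apply Rlt_le, exp_pos]).
  assert (HB : forall n, (N <= n)%nat -> Cmod (u n) <= B).
  { intros n Hn; replace n with (N + (n - N))%nat by lia.
    eapply Rle_trans; [apply Hb|]; apply Rmult_le_compat_l; [apply Cmod_ge_0|].
    apply exp_le, Rmult_le_compat_l; auto; generalize (Hpos (N + (n - N))%nat ltac:(lia)); lra. }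
  assert (Hd : forall n k, (N <= n)%nat ->
    Cmod (u (n + k)%nat - u n)%C <= B * K * (/ INR n - / INR (n + k))).
  { intros n k Hn; induction k.
    - rewrite Nat.add_0_r; replace (u n - u n)%C with (RtoC 0) by ring.
      rewrite Cmod_0, Rminus_diag; lra.
    - eapply Rle_trans; [apply (Cmod_triangle_minus _ (u (n + k)%nat))|].
      rewrite Nat.add_succ_r, Hu by lia.
      replace (u (n + k)%nat * (RtoC 1 + eps (n + k)%nat) - u (n + k)%nat)%C
        with (u (n + k)%nat * eps (n + k)%nat)%C by ring.
      rewrite Cmod_mult.
      assert (Cmod (u (n + k)%nat) * Cmod (eps (n + k)%nat)
        <= B * (K * (/ INR (n + k) - / INR (S (n + k))))).
      { apply Rmult_le_compat; try apply Cmod_ge_0; [apply HB; lia|apply He; lia]. }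
      lra. }
  apply ccv_cauchy; intros e Hee.
  destruct (archimed_cor1 (e / (B * K + 1))) as (M & HM & HM0).
  { apply Rdiv_lt_0_compat; auto; assert (0 <= B * K) by now apply Rmult_le_pos. lra. }
  assert (HBK : 0 <= B * K) by now apply Rmult_le_pos.
  exists (N + M)%nat; intros n Hn; replace n with ((N + M) + (n - (N + M)))%nat by lia.
  eapply Rle_lt_trans; [apply Hd; lia|].
  assert (H1 := Hpos (N + M + (n - (N + M)))%nat ltac:(lia)).
  assert (H2 : / INR (N + M) <= / INR M).
  { apply Rinv_le_contravar; [now apply lt_0_INR|apply le_INR; lia]. }
  apply Rle_lt_trans with (B * K * / INR M).
  - apply Rmult_le_compat_l; lra.
  - apply Rle_lt_trans with ((B * K + 1) * / INR M).
    + assert (0 < / INR M) by (apply Rinv_0_lt_compat, lt_0_INR; auto); lra.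
    + apply (Rmult_lt_compat_l (B * K + 1)) in HM; [|lra].
      replace ((B * K + 1) * (e / (B * K + 1))) with e in HM by (field; lra); auto.
Qed.

Lemma ln_step n : (0 < n)%nat -> / INR (S n) <= ln (INR (S n)) - ln (INR n) <= / INR n.
Proof.
  intros Hn; apply lt_0_INR in Hn; assert (Hs : 0 < INR (S n)) by (rewrite S_INR; lra).
  assert (Hln : forall x, 0 < x -> ln x <= x - 1).
  { intros x Hx; assert (H := exp_ineq1_le (ln x)); rewrite exp_ln in H; lra. }
  assert (H1 := Hln (INR (S n) / INR n) (Rdiv_lt_0_compat _ _ Hs Hn)).
  assert (H2 := Hln (INR n / INR (S n)) (Rdiv_lt_0_compat _ _ Hn Hs)).
  rewrite ln_div in H1, H2 by auto.
  assert (E1 : INR (S n) / INR n - 1 = / INR n) by (rewrite S_INR; field; lra).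
  assert (E2 : INR n / INR (S n) - 1 = - / INR (S n)) by (rewrite S_INR in *; field; lra).
  lra.
Qed.

(** Consecutive terms have ratio exp (z ln ((n+1)/n)) (n+1)/(z+n+1) = 1 + O(n^-2). *)
Lemma gauss_term_cv z : (forall k : nat, (z + RtoC (INR k))%C <> RtoC 0) ->
  exists l, ccv (gauss_term z) l.
Proof.
  intros Hz.
  set (a := Cmod z); assert (Ha : 0 <= a) by apply Cmod_ge_0.
  (* For n >= N > 2 |z| + 1 the exponent is at most 1/2 in modulus and |z + n + 1| >= (n + 1)/2. *)
  destruct (archimed_cor1 (/ (2 * a + 1))) as (N & HN & HN0);
    [apply Rinv_0_lt_compat; lra|].
  assert (HNa : 2 * a + 1 < INR N).
  { apply Rinv_lt_cancel in HN; auto; apply lt_0_INR; auto. }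
  set (eta := fun n => ln (INR (S n)) - ln (INR n)).
  set (eps := fun n => ((cexp (z * RtoC (eta n)) * RtoC (INR (S n)) - (z + RtoC (INR (S n))))
     / (z + RtoC (INR (S n))))%C).
  apply (slowly_varying_cv _ eps N (32 * a ^ 2 + 2 * a)); auto.
  - nra.
  - intros n Hn; unfold gauss_term.
    change (cprod (S (S n)) (fun k => z + RtoC (INR k))%C)
      with (cprod (S n) (fun k => z + RtoC (INR k)) * (z + RtoC (INR (S n))))%C.
    assert (Hp : cprod (S n) (fun k => z + RtoC (INR k))%C <> RtoC 0) by (apply cprod_neq0; auto).
    assert (Hzn := Hz (S n)).
    replace (cexp (z * RtoC (ln (INR (S n)))))
      with (cexp (z * RtoC (ln (INR n))) * cexp (z * RtoC (eta n)))%C.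
    + rewrite fact_simpl, mult_INR, RtoC_mult; unfold eps; field; auto.
    + rewrite <- cexp_plus; f_equal; unfold eta; rewrite RtoC_minus; ring.
  - intros n Hn.
    assert (Hn0 : (0 < n)%nat) by lia.
    assert (HnN : INR N <= INR n) by now apply le_INR.
    assert (Hl := ln_step n Hn0); fold (eta n) in Hl.
    assert (Hsn : INR (S n) = INR n + 1) by apply S_INR.
    set (x := INR n) in *; set (y := INR (S n)) in *.
    assert (Hx : 0 < x) by lra.
    assert (Hix : 0 < / x) by now apply Rinv_0_lt_compat.
    assert (Hiy : 0 < / y) by (apply Rinv_0_lt_compat; lra).
    assert (Hm : Cmod (z * RtoC (eta n))%C <= a * / x).
    { rewrite Cmod_mult, Cmod_R, Rabs_pos_eq by lra; apply Rmult_le_compat_l; lra. }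
    assert (Hax : a * / x <= / 2).
    { apply (Rmult_le_reg_r x); auto; rewrite Rmult_assoc, Rinv_l by lra; lra. }
    assert (HT := cexp_taylor (z * RtoC (eta n))%C ltac:(lra)).
    assert (Hyz : y / 2 <= Cmod (z + RtoC y)%C).
    { assert (T := Cmod_rev_triangle (RtoC y) (- z)%C).
      rewrite Cmod_opp, Cmod_R, Rabs_pos_eq in T by lra.
      replace (RtoC y - - z)%C with (z + RtoC y)%C in T by ring; unfold a in *; lra. }
    unfold eps; fold y; rewrite Cmod_div by (unfold y; apply Hz).
    apply Rle_div_l; [lra|].
    replace (cexp (z * RtoC (eta n)) * RtoC y - (z + RtoC y))%C
      with ((cexp (z * RtoC (eta n)) - 1 - z * RtoC (eta n)) * RtoC y
        + z * RtoC (y * eta n - 1))%C by (rewrite RtoC_minus, RtoC_mult; ring).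
    eapply Rle_trans; [apply Cmod_triangle|]; rewrite !Cmod_mult, !Cmod_R.
    assert (Hye : 0 <= y * eta n - 1 <= / x).
    { assert (y * / y <= y * eta n) by (apply Rmult_le_compat_l; lra).
      assert (y * eta n <= y * / x) by (apply Rmult_le_compat_l; lra).
      rewrite Rinv_r in H by lra.
      assert (y * / x = 1 + / x) by (rewrite Hsn; field; lra). lra. }
    rewrite (Rabs_pos_eq y), (Rabs_pos_eq (y * eta n - 1)) by lra; fold a.
    assert (Hsq : Cmod (z * RtoC (eta n))%C ^ 2 <= (a * / x) ^ 2)
      by (apply pow_incr; split; [apply Cmod_ge_0|auto]).
    apply Rle_trans with (8 * (a * / x) ^ 2 * y + a * / x).
    + apply Rplus_le_compat; [apply Rmult_le_compat_r; lra|apply Rmult_le_compat_l; lra].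
    + apply Rle_trans with ((32 * a ^ 2 + 2 * a) * (/ x - / y) * (y / 2)).
      * replace ((32 * a ^ 2 + 2 * a) * (/ x - / y) * (y / 2))
          with (16 * a ^ 2 * / x + a * / x) by (rewrite Hsn; field; lra).
        apply Rplus_le_compat_r.
        replace (8 * (a * / x) ^ 2 * y) with (8 * a ^ 2 * / x * (y * / x)) by ring.
        replace (16 * a ^ 2 * / x) with (8 * a ^ 2 * / x * 2) by ring.
        apply Rmult_le_compat_l; [apply Rmult_le_pos; nra|].
        apply (Rmult_le_reg_r x); auto; rewrite Rmult_assoc, Rinv_l by lra; lra.
      * apply Rmult_le_compat_l; auto.
        apply Rmult_le_pos; [nra|].
        assert (/ y <= / x) by (apply Rinv_le_contravar; lra); lra.
Qed.

Lemma cGamma_cv z : (forall k : nat, (z + RtoC (INR k))%C <> RtoC 0) ->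
  ccv (gauss_term z) (cGamma z).
Proof.
  intros Hz; destruct (gauss_term_cv z Hz) as [l Hl].
  unfold cGamma; now rewrite (clim_ccv _ _ Hl).
Qed.

Lemma cexp_conj z : Cconj (cexp z) = cexp (Cconj z).
Proof.
  destruct z as [x y]; apply C_ext; unfold cexp, Cconj; simpl; rewrite ?cos_neg, ?sin_neg; ring.
Qed.

Lemma gauss_term_conj z n : Cconj (gauss_term z n) = gauss_term (Cconj z) n.
Proof.
  assert (HR : forall x, Cconj (RtoC x) = RtoC x) by (intros; apply C_ext; simpl; ring).
  unfold gauss_term, Cdiv; rewrite !Cmult_conj, Cinv_conj', cexp_conj, Cmult_conj, !HR; f_equal.
  f_equal; rewrite cprod_conj; apply cprod_ext; intros k _; now rewrite Cplus_conj, HR.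
Qed.

Lemma cGamma_conj z : (forall k : nat, (z + RtoC (INR k))%C <> RtoC 0) ->
  cGamma (Cconj z) = Cconj (cGamma z).
Proof.
  intros Hz; apply clim_ccv.
  eapply ccv_ext; [|apply ccv_conj, (cGamma_cv z Hz)]; intros n; apply gauss_term_conj.
Qed.

Lemma cexp_ln x : 0 < x -> cexp (RtoC (ln x)) = RtoC x.
Proof.
  intros Hx; unfold cexp, RtoC; simpl; rewrite cos_0, sin_0, exp_ln by auto.
  apply C_ext; simpl; ring.
Qed.

Lemma cprod_S_r n f : cprod (S n) f = (cprod n f * f n)%C.
Proof. reflexivity. Qed.

Lemma cprod_linear_pair z n :
  (cprod n (fun k => z + RtoC (INR (S k))) * cprod n (fun k => - z + RtoC (INR (S k)))
   = RtoC (INR (fact n) ^ 2) * sine_partial z n)%C.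
Proof.
  induction n.
  - simpl; unfold sine_partial; simpl; ring_simplify; f_equal; ring.
  - assert (E : sine_partial z (S n)
      = (sine_partial z n * (RtoC 1 - z * z / RtoC (INR (S n) ^ 2)))%C) by reflexivity.
    rewrite E, !cprod_S_r.
    transitivity ((cprod n (fun k => z + RtoC (INR (S k))) * cprod n (fun k => - z + RtoC (INR (S k))))
      * ((z + RtoC (INR (S n))) * (- z + RtoC (INR (S n)))))%C; [ring|].
    rewrite IHn, fact_simpl, mult_INR.
    assert (HN : INR (S n) <> 0) by (apply not_0_INR; lia).
    set (N := INR (S n)) in *.
    rewrite !RtoC_pow, RtoC_mult; field; now apply RtoC_neq0.
Qed.

Lemma is_lim_seq_inv_shift (c : C) : ccv (fun n => c / RtoC (INR (S n)))%C (RtoC 0).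
Proof.
  apply (ccv_dom _ _ (fun n => Cmod c * / INR (S n))).
  - intros n; replace (c / RtoC (INR (S n)) - RtoC 0)%C with (c / RtoC (INR (S n)))%C by ring.
    assert (HN : 0 < INR (S n)) by (apply lt_0_INR; lia).
    rewrite Cmod_div, Cmod_R, Rabs_pos_eq by (try lra; apply RtoC_neq0; lra).
    unfold Rdiv; lra.
  - apply is_lim_seq_scal0.
    apply is_lim_seq_0_eps.
    { intros n; apply Rlt_le, Rinv_0_lt_compat, lt_0_INR; lia. }
    intros eps He; destruct (archimed_cor1 eps He) as (N & HN & HN0).
    exists N; intros n Hn; apply Rle_lt_trans with (/ INR N); auto.
    apply Rinv_le_contravar; [now apply lt_0_INR|apply le_INR; lia].
Qed.

Lemma csin_integer k : csin (RtoC PI * RtoC (IZR k)) = RtoC 0.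
Proof.
  rewrite <- RtoC_mult; unfold csin, RtoC; simpl Re; simpl Im.
  rewrite sinh_0, (sin_eq_0_1 (PI * IZR k)) by (exists k; ring); f_equal; ring.
Qed.

(* The product of the two Gauss terms is n / (n+1-z) / (z prod_(1<=k<=n) (1 - z^2/k^2)). *)
Lemma cGamma_reflection z : csin (RtoC PI * z) <> RtoC 0 ->
  (cGamma z * cGamma (1 - z))%C = (RtoC PI / csin (RtoC PI * z))%C.
Proof.
  intros Hs.
  assert (Hint : forall k : Z, z <> RtoC (IZR k)).
  { intros k E; apply Hs; rewrite E; apply csin_integer. }
  assert (H1 : forall k : nat, (z + RtoC (INR k))%C <> RtoC 0).
  { intros k E; apply (Hint (- Z.of_nat k)%Z).
    rewrite opp_IZR, <- INR_IZR_INZ, RtoC_opp.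
    replace z with (z + RtoC (INR k) - RtoC (INR k))%C by ring; rewrite E; ring. }
  assert (H2 : forall k : nat, (- z + RtoC (INR (S k)))%C <> RtoC 0).
  { intros k E; apply (Hint (Z.of_nat (S k))%Z); rewrite <- INR_IZR_INZ.
    replace z with (RtoC (INR (S k)) - (- z + RtoC (INR (S k))))%C by ring; rewrite E; ring. }
  assert (H2' : forall k : nat, (1 - z + RtoC (INR k))%C <> RtoC 0).
  { intros k; replace (1 - z + RtoC (INR k))%C with (- z + RtoC (INR (S k)))%C; auto.
    rewrite S_INR, RtoC_plus; ring. }
  destruct (sine_product z) as (K & HK & EK).
  assert (HPi : RtoC PI <> RtoC 0) by apply RtoC_neq0, PI_neq0.
  assert (Hz : z <> RtoC 0) by apply (Hint 0%Z).
  assert (HKn : K <> RtoC 0) by (intros E; apply Hs; rewrite <- EK, E; ring).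
  assert (Hlim := ccv_mult _ _ _ _ (cGamma_cv z H1) (cGamma_cv _ H2')).
  replace (RtoC PI / csin (RtoC PI * z))%C with (/ (RtoC 1 - RtoC 0) * / (z * K))%C.
  2: { rewrite <- EK; field; repeat split; auto. }
  (* The sequences are started at index 1, so that ln N is a genuine logarithm. *)
  apply (ccv_unique _ _ _ (ccv_incr _ _ 1 Hlim)).
  assert (Hlim2 : ccv (fun n => / (RtoC 1 - (z - RtoC 1) / RtoC (INR (S n)))
     * / (z * sine_partial z (n + 1)))%C (/ (RtoC 1 - RtoC 0) * / (z * K))%C).
  { apply ccv_mult; apply ccv_inv.
    - replace (RtoC 1 - RtoC 0)%C with (RtoC 1) by ring; apply RtoC_neq0, R1_neq_R0.
    - apply ccv_minus; [apply ccv_const|apply is_lim_seq_inv_shift].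
    - now apply Cmult_neq_0.
    - apply ccv_scal, (ccv_incr _ _ 1 HK). }
  eapply ccv_ext; [|exact Hlim2]; intros n; cbv beta.
  replace (n + 1)%nat with (S n) by lia.
  assert (HN : 0 < INR (S n)) by (apply lt_0_INR; lia).
  assert (HNn : RtoC (INR (S n)) <> RtoC 0) by (apply RtoC_neq0; lra).
  unfold gauss_term.
  rewrite (cprod_S_l (S n) (fun k => z + RtoC (INR k))%C).
  rewrite (cprod_ext (S (S n)) (fun k => 1 - z + RtoC (INR k))%C (fun k => - z + RtoC (INR (S k)))%C)
    by (intros; rewrite S_INR, RtoC_plus; ring).
  change (cprod (S (S n)) (fun k => - z + RtoC (INR (S k)))%C)
    with (cprod (S n) (fun k => - z + RtoC (INR (S k))) * (- z + RtoC (INR (S (S n)))))%C.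
  assert (E := cprod_linear_pair z (S n)).
  assert (HA : cprod (S n) (fun k => z + RtoC (INR (S k)))%C <> RtoC 0) by (apply cprod_neq0; auto).
  assert (HB : cprod (S n) (fun k => - z + RtoC (INR (S k)))%C <> RtoC 0) by (apply cprod_neq0; auto).
  set (A := cprod (S n) (fun k => z + RtoC (INR (S k)))%C) in *.
  set (B := cprod (S n) (fun k => - z + RtoC (INR (S k)))%C) in *.
  assert (HF : RtoC (INR (fact (S n))) <> RtoC 0) by (apply RtoC_neq0, INR_fact_neq_0).
  set (F := INR (fact (S n))) in *; set (N := INR (S n)) in *.
  assert (HSP : sine_partial z (S n) = (A * B / (RtoC F * RtoC F))%C).
  { rewrite E, RtoC_pow; field; auto. }
  assert (Ee : (cexp (z * RtoC (ln N)) * cexp ((1 - z) * RtoC (ln N)))%C = RtoC N).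
  { rewrite <- cexp_plus, <- (cexp_ln N) by auto; f_equal; ring. }
  assert (HD := H2 (S n)); rewrite S_INR in HD; fold N in HD.
  rewrite S_INR; fold N; rewrite RtoC_plus in *.
  replace (z + RtoC (INR 0))%C with z by (simpl; ring).
  transitivity ((cexp (z * RtoC (ln N)) * cexp ((1 - z) * RtoC (ln N))) *
     (RtoC F * RtoC F / (z * (A * B) * (- z + (RtoC N + RtoC 1)))))%C; [|field; repeat split; auto; exact HD].
  rewrite Ee, HSP; field; repeat split; auto.
  all: intros E0; apply HD; rewrite <- E0; ring.
Qed.

(** With z = i y the product of the Gauss terms at 1 + z and 1 - z is (n/(n+1))^2 divided by the
    partial sine product of length n + 1, and sin (PI i y) = i sinh (PI y). *)
Lemma cGamma_1_plus_minus y : y <> 0 ->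
  (cGamma (1 + Ci * RtoC y) * cGamma (1 - Ci * RtoC y))%C = RtoC (PI * y / sinh (PI * y)).
Proof.
  intros Hy; set (z := (Ci * RtoC y)%C).
  assert (Hz : z <> RtoC 0).
  { unfold z; apply Cmult_neq_0; [apply Ci_neq0|now apply RtoC_neq0]. }
  assert (Him : forall (e : R) k, e <> 0 -> (RtoC e * z + RtoC (INR k))%C <> RtoC 0).
  { intros e k He E; apply (f_equal Im) in E; unfold z in E; simpl in E.
    assert (e * y = 0) by lra; apply Rmult_integral in H; tauto. }
  assert (H1 : forall k : nat, (z + RtoC (INR k))%C <> RtoC 0).
  { intros k; replace z with (RtoC 1 * z)%C by ring; apply Him; lra. }
  assert (H2 : forall k : nat, (- z + RtoC (INR k))%C <> RtoC 0).
  { intros k; rewrite <- Cmult_m1_l; apply Him; lra. }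
  assert (H1' : forall k : nat, (1 + z + RtoC (INR k))%C <> RtoC 0).
  { intros k; replace (1 + z + RtoC (INR k))%C with (z + RtoC (INR (S k)))%C; auto.
    rewrite S_INR, RtoC_plus; ring. }
  assert (H2' : forall k : nat, (1 - z + RtoC (INR k))%C <> RtoC 0).
  { intros k; replace (1 - z + RtoC (INR k))%C with (- z + RtoC (INR (S k)))%C; auto.
    rewrite S_INR, RtoC_plus; ring. }
  destruct (sine_product z) as (K & HK & EK).
  assert (HPi : RtoC PI <> RtoC 0) by apply RtoC_neq0, PI_neq0.
  assert (Hsh : sinh (PI * y) <> 0).
  { intros E; rewrite <- sinh_0 in E.
    assert (HPy : PI * y <> 0) by (apply Rmult_integral_contrapositive; split; [apply PI_neq0|auto]).
    destruct (Rtotal_order (PI * y) 0) as [H|[H|H]]; [|auto|]; generalize (sinh_lt _ _ H); lra. }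
  assert (EK2 : K = RtoC (sinh (PI * y) / (PI * y))).
  { apply Cmult_cancel_r with (RtoC PI * z)%C; [now apply Cmult_neq_0|].
    rewrite (Cmult_comm K), EK; unfold csin, z.
    replace (Re (RtoC PI * (Ci * RtoC y))%C) with 0 by (simpl; ring).
    replace (Im (RtoC PI * (Ci * RtoC y))%C) with (PI * y) by (simpl; ring).
    rewrite sin_0, cos_0; apply C_ext; simpl; field; split; auto; apply PI_neq0. }
  assert (HKn : K <> RtoC 0).
  { rewrite EK2; apply RtoC_neq0; unfold Rdiv; apply Rmult_integral_contrapositive; split; auto.
    apply Rinv_neq_0_compat, Rmult_integral_contrapositive; split; [apply PI_neq0|auto]. }
  assert (Hlim := ccv_mult _ _ _ _ (cGamma_cv _ H1') (cGamma_cv _ H2')).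
  replace (RtoC (PI * y / sinh (PI * y))) with ((RtoC 1 - RtoC 0) * (RtoC 1 - RtoC 0) * / K)%C.
  2: { rewrite EK2, <- RtoC_inv.
       - replace (RtoC 1 - RtoC 0)%C with (RtoC 1) by ring; rewrite !Cmult_1_l; f_equal.
         field; repeat split; auto; apply PI_neq0.
       - unfold Rdiv; apply Rmult_integral_contrapositive; split; auto.
         apply Rinv_neq_0_compat, Rmult_integral_contrapositive; split; [apply PI_neq0|auto]. }
  apply (ccv_unique _ _ _ (ccv_incr _ _ 1 Hlim)).
  assert (Hfrac : ccv (fun n => RtoC 1 - RtoC 1 / RtoC (INR (S (n + 1))))%C (RtoC 1 - RtoC 0)%C).
  { apply ccv_minus; [apply ccv_const|].
    apply (ccv_incr (fun n => RtoC 1 / RtoC (INR (S n)))%C _ 1 (is_lim_seq_inv_shift _)). }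
  assert (Hlim2 : ccv (fun n => (RtoC 1 - RtoC 1 / RtoC (INR (S (n + 1))))
     * (RtoC 1 - RtoC 1 / RtoC (INR (S (n + 1)))) * / sine_partial z (n + 2))%C
     ((RtoC 1 - RtoC 0) * (RtoC 1 - RtoC 0) * / K)%C).
  { apply ccv_mult; [now apply ccv_mult|].
    apply ccv_inv; auto; apply (ccv_incr _ _ 2 HK). }
  eapply ccv_ext; [|exact Hlim2]; intros n; cbv beta.
  replace (n + 1)%nat with (S n) by lia; replace (n + 2)%nat with (S (S n)) by lia.
  assert (HN : 0 < INR (S n)) by (apply lt_0_INR; lia).
  unfold gauss_term.
  rewrite (cprod_ext (S (S n)) (fun k => 1 - z + RtoC (INR k))%C (fun k => - z + RtoC (INR (S k)))%C)
    by (intros; rewrite S_INR, RtoC_plus; ring).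
  rewrite (cprod_ext (S (S n)) (fun k => 1 + z + RtoC (INR k))%C (fun k => z + RtoC (INR (S k)))%C)
    by (intros; rewrite S_INR, RtoC_plus; ring).
  assert (E := cprod_linear_pair z (S (S n))).
  assert (HA : cprod (S (S n)) (fun k => z + RtoC (INR (S k)))%C <> RtoC 0) by (apply cprod_neq0; auto).
  assert (HB : cprod (S (S n)) (fun k => - z + RtoC (INR (S k)))%C <> RtoC 0) by (apply cprod_neq0; auto).
  set (A := cprod (S (S n)) (fun k => z + RtoC (INR (S k)))%C) in *.
  set (B := cprod (S (S n)) (fun k => - z + RtoC (INR (S k)))%C) in *.
  assert (HF : RtoC (INR (fact (S n))) <> RtoC 0) by (apply RtoC_neq0, INR_fact_neq_0).
  rewrite fact_simpl, mult_INR, S_INR in E.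
  set (F := INR (fact (S n))) in *.
  rewrite (S_INR (S n)); set (N := INR (S n)) in *.
  assert (HN1 : RtoC (N + 1) <> RtoC 0) by (apply RtoC_neq0; lra).
  rewrite RtoC_pow, RtoC_mult in E.
  assert (HSP : sine_partial z (S (S n)) = (A * B / (RtoC (N + 1) * RtoC F * (RtoC (N + 1) * RtoC F)))%C).
  { rewrite E; field; auto. }
  assert (Ee : (cexp ((1 + z) * RtoC (ln N)) * cexp ((1 - z) * RtoC (ln N)))%C = (RtoC N * RtoC N)%C).
  { rewrite <- cexp_plus, <- (cexp_ln N), <- cexp_plus by auto; f_equal; ring. }
  transitivity ((cexp ((1 + z) * RtoC (ln N)) * cexp ((1 - z) * RtoC (ln N))) *
     (RtoC F * RtoC F / (A * B)))%C; [|field; auto].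
  rewrite Ee, HSP; rewrite RtoC_plus in *; field; auto.
Qed.

(** * The Fredholm determinant *)

Lemma rsum_sum_n a n : rsum (S n) a = sum_n a n.
Proof.
  induction n.
  - rewrite sum_O; simpl; ring.
  - rewrite sum_Sn, <- IHn; reflexivity.
Qed.

Lemma ex_series_rsum_bounded a : (forall n, 0 <= a n) -> ex_series a ->
  exists X, forall n, rsum n a <= X.
Proof.
  intros Ha [l Hl]; exists l; intros n.
  assert (H : forall n, rsum n a <= rsum (S n) a) by (intros k; simpl; generalize (Ha k); lra).
  eapply Rle_trans; [apply H|]; rewrite rsum_sum_n.
  apply (is_lim_seq_incr_compare (sum_n a)); [exact Hl|].
  intros k; rewrite <- !rsum_sum_n; apply H.
Qed.

Lemma exp_partial_bounded y : 0 <= y -> exists X, forall n, rsum n (fun k => y ^ k / INR (fact k)) <= X.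
Proof.
  intros Hy; apply ex_series_rsum_bounded.
  - intros n; apply Rdiv_le_0_compat; [now apply pow_le|apply INR_fact_lt_0].
  - exists (exp y); eapply is_series_ext; [|apply (is_exp_Reals y)].
    intros n; unfold scal; simpl; unfold mult; simpl; rewrite pow_n_pow; reflexivity.
Qed.

Section BoundedSeries.
Variable h : nat -> R.
Hypothesis Hh : forall n, 0 <= h n.
Hypothesis Hb : exists X, forall n, rsum n h <= X.

(** The cut-off m is chosen before the series, so it serves all series under the majorant h at
    once. *)
Lemma series_tail eps : 0 < eps -> exists m, forall a, (forall n, Cmod (a n) <= h n) ->
  forall k, (m <= k)%nat -> Cmod (csum k a - csum m a)%C < eps.
Proof.
  intros He; destruct Hb as [X HX].
  assert (Hm : forall n, rsum n h <= rsum (S n) h) by (intros k; simpl; generalize (Hh k); lra).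
  destruct (ex_finite_lim_seq_incr (fun n => rsum n h) X Hm HX) as [l Hl].
  assert (Hle : forall n, rsum n h <= l)
    by (intros; apply (is_lim_seq_incr_compare (fun n => rsum n h)); auto).
  apply is_lim_seq_spec in Hl; destruct (Hl (mkposreal eps He)) as [m Hmm].
  exists m; intros a Ha k Hk; specialize (Hmm m (le_n _)); simpl in Hmm; apply Rabs_def2 in Hmm.
  replace k with (m + (k - m))%nat by lia; rewrite csum_app.
  replace (csum m a + csum (k - m) (fun j => a (m + j)%nat) - csum m a)%C
    with (csum (k - m) (fun j => a (m + j)%nat)) by ring.
  eapply Rle_lt_trans; [apply Cmod_csum|].
  apply Rle_lt_trans with (rsum (k - m) (fun j => h (m + j)%nat)); [apply rsum_le; auto|].
  generalize (Hle (m + (k - m))%nat); rewrite rsum_app; lra.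
Qed.

Lemma series_cv a : (forall n, Cmod (a n) <= h n) ->
  ccv (fun k => csum k a) (clim (fun k => csum k a)).
Proof.
  intros Ha; destruct (ccv_cauchy (fun k => csum k a)) as [l Hl].
  - intros eps He; destruct (series_tail eps He) as [m Hm]; exists m; intros n Hn; now apply Hm.
  - now rewrite (clim_ccv _ _ Hl).
Qed.

Lemma series_tannery (a : nat -> nat -> C) b :
  (forall N n, Cmod (a N n) <= h n) -> (forall n, ccv (fun N => a N n) (b n)) ->
  ccv (fun N => clim (fun k => csum k (a N))) (clim (fun k => csum k b)).
Proof.
  intros Ha Hlim.
  assert (HB : forall n, Cmod (b n) <= h n) by (intros n; apply (ccv_bound (fun N => a N n)); auto).
  apply ccv_eps; intros eps He; destruct (series_tail (eps / 4)) as [m Hm]; [lra|].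
  assert (Hc : ccv (fun N => csum m (a N)) (csum m b)) by (apply ccv_csum; auto).
  apply ccv_eps with (eps := eps / 4) in Hc; [|lra]; destruct Hc as [N0 HN0].
  assert (Hrest : forall a', (forall n, Cmod (a' n) <= h n) ->
    Cmod (clim (fun k => csum k a') - csum m a')%C <= eps / 4).
  { intros a' Ha'.
    apply (ccv_bound (fun k => csum (k + m) a' - csum m a')%C).
    - apply ccv_minus; [apply (ccv_incr _ _ m (series_cv a' Ha'))|apply ccv_const].
    - intros k; apply Rlt_le, Hm; auto; lia. }
  exists N0; intros N HN; specialize (HN0 N HN); cbv beta in HN0.
  assert (R1 := Hrest (a N) (Ha N)); assert (R2 := Hrest b HB).
  rewrite Cmod_minus_sym in R2.
  generalize (Cmod_triangle_minus (clim (fun k => csum k (a N))) (csum m (a N)) (clim (fun k => csum k b)))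
    (Cmod_triangle_minus (csum m (a N)) (csum m b) (clim (fun k => csum k b))); lra.
Qed.
End BoundedSeries.

(** * Toeplitz coefficients and factorization of the matrices *)

Definition beta_coef (T : R) (p : R -> R) (l : Z) : C :=
  (ptilde T p l / cGamma (RtoC 1 - Ci * RtoC (omega T * IZR l)))%C.

Lemma ptilde_opp T p l : ptilde T p (- l) = Cconj (ptilde T p l).
Proof.
  unfold ptilde, Cconj; simpl fst; simpl snd; rewrite opp_IZR.
  assert (E1 : (fun x => p x * cos (- IZR l * omega T * x)) = (fun x => p x * cos (IZR l * omega T * x))).
  { apply functional_extensionality; intros x; f_equal; rewrite <- cos_neg; f_equal; ring. }
  assert (E2 : (fun x => p x * sin (- IZR l * omega T * x)) = (fun x => - (p x * sin (IZR l * omega T * x)))).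
  { apply functional_extensionality; intros x.
    replace (- IZR l * omega T * x) with (- (IZR l * omega T * x)) by ring; rewrite sin_neg; ring. }
  rewrite E1, E2, PerIntegral.per_integral_opp; f_equal; ring.
Qed.

Lemma one_minus_Ci_neq0 y k : y <> 0 -> (RtoC 1 - Ci * RtoC y + RtoC (INR k))%C <> RtoC 0.
Proof.
  intros Hy E; apply (f_equal Im) in E; simpl in E; lra.
Qed.

Lemma beta_coef_opp T p l : 0 < omega T -> beta_coef T p (- l) = Cconj (beta_coef T p l).
Proof.
  intros Ho; unfold beta_coef, Cdiv; rewrite Cmult_conj, Cinv_conj', ptilde_opp; f_equal; f_equal.
  rewrite <- cGamma_conj.
  - f_equal; rewrite opp_IZR; apply C_ext; simpl; ring.
  - intros k E; apply (f_equal Re) in E; simpl in E; generalize (pos_INR k); lra.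
Qed.

Lemma beta_coef_sqr T p l : 0 < omega T -> l <> 0%Z ->
  Cmod (beta_coef T p l) ^ 2
  = Cmod (ptilde T p l) ^ 2 * (sinh (PI * omega T * IZR l) / (PI * omega T * IZR l)).
Proof.
  intros Ho Hl; unfold beta_coef; set (y := omega T * IZR l).
  assert (Hy : y <> 0).
  { unfold y; apply Rmult_integral_contrapositive; split; [lra|].
    intros E; apply Hl; now apply eq_IZR. }
  assert (HG : Cmod (cGamma (RtoC 1 - Ci * RtoC y)) ^ 2 = PI * y / sinh (PI * y)).
  { apply RtoC_inj; rewrite <- cGamma_1_plus_minus by auto.
    rewrite Cmod2_conj, <- cGamma_conj, Cmult_comm by (intros; now apply one_minus_Ci_neq0).
    f_equal; f_equal; apply C_ext; simpl; ring. }
  assert (Hs : sinh (PI * y) <> 0).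
  { apply sinh_neq0, Rmult_integral_contrapositive; split; auto; apply PI_neq0. }
  assert (HG0 : cGamma (RtoC 1 - Ci * RtoC y) <> RtoC 0).
  { intros E; rewrite E, Cmod_0 in HG.
    assert (PI * y / sinh (PI * y) <> 0).
    { unfold Rdiv; apply Rmult_integral_contrapositive; split.
      - apply Rmult_integral_contrapositive; split; auto; apply PI_neq0.
      - now apply Rinv_neq_0_compat. }
    apply H; rewrite <- HG; ring. }
  rewrite Cmod_div by auto; unfold Rdiv at 1; rewrite Rpow_mult_distr, pow_inv, HG.
  replace (PI * omega T * IZR l) with (PI * y) by (unfold y; ring).
  f_equal; field; split; auto.
  split; auto; apply PI_neq0.
Qed.

(** Pairing l with -l counts l = 0 twice, which only enlarges the bound. *)
Lemma l1_of_nat_series (g : Z -> R) : (forall k, 0 <= g k) ->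
  (exists X, forall n, rsum n (fun l => g (Z.of_nat l) + g (- Z.of_nat l)%Z) <= X) -> l1 g.
Proof.
  intros Hg [X HX]; split; auto; exists X; intros M.
  eapply Rle_trans; [|apply (HX (S M))].
  unfold rzs, rwin; replace (2 * M + 1)%nat with (M + S M)%nat by lia.
  rewrite rsum_app, rsum_plus, Rplus_comm; apply Rplus_le_compat.
  - right; apply rsum_ext; intros k _; f_equal; lia.
  - change (S M) with (1 + M)%nat; rewrite rsum_app, rsum_rev.
    replace (rsum M (fun k => g (- Z.of_nat (1 + k))%Z))
      with (rsum M (fun k => g (Z.of_nat (M - S k) + - Z.of_nat M)%Z)).
    + simpl; generalize (Hg (- 0)%Z); simpl; lra.
    + apply rsum_ext; intros k Hk; f_equal; lia.
Qed.

Lemma omega_pos T : 0 < T -> 0 < omega T.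
Proof. intros HT; apply Rdiv_lt_0_compat; auto; generalize PI_RGT_0; lra. Qed.

Lemma beta_coef_dominated T p : 0 < T ->
  ex_series (fun l : nat =>
    (Cmod (ptilde T p (Z.of_nat l)) + Cmod (ptilde T p (- Z.of_nat l)%Z))
    * Rpower (1 + INR l ^ 2) (/ 4)) ->
  exists rho, forall c', (forall l, Cmod (c' l) <= Cmod (beta_coef T p l)) ->
    minors_dominated (omega T) c' rho.
Proof.
  intros HT Hs; assert (Ho := omega_pos T HT).
  apply (coefficients_dominated (omega T) (beta_coef T p) (fun l => Cmod (ptilde T p l))); auto.
  - intros; apply Cmod_ge_0.
  - intros; now apply beta_coef_sqr.
  - apply l1_of_nat_series.
    + intros k; apply Rmult_le_pos; [apply Cmod_ge_0|apply Rlt_le, exp_pos].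
    + apply ex_series_rsum_bounded in Hs.
      * destruct Hs as [X HX]; exists X; intros n; eapply Rle_trans; [|apply (HX n)].
        right; apply rsum_ext; intros k _; unfold weight.
        rewrite opp_IZR, <- INR_IZR_INZ; replace ((- INR k) ^ 2) with (INR k ^ 2) by ring; ring.
      * intros k; apply Rmult_le_pos; [|apply Rlt_le, exp_pos].
        apply Rplus_le_le_0_compat; apply Cmod_ge_0.
Qed.

Lemma csin_half_minus u : csin (RtoC PI * (RtoC (/ 2) - Ci * u)) = ccosh (RtoC PI * u).
Proof.
  destruct u as [x y].
  replace (RtoC PI * (x, y))%C with ((PI * x, PI * y) : C) by (apply C_ext; simpl; ring).
  rewrite ccosh_pair; unfold csin.
  replace (Re (RtoC PI * (RtoC (/ 2) - Ci * (x, y)))%C) with (PI / 2 + PI * y) by (simpl; field).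
  replace (Im (RtoC PI * (RtoC (/ 2) - Ci * (x, y)))%C) with (- (PI * x)) by (simpl; field).
  assert (E1 := cos_sin (PI * y)); assert (E2 := sin_cos (PI * y)).
  rewrite <- E1; replace (cos (PI / 2 + PI * y)) with (- sin (PI * y)) by lra.
  rewrite sinh_opp; unfold cosh; rewrite Ropp_involutive; f_equal; field.
Qed.

(** Reflection at 1/2 - i u with u the node, where sin (PI (1/2 - i u)) = cosh (PI u). *)
Lemma cGamma_pair om s k : regular om s ->
  (cGamma (RtoC (/ 2) - Ci * RtoC (om * IZR k) - Ci * s)
   * cGamma (RtoC (/ 2) + Ci * RtoC (om * IZR k) + Ci * s))%C = wfun (node om s k).
Proof.
  intros Hr; set (u := node om s k).
  replace (RtoC (/ 2) - Ci * RtoC (om * IZR k) - Ci * s)%C with (RtoC (/ 2) - Ci * u)%C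
    by (unfold u, node; ring).
  replace (RtoC (/ 2) + Ci * RtoC (om * IZR k) + Ci * s)%C with (1 - (RtoC (/ 2) - Ci * u))%C.
  - rewrite cGamma_reflection; rewrite csin_half_minus; [reflexivity|apply Hr].
  - unfold u, node; replace (RtoC 1) with (RtoC (/ 2) + RtoC (/ 2))%C
      by (rewrite <- RtoC_plus; f_equal; field); ring.
Qed.

(** The Gamma factors leave the determinant as row and column factors; paired index by index they
    give the values of w. *)
Lemma fred_coef_minors om s n (K : Z -> Z -> C) c : regular om s ->
  (forall k m, K k m = (cGamma (RtoC (/ 2) - Ci * RtoC (om * IZR k) - Ci * s) * c (k - m)%Z
     * cGamma (RtoC (/ 2) + Ci * RtoC (om * IZR m) + Ci * s))%C) ->
  fred_coef n K = trace_term om c s n.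
Proof.
  intros Hr HK; unfold fred_coef, trace_term, glim; f_equal; apply functional_extensionality; intros M.
  rewrite boxsum_gbox; apply gbox_ext; intros i.
  rewrite (cdet_ext n _ (fun a b =>
     (cGamma (RtoC (/ 2) - Ci * RtoC (om * IZR (i a)) - Ci * s) * c (i a - i b)%Z
     * cGamma (RtoC (/ 2) + Ci * RtoC (om * IZR (i b)) + Ci * s))%C)) by (intros; apply HK).
  rewrite (cdet_scale n (fun a => cGamma (RtoC (/ 2) - Ci * RtoC (om * IZR (i a)) - Ci * s))
     (fun b => cGamma (RtoC (/ 2) + Ci * RtoC (om * IZR (i b)) + Ci * s)) (fun a b => c (i a - i b)%Z)).
  unfold minor_term, detc; rewrite <- cprod_mult, Cmult_comm; f_equal.
  apply cprod_ext; intros a _; now apply cGamma_pair.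
Qed.

Definition truncate (N : nat) (c : Z -> C) (l : Z) : C :=
  if Z.leb (Z.abs l) (Z.of_nat N) then c l else RtoC 0.

Lemma Hent_factor T p s k m : Hent T p s k m
  = (cGamma (RtoC (/ 2) - Ci * RtoC (omega T * IZR k) - Ci * s) * beta_coef T p (k - m)
     * cGamma (RtoC (/ 2) + Ci * RtoC (omega T * IZR m) + Ci * s))%C.
Proof.
  unfold Hent, cBeta, beta_coef, Cdiv.
  replace (RtoC (/ 2) - Ci * RtoC (omega T * IZR k) - Ci * s +
     (RtoC (/ 2) + Ci * RtoC (omega T * IZR m) + Ci * s))%C
    with (RtoC 1 - Ci * RtoC (omega T * IZR (k - m)))%C; [ring|].
  rewrite minus_IZR; destruct s; apply C_ext; simpl; field.
Qed.

Lemma HNent_factor T p N s k m : HNent T p N s k m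
  = (cGamma (RtoC (/ 2) - Ci * RtoC (omega T * IZR k) - Ci * s) * truncate N (beta_coef T p) (k - m)
     * cGamma (RtoC (/ 2) + Ci * RtoC (omega T * IZR m) + Ci * s))%C.
Proof.
  unfold HNent, truncate; rewrite Hent_factor.
  destruct (Z.leb (Z.abs (k - m)) (Z.of_nat N)); ring.
Qed.

Lemma Cmod_truncate N c l : Cmod (truncate N c l) <= Cmod (c l).
Proof.
  unfold truncate; destruct (Z.leb _ _); [lra|rewrite Cmod_0; apply Cmod_ge_0].
Qed.

(** On a box of radius M0 all index differences are at most 2 M0, so truncation at N >= 2 M0 does
    not change the minors there; outside, the common majorant controls all truncations at once. *)
Lemma trace_term_truncate_cv om c rho n :
  (forall c', (forall l, Cmod (c' l) <= Cmod (c l)) -> minors_dominated om c' rho) ->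
  ccv (fun N => trace_term om (truncate N c) 0 n) (trace_term om c 0 n).
Proof.
  intros Hd; assert (Hw := wbound_0 om).
  assert (Hl : l1 rho) by (apply (Hd c); intros; lra).
  assert (HdN := fun N => Hd (truncate N c) (Cmod_truncate N c)).
  assert (Hdc := Hd c (fun l => Rle_refl _)).
  apply ccv_eps; intros eps He.
  destruct (gbox_tail n (1 ^ n) rho ltac:(rewrite pow1; lra) Hl (eps / 3)) as [M0 HM]; [lra|].
  assert (Hlim : forall c', minors_dominated om c' rho ->
    Cmod (trace_term om c' 0 n - gbox n (- Z.of_nat M0) (2 * M0 + 1) (minor_term om c' 0 n))%C <= eps / 3).
  { intros c' Hc'.
    apply (ccv_bound (fun M => gbox n (- Z.of_nat (M + M0)) (2 * (M + M0) + 1) (minor_term om c' 0 n)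
       - gbox n (- Z.of_nat M0) (2 * M0 + 1) (minor_term om c' 0 n))%C).
    - apply ccv_minus; [|apply ccv_const].
      apply (ccv_incr (fun M => gbox n (- Z.of_nat M) (2 * M + 1) (minor_term om c' 0 n)) _ M0).
      now apply (trace_term_cv om c' rho 0 1).
    - intros M; apply Rlt_le, HM; try lia.
      now apply (minor_term_bound om c' rho 0 1). }
  exists (2 * M0)%nat; intros N HN.
  assert (E : gbox n (- Z.of_nat M0) (2 * M0 + 1) (minor_term om (truncate N c) 0 n)
    = gbox n (- Z.of_nat M0) (2 * M0 + 1) (minor_term om c 0 n)).
  { apply gbox_ext_window; intros i Hi; unfold minor_term; f_equal.
    apply cdet_ext; intros a b Ha Hb; unfold truncate.
    destruct (Z.leb_spec (Z.abs (i a - i b)) (Z.of_nat N)); auto.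
    generalize (Hi a Ha) (Hi b Hb); lia. }
  assert (R1 := Hlim _ (HdN N)); assert (R2 := Hlim _ Hdc); rewrite E in R1.
  rewrite Cmod_minus_sym in R2.
  eapply Rle_lt_trans; [apply (Cmod_triangle_minus _ (gbox n (- Z.of_nat M0) (2 * M0 + 1)
     (minor_term om c 0 n)))|]; lra.
Qed.

(** Both parities use traces at s = 0; s enters afterwards as the factor f(s)/f(0) of the odd
    part. *)
Definition even_coef (om : R) (c : Z -> C) (mu : C) (n : nat) : C :=
  if Nat.odd n then RtoC 0 else (cpow (- mu) n / RtoC (INR (fact n)) * trace_term om c 0 n)%C.
Definition odd_coef (om : R) (c : Z -> C) (mu : C) (n : nat) : C :=
  if Nat.odd n then (cpow (- mu) n / RtoC (INR (fact n)) * trace_term om c 0 n)%C else RtoC 0.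
Definition even_part (om : R) (c : Z -> C) (mu : C) : C := clim (fun k => csum k (even_coef om c mu)).
Definition odd_part (om : R) (c : Z -> C) (mu : C) : C := clim (fun k => csum k (odd_coef om c mu)).

Lemma fact_neq0_C n : RtoC (INR (fact n)) <> RtoC 0.
Proof. apply RtoC_neq0, INR_fact_neq_0. Qed.

Lemma coef_bound om c rho X mu n : l1 rho -> (forall lo L, rwin lo L rho <= X) ->
  minors_dominated om c rho ->
  Cmod (even_coef om c mu n) <= (Cmod mu * X) ^ n / INR (fact n) /\
  Cmod (odd_coef om c mu n) <= (Cmod mu * X) ^ n / INR (fact n).
Proof.
  intros Hl HX Hd.
  assert (HX0 : 0 <= X) by (eapply Rle_trans; [|apply (HX 0%Z O)]; unfold rwin; simpl; lra).
  assert (Hpos : 0 <= (Cmod mu * X) ^ n / INR (fact n)).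
  { apply Rdiv_le_0_compat; [apply pow_le, Rmult_le_pos; auto; apply Cmod_ge_0|apply INR_fact_lt_0]. }
  assert (Ht : Cmod (trace_term om c 0 n) <= X ^ n).
  { rewrite <- (Rmult_1_l (X ^ n)); rewrite <- (pow1 n) at 1.
    apply (glim_bound n (1 ^ n) rho); auto; [rewrite pow1; lra|].
    now apply (minor_term_bound om c rho 0 1), wbound_0. }
  assert (Hmain : Cmod (cpow (- mu) n / RtoC (INR (fact n)) * trace_term om c 0 n)%C
    <= (Cmod mu * X) ^ n / INR (fact n)).
  { rewrite Cmod_mult, Cmod_div, Cmod_cpow, Cmod_opp, Cmod_R, Rabs_pos_eq
      by (try apply fact_neq0_C; apply Rlt_le, INR_fact_lt_0).
    rewrite Rpow_mult_distr; unfold Rdiv.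
    replace (Cmod mu ^ n * X ^ n * / INR (fact n)) with (Cmod mu ^ n * / INR (fact n) * X ^ n) by ring.
    apply Rmult_le_compat_l; auto; apply Rmult_le_pos; [apply pow_le, Cmod_ge_0|].
    apply Rlt_le, Rinv_0_lt_compat, INR_fact_lt_0. }
  unfold even_coef, odd_coef; destruct (Nat.odd n); rewrite ?Cmod_0; auto.
Qed.

Lemma trace_term_split om c rho s K n : 0 < om -> minors_dominated om c rho -> wbound om s K ->
  trace_term om c s n
  = if Nat.odd n then (fsum om s / fsum om 0 * trace_term om c 0 n)%C else trace_term om c 0 n.
Proof.
  intros Ho Hd Hw; destruct (Nat.odd n) eqn:Hn.
  - destruct (trace_term_odd om c rho n Ho Hd Hn) as [B HB].
    rewrite (HB s K Hw), (HB 0 1 (wbound_0 om)).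
    destruct (fsum_0_pos om Ho) as (x & Hx & E); rewrite E; field; apply RtoC_neq0; lra.
  - now apply (trace_term_even om c rho n Ho Hd Hn s K).
Qed.

(** Stated for every matrix of the factored form, so that it covers [Hent] and each [HNent]. *)
Lemma fredholm_det_split om c rho s mu (K : Z -> Z -> C) : 0 < om -> minors_dominated om c rho ->
  ~ pole om s ->
  (forall k m, K k m = (cGamma (RtoC (/ 2) - Ci * RtoC (om * IZR k) - Ci * s) * c (k - m)%Z
     * cGamma (RtoC (/ 2) + Ci * RtoC (om * IZR m) + Ci * s))%C) ->
  fredholm_det mu K = (even_part om c mu + fsum om s / fsum om 0 * odd_part om c mu)%C.
Proof.
  intros Ho Hd Hs HK; destruct (wbound_not_pole om s Ho Hs) as [B HB].
  destruct (Hd) as [Hl _]; destruct (l1_window rho Hl) as (X & HX0 & HX).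
  assert (Hy : 0 <= Cmod mu * X) by (apply Rmult_le_pos; auto; apply Cmod_ge_0).
  assert (Hh : forall n, 0 <= (Cmod mu * X) ^ n / INR (fact n)).
  { intros n; apply Rdiv_le_0_compat; [now apply pow_le|apply INR_fact_lt_0]. }
  assert (Hcb := fun n => coef_bound om c rho X mu n Hl HX Hd).
  apply clim_ccv.
  apply (ccv_ext (fun k => csum k (even_coef om c mu)
     + fsum om s / fsum om 0 * csum k (odd_coef om c mu))%C).
  - intros k; rewrite <- csum_scal, <- csum_plus; apply csum_ext; intros n _.
    rewrite (fred_coef_minors om s n K c) by (auto; apply HB).
    rewrite (trace_term_split om c rho s B n Ho Hd HB).
    unfold even_coef, odd_coef; destruct (Nat.odd n); ring.
  - apply ccv_plus; [|apply ccv_scal]; apply (series_cv _ Hh (exp_partial_bounded _ Hy)); intros n; apply Hcb.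
Qed.

Lemma even_odd_part_truncate_cv om c rho mu :
  (forall c', (forall l, Cmod (c' l) <= Cmod (c l)) -> minors_dominated om c' rho) ->
  ccv (fun N => even_part om (truncate N c) mu) (even_part om c mu) /\
  ccv (fun N => odd_part om (truncate N c) mu) (odd_part om c mu).
Proof.
  intros Hd; assert (Hl : l1 rho) by (apply (Hd c); intros; lra).
  destruct (l1_window rho Hl) as (X & HX0 & HX).
  assert (Hy : 0 <= Cmod mu * X) by (apply Rmult_le_pos; auto; apply Cmod_ge_0).
  assert (Hh : forall n, 0 <= (Cmod mu * X) ^ n / INR (fact n)).
  { intros n; apply Rdiv_le_0_compat; [now apply pow_le|apply INR_fact_lt_0]. }
  assert (HdN := fun N => Hd (truncate N c) (Cmod_truncate N c)).
  assert (Hcb := fun N n => coef_bound om _ rho X mu n Hl HX (HdN N)).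
  assert (Ht := fun n => trace_term_truncate_cv om c rho n Hd).
  split; apply (series_tannery _ Hh (exp_partial_bounded _ Hy)); try (intros; apply Hcb); intros n.
  - unfold even_coef; destruct (Nat.odd n); [apply ccv_const|now apply ccv_scal].
  - unfold odd_coef; destruct (Nat.odd n); [now apply ccv_scal|apply ccv_const].
Qed.

(** Conjugation transposes the Toeplitz matrix, and the weights at s = 0 are real. *)
Lemma trace_term_conj om c n : (forall l, c (- l)%Z = Cconj (c l)) ->
  forall rho, minors_dominated om c rho ->
  Cconj (trace_term om c 0 n) = trace_term om c 0 n.
Proof.
  intros Hc rho Hd.
  assert (H := trace_term_cv om c rho 0 1 n Hd (wbound_0 om)).
  symmetry; apply (ccv_unique _ _ _ H).
  eapply ccv_ext; [|apply (ccv_conj _ _ H)]; intros M; cbv beta.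
  rewrite gbox_conj; apply gbox_ext; intros i; unfold minor_term.
  rewrite Cmult_conj, cprod_conj; f_equal.
  - unfold detc; rewrite cdet_conj, <- cdet_tr; apply cdet_ext; intros a b _ _.
    rewrite <- Hc; f_equal; ring.
  - apply cprod_ext; intros a _; rewrite wfun_node_0; apply C_ext; simpl; ring.
Qed.

Lemma Cconj_RtoC x : Cconj (RtoC x) = RtoC x.
Proof. apply C_ext; simpl; ring. Qed.

Lemma part_conj om c rho mu : minors_dominated om c rho -> (forall l, c (- l)%Z = Cconj (c l)) ->
  Cconj (even_part om c mu) = even_part om c (Cconj mu) /\
  Cconj (odd_part om c mu) = odd_part om c (Cconj mu).
Proof.
  intros Hd Hc; destruct (Hd) as [Hl _]; destruct (l1_window rho Hl) as (X & HX0 & HX).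
  assert (Hy : 0 <= Cmod mu * X) by (apply Rmult_le_pos; auto; apply Cmod_ge_0).
  assert (Hh : forall n, 0 <= (Cmod mu * X) ^ n / INR (fact n)).
  { intros n; apply Rdiv_le_0_compat; [now apply pow_le|apply INR_fact_lt_0]. }
  assert (Hcb := fun n => coef_bound om c rho X mu n Hl HX Hd).
  assert (Hterm : forall n, Cconj (cpow (- mu) n / RtoC (INR (fact n)) * trace_term om c 0 n)%C
    = (cpow (- Cconj mu) n / RtoC (INR (fact n)) * trace_term om c 0 n)%C).
  { intros n; rewrite Cmult_conj, (trace_term_conj om c n Hc rho Hd); f_equal.
    unfold Cdiv; now rewrite Cmult_conj, cpow_conj, Copp_conj, Cinv_conj', Cconj_RtoC. }
  split; symmetry; apply clim_ccv.
  - eapply ccv_ext; [|apply ccv_conj, (series_cv _ Hh (exp_partial_bounded _ Hy) (even_coef om c mu));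
      intros n; apply Hcb].
    intros k; cbv beta; rewrite csum_conj; apply csum_ext; intros n _; unfold even_coef.
    destruct (Nat.odd n); [apply Cconj_RtoC|apply Hterm].
  - eapply ccv_ext; [|apply ccv_conj, (series_cv _ Hh (exp_partial_bounded _ Hy) (odd_coef om c mu));
      intros n; apply Hcb].
    intros k; cbv beta; rewrite csum_conj; apply csum_ext; intros n _; unfold odd_coef.
    destruct (Nat.odd n); [apply Hterm|apply Cconj_RtoC].
Qed.

Lemma cpow_opp z n : cpow (- z) n = if Nat.odd n then (- cpow z n)%C else cpow z n.
Proof.
  induction n; [reflexivity|].
  rewrite Nat.odd_succ, <- Nat.negb_odd; simpl cpow; rewrite IHn.
  destruct (Nat.odd n); simpl; ring.
Qed.

Lemma part_opp om c rho mu : minors_dominated om c rho ->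
  even_part om c (- mu) = even_part om c mu /\ odd_part om c (- mu) = (- odd_part om c mu)%C.
Proof.
  intros Hd; destruct (Hd) as [Hl _]; destruct (l1_window rho Hl) as (X & HX0 & HX).
  assert (Hy : 0 <= Cmod mu * X) by (apply Rmult_le_pos; auto; apply Cmod_ge_0).
  assert (Hh : forall n, 0 <= (Cmod mu * X) ^ n / INR (fact n)).
  { intros n; apply Rdiv_le_0_compat; [now apply pow_le|apply INR_fact_lt_0]. }
  assert (Hcb := fun n => coef_bound om c rho X mu n Hl HX Hd).
  split.
  - unfold even_part; f_equal; apply functional_extensionality; intros k; apply csum_ext; intros n _.
    unfold even_coef; rewrite (cpow_opp (- mu)); destruct (Nat.odd n); reflexivity.
  - apply clim_ccv; rewrite <- (Cmult_m1_l (odd_part om c mu)).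
    eapply ccv_ext; [|apply ccv_scal, (series_cv _ Hh (exp_partial_bounded _ Hy) (odd_coef om c mu));
      intros n; apply Hcb].
    intros k; cbv beta; rewrite <- csum_scal; apply csum_ext; intros n _.
    unfold odd_coef; rewrite (cpow_opp (- mu)); destruct (Nat.odd n); [|ring].
    rewrite Cmult_m1_l; unfold Cdiv; ring.
Qed.

Lemma Cinv_opp z : (/ - z)%C = (- / z)%C.
Proof.
  destruct z as [x y]; apply C_ext; simpl;
  replace (- x * (- x * 1) + - y * (- y * 1)) with (x * (x * 1) + y * (y * 1)) by ring;
  unfold Rdiv; ring.
Qed.

(** * Complex derivatives and residues as filter limits *)

Lemma sq_derivable_cderiv f z l : sq_derivable f z l -> cderiv f z l.
Proof.
  intros (A & r & HA & Hr & H); split.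
  - apply @is_linear_scal_l.
  - intros x Hx.
    assert (Ex := @is_filter_lim_locally_unique _ (AbsRing_NormedModule C_AbsRing) z x Hx); subst x.
    intros eps.
    assert (Hd : 0 < Rmin r (eps / (A + 1))).
    { apply Rmin_pos; auto; apply Rdiv_lt_0_compat; [apply cond_pos|lra]. }
    exists (mkposreal _ Hd); refine (fun (y : C) Hy => _); change C in z.
    change (Cmod (y - z)%C < Rmin r (eps / (A + 1))) in Hy.
    change (Cmod ((f y - f z) - (y - z) * l)%C <= eps * Cmod (y - z)%C).
    assert (H1 := Rmin_l r (eps / (A + 1))); assert (H2 := Rmin_r r (eps / (A + 1))).
    assert (Hm := Cmod_ge_0 (y - z)%C).
    specialize (H (y - z)%C ltac:(lra)); replace (z + (y - z))%C with y in H by ring.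
    eapply Rle_trans; [apply H|].
    replace (A * Cmod (y - z)%C ^ 2) with (A * Cmod (y - z)%C * Cmod (y - z)%C) by ring.
    apply Rmult_le_compat_r; auto.
    apply Rle_trans with ((A + 1) * (eps / (A + 1))).
    + apply Rmult_le_compat; lra.
    + right; field; lra.
Qed.

Lemma cderiv_unique f z l m : cderiv f z l -> cderiv f z m -> l = m.
Proof.
  intros H1 H2; rewrite <- (is_C_derive_unique f z l H1); now apply is_C_derive_unique.
Qed.

Lemma cderiv_ext_near (f g : C -> C) z l r : 0 < r ->
  (forall h, Cmod h < r -> f (z + h)%C = g (z + h)%C) -> cderiv f z l -> cderiv g z l.
Proof.
  intros Hr H; apply (is_derive_ext_loc (K := C_AbsRing) (V := C_NormedModule)).
  exists (mkposreal r Hr); refine (fun (y : C) Hy => _); change (Cmod (y - z)%C < r) in Hy.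
  replace y with (z + (y - z))%C by ring; now apply H.
Qed.

Lemma has_residue_res_lim f a r : has_residue f a r -> res_lim f a r.
Proof.
  intros H; apply filterlim_locally; intros eps.
  destruct (H eps (cond_pos eps)) as (d & Hd & Hdd).
  (* Balls of the product structure bound the two coordinates separately; radius d/2 in each keeps
     the modulus below d. *)
  assert (Hd2 : 0 < d / 2) by lra.
  exists (mkposreal _ Hd2); refine (fun (y : C) Hy Hne => _).
  apply C_NormedModule_mixin_compat1.
  destruct Hy as [Hy1 Hy2].
  change (Rabs (fst y - fst a) < d / 2) in Hy1; change (Rabs (snd y - snd a) < d / 2) in Hy2.
  assert (Hlt : Cmod (y - a)%C < d).
  { eapply Rle_lt_trans; [apply Cmod_le_ReIm|]; change (Re (y - a)%C) with (fst y - fst a).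
    change (Im (y - a)%C) with (snd y - snd a); lra. }
  assert (Hn : (y - a)%C <> RtoC 0).
  { intros E; assert (E' : y = (a + (y - a))%C) by ring.
    rewrite E, Cplus_0_r in E'; now apply Hne. }
  assert (G := Hdd (y - a)%C (conj (proj1 (Cmod_gt_0 _) Hn) Hlt)).
  replace (a + (y - a))%C with y in G by ring; exact G.
Qed.

Lemma sq_derivable_affine f z l a b : sq_derivable f z l ->
  sq_derivable (fun w => a + b * f w)%C z (b * l)%C.
Proof.
  intros (A & r & HA & Hr & H); exists (Cmod b * A), r; repeat split; auto.
  - apply Rmult_le_pos; auto; apply Cmod_ge_0.
  - intros h Hh; replace (a + b * f (z + h) - (a + b * f z) - h * (b * l))%C
      with (b * (f (z + h) - f z - h * l))%C by ring.
    rewrite Cmod_mult, Rmult_assoc; apply Rmult_le_compat_l; [apply Cmod_ge_0|auto].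
Qed.

Lemma has_residue_affine f z r a b : has_residue f z r ->
  has_residue (fun w => a + b * f w)%C z (b * r)%C.
Proof.
  intros H eps He; assert (Hb := Cmod_ge_0 b); assert (Ha := Cmod_ge_0 a).
  destruct (H (eps / 2 / (Cmod b + 1))) as (d & Hd & Hdd).
  { apply Rdiv_lt_0_compat; lra. }
  exists (Rmin d (eps / 2 / (Cmod a + 1))); split.
  { apply Rmin_pos; auto; apply Rdiv_lt_0_compat; lra. }
  intros h Hh; generalize (Rmin_l d (eps / 2 / (Cmod a + 1))) (Rmin_r d (eps / 2 / (Cmod a + 1))); intros.
  specialize (Hdd h ltac:(lra)).
  replace (h * (a + b * f (z + h)) - b * r)%C with (h * a + b * (h * f (z + h) - r))%C by ring.
  eapply Rle_lt_trans; [apply Cmod_triangle|]; rewrite !Cmod_mult.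
  assert (G1 : Cmod h * Cmod a <= eps / 2).
  { apply Rle_trans with (eps / 2 / (Cmod a + 1) * (Cmod a + 1)).
    - apply Rmult_le_compat; try lra; apply Cmod_ge_0.
    - right; field; lra. }
  assert (G2 : Cmod b * Cmod (h * f (z + h) - r)%C < eps / 2).
  { apply Rle_lt_trans with (Cmod b * (eps / 2 / (Cmod b + 1))).
    - apply Rmult_le_compat_l; lra.
    - apply Rlt_le_trans with ((Cmod b + 1) * (eps / 2 / (Cmod b + 1))).
      + apply Rmult_lt_compat_r; [apply Rdiv_lt_0_compat; lra|lra].
      + right; field; lra. }
  lra.
Qed.

Lemma half_period_congr T s :
  half_period (omega T) s <->
  (congr_M T s (RtoC 0) \/ congr_M T s (omega T / 2, 0) \/
   congr_M T s (omega T / 2, 1) \/ congr_M T s (0, 1)).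
Proof.
  assert (Hhalf : forall a b : R, (s + s)%C = (a, b) -> s = (a / 2, b / 2)).
  { intros a b E; injection E; intros E2 E1; apply C_ext; simpl; unfold Re, Im; lra. }
  split.
  - intros (j & k & E); apply Hhalf in E.
    destruct (Zeven_odd_dec j) as [Hj|Hj]; destruct (Zeven_odd_dec k) as [Hk|Hk];
    [apply Zeven_ex in Hj; apply Zeven_ex in Hk|apply Zeven_ex in Hj; apply Zodd_ex in Hk
    |apply Zodd_ex in Hj; apply Zeven_ex in Hk|apply Zodd_ex in Hj; apply Zodd_ex in Hk];
    destruct Hj as [m ->]; destruct Hk as [n ->]; [left|right; right; right|right; left|right; right; left];
    exists m, n; rewrite E, ?plus_IZR, ?mult_IZR; apply C_ext; simpl; field.
  - intros [H|[H|[H|H]]]; destruct H as (m & n & E);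
    [exists (2 * m)%Z, (2 * n)%Z|exists (2 * m + 1)%Z, (2 * n)%Z
    |exists (2 * m + 1)%Z, (2 * n + 1)%Z|exists (2 * m)%Z, (2 * n + 1)%Z];
    rewrite E, ?plus_IZR, ?mult_IZR; apply C_ext; simpl; field.
Qed.

(** * The limit determinant, its symmetries and its critical points *)

Theorem theorem4p1 (T : R) (p : R -> R) :
  0 < T ->
  (forall x, p (x + T) = p x) ->
  Leb.per_integrable T p ->
  (* sum_{l in Z} |ptilde_l| (1 + l^2)^{1/4} < oo *)
  ex_series (fun l : nat =>
    (Cmod (ptilde T p (Z.of_nat l)) + Cmod (ptilde T p (- Z.of_nat l)%Z))
    * Rpower (1 + INR l ^ 2) (/ 4)) ->
  exists Delta : C -> C -> C,
  forall lam : C, lam <> RtoC 0 ->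
  (* (i) *)
  (forall s, ~ inLambda T s ->
     filterlim (fun N => DeltaN T p N s lam) eventually (locally (Delta s lam))) /\
  (forall delta, 0 < delta -> forall eps, 0 < eps ->
     exists N0 : nat, forall (N : nat) (s : C), (N0 <= N)%nat ->
       (forall a, inLambda T a -> delta < Cmod (s - a)%C) ->
       Cmod (DeltaN T p N s lam - Delta s lam)%C < eps) /\
  (forall s, ~ inLambda T s -> Rabs (Im s) < 1 ->
     Delta s lam = fredholm_det (/ lam)%C (Hent T p s)) /\
  (* (ii) *)
  (forall s, ~ inLambda T s ->
     Delta (- s)%C lam = Delta s lam /\
     Delta (s + (0, 2))%C lam = Delta s lam /\
     Delta (s + RtoC (omega T))%C lam = Delta s lam /\
     Cconj (Delta s lam) = Delta (Cconj s) (Cconj lam) /\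
     Delta (s + Ci)%C lam = Delta s (- lam)%C) /\
  ((exists c : C, forall s, ~ inLambda T s -> Delta s lam = c) \/
   ((forall s, ~ inLambda T s -> cdifferentiable (fun z => Delta z lam) s) /\
    (forall a, inLambda T a ->
       exists r : C, r <> RtoC 0 /\ res_lim (fun z => Delta z lam) a r))) /\
  (exists r : C, res_lim (fun z => Delta z lam) (0, / 2) r /\
                 res_lim (fun z => Delta z lam) (0, - / 2) (- r)%C) /\
  (* (iii) *)
  (~ (exists c : C, forall s, ~ inLambda T s -> Delta s lam = c) ->
   forall D1 D2 : C -> C,
   (forall s, ~ inLambda T s -> cderiv (fun z => Delta z lam) s (D1 s)) ->
   (forall s, ~ inLambda T s -> cderiv D1 s (D2 s)) ->
   forall s, ~ inLambda T s ->
     (D1 s = RtoC 0 <->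
        (congr_M T s (RtoC 0) \/ congr_M T s (omega T / 2, 0) \/
         congr_M T s (omega T / 2, 1) \/ congr_M T s (0, 1))) /\
     (D1 s = RtoC 0 -> D2 s <> RtoC 0)).

Proof.
  intros HT _ _ Hsum.
  assert (Ho := omega_pos T HT); set (om := omega T) in *.
  set (c := beta_coef T p).
  destruct (beta_coef_dominated T p HT Hsum) as [rho Hrho].
  fold om c in Hrho.
  assert (Hd : minors_dominated om c rho) by (apply Hrho; intros; lra).
  assert (HdN := fun N => Hrho _ (Cmod_truncate N c)).
  assert (Hconj : forall l, c (- l)%Z = Cconj (c l)) by (intros; now apply beta_coef_opp).
  destruct (fsum_0_pos om Ho) as (x0 & Hx0 & E0).
  assert (E0n : fsum om 0 <> RtoC 0) by (rewrite E0; apply RtoC_neq0; lra).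
  (* The determinant is expanded at mu = 1/lam; dividing the odd part by f(0) turns the traces at s
     = 0 into the coefficient of f. *)
  set (A := fun lam : C => even_part om c (/ lam)%C).
  set (B := fun lam : C => (odd_part om c (/ lam) / fsum om 0)%C).
  set (D := fun s lam : C => (A lam + B lam * fsum om s)%C).
  exists D; intros lam Hlam.
  set (AN := fun N => even_part om (truncate N c) (/ lam)%C).
  set (BN := fun N => (odd_part om (truncate N c) (/ lam) / fsum om 0)%C).
  assert (EN : forall N s, ~ pole om s -> DeltaN T p N s lam = (AN N + BN N * fsum om s)%C).
  { intros N s Hs; unfold DeltaN.
    rewrite (fredholm_det_split om (truncate N c) rho s (/ lam)%C _ Ho (HdN N) Hs (HNent_factor T p N s)).
    unfold AN, BN; field; auto. }
  destruct (even_odd_part_truncate_cv om c rho (/ lam)%C Hrho) as [HA HB0].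
  assert (HB : ccv BN (B lam)).
  { unfold BN, B, Cdiv; eapply ccv_ext; [|rewrite Cmult_comm; apply ccv_scal, HB0].
    intros n; cbv beta; ring. }
  assert (Hres : forall a r, has_residue (fsum om) a r ->
    has_residue (fun z => D z lam) a (B lam * r)%C).
  { intros a r; exact (has_residue_affine (fsum om) a r (A lam) (B lam)). }
  assert (Hsq : forall s, ~ pole om s -> sq_derivable (fun z => D z lam) s (B lam * fsum1 om s)%C).
  { intros s Hs.
    exact (sq_derivable_affine (fsum om) s _ (A lam) (B lam) (proj1 (proj2 (fsum_derivatives om s Ho Hs)))). }
  split; [|split; [|split; [|split; [|split; [|split]]]]].
  - intros s Hs; apply filterlim_ccv.
    eapply ccv_ext; [intros N; symmetry; apply (EN N s Hs)|].
    apply ccv_plus; [exact HA|]; apply ccv_mult; [exact HB|apply ccv_const].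
  - intros delta Hdel eps Heps.
    (* The lower bound for cosh is available for delta <= 1; being far for a larger delta implies
       being far for the smaller one. *)
    assert (Hdel' : 0 < Rmin delta 1 <= 1) by (split; [apply Rmin_pos; lra|apply Rmin_r]).
    destruct (fsum_bound om _ Ho Hdel') as (F & HF & HFs).
    rewrite ccv_eps in HB; apply (proj1 (ccv_eps _ _)) with (eps := eps / 2) in HA; [|lra].
    destruct HA as [N1 HN1].
    destruct (HB (eps / 2 / (F + 1))) as [N2 HN2]; [apply Rdiv_lt_0_compat; lra|].
    exists (N1 + N2)%nat; intros N s HN Hfar.
    assert (Hf : far om (Rmin delta 1) s) by (apply (far_weaken om delta); [apply Rmin_l|exact Hfar]).
    assert (Hs : ~ pole om s) by (apply (far_not_pole om (Rmin delta 1)); auto; lra).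
    rewrite EN by auto; unfold D.
    replace (AN N + BN N * fsum om s - (A lam + B lam * fsum om s))%C
      with ((AN N - A lam) + (BN N - B lam) * fsum om s)%C by ring.
    eapply Rle_lt_trans; [apply Cmod_triangle|]; rewrite Cmod_mult.
    specialize (HN1 N ltac:(lia)); specialize (HN2 N ltac:(lia)); specialize (HFs s Hf).
    assert (Cmod (BN N - B lam)%C * Cmod (fsum om s) <= eps / 2 / (F + 1) * (F + 1)).
    { apply Rmult_le_compat; try apply Cmod_ge_0; lra. }
    replace (eps / 2 / (F + 1) * (F + 1)) with (eps / 2) in H by (field; lra).
    unfold AN, A in *; lra.
  - intros s Hs _.
    rewrite (fredholm_det_split om c rho s (/ lam)%C _ Ho Hd Hs (Hent_factor T p s)).
    unfold D, A, B; field; auto.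
  - intros s Hs; unfold D; repeat split.
    + now rewrite fsum_opp.
    + replace (s + (0, 2)%R)%C with (s + (0, 2 * IZR 1)%R)%C by (apply C_ext; simpl; ring).
      rewrite (antiperiodic_shift om (fsum om)); auto; intros; now apply fsum_Ci.
    + replace (s + RtoC om)%C with (node om s 1) by (unfold node; rewrite Rmult_1_r; reflexivity).
      now rewrite fsum_shift.
    + destruct (part_conj om c rho (/ lam)%C Hd Hconj) as [P1 P2].
      unfold A, B, Cdiv; rewrite Cplus_conj, !Cmult_conj, P1, P2, !Cinv_conj', (fsum_conj om s) by auto.
      rewrite E0, Cconj_RtoC; reflexivity.
    + destruct (part_opp om c rho (/ lam)%C Hd) as [P1 P2].
      unfold A, B, Cdiv; rewrite fsum_Ci, Cinv_opp, P1, P2 by auto; ring.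
  (* The coefficient of f decides between the constant and the elliptic case. *)
  - destruct (classic (B lam = RtoC 0)) as [HB0'|HBn].
    + left; exists (A lam); intros s _; unfold D; rewrite HB0'; ring.
    + right; split.
      * intros s Hs; eexists; apply sq_derivable_cderiv, Hsq, Hs.
      * intros a Ha; destruct (fsum_residue om a Ho Ha) as [Hr|Hr]; eexists;
        (split; [|apply has_residue_res_lim, Hres, Hr]);
        apply Cmult_neq_0; auto; [apply Ci_neq0|].
        intros E; apply Ci_neq0; replace Ci with (- - Ci)%C by ring; rewrite E; ring.
  (* Adding i carries -i/2 to i/2 and changes the sign of f, so the residues are opposite; if B
     vanishes, both are 0. *)
  - assert (Hr1 := fsum_residue_half_i om Ho).
    assert (Hp : pole om (0, - / 2)).
    { exists 0%Z, (-1)%Z; apply C_ext; simpl; field. }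
    assert (Hr2 : has_residue (fsum om) (0, - / 2) Ci).
    { apply (proj2 (has_residue_Ci om _ _ Ho Hp)).
      replace ((0, - / 2)%R + Ci)%C with ((0, / 2)%R : C); [exact Hr1|].
      apply C_ext; simpl; field. }
    exists (B lam * - Ci)%C; split; apply has_residue_res_lim.
    + now apply Hres.
    + replace (- (B lam * - Ci))%C with (B lam * Ci)%C by ring; now apply Hres.
  - intros Hnc D1 D2 HD1 HD2 s Hs.
    assert (HBn : B lam <> RtoC 0).
    { intros E; apply Hnc; exists (A lam); intros z _; unfold D; rewrite E; ring. }
    assert (E1 : forall z, ~ pole om z -> D1 z = (B lam * fsum1 om z)%C).
    { intros z Hz; apply (cderiv_unique _ _ _ _ (HD1 z Hz)); now apply sq_derivable_cderiv, Hsq. }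
    assert (E2 : D2 s = (B lam * fsum2 om s)%C).
    (* [D1] is determined only off the poles, so its formula is differentiated on a disc around s
       that contains none. *)
    { destruct (far_of_not_pole om s Ho Hs) as (d & Hdd & Hfar).
      apply (cderiv_unique (fun z => RtoC 0 + B lam * fsum1 om z)%C s).
      - apply (cderiv_ext_near D1 _ s (D2 s) d); [lra| |now apply HD2].
        intros h Hh; rewrite E1; [ring|]; intros Hp; specialize (Hfar _ Hp).
        replace (s - (s + h))%C with (- h)%C in Hfar by ring; rewrite Cmod_opp in Hfar; lra.
      - apply sq_derivable_cderiv.
        exact (sq_derivable_affine (fsum1 om) s _ _ _ (proj2 (proj2 (fsum_derivatives om s Ho Hs)))). }
    assert (Hz : D1 s = RtoC 0 -> fsum1 om s = RtoC 0).
    { intros E; apply Cmult_cancel_r with (B lam); auto.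
      rewrite Cmult_0_l, Cmult_comm, <- E1; auto. }
    split.
    + split.
      * intros E; apply (proj1 (half_period_congr T s)); apply fsum1_zero; auto.
      * intros Hh; apply (proj2 (half_period_congr T s)) in Hh; fold om in Hh; rewrite E1, fsum1_half_period by auto; ring.
    + intros E; rewrite E2; apply Cmult_neq_0; auto; apply fsum1_zero; auto.
Qed.
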